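(* Let $b\geq 2$ be an integer. The function $F_b(s)=\sum_{n=1}^\infty d_b(n)n^{-s}$ (defined by this series for $\Re(s)>1$) has a meromorphic continuation to $\mathbb{C}$. The poles of $F_b(s)$ consist of: (i) a double pole at $s=1$ with Laurent expansion beginning \[ F_b(s)=\frac{b-1}{2\log b}(s-1)^{-2} + \biggl( \frac{b-1}{2\log b} \log(2\pi) - \frac{b+1}{4}\biggr)(s-1)^{-1} + O(1); \] (ii) simple poles at each point $s=1+2\pi i m/\log b$ with $m\in\mathbb{Z}$, $m\neq 0$, with residue \[ \operatorname{Res}\Bigl( F_b(s) , s=1+\tfrac{2\pi i m}{\log b} \Bigr) = - \frac{b-1}{2\pi i m}\, \zeta\Bigl(\tfrac{2\pi i m}{\log b}\Bigr); \] (iii) simple poles at each point $s=1-k+2\pi i m/\log b$, where $k=1$ or $k\geq 2$ is an even integer, and $m\in\mathbb{Z}$, with residue \[ \operatorname{Res}\Bigl( F_b(s) , s=1-k+\tfrac{2\pi i m}{\log b} \Bigr) = (-1)^{k+1}\frac{b-1}{\log b}\,\zeta\Bigl(\tfrac{2\pi i m}{\log b}\Bigr)\frac{B_k}{k!} \prod_{j=1}^{k-1} \Bigl(\tfrac{2\pi i m}{\log b} - j\Bigr). \]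
   Context: For an integer $b\geq 2$ and a positive integer $n$ with base-$b$ expansion $n=\sum_{i\geq 0}\delta_{b,i}(n)b^i$, $\delta_{b,i}(n)\in\{0,1,\dots,b-1\}$, the base-$b$ sum-of-digits function is $d_b(n)=\sum_{i\geq 0}\delta_{b,i}(n)$. $\zeta$ is the Riemann zeta function. The Bernoulli numbers $B_k$ are defined by $\frac{x}{e^x-1}=\sum_{k=0}^\infty \frac{B_k}{k!}x^k$ (so $B_0=1$, $B_1=-1/2$, $B_2=1/6$). An empty product equals $1$. *)

(* Defs.v *)
From Stdlib Require Export Reals List Arith ClassicalEpsilon.
From Coquelicot Require Export Coquelicot.

Open Scope R_scope.

(** * Complex functions of one complex variable *)

Definition holomorphic_at (f : C -> C) (z : C) : Prop :=
  locally (T := C_UniformSpace) z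
    (fun w => ex_derive (K := C_AbsRing) (V := C_NormedModule) f w).

(* A function with a singularity at [z] still has a value [f z]; only the values
   of [f] in a punctured neighbourhood of [z] ([locally']) are constrained. *)
Definition pole_of_order (n : nat) (f : C -> C) (z : C) : Prop :=
  (1 <= n)%nat /\
  exists g : C -> C,
    holomorphic_at g z /\ g z <> RtoC 0 /\
    locally' (T := C_UniformSpace) z (fun w => f w = (g w / (w - z) ^ n)%C).

Definition is_pole (f : C -> C) (z : C) : Prop :=
  exists n : nat, pole_of_order n f z.

Definition simple_pole (f : C -> C) (z : C) : Prop := pole_of_order 1 f z.

Definition double_pole (f : C -> C) (z : C) : Prop := pole_of_order 2 f z.

Definition meromorphic (f : C -> C) : Prop :=
  forall z : C, holomorphic_at f z \/ is_pole f z.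

(* [c j] is the coefficient of [(w - z)^-(j+1)] in the Laurent expansion. *)
Definition is_residue (f : C -> C) (z r : C) : Prop :=
  exists (n : nat) (c : nat -> C) (g : C -> C),
    holomorphic_at g z /\
    locally' (T := C_UniformSpace) z
      (fun w => f w =
         (sum_n (G := C_AbelianMonoid) (fun j => c j / (w - z) ^ S j)%C n
            + g w)%C) /\
    c 0%nat = r.

Definition bounded_near (f : C -> C) (z : C) : Prop :=
  exists M : R, locally' (T := C_UniformSpace) z (fun w => Cmod (f w) <= M).

(** * Dirichlet series and the Riemann zeta function *)

Definition Cexp (z : C) : C :=
  (exp (Re z) * cos (Im z), exp (Re z) * sin (Im z)).

(* [x ^ s] for real [x > 0], with the real logarithm of [x]. *)
Definition Rpow_C (x : R) (s : C) : C := Cexp (s * RtoC (ln x))%C.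

(* [l] is the sum of the series over n >= 1 of [a n * n^(-s)]. *)
Definition is_dirichlet_series (a : nat -> C) (s l : C) : Prop :=
  is_series (K := C_AbsRing) (V := C_NormedModule)
    (fun n => a (S n) * Rpow_C (INR (S n)) (- s))%C l.

(* The analytic continuation of the zeta series to the connected set C \ {1};
   these conditions determine [Z] everywhere except for its irrelevant value
   at the pole 1. *)
Definition is_riemann_zeta (Z : C -> C) : Prop :=
  (forall s : C, s <> RtoC 1 -> holomorphic_at Z s) /\
  (forall s : C, 1 < Re s -> is_dirichlet_series (fun _ => RtoC 1) s (Z s)).

Definition zeta : C -> C :=
  epsilon (inhabits (fun _ : C => RtoC 0)) is_riemann_zeta.

(** * Bernoulli numbers *)

(* The generating function x / (e^x - 1) equals the sum of (B k / k!) x^k near 0;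
   at x = 0 the quotient stands for its limit, which imposes nothing new. *)
Definition is_bernoulli (B : nat -> R) : Prop :=
  exists r : posreal, forall x : R, x <> 0 -> Rabs x < r ->
    is_pseries (K := R_AbsRing) (V := R_NormedModule)
      (fun k => B k / INR (fact k)) x (x / (exp x - 1)).

Definition bernoulli : nat -> R :=
  epsilon (inhabits (fun _ : nat => 0)) is_bernoulli.

(** * Sums of digits *)

Definition digit (b i n : nat) : nat := ((n / b ^ i) mod b)%nat.

(* For [2 <= b] the digits of index [i >= n] vanish, since [n < b ^ n]. *)
Definition digit_sum (b n : nat) : nat :=
  list_sum (map (fun i => digit b i n) (seq 0 (S n))).

(** * Poles *)

(* The point 2 pi i m / log b. *)
Definition omega (b : nat) (m : Z) : C :=
  (RtoC 2 * RtoC PI * Ci * RtoC (IZR m) / RtoC (ln (INR b)))%C.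

Definition shift_index (k : nat) : Prop :=
  k = 1%nat \/ ((2 <= k)%nat /\ Nat.Even k).

(* The product over 1 <= j <= k - 1 of [w - j]. *)
Definition shift_prod (k : nat) (w : C) : C :=
  fold_right Cmult (RtoC 1)
    (map (fun j => (w - RtoC (INR j))%C) (seq 1 (k - 1))).

(* Main.v *)
(* Put u = s - 1, d = d_b and g(n) = d(n) - d(n-1). The jumps satisfy g(n) = 1 when
   b does not divide n and g(b n) = g(n) - (b - 1), so that
     G(w) := sum_n g(n) n^(-w) = sum_n d(n) (n^(-w) - (n+1)^(-w))
           = zeta(w) (b^w - b) / (b^w - 1).
   Euler-Maclaurin expands u n^(-u-1) in the differences n^(-w) - (n+1)^(-w) at
   w = u + k, whence
     u F(1+u) = sum_(k <= K) (-1)^k (B_k / k!) u(u+1)...(u+k-1) G(u+k) - (tail),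
   with a tail holomorphic for Re u > -K-1. The poles of G are the points omega_m,
   where b^w = 1, and the k-th term moves them to omega_m - k; points with
   different k never meet, and B_k = 0 removes the odd k >= 3. At u = 0 the
   denominator u makes the pole double, and its expansion needs zeta(0) = -1/2 and
   zeta'(0) = -log(2 pi)/2, which follow from the same continuation applied to zeta
   and from Wallis's product.

   That the remaining points are poles amounts to zeta(i t) <> 0 for real t <> 0.
   The classical 3 + 4 cos + cos 2 argument on finite sieves gives
   zeta(1 + i t) <> 0. For Re s < 0 the function a -> zeta(s, a) + zeta(s, 1 - a) on
   the circle obeys a distribution relation that determines its Fourier
   coefficients up to a factor c(s), which yields Hurwitz's formula and
   zeta(s) = c(s) zeta(1 - s) without the Gamma function. If zeta(i t) = 0, then
   c(s) -> 0 as s -> i t, hence zeta(i t, a) + zeta(i t, 1 - a) = 0 for 0 < a < 1;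
   but this function contains a^(-i t), which has no limit as a -> 0. *)

Require Import Defs.
From Stdlib Require Import Lra Lia Psatz FunctionalExtensionality.

(** Complex analysis is built on Cauchy's formula over axis-parallel rectangles. The boundary
    integral of [1 / (w - z)] is never evaluated: it is nonzero, so it can be divided out, and 2 pi
    i does not occur. Holomorphy of uniform limits, removal of singularities and unique continuation
    all follow from that formula.

    One Euler-Maclaurin continuation, stated for a sequence [d] on the points n + a, serves twice.
    With [d = 1] the function summing first differences is a^(-w), which is entire, so u zeta(1 + u,
    a) is entire in u. With the digit sums it has the poles omega_m, the only source of poles
    besides the division by u.

    The points in (iii) are poles only because B_k <> 0 for even k; a quadratic recurrence gives
    this by making the signs alternate, without the values zeta(2 k). The factor c(s) of the
    functional equation stays a Fourier coefficient and is never computed. For zeta'(0), a quantity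
    sigma(n) of Stirling's type approximates the derivative up to a known constant; 2 sigma(n) -
    sigma(2 n) has the same limit and is explicit by Wallis's product. *)

Definition ccont (f : C -> C) (z : C) : Prop :=
  forall eps, 0 < eps -> exists d, 0 < d /\
    forall w, Cmod (w - z) < d -> Cmod (f w - f z) < eps.

(** A little-o estimate with a non-strict bound: it holds trivially at w = z, so the disc need not
    be punctured. *)
Definition cderiv (f : C -> C) (z l : C) : Prop :=
  forall eps, 0 < eps -> exists d, 0 < d /\
    forall w, Cmod (w - z) < d ->
      Cmod (f w - f z - l * (w - z)) <= eps * Cmod (w - z).

Definition cdiff (f : C -> C) (z : C) : Prop := exists l, cderiv f z l.

Definition hol (f : C -> C) (z : C) : Prop :=
  exists d, 0 < d /\ forall w, Cmod (w - z) < d -> cdiff f w.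

(** * Elementary estimates for the modulus *)

Lemma Cmod_minus_sym (x y : C) : Cmod (x - y) = Cmod (y - x).
Proof. rewrite <- (Cmod_opp (y - x)). f_equal. ring. Qed.

Lemma Cmod_triangle_minus (x y : C) : Cmod (x - y) <= Cmod x + Cmod y.
Proof. unfold Cminus. rewrite <- (Cmod_opp y). apply Cmod_triangle. Qed.

Lemma Cmod_le_minus (x y : C) : Cmod x <= Cmod y + Cmod (x - y).
Proof. replace x with (y + (x - y))%C at 1 by ring. apply Cmod_triangle. Qed.

Lemma Cmod_self_minus (x : C) : Cmod (x - x) = 0.
Proof. replace (x - x)%C with (RtoC 0) by ring. apply Cmod_0. Qed.

Lemma im_le_Cmod (z : C) : Rabs (Im z) <= Cmod z.
Proof. apply Rle_trans with (2 := Rmax_Cmod z). apply Rmax_r. Qed.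

Lemma Cmod_le_Re_Im (z : C) : Cmod z <= Rabs (Re z) + Rabs (Im z).
Proof.
  replace z with (RtoC (Re z) + Ci * RtoC (Im z))%C at 1.
  - eapply Rle_trans; [apply Cmod_triangle|].
    rewrite Cmod_mult, Cmod_Ci, !Cmod_R. lra.
  - destruct z as [x y]. unfold Ci, RtoC, Cplus, Cmult; simpl. f_equal; ring.
Qed.

Lemma C_ext (x y : C) : Re x = Re y -> Im x = Im y -> x = y.
Proof. destruct x, y; simpl; intros; subst; reflexivity. Qed.

Lemma Cmod_0_eq (z : C) : (forall eps, 0 < eps -> Cmod z <= eps) -> z = RtoC 0.
Proof.
  intros H. apply Cmod_eq_0. destruct (Rle_lt_or_eq_dec 0 (Cmod z) (Cmod_ge_0 z)); [|auto].
  specialize (H (Cmod z / 2)). lra.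
Qed.

(** * Continuity and complex differentiability *)

Lemma ccont_ext_loc (f g : C -> C) z r : 0 < r ->
  (forall w, Cmod (w - z) < r -> f w = g w) -> ccont f z -> ccont g z.
Proof.
  intros Hr E H eps He. destruct (H eps He) as [d [Hd K]].
  exists (Rmin d r). split; [apply Rmin_pos; auto|]. intros w Hw.
  rewrite <- (E w), <- (E z).
  - apply K. eapply Rlt_le_trans; [exact Hw|apply Rmin_l].
  - rewrite Cmod_self_minus; auto.
  - eapply Rlt_le_trans; [exact Hw|apply Rmin_r].
Qed.

Lemma ccont_const c z : ccont (fun _ => c) z.
Proof.
  intros eps He. exists 1. split; [lra|]. intros. rewrite Cmod_self_minus; auto.
Qed.

Lemma ccont_id z : ccont (fun w => w) z.
Proof. intros eps He. exists eps. auto. Qed.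

Lemma ccont_plus f g z : ccont f z -> ccont g z -> ccont (fun w => f w + g w)%C z.
Proof.
  intros Hf Hg eps He.
  destruct (Hf (eps / 2) ltac:(lra)) as [d [Hd K]].
  destruct (Hg (eps / 2) ltac:(lra)) as [d' [Hd' K']].
  exists (Rmin d d'). split; [apply Rmin_pos; auto|]. intros w Hw.
  replace (f w + g w - (f z + g z))%C with ((f w - f z) + (g w - g z))%C by ring.
  eapply Rle_lt_trans; [apply Cmod_triangle|].
  specialize (K w (Rlt_le_trans _ _ _ Hw (Rmin_l _ _))).
  specialize (K' w (Rlt_le_trans _ _ _ Hw (Rmin_r _ _))). lra.
Qed.

Lemma ccont_mult f g z : ccont f z -> ccont g z -> ccont (fun w => f w * g w)%C z.
Proof.
  intros Hf Hg eps He.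
  (* With both increments below m <= 1, the three terms of the expansion add up to at most [M * m],
     and m is chosen so that this is eps / 2. *)
  pose (M := Cmod (f z) + Cmod (g z) + 1).
  assert (HM : 1 <= M) by (unfold M; generalize (Cmod_ge_0 (f z)) (Cmod_ge_0 (g z)); lra).
  assert (He' : 0 < Rmin 1 (eps / (2 * M)))
    by (apply Rmin_pos; [lra|apply Rdiv_lt_0_compat; lra]).
  destruct (Hf _ He') as [d [Hd K]].
  destruct (Hg _ He') as [d' [Hd' K']].
  exists (Rmin d d'). split; [apply Rmin_pos; auto|]. intros w Hw.
  replace (f w * g w - (f z * g z))%C
    with ((f w - f z) * (g w - g z) + (f w - f z) * g z + f z * (g w - g z))%C by ring.
  specialize (K w (Rlt_le_trans _ _ _ Hw (Rmin_l _ _))).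
  specialize (K' w (Rlt_le_trans _ _ _ Hw (Rmin_r _ _))).
  eapply Rle_lt_trans; [apply Cmod_triangle|].
  eapply Rle_lt_trans; [apply Rplus_le_compat_r, Cmod_triangle|].
  rewrite !Cmod_mult.
  generalize (Rmin_l 1 (eps / (2 * M))) (Rmin_r 1 (eps / (2 * M))); intros H1 H2.
  set (m := Rmin 1 (eps / (2 * M))) in *.
  generalize (Cmod_ge_0 (f z)) (Cmod_ge_0 (g z))
    (Cmod_ge_0 (f w - f z)) (Cmod_ge_0 (g w - g z)); intros.
  assert (M * m <= eps / 2).
  { apply Rle_trans with (M * (eps / (2 * M))).
    - apply Rmult_le_compat_l; lra.
    - right. field. lra. }
  assert (Cmod (f w - f z) * Cmod (g w - g z) <= m * 1) by (apply Rmult_le_compat; lra).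
  assert (Cmod (f w - f z) * Cmod (g z) <= m * Cmod (g z)) by (apply Rmult_le_compat_r; lra).
  assert (Cmod (f z) * Cmod (g w - g z) <= Cmod (f z) * m) by (apply Rmult_le_compat_l; lra).
  assert (M * m = m * 1 + m * Cmod (g z) + Cmod (f z) * m) by (unfold M; ring).
  lra.
Qed.

Lemma ccont_neq0 f z : ccont f z -> f z <> RtoC 0 ->
  exists d, 0 < d /\ forall w, Cmod (w - z) < d -> Cmod (f z) / 2 < Cmod (f w).
Proof.
  intros Hf Hz. apply Cmod_gt_0 in Hz.
  destruct (Hf (Cmod (f z) / 2) ltac:(lra)) as [d [Hd K]].
  exists d. split; auto. intros w Hw. specialize (K w Hw).
  generalize (Cmod_le_minus (f z) (f w)). rewrite Cmod_minus_sym. lra.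
Qed.

Lemma ccont_inv f z : ccont f z -> f z <> RtoC 0 -> ccont (fun w => / f w)%C z.
Proof.
  intros Hf Hz eps He.
  destruct (ccont_neq0 f z Hf Hz) as [d [Hd K]].
  assert (Hz' := Hz). apply Cmod_gt_0 in Hz'.
  set (m := Cmod (f z)) in *.
  destruct (Hf (eps * (m * m / 2))) as [d' [Hd' K']].
  { apply Rmult_lt_0_compat; [lra|]. assert (0 < m * m) by nra. lra. }
  exists (Rmin d d'). split; [apply Rmin_pos; auto|]. intros w Hw.
  specialize (K w (Rlt_le_trans _ _ _ Hw (Rmin_l _ _))).
  specialize (K' w (Rlt_le_trans _ _ _ Hw (Rmin_r _ _))).
  assert (Hw0 : f w <> RtoC 0) by (apply Cmod_gt_0; lra).
  replace (/ f w - / f z)%C with (- (f w - f z) / (f w * f z))%C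
    by (field; auto).
  rewrite Cmod_div, Cmod_opp, Cmod_mult by (apply Cmult_neq_0; auto).
  fold m. apply Rlt_div_l; [nra|].
  apply Rlt_trans with (1 := K'). apply Rmult_lt_compat_l; [auto|].
  nra.
Qed.

Lemma ccont_comp f g z : ccont g (f z) -> ccont f z -> ccont (fun w => g (f w)) z.
Proof.
  intros Hg Hf eps He. destruct (Hg eps He) as [d [Hd K]].
  destruct (Hf d Hd) as [d' [Hd' K']]. exists d'. split; auto.
Qed.

(* Caratheodory's characterisation reduces the rules of differentiation to
   those for continuity. *)
Lemma cderiv_caratheodory f z l :
  cderiv f z l <->
  exists phi, ccont phi z /\ phi z = l /\ forall w, (f w - f z = phi w * (w - z))%C.
Proof.
  split.
  - intros H.
    exists (fun w => if Req_EM_T (Cmod (w - z)) 0 then l else ((f w - f z) / (w - z))%C).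
    split; [|split].
    + intros eps He. destruct (H (eps / 2) ltac:(lra)) as [d [Hd K]].
      exists d. split; auto. intros w Hw.
      destruct (Req_EM_T (Cmod (z - z)) 0) as [_|N]; [|destruct N; apply Cmod_self_minus].
      destruct (Req_EM_T (Cmod (w - z)) 0) as [E|N].
      * rewrite Cmod_self_minus; auto.
      * assert (Hz : (w - z)%C <> RtoC 0) by (intros E; apply N; rewrite E; apply Cmod_0).
        replace ((f w - f z) / (w - z) - l)%C with ((f w - f z - l * (w - z)) / (w - z))%C
          by (field; auto).
        rewrite Cmod_div by auto.
        generalize (Cmod_ge_0 (w - z)); intros.
        apply Rlt_div_l; [lra|]. specialize (K w Hw). nra.
    + destruct (Req_EM_T (Cmod (z - z)) 0) as [_|N]; [reflexivity|].
      destruct N; apply Cmod_self_minus.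
    + intros w. destruct (Req_EM_T (Cmod (w - z)) 0) as [E|N].
      * apply Cmod_eq_0 in E. rewrite E. replace w with z; [ring|].
        symmetry. apply Ceq_minus; auto.
      * field. intros E; apply N; rewrite E; apply Cmod_0.
  - intros [phi [Hc [Hl Hp]]] eps He. destruct (Hc eps He) as [d [Hd K]].
    exists d. split; auto. intros w Hw. rewrite Hp, <- Hl.
    replace (phi w * (w - z) - phi z * (w - z))%C with ((phi w - phi z) * (w - z))%C by ring.
    rewrite Cmod_mult. apply Rmult_le_compat_r; [apply Cmod_ge_0|]. left; auto.
Qed.

Lemma cderiv_ccont f z l : cderiv f z l -> ccont f z.
Proof.
  rewrite cderiv_caratheodory. intros [phi [Hc [Hl Hp]]].
  apply (ccont_ext_loc (fun w => f z + phi w * (w + - z))%C _ _ 1 Rlt_0_1).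
  - intros w _. replace (f w) with (f z + (f w - f z))%C by ring. rewrite Hp. ring.
  - apply ccont_plus; [apply ccont_const|]. apply ccont_mult; auto.
    apply ccont_plus; [apply ccont_id|apply ccont_const].
Qed.

Lemma cdiff_ccont f z : cdiff f z -> ccont f z.
Proof. intros [l H]. exact (cderiv_ccont _ _ _ H). Qed.

Lemma cderiv_ext_loc f g z l r : 0 < r ->
  (forall w, Cmod (w - z) < r -> f w = g w) -> cderiv f z l -> cderiv g z l.
Proof.
  intros Hr E H eps He. destruct (H eps He) as [d [Hd K]].
  exists (Rmin d r). split; [apply Rmin_pos; auto|]. intros w Hw.
  rewrite <- (E w), <- (E z).
  - apply K. eapply Rlt_le_trans; [exact Hw|apply Rmin_l].
  - rewrite Cmod_self_minus; auto.
  - eapply Rlt_le_trans; [exact Hw|apply Rmin_r].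
Qed.

Lemma cderiv_ext f g z l : (forall w, f w = g w) -> cderiv f z l -> cderiv g z l.
Proof. intros E. apply (cderiv_ext_loc f g z l 1 Rlt_0_1). auto. Qed.

Lemma cderiv_eq f z l m : l = m -> cderiv f z l -> cderiv f z m.
Proof. intros <-; auto. Qed.

Lemma cderiv_const c z : cderiv (fun _ => c) z (RtoC 0).
Proof.
  apply cderiv_caratheodory. exists (fun _ => RtoC 0).
  split; [apply ccont_const|split; [auto|intros; ring]].
Qed.

Lemma cderiv_id z : cderiv (fun w => w) z (RtoC 1).
Proof.
  apply cderiv_caratheodory. exists (fun _ => RtoC 1).
  split; [apply ccont_const|split; [auto|intros; ring]].
Qed.

Lemma cderiv_plus f g z l m :
  cderiv f z l -> cderiv g z m -> cderiv (fun w => f w + g w)%C z (l + m)%C.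
Proof.
  rewrite !cderiv_caratheodory. intros [p [Cp [Lp Ep]]] [q [Cq [Lq Eq]]].
  exists (fun w => p w + q w)%C. split; [apply ccont_plus; auto|split; [congruence|]].
  intros w. replace (f w + g w - (f z + g z))%C with ((f w - f z) + (g w - g z))%C by ring.
  rewrite Ep, Eq. ring.
Qed.

Lemma cderiv_mult f g z l m :
  cderiv f z l -> cderiv g z m ->
  cderiv (fun w => f w * g w)%C z (l * g z + f z * m)%C.
Proof.
  intros Hf Hg. assert (Cf := cderiv_ccont _ _ _ Hf).
  revert Hf Hg. rewrite !cderiv_caratheodory. intros [p [Cp [Lp Ep]]] [q [Cq [Lq Eq]]].
  exists (fun w => p w * g z + f w * q w)%C. split; [|split].
  - apply ccont_plus; apply ccont_mult; auto. apply ccont_const.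
  - congruence.
  - intros w. replace (f w * g w - f z * g z)%C
      with ((f w - f z) * g z + f w * (g w - g z))%C by ring.
    rewrite Ep, Eq. ring.
Qed.

Lemma cderiv_scal f z l c : cderiv f z l -> cderiv (fun w => c * f w)%C z (c * l)%C.
Proof.
  intros H. replace (c * l)%C with (RtoC 0 * f z + c * l)%C by ring.
  apply (cderiv_mult (fun _ => c)); auto. apply cderiv_const.
Qed.

Lemma cderiv_opp f z l : cderiv f z l -> cderiv (fun w => - f w)%C z (- l)%C.
Proof.
  intros H. apply (cderiv_ext (fun w => RtoC (-1) * f w)%C).
  - intros; ring.
  - replace (- l)%C with (RtoC (-1) * l)%C by ring. apply cderiv_scal; auto.
Qed.

Lemma cderiv_minus f g z l m :
  cderiv f z l -> cderiv g z m -> cderiv (fun w => f w - g w)%C z (l - m)%C.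
Proof. intros. apply cderiv_plus; auto. apply cderiv_opp; auto. Qed.

Lemma cderiv_inv f z l : cderiv f z l -> f z <> RtoC 0 ->
  cderiv (fun w => / f w)%C z (- l / (f z * f z))%C.
Proof.
  intros Hf Hz. assert (Cf := cderiv_ccont _ _ _ Hf).
  destruct (ccont_neq0 f z Cf Hz) as [d [Hd K]].
  assert (Hn : forall w, Cmod (w - z) < d -> f w <> RtoC 0).
  { intros w Hw. apply Cmod_gt_0. generalize (K w Hw) (Cmod_ge_0 (f z)). lra. }
  assert (Hc := proj1 (cderiv_caratheodory _ _ _) Hf).
  destruct Hc as [p [Cp [Lp Ep]]].
  (* Caratheodory's identity must hold for every w, also where [f] vanishes. Outside the disc the
     reciprocal is therefore replaced by the expression that satisfies the identity by
     construction. *)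
  assert (G : cderiv (fun w => if Rlt_dec (Cmod (w - z)) d then / f w else
     / f z + - p w / (f w * f z) * (w - z))%C z (- l / (f z * f z))%C).
  { apply cderiv_caratheodory. exists (fun w => - p w / (f w * f z))%C. split; [|split].
    - apply (ccont_ext_loc (fun w => (RtoC (-1) * p w) * / (f w * f z))%C _ _ 1 Rlt_0_1).
      + intros w _. unfold Cdiv. ring.
      + apply ccont_mult; [apply ccont_mult; auto; apply ccont_const|].
        apply ccont_inv; [apply ccont_mult; auto; apply ccont_const|].
        apply Cmult_neq_0; auto.
    - rewrite Lp; auto.
    - intros w. destruct (Rlt_dec (Cmod (z - z)) d) as [_|N];
        [|destruct N; rewrite Cmod_self_minus; auto].
      destruct (Rlt_dec (Cmod (w - z)) d) as [Hw|_]; [|ring].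
      assert (f w <> RtoC 0) by auto.
      replace (- p w / (f w * f z) * (w - z))%C with (- (f w - f z) / (f w * f z))%C
        by (rewrite Ep; field; auto).
      field; auto. }
  apply (cderiv_ext_loc _ _ _ _ d Hd) with (2 := G).
  intros w Hw. destruct (Rlt_dec (Cmod (w - z)) d); tauto.
Qed.

Lemma cderiv_comp f g z l m :
  cderiv g (f z) m -> cderiv f z l -> cderiv (fun w => g (f w)) z (m * l)%C.
Proof.
  intros Hg Hf. assert (Cf := cderiv_ccont _ _ _ Hf).
  revert Hf Hg. rewrite !cderiv_caratheodory. intros [p [Cp [Lp Ep]]] [q [Cq [Lq Eq]]].
  exists (fun w => q (f w) * p w)%C. split; [|split].
  - apply ccont_mult; auto. apply (ccont_comp f q); auto.
  - congruence.
  - intros w. rewrite Eq, Ep. ring.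
Qed.

Lemma cdiff_ext_loc f g z r : 0 < r ->
  (forall w, Cmod (w - z) < r -> f w = g w) -> cdiff f z -> cdiff g z.
Proof. intros Hr E [l H]. exists l. apply (cderiv_ext_loc f g z l r); auto. Qed.

Lemma cdiff_ext f g z : (forall w, f w = g w) -> cdiff f z -> cdiff g z.
Proof. intros E. apply (cdiff_ext_loc f g z 1 Rlt_0_1). auto. Qed.

Lemma cdiff_const c z : cdiff (fun _ => c) z.
Proof. eexists; apply cderiv_const. Qed.

Lemma cdiff_id z : cdiff (fun w => w) z.
Proof. eexists; apply cderiv_id. Qed.

Lemma cdiff_plus f g z : cdiff f z -> cdiff g z -> cdiff (fun w => f w + g w)%C z.
Proof. intros [l H] [m K]. eexists; apply cderiv_plus; eauto. Qed.

Lemma cdiff_minus f g z : cdiff f z -> cdiff g z -> cdiff (fun w => f w - g w)%C z.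
Proof. intros [l H] [m K]. eexists; apply cderiv_minus; eauto. Qed.

Lemma cdiff_opp f z : cdiff f z -> cdiff (fun w => - f w)%C z.
Proof. intros [l H]. eexists; apply cderiv_opp; eauto. Qed.

Lemma cdiff_mult f g z : cdiff f z -> cdiff g z -> cdiff (fun w => f w * g w)%C z.
Proof. intros [l H] [m K]. eexists; apply cderiv_mult; eauto. Qed.

Lemma cdiff_inv f z : cdiff f z -> f z <> RtoC 0 -> cdiff (fun w => / f w)%C z.
Proof. intros [l H] K. eexists; apply cderiv_inv; eauto. Qed.

Lemma cdiff_div f g z : cdiff f z -> cdiff g z -> g z <> RtoC 0 ->
  cdiff (fun w => f w / g w)%C z.
Proof. intros. apply cdiff_mult; auto. apply cdiff_inv; auto. Qed.

Lemma cdiff_comp f g z : cdiff g (f z) -> cdiff f z -> cdiff (fun w => g (f w)) z.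
Proof. intros [l H] [m K]. eexists; eapply cderiv_comp; eauto. Qed.

Lemma cdiff_pow f z n : cdiff f z -> cdiff (fun w => (f w) ^ n)%C z.
Proof.
  intros H. induction n as [|n IH].
  - apply (cdiff_ext (fun _ => RtoC 1)); [intros; reflexivity|apply cdiff_const].
  - apply (cdiff_ext (fun w => f w * (f w) ^ n)%C); [intros; reflexivity|].
    apply cdiff_mult; auto.
Qed.

Lemma hol_cdiff f z : hol f z -> cdiff f z.
Proof. intros [d [Hd K]]. apply K. rewrite Cmod_self_minus; auto. Qed.

Lemma hol_everywhere f z : (forall w, cdiff f w) -> hol f z.
Proof. intros H. exists 1. split; [lra|auto]. Qed.

Lemma hol_ext_loc f g z r : 0 < r ->
  (forall w, Cmod (w - z) < r -> f w = g w) -> hol f z -> hol g z.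
Proof.
  intros Hr E [d [Hd K]]. exists (Rmin d r). split; [apply Rmin_pos; auto|].
  intros w Hw.
  assert (H1 := Rlt_le_trans _ _ _ Hw (Rmin_l _ _)).
  assert (H2 := Rlt_le_trans _ _ _ Hw (Rmin_r _ _)).
  apply (cdiff_ext_loc f g w (r - Cmod (w - z))); [lra| |auto].
  intros v Hv. apply E. replace (v - z)%C with ((v - w) + (w - z))%C by ring.
  eapply Rle_lt_trans; [apply Cmod_triangle|]. lra.
Qed.

(** [P] stands for any pointwise rule on pairs of functions; intersecting the two discs turns a rule
    for [cdiff] into one for [hol]. *)
Lemma hol_lift2 (P : (C -> C) -> (C -> C) -> C -> C) f g z :
  (forall w, cdiff f w -> cdiff g w -> cdiff (P f g) w) ->
  hol f z -> hol g z -> hol (P f g) z.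
Proof.
  intros H [d [Hd K]] [d' [Hd' K']]. exists (Rmin d d'). split; [apply Rmin_pos; auto|].
  intros w Hw. apply H; [apply K|apply K'];
    (eapply Rlt_le_trans; [exact Hw|]); [apply Rmin_l|apply Rmin_r].
Qed.

Lemma hol_plus f g z : hol f z -> hol g z -> hol (fun w => f w + g w)%C z.
Proof.
  apply (hol_lift2 (fun f g w => f w + g w)%C). intros; apply cdiff_plus; auto.
Qed.

Lemma hol_minus f g z : hol f z -> hol g z -> hol (fun w => f w - g w)%C z.
Proof.
  apply (hol_lift2 (fun f g w => f w - g w)%C). intros; apply cdiff_minus; auto.
Qed.

Lemma hol_mult f g z : hol f z -> hol g z -> hol (fun w => f w * g w)%C z.
Proof.
  apply (hol_lift2 (fun f g w => f w * g w)%C). intros; apply cdiff_mult; auto.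
Qed.

Lemma hol_const c z : hol (fun _ => c) z.
Proof. apply hol_everywhere. intros; apply cdiff_const. Qed.

Lemma hol_id z : hol (fun w => w) z.
Proof. apply hol_everywhere. intros; apply cdiff_id. Qed.

Lemma hol_inv f z : hol f z -> f z <> RtoC 0 -> hol (fun w => / f w)%C z.
Proof.
  intros H Hz. destruct (ccont_neq0 f z (cdiff_ccont _ _ (hol_cdiff _ _ H)) Hz) as [d [Hd K]].
  destruct H as [d' [Hd' K']]. exists (Rmin d d'). split; [apply Rmin_pos; auto|].
  intros w Hw. apply cdiff_inv.
  - apply K'. eapply Rlt_le_trans; [exact Hw|apply Rmin_r].
  - apply Cmod_gt_0. generalize (K w (Rlt_le_trans _ _ _ Hw (Rmin_l _ _))) (Cmod_ge_0 (f z)). lra.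
Qed.

Lemma hol_div f g z : hol f z -> hol g z -> g z <> RtoC 0 -> hol (fun w => f w / g w)%C z.
Proof. intros. apply hol_mult; auto. apply hol_inv; auto. Qed.

Lemma hol_comp f g z : hol g (f z) -> hol f z -> hol (fun w => g (f w)) z.
Proof.
  intros [d [Hd K]] Hf.
  destruct (cdiff_ccont _ _ (hol_cdiff _ _ Hf) d Hd) as [d1 [Hd1 K1]].
  destruct Hf as [d' [Hd' K']]. exists (Rmin d1 d'). split; [apply Rmin_pos; auto|].
  intros w Hw. apply cdiff_comp.
  - apply K, K1. eapply Rlt_le_trans; [exact Hw|apply Rmin_l].
  - apply K'. eapply Rlt_le_trans; [exact Hw|apply Rmin_r].
Qed.

(** * Comparison with Coquelicot's neighbourhoods and derivatives *)

Lemma locally_C_Cmod (P : C -> Prop) z :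
  locally (T := C_UniformSpace) z P <->
  exists d, 0 < d /\ forall w, Cmod (w - z) < d -> P w.
Proof.
  split.
  - intros [d Hd]. exists d. split; [apply cond_pos|]. intros w Hw. apply Hd.
    apply (C_NormedModule_mixin_compat1 z w d Hw).
  - intros [d [Hd K]].
    (* Balls of the uniform structure on C are squares; a square of half side r lies in the disc of
       radius sqrt 2 * r. *)
    assert (H2 : 0 < d / sqrt 2) by (apply Rdiv_lt_0_compat; [auto|apply sqrt_lt_R0; lra]).
    exists (mkposreal _ H2). intros w Hw. apply K.
    assert (H := C_NormedModule_mixin_compat2 z w _ Hw). simpl in H.
    replace d with (sqrt 2 * (d / sqrt 2)); [exact H|].
    field. apply Rgt_not_eq, sqrt_lt_R0; lra.
Qed.

Lemma locally'_C_Cmod (P : C -> Prop) z :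
  locally' (T := C_UniformSpace) z P <->
  exists d, 0 < d /\ forall w, Cmod (w - z) < d -> w <> z -> P w.
Proof. unfold locally', within. rewrite locally_C_Cmod. tauto. Qed.

Lemma is_derive_cderiv f z l :
  is_derive (K := C_AbsRing) (V := C_NormedModule) f z l <-> cderiv f z l.
Proof.
  split.
  - intros [_ H] eps He.
    assert (Hz : is_filter_lim (locally (T := AbsRing_UniformSpace C_AbsRing) z) z)
      by (intros P HP; exact HP).
    destruct (H z Hz (mkposreal eps He)) as [d Hd].
    exists d. split; [apply cond_pos|]. intros w Hw.
    generalize (Hd w Hw). simpl. intros G.
    replace (f w - f z - l * (w - z))%C
      with (minus (minus (f w) (f z)) (scal (minus w z) l) : C); [exact G|].
    unfold minus, plus, opp, scal; simpl. unfold mult; simpl. ring.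
  - intros H. split; [apply is_linear_scal_l|].
    intros y Hy.
    assert (E : z = y)
      by exact (is_filter_lim_locally_unique (V := AbsRing_NormedModule C_AbsRing) z y Hy).
    subst y. intros eps.
    destruct (H eps (cond_pos eps)) as [d [Hd K]].
    exists (mkposreal d Hd). intros w Hw. generalize (K w Hw). intros G.
    replace (f w - f z - l * (w - z))%C
      with (minus (minus (f w) (f z)) (scal (minus w z) l) : C) in G; [exact G|].
    unfold minus, plus, opp, scal; simpl. unfold mult; simpl. ring.
Qed.

Lemma holomorphic_at_hol f z : holomorphic_at f z <-> hol f z.
Proof.
  unfold holomorphic_at. rewrite locally_C_Cmod.
  split; intros [d [Hd K]]; exists d; split; auto; intros w Hw; destruct (K w Hw) as [l Hl];
    exists l; apply is_derive_cderiv; auto.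
Qed.

(** * Integrals of complex-valued functions of a real variable *)

Definition pcont (g : R -> C) (t : R) : Prop :=
  continuous (fun t => Re (g t)) t /\ continuous (fun t => Im (g t)) t.

Definition cint (g : R -> C) (a b : R) : C :=
  (RInt (fun t => Re (g t)) a b, RInt (fun t => Im (g t)) a b).

Lemma continuous_eps (f : R -> R) t :
  continuous f t <->
  forall eps, 0 < eps -> exists d, 0 < d /\
    forall s, Rabs (s - t) < d -> Rabs (f s - f t) < eps.
Proof.
  split.
  - intros H eps He.
    destruct (proj1 (filterlim_locally f (f t)) H (mkposreal eps He)) as [d Hd].
    exists d. split; [apply cond_pos|]. intros s Hs. exact (Hd s Hs).
  - intros H. apply filterlim_locally. intros eps.
    destruct (H eps (cond_pos eps)) as [d [Hd K]].
    exists (mkposreal d Hd). intros s Hs. exact (K s Hs).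
Qed.

Lemma pcont_eps g t :
  pcont g t <->
  forall eps, 0 < eps -> exists d, 0 < d /\
    forall s, Rabs (s - t) < d -> Cmod (g s - g t) < eps.
Proof.
  unfold pcont. rewrite !continuous_eps. split.
  - intros [H1 H2] eps He.
    destruct (H1 (eps / 2) ltac:(lra)) as [d [Hd K]].
    destruct (H2 (eps / 2) ltac:(lra)) as [d' [Hd' K']].
    exists (Rmin d d'). split; [apply Rmin_pos; auto|]. intros s Hs.
    specialize (K s (Rlt_le_trans _ _ _ Hs (Rmin_l _ _))).
    specialize (K' s (Rlt_le_trans _ _ _ Hs (Rmin_r _ _))).
    eapply Rle_lt_trans; [apply Cmod_le_Re_Im|].
    change (Re (g s - g t)) with (Re (g s) - Re (g t)).
    change (Im (g s - g t)) with (Im (g s) - Im (g t)). lra.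
  - intros H. split; intros eps He; destruct (H eps He) as [d [Hd K]]; exists d; split; auto;
      intros s Hs; (eapply Rle_lt_trans; [|apply (K s Hs)]).
    + apply Rle_trans with (2 := re_le_Cmod _). right. reflexivity.
    + apply Rle_trans with (2 := im_le_Cmod _). right. reflexivity.
Qed.

Lemma pcont_comp f g t : ccont f (g t) -> pcont g t -> pcont (fun s => f (g s)) t.
Proof.
  rewrite !pcont_eps. intros Hf Hg eps He.
  destruct (Hf eps He) as [d [Hd K]]. destruct (Hg d Hd) as [d' [Hd' K']].
  exists d'. auto.
Qed.

Lemma pcont_hor y t : pcont (fun x => (x, y) : C) t.
Proof. split; [apply continuous_id|apply continuous_const]. Qed.

Lemma pcont_ver x t : pcont (fun y => (x, y) : C) t.
Proof. split; [apply continuous_const|apply continuous_id]. Qed.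

Lemma pcont_const c t : pcont (fun _ => c) t.
Proof. split; apply continuous_const. Qed.

Lemma pcont_plus f g t : pcont f t -> pcont g t -> pcont (fun s => f s + g s)%C t.
Proof.
  intros [H1 H2] [K1 K2]. split.
  - exact (continuous_plus (fun s => Re (f s)) (fun s => Re (g s)) t H1 K1).
  - exact (continuous_plus (fun s => Im (f s)) (fun s => Im (g s)) t H2 K2).
Qed.

Lemma pcont_mult f g t : pcont f t -> pcont g t -> pcont (fun s => f s * g s)%C t.
Proof.
  intros [H1 H2] [K1 K2]. split.
  - exact (continuous_minus (fun s => Re (f s) * Re (g s)) (fun s => Im (f s) * Im (g s)) t
      (continuous_mult (fun s => Re (f s)) (fun s => Re (g s)) t H1 K1)
      (continuous_mult (fun s => Im (f s)) (fun s => Im (g s)) t H2 K2)).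
  - exact (continuous_plus (fun s => Re (f s) * Im (g s)) (fun s => Im (f s) * Re (g s)) t
      (continuous_mult (fun s => Re (f s)) (fun s => Im (g s)) t H1 K2)
      (continuous_mult (fun s => Im (f s)) (fun s => Re (g s)) t H2 K1)).
Qed.

Lemma ex_RInt_pcont g a b : a <= b -> (forall t, a <= t <= b -> pcont g t) ->
  ex_RInt (fun t => Re (g t)) a b /\ ex_RInt (fun t => Im (g t)) a b.
Proof.
  intros Hab H.
  split; apply (ex_RInt_continuous (V := R_CompleteNormedModule)); intros t Ht;
    rewrite Rmin_left, Rmax_right in Ht by auto; apply (H t Ht).
Qed.

Lemma cint_ext f g a b : a <= b -> (forall t, a <= t <= b -> f t = g t) ->
  cint f a b = cint g a b.
Proof.
  intros Hab H. unfold cint. f_equal; apply RInt_ext; intros t Ht;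
    rewrite Rmin_left, Rmax_right in Ht by auto; rewrite (H t); auto; lra.
Qed.

Lemma cint_plus f g a b : a <= b ->
  (forall t, a <= t <= b -> pcont f t) -> (forall t, a <= t <= b -> pcont g t) ->
  cint (fun t => f t + g t)%C a b = (cint f a b + cint g a b)%C.
Proof.
  intros Hab Hf Hg.
  destruct (ex_RInt_pcont f a b Hab Hf), (ex_RInt_pcont g a b Hab Hg).
  unfold cint. apply C_ext; simpl.
  - apply (RInt_plus (V := R_CompleteNormedModule) (fun t => Re (f t)) (fun t => Re (g t))); auto.
  - apply (RInt_plus (V := R_CompleteNormedModule) (fun t => Im (f t)) (fun t => Im (g t))); auto.
Qed.

Lemma cint_scal c f a b : a <= b -> (forall t, a <= t <= b -> pcont f t) ->
  cint (fun t => c * f t)%C a b = (c * cint f a b)%C.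
Proof.
  intros Hab Hf. destruct (ex_RInt_pcont f a b Hab Hf) as [H1 H2].
  assert (S : forall k (u : R -> R), ex_RInt u a b -> ex_RInt (fun t => k * u t) a b)
    by (intros k u Hu; exact (ex_RInt_scal (V := R_NormedModule) u a b k Hu)).
  assert (E : forall k (u : R -> R), ex_RInt u a b ->
      RInt (fun t => k * u t) a b = k * RInt u a b)
    by (intros k u Hu; exact (RInt_scal (V := R_CompleteNormedModule) u a b k Hu)).
  unfold cint. apply C_ext; simpl; fold (Re c) (Im c).
  - rewrite <- (E _ _ H1), <- (E _ _ H2).
    rewrite <- (RInt_minus (V := R_CompleteNormedModule)) by auto.
    reflexivity.
  - rewrite <- (E _ _ H1), <- (E _ _ H2).
    rewrite <- (RInt_plus (V := R_CompleteNormedModule)) by auto.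
    reflexivity.
Qed.

Lemma cint_Chasles f a b c : a <= b -> b <= c -> (forall t, a <= t <= c -> pcont f t) ->
  (cint f a b + cint f b c)%C = cint f a c.
Proof.
  intros Hab Hbc Hf.
  destruct (ex_RInt_pcont f a b Hab) as [H1 H2]; [intros; apply Hf; lra|].
  destruct (ex_RInt_pcont f b c Hbc) as [H3 H4]; [intros; apply Hf; lra|].
  unfold cint. apply C_ext; simpl.
  - apply (RInt_Chasles (V := R_CompleteNormedModule) (fun t => Re (f t))); auto.
  - apply (RInt_Chasles (V := R_CompleteNormedModule) (fun t => Im (f t))); auto.
Qed.

(** The factor 2 comes from bounding the real and the imaginary part separately by [M]. *)
Lemma cint_bound f a b M : a <= b -> (forall t, a <= t <= b -> pcont f t) ->
  (forall t, a <= t <= b -> Cmod (f t) <= M) -> Cmod (cint f a b) <= 2 * M * (b - a).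
Proof.
  intros Hab Hf HM. destruct (ex_RInt_pcont f a b Hab Hf) as [H1 H2].
  assert (B : forall u : R -> R, ex_RInt u a b -> (forall t, a <= t <= b -> Rabs (u t) <= M) ->
      Rabs (RInt u a b) <= M * (b - a)).
  { intros u Hu K. rewrite Rmult_comm.
    apply (norm_RInt_le_const (V := R_NormedModule) u a b (RInt u a b) M Hab).
    - exact K.
    - apply (RInt_correct (V := R_CompleteNormedModule)); auto. }
  eapply Rle_trans; [apply Cmod_le_Re_Im|].
  assert (K1 := B _ H1). assert (K2 := B _ H2).
  unfold cint; simpl.
  assert (forall t, a <= t <= b -> Rabs (Re (f t)) <= M)
    by (intros t Ht; eapply Rle_trans; [apply re_le_Cmod|auto]).
  assert (forall t, a <= t <= b -> Rabs (Im (f t)) <= M)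
    by (intros t Ht; eapply Rle_trans; [apply im_le_Cmod|auto]).
  specialize (K1 ltac:(auto)). specialize (K2 ltac:(auto)). lra.
Qed.

Lemma pcont_bounded f a b : a <= b -> (forall t, a <= t <= b -> pcont f t) ->
  exists M, 0 <= M /\ forall t, a <= t <= b -> Cmod (f t) <= M.
Proof.
  intros Hab H.
  assert (B : forall u : R -> R, (forall t, a <= t <= b -> continuous u t) ->
    exists M, forall t, a <= t <= b -> Rabs (u t) <= M).
  { intros u Hu.
    destruct (continuity_ab_maj (fun t => Rabs (u t)) a b Hab) as [m [Hm _]].
    - intros c Hc. apply continuity_pt_filterlim.
      apply (continuous_comp u Rabs); [exact (Hu c Hc)|].
      apply continuous_eps. intros eps He. exists eps. split; auto.
      intros s Hs. eapply Rle_lt_trans; [apply Rabs_triang_inv2|auto].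
    - exists (Rabs (u m)). auto. }
  destruct (B _ (fun t Ht => proj1 (H t Ht))) as [M1 H1].
  destruct (B _ (fun t Ht => proj2 (H t Ht))) as [M2 H2].
  exists (M1 + M2). split.
  - assert (a <= a <= b) by lra.
    generalize (H1 a ltac:(auto)) (H2 a ltac:(auto)) (Rabs_pos (Re (f a))) (Rabs_pos (Im (f a))).
    lra.
  - intros t Ht. eapply Rle_trans; [apply Cmod_le_Re_Im|].
    generalize (H1 t Ht) (H2 t Ht). lra.
Qed.

Lemma Re_increment a b h c : Re (a - b - RtoC h * c)%C = Re a - Re b - h * Re c.
Proof. destruct a, b, c; simpl; ring. Qed.

Lemma Im_increment a b h c : Im (a - b - RtoC h * c)%C = Im a - Im b - h * Im c.
Proof. destruct a, b, c; simpl; ring. Qed.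

(* [F] is a primitive of [f] along the path [t -> p + t v]. *)
Lemma cint_primitive (F f : C -> C) (p : R -> C) v a b : a <= b ->
  (forall s t, p s - p t = RtoC (s - t) * v)%C ->
  (forall t, a <= t <= b -> pcont (fun s => f (p s)) t) ->
  (forall t, a <= t <= b -> cderiv F (p t) (f (p t))) ->
  (v * cint (fun t => f (p t)) a b = F (p b) - F (p a))%C.
Proof.
  intros Hab Hp Hc Hd.
  assert (Hv : forall t, a <= t <= b -> pcont (fun s => v * f (p s))%C t)
    by (intros t Ht; apply pcont_mult; [apply pcont_const|auto]).
  rewrite <- cint_scal by auto.
  assert (D : forall t, a <= t <= b -> forall eps, 0 < eps -> exists d, 0 < d /\
     forall s, Rabs (s - t) < d ->
     Cmod (F (p s) - F (p t) - RtoC (s - t) * (v * f (p t))) <= eps * Rabs (s - t)).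
  { intros t Ht eps He.
    (* Dividing by [Cmod v + 1] instead of [Cmod v] includes the constant path v = 0. *)
    assert (Hv0 : 0 < Cmod v + 1) by (generalize (Cmod_ge_0 v); lra).
    destruct (Hd t Ht (eps / (Cmod v + 1))) as [d [Hd' K]].
    { apply Rdiv_lt_0_compat; auto. }
    exists (d / (Cmod v + 1)). split; [apply Rdiv_lt_0_compat; auto|].
    intros s Hs. specialize (K (p s)). rewrite Hp, Cmod_mult, Cmod_R in K.
    apply Rlt_div_r in Hs; auto.
    generalize (Rabs_pos (s - t)) (Cmod_ge_0 v); intros.
    replace (RtoC (s - t) * (v * f (p t)))%C with (f (p t) * (RtoC (s - t) * v))%C by ring.
    eapply Rle_trans; [apply K; nra|].
    replace (eps * Rabs (s - t)) with (eps / (Cmod v + 1) * (Rabs (s - t) * (Cmod v + 1)))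
      by (field; lra).
    apply Rmult_le_compat_l; [left; apply Rdiv_lt_0_compat; auto|nra]. }
  unfold cint. apply C_ext;
    [change (RInt (fun t => Re (v * f (p t))%C) a b = minus (Re (F (p b))) (Re (F (p a))))
    |change (RInt (fun t => Im (v * f (p t))%C) a b = minus (Im (F (p b))) (Im (F (p a))))].
  - apply (is_RInt_unique (V := R_CompleteNormedModule)).
    apply (is_RInt_derive (V := R_CompleteNormedModule) (fun t => Re (F (p t)))
      (fun t => Re (v * f (p t))%C)); intros t Ht;
      rewrite Rmin_left, Rmax_right in Ht by auto; [|exact (proj1 (Hv t Ht))].
    apply is_derive_Reals. intros eps He. destruct (D t Ht (eps / 2) ltac:(lra)) as [d [Hd' K]].
    exists (mkposreal d Hd'). intros h Hh Hhd. simpl in Hhd.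
    specialize (K (t + h)). replace (t + h - t) with h in K by ring.
    assert (Rabs (Re (F (p (t + h)%R) - F (p t) - RtoC h * (v * f (p t)))%C) <= eps / 2 * Rabs h)
      by (eapply Rle_trans; [apply re_le_Cmod|auto]).
    assert (0 < Rabs h) by (apply Rabs_pos_lt; auto).
    match goal with |- Rabs ?x < _ => replace x with
      (Re (F (p (t + h)%R) - F (p t) - RtoC h * (v * f (p t)))%C / h)
      by (rewrite Re_increment; field; auto) end.
    rewrite Rabs_div by auto. apply Rlt_div_l; [auto|nra].
  - apply (is_RInt_unique (V := R_CompleteNormedModule)).
    apply (is_RInt_derive (V := R_CompleteNormedModule) (fun t => Im (F (p t)))
      (fun t => Im (v * f (p t))%C)); intros t Ht;
      rewrite Rmin_left, Rmax_right in Ht by auto; [|exact (proj2 (Hv t Ht))].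
    apply is_derive_Reals. intros eps He. destruct (D t Ht (eps / 2) ltac:(lra)) as [d [Hd' K]].
    exists (mkposreal d Hd'). intros h Hh Hhd. simpl in Hhd.
    specialize (K (t + h)). replace (t + h - t) with h in K by ring.
    assert (Rabs (Im (F (p (t + h)%R) - F (p t) - RtoC h * (v * f (p t)))%C) <= eps / 2 * Rabs h)
      by (eapply Rle_trans; [apply im_le_Cmod|auto]).
    assert (0 < Rabs h) by (apply Rabs_pos_lt; auto).
    match goal with |- Rabs ?x < _ => replace x with
      (Im (F (p (t + h)%R) - F (p t) - RtoC h * (v * f (p t)))%C / h)
      by (rewrite Im_increment; field; auto) end.
    rewrite Rabs_div by auto. apply Rlt_div_l; [auto|nra].
Qed.

(** * Integrals along the boundary of a rectangle *)

(** The boundary is run through counterclockwise: the top and the left edge enter with a minus sign,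
    and [Ci] is the velocity along vertical edges. *)
Definition rect (f : C -> C) (x1 x2 y1 y2 : R) : C :=
  (cint (fun x => f (x, y1)) x1 x2 - cint (fun x => f (x, y2)) x1 x2
   + Ci * (cint (fun y => f (x2, y)) y1 y2 - cint (fun y => f (x1, y)) y1 y2))%C.

Definition in_rect (x1 x2 y1 y2 : R) (w : C) : Prop :=
  x1 <= Re w <= x2 /\ y1 <= Im w <= y2.

Definition on_edge (x1 x2 y1 y2 : R) (w : C) : Prop :=
  in_rect x1 x2 y1 y2 w /\ (Re w = x1 \/ Re w = x2 \/ Im w = y1 \/ Im w = y2).

Lemma pcont_edges f x1 x2 y1 y2 : x1 <= x2 -> y1 <= y2 ->
  (forall w, on_edge x1 x2 y1 y2 w -> ccont f w) ->
  (forall t, x1 <= t <= x2 -> pcont (fun x => f (x, y1)) t) /\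
  (forall t, x1 <= t <= x2 -> pcont (fun x => f (x, y2)) t) /\
  (forall t, y1 <= t <= y2 -> pcont (fun y => f (x2, y)) t) /\
  (forall t, y1 <= t <= y2 -> pcont (fun y => f (x1, y)) t).
Proof.
  intros Hx Hy H. unfold on_edge, in_rect in H.
  split; [|split; [|split]]; intros t Ht.
  - apply (pcont_comp f (fun x => (x, y1) : C)); [|apply pcont_hor].
    apply H. simpl. split; [split|]; auto; lra.
  - apply (pcont_comp f (fun x => (x, y2) : C)); [|apply pcont_hor].
    apply H. simpl. split; [split|]; auto; lra.
  - apply (pcont_comp f (fun y => (x2, y) : C)); [|apply pcont_ver].
    apply H. simpl. split; [split|]; auto; lra.
  - apply (pcont_comp f (fun y => (x1, y) : C)); [|apply pcont_ver].
    apply H. simpl. split; [split|]; auto; lra.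
Qed.

Lemma rect_ext f g x1 x2 y1 y2 : x1 <= x2 -> y1 <= y2 ->
  (forall w, on_edge x1 x2 y1 y2 w -> f w = g w) ->
  rect f x1 x2 y1 y2 = rect g x1 x2 y1 y2.
Proof.
  intros Hx Hy H. unfold on_edge, in_rect in H. unfold rect.
  rewrite (cint_ext (fun x => f (x, y1)) (fun x => g (x, y1))),
    (cint_ext (fun x => f (x, y2)) (fun x => g (x, y2))),
    (cint_ext (fun x => f (x2, x)) (fun x => g (x2, x))),
    (cint_ext (fun x => f (x1, x)) (fun x => g (x1, x))); auto;
  intros; apply H; simpl; repeat split; auto; lra.
Qed.

Lemma rect_plus f g x1 x2 y1 y2 : x1 <= x2 -> y1 <= y2 ->
  (forall w, on_edge x1 x2 y1 y2 w -> ccont f w) ->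
  (forall w, on_edge x1 x2 y1 y2 w -> ccont g w) ->
  rect (fun w => f w + g w)%C x1 x2 y1 y2 = (rect f x1 x2 y1 y2 + rect g x1 x2 y1 y2)%C.
Proof.
  intros Hx Hy Hf Hg.
  destruct (pcont_edges f x1 x2 y1 y2 Hx Hy Hf) as [F1 [F2 [F3 F4]]].
  destruct (pcont_edges g x1 x2 y1 y2 Hx Hy Hg) as [G1 [G2 [G3 G4]]].
  unfold rect. rewrite !cint_plus; auto. ring.
Qed.

Lemma rect_scal c f x1 x2 y1 y2 : x1 <= x2 -> y1 <= y2 ->
  (forall w, on_edge x1 x2 y1 y2 w -> ccont f w) ->
  rect (fun w => c * f w)%C x1 x2 y1 y2 = (c * rect f x1 x2 y1 y2)%C.
Proof.
  intros Hx Hy Hf.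
  destruct (pcont_edges f x1 x2 y1 y2 Hx Hy Hf) as [F1 [F2 [F3 F4]]].
  unfold rect. rewrite !cint_scal; auto. ring.
Qed.

Lemma rect_minus f g x1 x2 y1 y2 : x1 <= x2 -> y1 <= y2 ->
  (forall w, on_edge x1 x2 y1 y2 w -> ccont f w) ->
  (forall w, on_edge x1 x2 y1 y2 w -> ccont g w) ->
  rect (fun w => f w - g w)%C x1 x2 y1 y2 = (rect f x1 x2 y1 y2 - rect g x1 x2 y1 y2)%C.
Proof.
  intros Hx Hy Hf Hg.
  rewrite (rect_ext _ (fun w => f w + RtoC (-1) * g w)%C); auto; [|intros; ring].
  rewrite rect_plus, rect_scal; auto; [ring|].
  intros w Hw. apply ccont_mult; [apply ccont_const|auto].
Qed.

(** The 4 is the 2 of [cint_bound] times the two edges of each direction. *)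
Lemma rect_bound f x1 x2 y1 y2 M : x1 <= x2 -> y1 <= y2 ->
  (forall w, on_edge x1 x2 y1 y2 w -> ccont f w) ->
  (forall w, on_edge x1 x2 y1 y2 w -> Cmod (f w) <= M) ->
  Cmod (rect f x1 x2 y1 y2) <= 4 * M * ((x2 - x1) + (y2 - y1)).
Proof.
  intros Hx Hy Hf HM.
  destruct (pcont_edges f x1 x2 y1 y2 Hx Hy Hf) as [F1 [F2 [F3 F4]]].
  unfold on_edge, in_rect in HM.
  assert (B1 := cint_bound (fun x => f (x, y1)) x1 x2 M Hx F1).
  assert (B2 := cint_bound (fun x => f (x, y2)) x1 x2 M Hx F2).
  assert (B3 := cint_bound (fun y => f (x2, y)) y1 y2 M Hy F3).
  assert (B4 := cint_bound (fun y => f (x1, y)) y1 y2 M Hy F4).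
  unfold rect. eapply Rle_trans; [apply Cmod_triangle|]. rewrite Cmod_mult, Cmod_Ci.
  eapply Rle_trans; [apply Rplus_le_compat_r, Cmod_triangle_minus|].
  eapply Rle_trans; [apply Rplus_le_compat_l, Rmult_le_compat_l, Cmod_triangle_minus; lra|].
  assert (C1 : Cmod (cint (fun x => f (x, y1)) x1 x2) <= 2 * M * (x2 - x1))
    by (apply B1; intros; apply HM; simpl; repeat split; auto; lra).
  assert (C2 : Cmod (cint (fun x => f (x, y2)) x1 x2) <= 2 * M * (x2 - x1))
    by (apply B2; intros; apply HM; simpl; repeat split; auto; lra).
  assert (C3 : Cmod (cint (fun y => f (x2, y)) y1 y2) <= 2 * M * (y2 - y1))
    by (apply B3; intros; apply HM; simpl; repeat split; auto; lra).
  assert (C4 : Cmod (cint (fun y => f (x1, y)) y1 y2) <= 2 * M * (y2 - y1))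
    by (apply B4; intros; apply HM; simpl; repeat split; auto; lra).
  lra.
Qed.

Lemma edge_bounded f x1 x2 y1 y2 : x1 <= x2 -> y1 <= y2 ->
  (forall w, on_edge x1 x2 y1 y2 w -> ccont f w) ->
  exists M, 0 <= M /\ forall w, on_edge x1 x2 y1 y2 w -> Cmod (f w) <= M.
Proof.
  intros Hx Hy Hf.
  destruct (pcont_edges f x1 x2 y1 y2 Hx Hy Hf) as [F1 [F2 [F3 F4]]].
  destruct (pcont_bounded _ _ _ Hx F1) as [M1 [P1 K1]].
  destruct (pcont_bounded _ _ _ Hx F2) as [M2 [P2 K2]].
  destruct (pcont_bounded _ _ _ Hy F3) as [M3 [P3 K3]].
  destruct (pcont_bounded _ _ _ Hy F4) as [M4 [P4 K4]].
  exists (M1 + M2 + M3 + M4). split; [lra|].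
  intros [x y] [[Hx' Hy'] E]; simpl in *.
  destruct E as [E|[E|[E|E]]]; subst.
  - generalize (K4 y Hy'). lra.
  - generalize (K3 y Hy'). lra.
  - generalize (K1 x Hx'). lra.
  - generalize (K2 x Hx'). lra.
Qed.

(** Each edge contributes the difference of [F] at two corners, and around the closed path these
    differences cancel. *)
Lemma rect_primitive F f x1 x2 y1 y2 : x1 <= x2 -> y1 <= y2 ->
  (forall w, on_edge x1 x2 y1 y2 w -> ccont f w) ->
  (forall w, on_edge x1 x2 y1 y2 w -> cderiv F w (f w)) ->
  rect f x1 x2 y1 y2 = RtoC 0.
Proof.
  intros Hx Hy Hf HF.
  destruct (pcont_edges f x1 x2 y1 y2 Hx Hy Hf) as [F1 [F2 [F3 F4]]].
  unfold on_edge, in_rect in HF.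
  assert (E1 := cint_primitive F f (fun x => (x, y1) : C) (RtoC 1) x1 x2 Hx).
  assert (E2 := cint_primitive F f (fun x => (x, y2) : C) (RtoC 1) x1 x2 Hx).
  assert (E3 := cint_primitive F f (fun y => (x2, y) : C) Ci y1 y2 Hy).
  assert (E4 := cint_primitive F f (fun y => (x1, y) : C) Ci y1 y2 Hy).
  rewrite Cmult_1_l in E1, E2. unfold rect.
  match goal with |- (?a - ?b + Ci * (?c - ?d))%C = _ =>
    replace (a - b + Ci * (c - d))%C with (a - b + (Ci * c - Ci * d))%C by ring end.
  rewrite E1, E2, E3, E4; auto; try ring;
    try (intros; apply C_ext; simpl; ring);
    intros; apply HF; simpl; repeat split; auto; lra.
Qed.

Lemma rect_split_x f x1 m x2 y1 y2 : x1 <= m <= x2 -> y1 <= y2 ->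
  (forall w, on_edge x1 m y1 y2 w -> ccont f w) ->
  (forall w, on_edge m x2 y1 y2 w -> ccont f w) ->
  rect f x1 x2 y1 y2 = (rect f x1 m y1 y2 + rect f m x2 y1 y2)%C.
Proof.
  intros [Hx1 Hx2] Hy Hl Hr.
  destruct (pcont_edges f x1 m y1 y2 Hx1 Hy Hl) as [F1 [F2 [F3 F4]]].
  destruct (pcont_edges f m x2 y1 y2 Hx2 Hy Hr) as [G1 [G2 [G3 G4]]].
  assert (A : forall P : R -> Prop, (forall t, x1 <= t <= m -> P t) ->
    (forall t, m <= t <= x2 -> P t) -> forall t, x1 <= t <= x2 -> P t).
  { intros P H1 H2 t Ht. destruct (Rle_dec t m); [apply H1|apply H2]; lra. }
  unfold rect.
  rewrite <- (cint_Chasles (fun x => f (x, y1)) x1 m x2),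
    <- (cint_Chasles (fun x => f (x, y2)) x1 m x2);
    [ring|lra|lra|apply A; assumption|lra|lra|apply A; assumption].
Qed.

Lemma rect_split_y f x1 x2 y1 m y2 : x1 <= x2 -> y1 <= m <= y2 ->
  (forall w, on_edge x1 x2 y1 m w -> ccont f w) ->
  (forall w, on_edge x1 x2 m y2 w -> ccont f w) ->
  rect f x1 x2 y1 y2 = (rect f x1 x2 y1 m + rect f x1 x2 m y2)%C.
Proof.
  intros Hx [Hy1 Hy2] Hl Hr.
  destruct (pcont_edges f x1 x2 y1 m Hx Hy1 Hl) as [F1 [F2 [F3 F4]]].
  destruct (pcont_edges f x1 x2 m y2 Hx Hy2 Hr) as [G1 [G2 [G3 G4]]].
  assert (A : forall P : R -> Prop, (forall t, y1 <= t <= m -> P t) ->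
    (forall t, m <= t <= y2 -> P t) -> forall t, y1 <= t <= y2 -> P t).
  { intros P H1 H2 t Ht. destruct (Rle_dec t m); [apply H1|apply H2]; lra. }
  unfold rect.
  rewrite <- (cint_Chasles (fun y => f (x2, y)) y1 m y2),
    <- (cint_Chasles (fun y => f (x1, y)) y1 m y2);
    [ring|lra|lra|apply A; assumption|lra|lra|apply A; assumption].
Qed.

(** * Goursat's theorem and Cauchy's formula on rectangles *)

(** The inner edges cancel, so the four quarters add up to the whole and one of them has at least a
    quarter of its modulus. The offsets [i] and [j] tell which one. *)
Lemma rect_quarter f x y a b : 0 <= a -> 0 <= b ->
  (forall w, in_rect x (x + a) y (y + b) w -> ccont f w) ->
  exists i j, (i = 0 \/ i = a / 2) /\ (j = 0 \/ j = b / 2) /\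
    Cmod (rect f x (x + a) y (y + b)) / 4
    <= Cmod (rect f (x + i) (x + i + a / 2) (y + j) (y + j + b / 2)).
Proof.
  intros Ha Hb H.
  assert (E : (rect f x (x + a) y (y + b) =
    rect f (x + 0) (x + 0 + a / 2) (y + 0) (y + 0 + b / 2) +
    rect f (x + 0) (x + 0 + a / 2) (y + b / 2) (y + b / 2 + b / 2) +
    (rect f (x + a / 2) (x + a / 2 + a / 2) (y + 0) (y + 0 + b / 2) +
    rect f (x + a / 2) (x + a / 2 + a / 2) (y + b / 2) (y + b / 2 + b / 2)))%C).
  { rewrite !Rplus_0_r.
    replace (x + a / 2 + a / 2) with (x + a) by field.
    replace (y + b / 2 + b / 2) with (y + b) by field.
    rewrite (rect_split_x f x (x + a / 2) (x + a)), (rect_split_y f x (x + a / 2) y (y + b / 2)),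
      (rect_split_y f (x + a / 2) (x + a) y (y + b / 2)); auto; try lra;
      intros w [[H1 H2] _]; apply H; split; lra. }
  set (r1 := rect f (x + 0) (x + 0 + a / 2) (y + 0) (y + 0 + b / 2)) in *.
  set (r2 := rect f (x + 0) (x + 0 + a / 2) (y + b / 2) (y + b / 2 + b / 2)) in *.
  set (r3 := rect f (x + a / 2) (x + a / 2 + a / 2) (y + 0) (y + 0 + b / 2)) in *.
  set (r4 := rect f (x + a / 2) (x + a / 2 + a / 2) (y + b / 2) (y + b / 2 + b / 2)) in *.
  assert (T : Cmod (rect f x (x + a) y (y + b)) <= Cmod r1 + Cmod r2 + (Cmod r3 + Cmod r4)).
  { rewrite E. eapply Rle_trans; [apply Cmod_triangle|].
    generalize (Cmod_triangle r1 r2) (Cmod_triangle r3 r4). lra. }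
  set (R0 := Cmod (rect f x (x + a) y (y + b))) in *.
  destruct (Rle_dec (R0 / 4) (Cmod r1)); [exists 0, 0; auto|].
  destruct (Rle_dec (R0 / 4) (Cmod r2)); [exists 0, (b / 2); auto|].
  destruct (Rle_dec (R0 / 4) (Cmod r3)); [exists (a / 2), 0; auto|].
  exists (a / 2), (b / 2). split; [auto|split; [auto|]]. unfold r4 in *. lra.
Qed.

(** The left endpoints increase and stay below every right endpoint, so their supremum lies in all
    the intervals. *)
Lemma nested_halving (x : nat -> R) a : 0 <= a ->
  (forall n, x (S n) = x n \/ x (S n) = x n + a / 2 ^ n / 2) ->
  exists l, forall n, x n <= l <= x n + a / 2 ^ n.
Proof.
  intros Ha H.
  assert (P : forall n, 0 <= a / 2 ^ n).
  { intros n. apply Rmult_le_pos; [auto|]. left; apply Rinv_0_lt_compat, pow_lt; lra. }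
  assert (S1 : forall n, a / 2 ^ S n = a / 2 ^ n / 2).
  { intros n. simpl. field. apply pow_nonzero; lra. }
  assert (M : forall n k, x n <= x (n + k)%nat /\ x (n + k)%nat + a / 2 ^ (n + k) <= x n + a / 2 ^ n).
  { intros n k. induction k as [|k [I1 I2]].
    - rewrite Nat.add_0_r. lra.
    - rewrite Nat.add_succ_r, S1. generalize (P (n + k)%nat). destruct (H (n + k)%nat); lra. }
  assert (N : forall n m, x n <= x m + a / 2 ^ m).
  { intros n m. destruct (Nat.le_ge_cases n m) as [L|L].
    - replace m with (n + (m - n))%nat by lia. generalize (P (n + (m - n))%nat).
      destruct (M n (m - n)%nat). lra.
    - replace n with (m + (n - m))%nat by lia. generalize (P (m + (n - m))%nat).
      destruct (M m (n - m)%nat). lra. }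
  destruct (completeness (fun y => exists n, y = x n)) as [l [U L]].
  - exists (x 0%nat + a / 2 ^ 0). intros y [n ->]. apply N.
  - exists (x 0%nat). exists 0%nat. reflexivity.
  - exists l. intros n. split; [apply U; exists n; auto|].
    apply L. intros y [m ->]. apply N.
Qed.

Lemma pow_half_small a eps : 0 < eps -> exists n, a / 2 ^ n < eps.
Proof.
  intros He. destruct (Rle_dec a 0) as [Ha|Ha].
  - exists 0%nat. simpl. lra.
  - destruct (pow_lt_1_zero (/ 2) ltac:(rewrite Rabs_pos_eq; lra) (eps / a)) as [n Hn].
    { apply Rdiv_lt_0_compat; lra. }
    exists n. specialize (Hn n (Nat.le_refl n)). rewrite pow_inv in Hn.
    assert (0 < / 2 ^ n) by (apply Rinv_0_lt_compat, pow_lt; lra).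
    rewrite Rabs_pos_eq in Hn by lra.
    apply Rlt_div_r in Hn; [|lra]. unfold Rdiv. rewrite Rmult_comm. auto.
Qed.

(** Quartering repeatedly and keeping the worst quarter leaves at least 4^(-n) of the integral after
    n steps. Near the common point of the rectangles [f] is affine up to eps times the distance; the
    affine part integrates to 0, and the rest is at most a constant times eps times diameter times
    perimeter, which is also of order 4^(-n). *)
Theorem goursat f x1 x2 y1 y2 : x1 <= x2 -> y1 <= y2 ->
  (forall w, in_rect x1 x2 y1 y2 w -> cdiff f w) ->
  rect f x1 x2 y1 y2 = RtoC 0.
Proof.
  intros Hx Hy H. set (a := x2 - x1). set (b := y2 - y1).
  assert (Ha : 0 <= a) by (unfold a; lra). assert (Hb : 0 <= b) by (unfold b; lra).
  assert (Pa : forall c n, 0 <= c -> 0 <= c / 2 ^ n).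
  { intros c n Hc. apply Rmult_le_pos; [auto|]. left; apply Rinv_0_lt_compat, pow_lt; lra. }
  assert (S1 : forall c n, c / 2 ^ S n = c / 2 ^ n / 2).
  { intros c n. simpl. field. apply pow_nonzero; lra. }
  set (Q := fun n (p : R * R) => rect f (fst p) (fst p + a / 2 ^ n) (snd p) (snd p + b / 2 ^ n)).
  set (I := fun n (p : R * R) => x1 <= fst p /\ fst p + a / 2 ^ n <= x2 /\
                       y1 <= snd p /\ snd p + b / 2 ^ n <= y2).
  (* The implication is put under the existential quantifier, so that a total choice function exists
     even for corners outside the given rectangle. *)
  assert (step : forall n p, exists q, I n p ->
     (fst q = fst p \/ fst q = fst p + a / 2 ^ n / 2) /\
     (snd q = snd p \/ snd q = snd p + b / 2 ^ n / 2) /\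
     Cmod (Q n p) / 4 <= Cmod (Q (S n) q)).
  { intros n p. destruct (excluded_middle_informative (I n p)) as [Hp|Hp];
      [|exists p; tauto].
    destruct (rect_quarter f (fst p) (snd p) (a / 2 ^ n) (b / 2 ^ n)) as [i [j [Hi [Hj K]]]]; auto.
    - intros w [W1 W2]. apply cdiff_ccont, H. destruct Hp as [? [? [? ?]]]. split; lra.
    - exists (fst p + i, snd p + j). intros _. simpl fst; simpl snd.
      split; [|split].
      + destruct Hi; subst; lra.
      + destruct Hj; subst; lra.
      + unfold Q. simpl fst; simpl snd. rewrite !S1. exact K. }
  set (F := fun n p => proj1_sig (constructive_indefinite_description _ (step n p))).
  set (p := fix p n := match n with O => (x1, y1) | S n => F n (p n) end).
  assert (IP : forall n, I n (p n) /\ Cmod (Q 0%nat (p 0%nat)) / 4 ^ n <= Cmod (Q n (p n)) /\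
     (fst (p (S n)) = fst (p n) \/ fst (p (S n)) = fst (p n) + a / 2 ^ n / 2) /\
     (snd (p (S n)) = snd (p n) \/ snd (p (S n)) = snd (p n) + b / 2 ^ n / 2)).
  { assert (FP : forall n, I n (p n) ->
     (fst (p (S n)) = fst (p n) \/ fst (p (S n)) = fst (p n) + a / 2 ^ n / 2) /\
     (snd (p (S n)) = snd (p n) \/ snd (p (S n)) = snd (p n) + b / 2 ^ n / 2) /\
     Cmod (Q n (p n)) / 4 <= Cmod (Q (S n) (p (S n)))).
    { intros n. change (p (S n)) with (F n (p n)). unfold F.
      destruct (constructive_indefinite_description _ (step n (p n))). simpl. auto. }
    induction n as [|n [I1 [I2 [I3 I4]]]].
    - assert (I 0%nat (p 0%nat)) by (unfold I, a, b; simpl; lra).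
      split; [auto|split; [simpl; lra|]]. destruct (FP 0%nat) as [? [? _]]; auto.
    - assert (I (S n) (p (S n))).
      { unfold I in *. rewrite !S1. generalize (Pa a n Ha) (Pa b n Hb).
        destruct I3, I4; lra. }
      split; [auto|split].
      + destruct (FP n I1) as [_ [_ K]]. simpl (4 ^ S n).
        replace (Cmod (Q 0%nat (p 0%nat)) / (4 * 4 ^ n))
          with (Cmod (Q 0%nat (p 0%nat)) / 4 ^ n / 4); [lra|].
        field. apply pow_nonzero; lra.
      + destruct (FP (S n)) as [? [? _]]; auto. }
  destruct (nested_halving (fun n => fst (p n)) a Ha) as [lx Lx]; [apply IP|].
  destruct (nested_halving (fun n => snd (p n)) b Hb) as [ly Ly]; [apply IP|].
  assert (HQ0 : Q 0%nat (p 0%nat) = rect f x1 x2 y1 y2).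
  { unfold Q. simpl. unfold a, b. f_equal; field. }
  rewrite <- HQ0. set (z := (lx, ly) : C).
  destruct (H z) as [l Hl].
  { destruct (IP 0%nat) as [[? [? [? ?]]] _]. specialize (Lx 0%nat). specialize (Ly 0%nat).
    unfold z. split; simpl Re; simpl Im; lra. }
  apply Cmod_0_eq. intros eps He.
  set (s := a + b). assert (Hs : 0 <= s) by (unfold s; lra).
  (* [rect_bound] on the n-th rectangle yields 4 * eps' * (s / 2^n) * (s / 2^n); after
     multiplication by 4^n the factor 4 * s * s is left. The + 1 covers s = 0. *)
  assert (He' : 0 < eps / (4 * s * s + 1)) by (apply Rdiv_lt_0_compat; nra).
  destruct (Hl _ He') as [d [Hd K]].
  destruct (pow_half_small s d Hd) as [n Hn].
  destruct (IP n) as [[N1 [N2 [N3 N4]]] [N5 _]].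
  specialize (Lx n). specialize (Ly n). simpl in Lx, Ly.
  assert (Pn : 0 < 2 ^ n) by (apply pow_lt; lra).
  assert (Ia := Pa a n Ha). assert (Ib := Pa b n Hb).
  assert (Sn : s / 2 ^ n = a / 2 ^ n + b / 2 ^ n) by (unfold s; field; lra).
  assert (W : forall w, in_rect (fst (p n)) (fst (p n) + a / 2 ^ n) (snd (p n)) (snd (p n) + b / 2 ^ n) w ->
      Cmod (w - z) <= s / 2 ^ n).
  { intros [u v] [W1 W2]. simpl in W1, W2. eapply Rle_trans; [apply Cmod_le_Re_Im|].
    unfold z; simpl. rewrite Sn. apply Rplus_le_compat; apply Rabs_le; lra. }
  (* An affine function has a quadratic primitive, so subtracting it from [f] does not change the
     integral. *)
  assert (Lin : rect (fun w => f z + l * (w - z))%C (fst (p n)) (fst (p n) + a / 2 ^ n)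
       (snd (p n)) (snd (p n) + b / 2 ^ n) = RtoC 0).
  { apply rect_primitive with (F := fun w => ((f z - l * z) * w + l / 2 * (w * w))%C);
      try lra; intros w _.
    - apply ccont_plus; [apply ccont_const|apply ccont_mult; [apply ccont_const|]].
      apply ccont_plus; [apply ccont_id|apply ccont_const].
    - replace (f z + l * (w - z))%C
        with ((f z - l * z) * 1 + l / 2 * (1 * w + w * 1))%C by field.
      apply cderiv_plus; apply cderiv_scal; [apply cderiv_id|].
      apply (cderiv_mult (fun w => w) (fun w => w)); apply cderiv_id. }
  assert (B : Cmod (Q n (p n)) <= 4 * (eps / (4 * s * s + 1) * (s / 2 ^ n)) * (a / 2 ^ n + b / 2 ^ n)).
  { replace (Q n (p n)) with (rect (fun w => f w - (f z + l * (w - z)))%C (fst (p n))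
      (fst (p n) + a / 2 ^ n) (snd (p n)) (snd (p n) + b / 2 ^ n)).
    - eapply Rle_trans; [apply rect_bound|]; try lra.
      + intros w [[W1 W2] _]. apply cdiff_ccont. apply cdiff_minus.
        * apply H. split; lra.
        * apply cdiff_plus; [apply cdiff_const|apply cdiff_mult; [apply cdiff_const|]].
          apply cdiff_minus; [apply cdiff_id|apply cdiff_const].
      + intros w [Hw _]. assert (Ww := W w Hw).
        replace (f w - (f z + l * (w - z)))%C with (f w - f z - l * (w - z))%C by ring.
        eapply Rle_trans; [apply K; lra|]. apply Rmult_le_compat_l; [lra|exact Ww].
      + right. f_equal. ring.
    - rewrite rect_minus; try lra.
      + rewrite Lin. unfold Q. ring.
      + intros w [[W1 W2] _]. apply cdiff_ccont, H. split; lra.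
      + intros w _. apply ccont_plus; [apply ccont_const|apply ccont_mult; [apply ccont_const|]].
        apply ccont_plus; [apply ccont_id|apply ccont_const]. }
  rewrite <- Sn in B.
  assert (P4 : (4 ^ n = 2 ^ n * 2 ^ n)) by (rewrite <- Rpow_mult_distr; f_equal; lra).
  assert (F4 : 0 < 4 ^ n) by (apply pow_lt; lra).
  apply Rle_trans with (4 * s * s * (eps / (4 * s * s + 1))).
  - assert (G := Rle_trans _ _ _ N5 B). apply (proj1 (Rle_div_l _ _ _ F4)) in G.
    eapply Rle_trans; [exact G|]. rewrite P4. right. field. split; [nra|lra].
  - replace (4 * s * s * (eps / (4 * s * s + 1))) with (4 * s * s / (4 * s * s + 1) * eps)
      by (field; nra).
    assert (4 * s * s / (4 * s * s + 1) <= 1) by (apply Rle_div_l; nra). nra.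
Qed.

(** Cutting off four rectangles that miss [p] leaves a square about [p] of arbitrarily small side;
    boundedness of [f] near [p] makes the integral over it arbitrarily small. *)
Lemma goursat_punctured f x1 x2 y1 y2 p M r :
  x1 < Re p < x2 -> y1 < Im p < y2 -> 0 < r ->
  (forall w, in_rect x1 x2 y1 y2 w -> w <> p -> cdiff f w) ->
  (forall w, Cmod (w - p) < r -> w <> p -> Cmod (f w) <= M) ->
  rect f x1 x2 y1 y2 = RtoC 0.
Proof.
  intros [Hx1 Hx2] [Hy1 Hy2] Hr H HM. apply Cmod_0_eq. intros eps He.
  set (M' := Rmax M 0).
  assert (HM0 : 0 <= M') by apply Rmax_r.
  assert (HM1 : forall w, Cmod (w - p) < r -> w <> p -> Cmod (f w) <= M')
    by (intros; eapply Rle_trans; [apply HM; auto|apply Rmax_l]).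
  destruct p as [px py]. simpl in *.
  (* A square of half side d has width plus height 4 * d, so [rect_bound] gives 16 * M' * d; the
     condition 2 * d < r keeps the square inside the disc where the bound is known. *)
  assert (D : exists d, 0 < d /\ x1 <= px - d /\ px + d <= x2 /\ y1 <= py - d /\ py + d <= y2 /\
     2 * d < r /\ 16 * M' * d <= eps).
  { exists (Rmin (Rmin (Rmin (px - x1) (x2 - px)) (Rmin (py - y1) (y2 - py)))
       (Rmin (r / 3) (eps / (16 * M' + 1)))).
    set (u := Rmin (Rmin (px - x1) (x2 - px)) (Rmin (py - y1) (y2 - py))).
    assert (u <= px - x1 /\ u <= x2 - px /\ u <= py - y1 /\ u <= y2 - py /\ 0 < u).
    { unfold u. repeat split; try (apply Rmin_pos; apply Rmin_pos; lra).
      - eapply Rle_trans; [apply Rmin_l|apply Rmin_l].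
      - eapply Rle_trans; [apply Rmin_l|apply Rmin_r].
      - eapply Rle_trans; [apply Rmin_r|apply Rmin_l].
      - eapply Rle_trans; [apply Rmin_r|apply Rmin_r]. }
    set (v := Rmin (r / 3) (eps / (16 * M' + 1))).
    assert (v <= r / 3 /\ v <= eps / (16 * M' + 1) /\ 0 < v).
    { unfold v. split; [apply Rmin_l|split; [apply Rmin_r|apply Rmin_pos; [lra|]]].
      apply Rdiv_lt_0_compat; lra. }
    assert (Rmin u v <= u) by apply Rmin_l. assert (Rmin u v <= v) by apply Rmin_r.
    assert (0 < Rmin u v) by (apply Rmin_pos; lra).
    repeat split; try lra.
    assert (G : Rmin u v <= eps / (16 * M' + 1)) by lra.
    apply Rle_div_r in G; [|lra]. nra. }
  destruct D as [d [Hd [D1 [D2 [D3 [D4 [D5 D6]]]]]]].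
  assert (C0 : forall w, in_rect x1 x2 y1 y2 w -> w <> (px, py) -> ccont f w)
    by (intros; apply cdiff_ccont; auto).
  assert (Z : forall a b c e, x1 <= a <= b -> b <= x2 -> y1 <= c <= e -> e <= y2 ->
      (b < px \/ px < a \/ e < py \/ py < c) -> rect f a b c e = RtoC 0).
  { intros a b c e A1 A2 A3 A4 A5. apply goursat; try lra.
    intros w [W1 W2]. apply H; [split; lra|]. intros E; subst w; simpl in *; lra. }
  assert (E : rect f x1 x2 y1 y2 = rect f (px - d) (px + d) (py - d) (py + d)).
  { rewrite (rect_split_x f x1 (px - d) x2), (rect_split_x f (px - d) (px + d) x2),
      (rect_split_y f (px - d) (px + d) y1 (py - d) y2),
      (rect_split_y f (px - d) (px + d) (py - d) (py + d) y2),
      (Z x1 (px - d) y1 y2), (Z (px + d) x2 y1 y2), (Z (px - d) (px + d) y1 (py - d)),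
      (Z (px - d) (px + d) (py + d) y2); try lra; try ring;
      intros w [[W1 W2] W3]; (apply C0; [split; lra|]); intros E; subst w; simpl in *; lra. }
  rewrite E. eapply Rle_trans; [apply rect_bound with (M := M')|]; try lra.
  - intros w [[W1 W2] W3]. apply C0; [split; lra|]. intros E'; subst w; simpl in *; lra.
  - intros w [[W1 W2] W3]. apply HM1; [|intros E'; subst w; simpl in *; lra].
    eapply Rle_lt_trans; [apply Cmod_le_Re_Im|]. destruct w as [u v]. simpl in *.
    apply Rle_lt_trans with (d + d); [|lra].
    apply Rplus_le_compat; apply Rabs_le; lra.
Qed.

Definition inside (x1 x2 y1 y2 : R) (w : C) : Prop :=
  x1 < Re w < x2 /\ y1 < Im w < y2.

Definition cauchy_int (h : C -> C) (x1 x2 y1 y2 : R) (z : C) : C :=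
  rect (fun w => h w / (w - z))%C x1 x2 y1 y2.

Lemma edge_distance x1 x2 y1 y2 z : inside x1 x2 y1 y2 z ->
  exists m, 0 < m /\ (forall w, on_edge x1 x2 y1 y2 w -> m <= Cmod (w - z)) /\
    (forall v, Cmod (v - z) < m -> inside x1 x2 y1 y2 v).
Proof.
  intros [Hx Hy].
  set (m := Rmin (Rmin (Re z - x1) (x2 - Re z)) (Rmin (Im z - y1) (y2 - Im z))).
  assert (Hm : 0 < m) by (unfold m; apply Rmin_pos; apply Rmin_pos; lra).
  assert (m <= Re z - x1) by (eapply Rle_trans; [apply Rmin_l|apply Rmin_l]).
  assert (m <= x2 - Re z) by (eapply Rle_trans; [apply Rmin_l|apply Rmin_r]).
  assert (m <= Im z - y1) by (eapply Rle_trans; [apply Rmin_r|apply Rmin_l]).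
  assert (m <= y2 - Im z) by (eapply Rle_trans; [apply Rmin_r|apply Rmin_r]).
  exists m. split; [auto|split].
  - intros w [W E].
    assert (A := re_le_Cmod (w - z)). assert (B := im_le_Cmod (w - z)).
    change (Re (w - z)) with (Re w - Re z) in A. change (Im (w - z)) with (Im w - Im z) in B.
    generalize (Rle_abs (Re w - Re z)) (Rle_abs (- (Re w - Re z)))
      (Rle_abs (Im w - Im z)) (Rle_abs (- (Im w - Im z))).
    rewrite !Rabs_Ropp. intros. destruct E as [E|[E|[E|E]]]; lra.
  - intros v Hv.
    assert (A := re_le_Cmod (v - z)). assert (B := im_le_Cmod (v - z)).
    change (Re (v - z)) with (Re v - Re z) in A. change (Im (v - z)) with (Im v - Im z) in B.
    generalize (Rle_abs (Re v - Re z)) (Rle_abs (- (Re v - Re z)))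
      (Rle_abs (Im v - Im z)) (Rle_abs (- (Im v - Im z))).
    rewrite !Rabs_Ropp. intros. split; lra.
Qed.

Lemma ccont_div_at h z w : ccont h w -> w <> z -> ccont (fun w => h w / (w - z))%C w.
Proof.
  intros Hh Hw. apply ccont_mult; auto. apply ccont_inv.
  - apply ccont_plus; [apply ccont_id|apply ccont_const].
  - intros E. apply Hw, Ceq_minus, E.
Qed.

(** The difference quotient of [f] at z is holomorphic off z and bounded near z, so its integral
    vanishes. The integral of [1 / (w - z)] takes the place of 2 pi i. *)
Theorem cauchy_formula f x1 x2 y1 y2 z :
  inside x1 x2 y1 y2 z -> (forall w, in_rect x1 x2 y1 y2 w -> cdiff f w) ->
  (f z * cauchy_int (fun _ => RtoC 1) x1 x2 y1 y2 z = cauchy_int f x1 x2 y1 y2 z)%C.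
Proof.
  intros Hz H. destruct (edge_distance _ _ _ _ _ Hz) as [m [Hm [Em _]]].
  assert (Nz : forall w, on_edge x1 x2 y1 y2 w -> w <> z).
  { intros w Hw E. specialize (Em w Hw). rewrite E, Cmod_self_minus in Em. lra. }
  destruct Hz as [Hx Hy].
  assert (Cf : forall w, on_edge x1 x2 y1 y2 w -> ccont f w)
    by (intros w [Hw _]; apply cdiff_ccont; auto).
  assert (K : rect (fun w => (f w - f z) / (w - z))%C x1 x2 y1 y2 = RtoC 0).
  { destruct (H z) as [l Hl]; [split; lra|].
    destruct (Hl 1 Rlt_0_1) as [d [Hd K]].
    apply (goursat_punctured _ x1 x2 y1 y2 z (Cmod l + 1) d); auto.
    - intros w Hw Nw. apply cdiff_div.
      + apply cdiff_minus; [auto|apply cdiff_const].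
      + apply cdiff_minus; [apply cdiff_id|apply cdiff_const].
      + intros E. apply Nw, Ceq_minus, E.
    - intros w Hw Nw. specialize (K w Hw).
      assert (N0 : (w - z)%C <> RtoC 0) by (intros E; apply Nw, Ceq_minus, E).
      rewrite Cmod_div by auto. assert (0 < Cmod (w - z)) by (apply Cmod_gt_0; auto).
      apply Rle_div_l; [auto|].
      generalize (Cmod_le_minus (f w - f z) (l * (w - z))). rewrite Cmod_mult. lra. }
  rewrite (rect_ext _ (fun w => f w / (w - z) - f z * (1 / (w - z)))%C) in K; try lra.
  - rewrite rect_minus, rect_scal in K; try lra.
    + unfold cauchy_int. apply Ceq_minus in K. symmetry. exact K.
    + intros w Hw. apply ccont_div_at; [apply ccont_const|auto].
    + intros w Hw. apply ccont_div_at; auto.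
    + intros w Hw. apply ccont_mult; [apply ccont_const|].
      apply ccont_div_at; [apply ccont_const|auto].
  - intros w Hw. field. intros E. apply (Nz w Hw), Ceq_minus, E.
Qed.

(** The imaginary part is a sum of four integrals of positive functions, namely the angles under
    which the four sides are seen from z. Positivity suffices; their sum is not computed. *)
Lemma cauchy_int_1_neq0 x1 x2 y1 y2 z : inside x1 x2 y1 y2 z ->
  cauchy_int (fun _ => RtoC 1) x1 x2 y1 y2 z <> RtoC 0.
Proof.
  intros Hz. destruct (edge_distance _ _ _ _ _ Hz) as [m [Hm [Em _]]].
  assert (Nz : forall w, on_edge x1 x2 y1 y2 w -> w <> z).
  { intros w Hw E. specialize (Em w Hw). rewrite E, Cmod_self_minus in Em. lra. }
  destruct Hz as [Hx Hy].
  set (h := fun w => (1 / (w - z))%C).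
  assert (Hc : forall w, on_edge x1 x2 y1 y2 w -> ccont h w)
    by (intros w Hw; apply ccont_div_at; [apply ccont_const|auto]).
  destruct (pcont_edges h x1 x2 y1 y2) as [F1 [F2 [F3 F4]]]; auto; try lra.
  assert (P : 0 < Im (cauchy_int (fun _ => RtoC 1) x1 x2 y1 y2 z)).
  { unfold cauchy_int. fold h. unfold rect.
    match goal with |- 0 < Im ?X => replace (Im X) with
      (RInt (fun x => Im (h (x, y1))) x1 x2 + - RInt (fun x => Im (h (x, y2))) x1 x2
       + (RInt (fun y => Re (h (x2, y))) y1 y2 + - RInt (fun y => Re (h (x1, y))) y1 y2))
      by (unfold cint; simpl; ring) end.
    assert (O : forall u a b, a < b -> (forall t, a <= t <= b -> continuous u t) ->
      (forall t, a <= t <= b -> u t < 0) -> 0 < - RInt u a b).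
    { intros u a b Hab Hu Hn. rewrite <- (RInt_opp (V := R_CompleteNormedModule) u).
      - apply RInt_gt_0; auto.
        + intros t Ht. unfold opp; simpl. specialize (Hn t). lra.
        + intros t Ht. apply (continuous_opp u). auto.
      - apply (ex_RInt_continuous (V := R_CompleteNormedModule)).
        intros t Ht. rewrite Rmin_left, Rmax_right in Ht by lra. auto. }
    assert (V : forall x y, (x, y) <> z -> 0 < (x - Re z) ^ 2 + (y - Im z) ^ 2).
    { intros x y N. destruct z as [zx zy]. unfold Re, Im; cbn [fst snd].
      generalize (pow2_ge_0 (x - zx)) (pow2_ge_0 (y - zy)). intros.
      destruct (Req_dec x zx) as [->|]; [destruct (Req_dec y zy) as [->|]|].
      - destruct N; reflexivity.
      - assert (0 < (y - zy) ^ 2) by (apply pow2_gt_0; lra). lra.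
      - assert (0 < (x - zx) ^ 2) by (apply pow2_gt_0; lra). lra. }
    assert (ER : forall x y, (x, y) <> z ->
      Re (h (x, y)) = (x - Re z) / ((x - Re z) ^ 2 + (y - Im z) ^ 2)).
    { intros x y N. specialize (V x y N). unfold h. destruct z as [zx zy]. simpl in *. field.
      unfold Rminus in V. lra. }
    assert (EI : forall x y, (x, y) <> z ->
      Im (h (x, y)) = - (y - Im z) / ((x - Re z) ^ 2 + (y - Im z) ^ 2)).
    { intros x y N. specialize (V x y N). unfold h. destruct z as [zx zy]. simpl in *. field.
      unfold Rminus in V. lra. }
    assert (N1 : forall t, x1 <= t <= x2 -> (t, y1) <> z)
      by (intros t Ht; apply Nz; split; [split|]; simpl; auto; lra).
    assert (N2 : forall t, x1 <= t <= x2 -> (t, y2) <> z)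
      by (intros t Ht; apply Nz; split; [split|]; simpl; auto; lra).
    assert (N3 : forall t, y1 <= t <= y2 -> (x2, t) <> z)
      by (intros t Ht; apply Nz; split; [split|]; simpl; auto; lra).
    assert (N4 : forall t, y1 <= t <= y2 -> (x1, t) <> z)
      by (intros t Ht; apply Nz; split; [split|]; simpl; auto; lra).
    repeat apply Rplus_lt_0_compat.
    - apply RInt_gt_0; [lra| |exact (fun t Ht => proj2 (F1 t Ht))].
      intros t Ht. rewrite EI by (apply N1; lra). apply Rdiv_lt_0_compat; [lra|].
      apply V, N1; lra.
    - apply O; [lra|exact (fun t Ht => proj2 (F2 t Ht))|].
      intros t Ht. rewrite EI by (apply N2; lra). apply Ropp_lt_cancel.
      rewrite Ropp_0, <- Rdiv_opp_l. apply Rdiv_lt_0_compat; [lra|]. apply V, N2; lra.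
    - apply RInt_gt_0; [lra| |exact (fun t Ht => proj1 (F3 t Ht))].
      intros t Ht. rewrite ER by (apply N3; lra). apply Rdiv_lt_0_compat; [lra|].
      apply V, N3; lra.
    - apply O; [lra|exact (fun t Ht => proj1 (F4 t Ht))|].
      intros t Ht. rewrite ER by (apply N4; lra). apply Ropp_lt_cancel.
      rewrite Ropp_0, <- Rdiv_opp_l. apply Rdiv_lt_0_compat; [lra|]. apply V, N4; lra. }
  intros E. rewrite E in P. simpl in P. lra.
Qed.

Lemma cauchy_int_bound h x1 x2 y1 y2 z M m :
  inside x1 x2 y1 y2 z -> 0 < m ->
  (forall w, on_edge x1 x2 y1 y2 w -> m <= Cmod (w - z)) ->
  (forall w, on_edge x1 x2 y1 y2 w -> ccont h w) ->
  (forall w, on_edge x1 x2 y1 y2 w -> Cmod (h w) <= M) ->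
  Cmod (cauchy_int h x1 x2 y1 y2 z) <= 4 * (M / m) * ((x2 - x1) + (y2 - y1)).
Proof.
  intros [Hx Hy] Hm Em Hc HM.
  assert (Nz : forall w, on_edge x1 x2 y1 y2 w -> w <> z).
  { intros w Hw E. specialize (Em w Hw). rewrite E, Cmod_self_minus in Em. lra. }
  apply rect_bound; try lra.
  - intros w Hw. apply ccont_div_at; auto.
  - intros w Hw. rewrite Cmod_div by (intros E; apply (Nz w Hw), Ceq_minus, E).
    specialize (Em w Hw). unfold Rdiv. apply Rmult_le_compat.
    + apply Cmod_ge_0.
    + left. apply Rinv_0_lt_compat. lra.
    + auto.
    + apply Rinv_le_contravar; auto.
Qed.

(** Differentiation under the integral is replaced by the identity 1/(w-v) = 1/(w-z) + (v-z)/(w-z)^2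
    + (v-z)^2/((w-z)^2 (w-v)): integrated against [h], its last term is quadratic in v - z with the
    uniform bound [B]. *)
Lemma cauchy_int_cdiff h x1 x2 y1 y2 z :
  inside x1 x2 y1 y2 z -> (forall w, on_edge x1 x2 y1 y2 w -> ccont h w) ->
  cdiff (cauchy_int h x1 x2 y1 y2) z.
Proof.
  intros Hz Hc. destruct (edge_distance _ _ _ _ _ Hz) as [m [Hm [Em Bm]]].
  destruct Hz as [Hx Hy].
  destruct (edge_bounded h x1 x2 y1 y2) as [M [HM0 HM]]; auto; try lra.
  exists (rect (fun w => h w / (w - z) / (w - z))%C x1 x2 y1 y2).
  set (P := (x2 - x1) + (y2 - y1)). assert (HP : 0 < P) by (unfold P; lra).
  set (B := 4 * (M / (m * m * (m / 2))) * P).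
  assert (HB : 0 <= B).
  { unfold B. apply Rmult_le_pos; [|lra]. apply Rmult_le_pos; [lra|].
    apply Rmult_le_pos; [auto|]. left; apply Rinv_0_lt_compat.
    repeat apply Rmult_lt_0_compat; lra. }
  intros eps He. exists (Rmin (m / 2) (eps / (B + 1))).
  split; [apply Rmin_pos; [lra|apply Rdiv_lt_0_compat; lra]|].
  intros v Hv. assert (Hv1 := Rlt_le_trans _ _ _ Hv (Rmin_l _ _)).
  assert (Hv2 := Rlt_le_trans _ _ _ Hv (Rmin_r _ _)).
  assert (Nz : forall w, on_edge x1 x2 y1 y2 w -> w <> z).
  { intros w Hw E. specialize (Em w Hw). rewrite E, Cmod_self_minus in Em. lra. }
  assert (Ev : forall w, on_edge x1 x2 y1 y2 w -> m / 2 <= Cmod (w - v)).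
  { intros w Hw. specialize (Em w Hw). generalize (Cmod_le_minus (w - z) (w - v)).
    replace (w - z - (w - v))%C with (v - z)%C by ring. lra. }
  assert (Nv : forall w, on_edge x1 x2 y1 y2 w -> w <> v).
  { intros w Hw E. specialize (Ev w Hw). rewrite E, Cmod_self_minus in Ev. lra. }
  assert (Nz' : forall w, on_edge x1 x2 y1 y2 w -> (w - z)%C <> RtoC 0)
    by (intros w Hw E; apply (Nz w Hw), Ceq_minus, E).
  assert (Nv' : forall w, on_edge x1 x2 y1 y2 w -> (w - v)%C <> RtoC 0)
    by (intros w Hw E; apply (Nv w Hw), Ceq_minus, E).
  assert (C1 : forall w, on_edge x1 x2 y1 y2 w -> ccont (fun w => h w / (w - z))%C w)
    by (intros; apply ccont_div_at; auto).
  assert (C2 : forall w, on_edge x1 x2 y1 y2 w -> ccont (fun w => h w / (w - z) / (w - z))%C w)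
    by (intros; apply (ccont_div_at (fun w => h w / (w - z))%C); auto).
  assert (C3 : forall w, on_edge x1 x2 y1 y2 w ->
     ccont (fun w => h w / (w - z) / (w - z) / (w - v))%C w)
    by (intros; apply (ccont_div_at (fun w => h w / (w - z) / (w - z))%C); auto).
  assert (C4 : forall w, on_edge x1 x2 y1 y2 w -> ccont (fun w => h w / (w - v))%C w)
    by (intros; apply ccont_div_at; auto).
  assert (E : (cauchy_int h x1 x2 y1 y2 v - cauchy_int h x1 x2 y1 y2 z
     - rect (fun w => h w / (w - z) / (w - z)) x1 x2 y1 y2 * (v - z)
     = (v - z) * (v - z) * rect (fun w => h w / (w - z) / (w - z) / (w - v)) x1 x2 y1 y2)%C).
  { unfold cauchy_int.
    rewrite (rect_ext (fun w => h w / (w - v))%C (fun w => h w / (w - z)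
       + ((v - z) * (h w / (w - z) / (w - z))
       + ((v - z) * (v - z)) * (h w / (w - z) / (w - z) / (w - v))))%C); try lra.
    - rewrite rect_plus, rect_plus, !rect_scal; auto; try lra; try ring.
      + intros w Hw. apply ccont_mult; [apply ccont_const|auto].
      + intros w Hw. apply ccont_mult; [apply ccont_const|auto].
      + intros w Hw. apply ccont_plus; apply ccont_mult; try apply ccont_const; auto.
    - intros w Hw. field. auto. }
  rewrite E, Cmod_mult, Cmod_mult.
  assert (R1 : Cmod (rect (fun w => h w / (w - z) / (w - z) / (w - v))%C x1 x2 y1 y2) <= B).
  { apply rect_bound; auto; try lra. intros w Hw.
    rewrite !Cmod_div by auto. specialize (Em w Hw). specialize (Ev w Hw).
    specialize (HM w Hw).
    assert (0 < / Cmod (w - z)) by (apply Rinv_0_lt_compat; lra).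
    assert (0 < / Cmod (w - v)) by (apply Rinv_0_lt_compat; lra).
    assert (/ Cmod (w - z) <= / m) by (apply Rinv_le_contravar; lra).
    assert (/ Cmod (w - v) <= / (m / 2)) by (apply Rinv_le_contravar; lra).
    replace (M / (m * m * (m / 2))) with (M * / m * / m * / (m / 2)) by (field; lra).
    unfold Rdiv at 1 2 3. assert (G0 := Cmod_ge_0 (h w)).
    assert (Q1 : Cmod (h w) * / Cmod (w - z) <= M * / m)
      by (apply Rmult_le_compat; lra).
    assert (Q2 : 0 <= Cmod (h w) * / Cmod (w - z)) by (apply Rmult_le_pos; lra).
    assert (Q3 : Cmod (h w) * / Cmod (w - z) * / Cmod (w - z) <= M * / m * / m)
      by (apply Rmult_le_compat; lra).
    assert (Q4 : 0 <= Cmod (h w) * / Cmod (w - z) * / Cmod (w - z))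
      by (apply Rmult_le_pos; lra).
    apply Rmult_le_compat; lra. }
  generalize (Cmod_ge_0 (v - z)) (Cmod_ge_0 (rect (fun w => h w / (w - z) / (w - z) / (w - v))%C x1 x2 y1 y2)).
  intros G1 G2. apply Rlt_div_r in Hv2; [|lra].
  apply Rle_trans with (Cmod (v - z) * (Cmod (v - z) * B)).
  - rewrite Rmult_assoc. apply Rmult_le_compat_l; [auto|]. apply Rmult_le_compat_l; auto.
  - rewrite (Rmult_comm eps). apply Rmult_le_compat_l; [auto|]. nra.
Qed.

(** * Removable singularities, uniform limits, unique continuation *)

Lemma square_inside a r w : Cmod (w - a) < r ->
  inside (Re a - r) (Re a + r) (Im a - r) (Im a + r) w.
Proof.
  intros H. assert (A := re_le_Cmod (w - a)). assert (B := im_le_Cmod (w - a)).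
  change (Re (w - a)) with (Re w - Re a) in A. change (Im (w - a)) with (Im w - Im a) in B.
  generalize (Rle_abs (Re w - Re a)) (Rle_abs (- (Re w - Re a)))
    (Rle_abs (Im w - Im a)) (Rle_abs (- (Im w - Im a))).
  rewrite !Rabs_Ropp. intros. split; lra.
Qed.

Lemma square_in_rect a r w :
  in_rect (Re a - r) (Re a + r) (Im a - r) (Im a + r) w -> Cmod (w - a) <= 2 * r.
Proof.
  intros [A B]. eapply Rle_trans; [apply Cmod_le_Re_Im|].
  change (Re (w - a)) with (Re w - Re a). change (Im (w - a)) with (Im w - Im a).
  assert (Rabs (Re w - Re a) <= r) by (apply Rabs_le; lra).
  assert (Rabs (Im w - Im a) <= r) by (apply Rabs_le; lra). lra.
Qed.

Lemma square_edge a r w : 0 < r ->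
  on_edge (Re a - r) (Re a + r) (Im a - r) (Im a + r) w -> r <= Cmod (w - a).
Proof.
  intros Hr [_ E]. destruct (Rle_dec r (Cmod (w - a))) as [|N]; auto.
  destruct (square_inside a r w) as [A B]; [lra|]. destruct E as [E|[E|[E|E]]]; lra.
Qed.

(** Removal of the singularity of the difference quotient: [g] is the Cauchy integral of its
    boundary values, normalised by that of 1, and such a quotient is holomorphic at z0 as well.
    Repeated use produces Taylor coefficients one at a time. *)
Theorem hol_divided_difference f z0 : hol f z0 ->
  exists g d, 0 < d /\ hol g z0 /\
    forall w, Cmod (w - z0) < d -> f w = (f z0 + (w - z0) * g w)%C.
Proof.
  intros [d [Hd H]]. set (r := d / 3). assert (Hr : 0 < r) by (unfold r; lra).
  set (x1 := Re z0 - r). set (x2 := Re z0 + r). set (y1 := Im z0 - r). set (y2 := Im z0 + r).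
  assert (Ins : forall w, Cmod (w - z0) < r -> inside x1 x2 y1 y2 w)
    by (intros; apply square_inside; auto).
  assert (Hf : forall w, in_rect x1 x2 y1 y2 w -> cdiff f w).
  { intros w Hw. apply H. apply square_in_rect in Hw. unfold r in Hw. lra. }
  set (h := fun w => (f w - f z0)%C).
  assert (Hh : forall w, in_rect x1 x2 y1 y2 w -> cdiff h w)
    by (intros; apply cdiff_minus; [auto|apply cdiff_const]).
  set (q := fun w => (h w / (w - z0))%C).
  assert (Ne : forall w, on_edge x1 x2 y1 y2 w -> w <> z0).
  { intros w Hw E. apply square_edge in Hw; auto. rewrite E, Cmod_self_minus in Hw. lra. }
  assert (Cq : forall w, on_edge x1 x2 y1 y2 w -> ccont q w).
  { intros w Hw. apply ccont_div_at; [|auto]. apply cdiff_ccont, Hh, Hw. }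
  assert (C1 : forall w, on_edge x1 x2 y1 y2 w -> ccont (fun _ => RtoC 1) w)
    by (intros; apply ccont_const).
  exists (fun w => (cauchy_int q x1 x2 y1 y2 w / cauchy_int (fun _ => RtoC 1) x1 x2 y1 y2 w)%C), r.
  split; [auto|split].
  - exists r. split; auto. intros w Hw. apply cdiff_div.
    + apply cauchy_int_cdiff; auto.
    + apply cauchy_int_cdiff; auto.
    + apply cauchy_int_1_neq0; auto.
  - intros w Hw.
    assert (J0 := cauchy_int_1_neq0 _ _ _ _ _ (Ins w Hw)).
    assert (E1 := cauchy_formula h x1 x2 y1 y2 w (Ins w Hw) Hh).
    assert (E0 : cauchy_int h x1 x2 y1 y2 z0 = RtoC 0).
    { rewrite <- (cauchy_formula h x1 x2 y1 y2 z0); auto.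
      - unfold h. ring.
      - apply Ins. rewrite Cmod_self_minus. auto. }
    assert (Nw : forall v, on_edge x1 x2 y1 y2 v -> v <> w).
    { intros v Hv E. subst v. destruct (Ins w Hw) as [A B].
      destruct Hv as [_ [E|[E|[E|E]]]]; lra. }
    (* On the boundary h/(v-w) = h/(v-z0) + (w-z0) q/(v-w). The first part integrates to 0 because
       h(z0) = 0, so the case w = z0 needs no separate treatment. *)
    assert (E2 : (cauchy_int h x1 x2 y1 y2 w =
                  cauchy_int h x1 x2 y1 y2 z0 + (w - z0) * cauchy_int q x1 x2 y1 y2 w)%C).
    { unfold cauchy_int. destruct (Ins w Hw) as [A B].
      rewrite <- rect_scal, <- rect_plus; try lra.
      - apply rect_ext; try lra. intros v Hv. unfold q. field.
        split; intros E; [apply (Ne v Hv)|apply (Nw v Hv)]; apply Ceq_minus; auto.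
      - intros v Hv. apply ccont_div_at; [|auto]. apply cdiff_ccont, Hh, Hv.
      - intros v Hv. apply ccont_mult; [apply ccont_const|]. apply ccont_div_at; auto.
      - intros v Hv. apply ccont_div_at; auto. }
    replace (f w) with (f z0 + h w)%C by (unfold h; ring).
    f_equal. apply (f_equal (fun u => u / cauchy_int (fun _ => RtoC 1) x1 x2 y1 y2 w)%C) in E1.
    rewrite E2, E0 in E1. replace (h w) with
      (h w * cauchy_int (fun _ => RtoC 1) x1 x2 y1 y2 w
        / cauchy_int (fun _ => RtoC 1) x1 x2 y1 y2 w)%C by (field; auto).
    rewrite E1. field. auto.
Qed.

Lemma cderiv_of_increment f g z0 d : 0 < d -> ccont g z0 ->
  (forall w, Cmod (w - z0) < d -> f w = (f z0 + (w - z0) * g w)%C) -> cderiv f z0 (g z0).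
Proof.
  intros Hd Hg E.
  assert (G : cderiv (fun w => f z0 + g w * (w - z0))%C z0 (g z0)).
  { apply cderiv_caratheodory. exists g. split; auto. split; auto. intros; ring. }
  apply (cderiv_ext_loc _ _ _ _ d Hd) with (2 := G).
  intros w Hw. rewrite (E w Hw). ring.
Qed.

Lemma uniform_limit_ccont (fn : nat -> C -> C) f z d : 0 < d ->
  (forall n, ccont (fn n) z) ->
  (forall eps, 0 < eps -> exists n, forall w, Cmod (w - z) < d -> Cmod (fn n w - f w) <= eps) ->
  ccont f z.
Proof.
  intros Hd Hc Hu eps He. destruct (Hu (eps / 4) ltac:(lra)) as [n Hn].
  destruct (Hc n (eps / 2) ltac:(lra)) as [d' [Hd' K]].
  exists (Rmin d d'). split; [apply Rmin_pos; auto|]. intros w Hw.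
  specialize (K w (Rlt_le_trans _ _ _ Hw (Rmin_r _ _))).
  assert (H1 := Hn w (Rlt_le_trans _ _ _ Hw (Rmin_l _ _))).
  assert (H2 := Hn z ltac:(rewrite Cmod_self_minus; auto)).
  replace (f w - f z)%C with ((fn n w - fn n z) - (fn n w - f w) + (fn n z - f z))%C by ring.
  eapply Rle_lt_trans; [apply Cmod_triangle|].
  eapply Rle_lt_trans; [apply Rplus_le_compat_r, Cmod_triangle_minus|]. lra.
Qed.

(** Cauchy's formula survives the uniform limit and exhibits [f] as a quotient of two Cauchy
    integrals of continuous functions, which is differentiable. *)
Theorem uniform_limit_hol (fn : nat -> C -> C) f z d : 0 < d ->
  (forall n w, Cmod (w - z) < d -> cdiff (fn n) w) ->
  (forall eps, 0 < eps -> exists n, forall w, Cmod (w - z) < d -> Cmod (fn n w - f w) <= eps) ->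
  hol f z.
Proof.
  intros Hd Hc Hu. set (r := d / 3). assert (Hr : 0 < r) by (unfold r; lra).
  set (x1 := Re z - r). set (x2 := Re z + r). set (y1 := Im z - r). set (y2 := Im z + r).
  assert (Ins : forall w, Cmod (w - z) < r -> inside x1 x2 y1 y2 w)
    by (intros; apply square_inside; auto).
  assert (Bl : forall w, in_rect x1 x2 y1 y2 w -> Cmod (w - z) < d).
  { intros w Hw. apply square_in_rect in Hw. unfold r in Hw. lra. }
  assert (Cf : forall w, Cmod (w - z) < d -> ccont f w).
  { intros w Hw. apply (uniform_limit_ccont fn f w (d - Cmod (w - z))); [lra| |].
    - intros n. apply cdiff_ccont; auto.
    - intros eps He. destruct (Hu eps He) as [n Hn]. exists n. intros v Hv. apply Hn.
      replace (v - z)%C with ((v - w) + (w - z))%C by ring.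
      eapply Rle_lt_trans; [apply Cmod_triangle|]. lra. }
  assert (K : forall w, Cmod (w - z) < r ->
     (f w * cauchy_int (fun _ => RtoC 1) x1 x2 y1 y2 w = cauchy_int f x1 x2 y1 y2 w)%C).
  { intros w Hw. apply Ceq_minus, Cmod_0_eq. intros eps He.
    set (J := cauchy_int (fun _ => RtoC 1) x1 x2 y1 y2 w).
    destruct (edge_distance _ _ _ _ _ (Ins w Hw)) as [m [Hm [Em _]]].
    destruct (Ins w Hw) as [A B].
    set (P := (x2 - x1) + (y2 - y1)). assert (HP : 0 < P) by (unfold P; lra).
    (* Up to the factor eps / T, the two error terms add up to [T - 1]: one from the value at w,
       multiplied by J, and one from the integral over the boundary. *)
    set (T := Cmod J + 4 * / m * P + 1).
    assert (HT : 0 < T).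
    { unfold T. assert (0 < / m) by (apply Rinv_0_lt_compat; auto).
      assert (0 < 4 * / m * P) by (repeat apply Rmult_lt_0_compat; lra).
      generalize (Cmod_ge_0 J). lra. }
    destruct (Hu (eps / T)) as [n Hn]; [apply Rdiv_lt_0_compat; auto|].
    assert (F := cauchy_formula (fn n) x1 x2 y1 y2 w (Ins w Hw)). fold J in F.
    assert (Ce : forall v, on_edge x1 x2 y1 y2 v -> ccont f v) by (intros v [Hv _]; auto).
    assert (Cn : forall v, on_edge x1 x2 y1 y2 v -> ccont (fn n) v)
      by (intros v [Hv _]; apply cdiff_ccont; auto).
    assert (Nw : forall v, on_edge x1 x2 y1 y2 v -> v <> w).
    { intros v Hv E. specialize (Em v Hv). rewrite E, Cmod_self_minus in Em. lra. }
    assert (E : (cauchy_int (fn n) x1 x2 y1 y2 w - cauchy_int f x1 x2 y1 y2 w =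
                 cauchy_int (fun v => fn n v - f v) x1 x2 y1 y2 w)%C).
    { unfold cauchy_int. rewrite <- rect_minus; try lra.
      - apply rect_ext; try lra. intros v Hv. field. intros E. apply (Nw v Hv), Ceq_minus, E.
      - intros v Hv. apply ccont_div_at; auto.
      - intros v Hv. apply ccont_div_at; auto. }
    assert (Bd : Cmod (cauchy_int (fun v => fn n v - f v)%C x1 x2 y1 y2 w)
              <= 4 * (eps / T / m) * P).
    { apply cauchy_int_bound; auto.
      - intros v Hv. apply ccont_plus; auto. apply (ccont_ext_loc (fun v => RtoC (-1) * f v)%C _ _ 1 Rlt_0_1).
        + intros; ring.
        + apply ccont_mult; auto. apply ccont_const.
      - intros v [Hv _]. apply Hn; auto. }
    replace (f w * J - cauchy_int f x1 x2 y1 y2 w)%C with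
      ((cauchy_int (fn n) x1 x2 y1 y2 w - cauchy_int f x1 x2 y1 y2 w) - (fn n w - f w) * J)%C.
    - rewrite E. eapply Rle_trans; [apply Cmod_triangle_minus|]. rewrite Cmod_mult.
      assert (Cmod (fn n w - f w) <= eps / T) by (apply Hn; unfold r in Hw; lra).
      apply Rle_trans with (4 * (eps / T / m) * P + eps / T * Cmod J).
      + apply Rplus_le_compat; [exact Bd|]. apply Rmult_le_compat_r; [apply Cmod_ge_0|auto].
      + replace (4 * (eps / T / m) * P + eps / T * Cmod J)
          with (eps / T * (T - 1)) by (replace (T - 1) with (Cmod J + 4 * / m * P) by (unfold T; ring); field; lra).
        assert (0 < eps / T) by (apply Rdiv_lt_0_compat; auto).
        replace eps with (eps / T * T) at 2 by (field; lra).
        apply Rmult_le_compat_l; lra.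
    - rewrite <- F; [ring|]. intros v Hv. auto. }
  exists r. split; auto. intros w Hw.
  apply (cdiff_ext_loc (fun w => cauchy_int f x1 x2 y1 y2 w / cauchy_int (fun _ => RtoC 1) x1 x2 y1 y2 w)%C
    _ _ (r - Cmod (w - z))); [lra| |].
  - intros v Hv. assert (Hv' : Cmod (v - z) < r).
    { replace (v - z)%C with ((v - w) + (w - z))%C by ring.
      eapply Rle_lt_trans; [apply Cmod_triangle|]. lra. }
    rewrite <- (K v Hv'). field. apply cauchy_int_1_neq0; auto.
  - apply cdiff_div.
    + apply cauchy_int_cdiff; auto. intros v [Hv _]. auto.
    + apply cauchy_int_cdiff; auto. intros; apply ccont_const.
    + apply cauchy_int_1_neq0; auto.
Qed.

(* Cauchy's formula for [f w / (w - a)^n], which is still holomorphic, gives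
   [|f z| <= K (|z - a| / r)^n] for every [n]. *)
Theorem zero_near_centre f a r rho z : 0 < r -> 0 < rho ->
  (forall w, in_rect (Re a - r) (Re a + r) (Im a - r) (Im a + r) w -> cdiff f w) ->
  (forall w, Cmod (w - a) < rho -> f w = RtoC 0) ->
  Cmod (z - a) < r -> f z = RtoC 0.
Proof.
  intros Hr Hrho H H0 Hz.
  set (x1 := Re a - r) in *. set (x2 := Re a + r) in *.
  set (y1 := Im a - r) in *. set (y2 := Im a + r) in *.
  assert (Iz : inside x1 x2 y1 y2 z) by (apply square_inside; auto).
  destruct (Req_dec (Cmod (z - a)) 0) as [Ea|Na]; [apply H0; lra|].
  assert (Nz : z <> a) by (intros E; apply Na; rewrite E; apply Cmod_self_minus).
  assert (Nz' : (z - a)%C <> RtoC 0) by (intros E; apply Nz, Ceq_minus, E).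
  assert (J0 := cauchy_int_1_neq0 _ _ _ _ _ Iz).
  set (J := cauchy_int (fun _ => RtoC 1) x1 x2 y1 y2 z) in *.
  assert (HJ : 0 < Cmod J) by (apply Cmod_gt_0; auto).
  destruct (edge_distance _ _ _ _ _ Iz) as [m [Hm [Em _]]].
  destruct (edge_bounded f x1 x2 y1 y2) as [M [HM0 HM]]; try (unfold x1, x2, y1, y2; lra).
  { intros w [Hw _]. apply cdiff_ccont; auto. }
  set (P := (x2 - x1) + (y2 - y1)).
  assert (HP : 0 < P) by (unfold P, x1, x2, y1, y2; lra).
  set (fn := fun n w => (f w / (w - a) ^ n)%C).
  assert (Hfn : forall n w, in_rect x1 x2 y1 y2 w -> cdiff (fn n) w).
  { intros n w Hw. destruct (Req_dec (Cmod (w - a)) 0) as [E|N].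
    (* At the centre the quotient has denominator 0 when n > 0, but its numerator is 0 on a whole
       disc, so the quotient is the zero function there. *)
    - apply (cdiff_ext_loc (fun _ => RtoC 0) _ _ rho Hrho); [|apply cdiff_const].
      apply Cmod_eq_0, Ceq_minus in E. subst w.
      intros v Hv. unfold fn. rewrite H0 by auto. unfold Cdiv. ring.
    - apply cdiff_div; auto.
      + apply (cdiff_pow (fun w => w - a)%C). apply cdiff_minus; [apply cdiff_id|apply cdiff_const].
      + apply Cpow_nz. intros E. apply N. rewrite E. apply Cmod_0. }
  set (t := Cmod (z - a) / r).
  assert (Ht : 0 <= t < 1).
  { unfold t. split; [apply Rmult_le_pos; [apply Cmod_ge_0|left; apply Rinv_0_lt_compat; auto]|].
    apply Rlt_div_l; lra. }
  set (K := 4 * (M / m) * P / Cmod J).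
  assert (B : forall n, Cmod (f z) <= K * t ^ n).
  { intros n. assert (F := cauchy_formula (fn n) x1 x2 y1 y2 z Iz (Hfn n)). fold J in F.
    assert (Bd : Cmod (cauchy_int (fn n) x1 x2 y1 y2 z) <= 4 * (M / r ^ n / m) * P).
    { apply cauchy_int_bound; auto.
      - intros w [Hw _]. apply cdiff_ccont, Hfn, Hw.
      - intros w Hw. assert (W := square_edge a r w Hr Hw).
        assert (w - a <> RtoC 0)%C by (apply Cmod_gt_0; lra).
        unfold fn. rewrite Cmod_div, Cmod_pow by (apply Cpow_nz; auto).
        unfold Rdiv. apply Rmult_le_compat.
        + apply Cmod_ge_0.
        + left. apply Rinv_0_lt_compat, pow_lt. lra.
        + auto.
        + apply Rinv_le_contravar; [apply pow_lt; auto|]. apply pow_incr. lra. }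
    rewrite <- F, Cmod_mult in Bd. unfold fn in Bd.
    rewrite Cmod_div, Cmod_pow in Bd by (apply Cpow_nz; auto).
    assert (0 < Cmod (z - a)) by (apply Cmod_gt_0; auto).
    assert (0 < Cmod (z - a) ^ n) by (apply pow_lt; auto).
    assert (0 < r ^ n) by (apply pow_lt; auto).
    apply (Rmult_le_compat_r (Cmod (z - a) ^ n / Cmod J)) in Bd.
    - replace (Cmod (f z)) with
        (Cmod (f z) / Cmod (z - a) ^ n * Cmod J * (Cmod (z - a) ^ n / Cmod J)) by (field; lra).
      eapply Rle_trans; [exact Bd|]. right. unfold K, t.
      replace ((Cmod (z - a) / r) ^ n) with (Cmod (z - a) ^ n / r ^ n)
        by (unfold Rdiv; rewrite Rpow_mult_distr, pow_inv; reflexivity).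
      field. repeat split; lra.
    - left. apply Rdiv_lt_0_compat; auto. }
  apply Cmod_0_eq. intros eps He.
  assert (HK : 0 <= K).
  { unfold K. apply Rmult_le_pos; [|left; apply Rinv_0_lt_compat; auto].
    apply Rmult_le_pos; [|lra]. apply Rmult_le_pos; [lra|].
    apply Rmult_le_pos; [auto|left; apply Rinv_0_lt_compat; auto]. }
  destruct (pow_lt_1_zero t ltac:(rewrite Rabs_pos_eq; lra) (eps / (K + 1))) as [n Hn].
  { apply Rdiv_lt_0_compat; lra. }
  specialize (Hn n (Nat.le_refl n)). specialize (B n).
  assert (0 <= t ^ n) by (apply pow_le; lra).
  rewrite Rabs_pos_eq in Hn by auto. apply Rlt_div_r in Hn; [|lra]. nra.
Qed.

(** A centre far to the right of z, at the same height, lies where [f] vanishes. The radius reaches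
    past z, and the square of that half side ends at the abscissa halfway between c and Re z. *)
Lemma zero_in_half_plane f c c' :
  (forall w, c < Re w -> cdiff f w) -> (forall w, c' < Re w -> f w = RtoC 0) ->
  forall z, c < Re z -> f z = RtoC 0.
Proof.
  intros H H0 z Hz. set (T := Rmax (c' + 1) (Re z + 1)).
  assert (T1 : c' + 1 <= T) by apply Rmax_l. assert (T2 : Re z + 1 <= T) by apply Rmax_r.
  apply (zero_near_centre f (T, Im z) (T - (c + Re z) / 2) 1); simpl.
  - lra.
  - lra.
  - intros w [W _]. apply H. lra.
  - intros w Hw. apply H0. generalize (re_le_Cmod (w - (T, Im z))).
    change (Re (w - (T, Im z))) with (Re w - T). generalize (Rle_abs (- (Re w - T))).
    rewrite Rabs_Ropp. lra.
  - replace (z - (T, Im z))%C with (RtoC (Re z - T)).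
    + rewrite Cmod_R, Rabs_left; lra.
    + apply C_ext; simpl; unfold Re, Im; ring.
Qed.

(* The plane punctured at 1 is covered by discs centred in the half-plane
   [1 < Re], then (to the left of 1) by discs centred in the upper half-plane. *)
Lemma zero_off_one f :
  (forall w, w <> RtoC 1 -> cdiff f w) -> (forall w, 1 < Re w -> f w = RtoC 0) ->
  forall z, Re z < 1 -> f z = RtoC 0.
Proof.
  intros H H0.
  assert (U : forall z, 0 < Im z -> f z = RtoC 0).
  { intros z Hz.
    (* Large discs centred at (3, T) exhaust the upper half-plane. The radius T - Im z / 2 leaves a
       strip above the real axis, so that the enclosing square misses the point 1. *)
    set (T := (Rsqr (Re z - 3) + Rsqr (Im z)) / Im z + 1 + Im z).
    assert (Q : 0 <= Rsqr (Re z - 3)) by apply Rle_0_sqr.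
    assert (HT : 0 < T - Im z).
    { unfold T. assert (0 <= (Rsqr (Re z - 3) + Rsqr (Im z)) / Im z).
      { apply Rmult_le_pos; [|left; apply Rinv_0_lt_compat; auto].
        generalize (Rle_0_sqr (Im z)). lra. }
      lra. }
    assert (HT' : (Rsqr (Re z - 3) + Rsqr (Im z)) < (T - Im z) * Im z).
    { unfold T. replace (((Rsqr (Re z - 3) + Rsqr (Im z)) / Im z + 1 + Im z - Im z) * Im z)
        with (Rsqr (Re z - 3) + Rsqr (Im z) + Im z) by (field; lra). lra. }
    set (e := Im z / 2).
    apply (zero_near_centre f (3, T) (T - e) 1); simpl; unfold e.
    - lra.
    - lra.
    - intros w [_ W]. apply H. intros E. subst w. simpl in W. lra.
    - intros w Hw. apply H0. generalize (re_le_Cmod (w - (3, T))).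
      change (Re (w - (3, T))) with (Re w - 3). generalize (Rle_abs (- (Re w - 3))).
      rewrite Rabs_Ropp. lra.
    - unfold Cmod. rewrite <- (sqrt_Rsqr (T - Im z / 2)) by lra. apply sqrt_lt_1_alt.
      change (fst (z - (3, T))%C) with (Re z - 3). change (snd (z - (3, T))%C) with (Im z - T).
      unfold Rsqr in *. split; [|nra].
      generalize (pow2_ge_0 (Re z - 3)) (pow2_ge_0 (Im z - T)). lra. }
  intros z Hz.
  (* The second family of discs is centred at (1 - D, y) with y >= 1, where [f] already vanishes; as
     D grows they exhaust the half-plane Re < 1, and the enclosing squares stay to the left of 1. *)
  set (y := Rabs (Im z) + 1).
  assert (Hy : 1 <= y) by (unfold y; generalize (Rabs_pos (Im z)); lra).
  set (D := Rsqr (Im z - y) / (1 - Re z) + 1 + (1 - Re z)).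
  assert (P : 0 <= Rsqr (Im z - y) / (1 - Re z)).
  { apply Rmult_le_pos; [apply Rle_0_sqr|left; apply Rinv_0_lt_compat; lra]. }
  assert (HD : Rsqr (Im z - y) < (D - (1 - Re z)) * (1 - Re z)).
  { unfold D. replace ((Rsqr (Im z - y) / (1 - Re z) + 1 + (1 - Re z) - (1 - Re z)) * (1 - Re z))
      with (Rsqr (Im z - y) + (1 - Re z)) by (field; lra). lra. }
  assert (HD' : 1 - Re z < D) by (unfold D; lra).
  apply (zero_near_centre f (1 - D, y) (D - (1 - Re z) / 2) 1); simpl.
  - lra.
  - lra.
  - intros w [W _]. apply H. intros E. subst w. simpl in W. lra.
  - intros w Hw. apply U. generalize (im_le_Cmod (w - (1 - D, y))).
    change (Im (w - (1 - D, y))) with (Im w - y). generalize (Rle_abs (- (Im w - y))).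
    rewrite Rabs_Ropp. lra.
  - unfold Cmod. rewrite <- (sqrt_Rsqr (D - (1 - Re z) / 2)) by lra. apply sqrt_lt_1_alt.
    change (fst (z - (1 - D, y)%R)%C) with (Re z - (1 - D)). change (snd (z - (1 - D, y)%R)%C) with (Im z - y).
    unfold Rsqr in *. split; [|nra]. generalize (pow2_ge_0 (Re z - (1-D))) (pow2_ge_0 (Im z - y)). lra.
Qed.

(** * The exponential and complex powers *)

Lemma Cexp_plus z w : Cexp (z + w) = (Cexp z * Cexp w)%C.
Proof.
  unfold Cexp. change (Re (z + w)) with (Re z + Re w). change (Im (z + w)) with (Im z + Im w).
  rewrite exp_plus, cos_plus, sin_plus. apply C_ext; simpl; ring.
Qed.

Lemma Cexp_0 : Cexp (RtoC 0) = RtoC 1.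
Proof. unfold Cexp; simpl. rewrite exp_0, cos_0, sin_0. apply C_ext; simpl; ring. Qed.

Lemma Cmod_Cexp z : Cmod (Cexp z) = exp (Re z).
Proof.
  unfold Cmod, Cexp; cbn [fst snd].
  replace ((exp (Re z) * cos (Im z)) ^ 2 + (exp (Re z) * sin (Im z)) ^ 2)
    with (Rsqr (exp (Re z))).
  - apply sqrt_Rsqr. left; apply exp_pos.
  - generalize (sin2_cos2 (Im z)). unfold Rsqr. intros E.
    transitivity (exp (Re z) * exp (Re z)
       * (sin (Im z) * sin (Im z) + cos (Im z) * cos (Im z))); [rewrite E|]; ring.
Qed.

Lemma Cexp_neq0 z : Cexp z <> RtoC 0.
Proof. apply Cmod_gt_0. rewrite Cmod_Cexp. apply exp_pos. Qed.

Lemma Cexp_opp z : Cexp (- z) = (/ Cexp z)%C.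
Proof.
  assert (E : (Cexp (- z) * Cexp z)%C = RtoC 1).
  { rewrite <- Cexp_plus. replace (- z + z)%C with (RtoC 0) by ring. apply Cexp_0. }
  replace (Cexp (- z)) with (Cexp (- z) * Cexp z * / Cexp z)%C by (field; apply Cexp_neq0).
  rewrite E. ring.
Qed.

Lemma derivable_pt_lim_le f x l : derivable_pt_lim f x l -> forall eps, 0 < eps ->
  exists d, 0 < d /\ forall h, Rabs h < d -> Rabs (f (x + h) - f x - l * h) <= eps * Rabs h.
Proof.
  intros H eps He. destruct (H eps He) as [d K]. exists d. split; [apply cond_pos|].
  intros h Hh. destruct (Req_dec h 0) as [->|N].
  - rewrite Rplus_0_r, Rabs_R0. replace (f x - f x - l * 0) with 0 by ring. rewrite Rabs_R0. lra.
  - specialize (K h N Hh).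
    replace (f (x + h) - f x - l * h) with (((f (x + h) - f x) / h - l) * h) by (field; auto).
    rewrite Rabs_mult. apply Rmult_le_compat_r; [apply Rabs_pos|lra].
Qed.

(** [Cexp] is put together from the real functions exp, cos and sin, so their derivatives at 0 are
    combined; every other point follows from the addition theorem. *)
Lemma cderiv_Cexp_0 : cderiv Cexp (RtoC 0) (RtoC 1).
Proof.
  intros eps He. set (e := Rmin (eps / 16) (1 / 2)).
  assert (He0 : 0 < e) by (unfold e; apply Rmin_pos; lra).
  assert (He1 : e <= eps / 16) by apply Rmin_l. assert (He2 : e <= 1 / 2) by apply Rmin_r.
  destruct (derivable_pt_lim_le exp 0 _ (derivable_pt_lim_exp 0) e He0) as [d1 [D1 K1]].
  destruct (derivable_pt_lim_le cos 0 _ (derivable_pt_lim_cos 0) e He0) as [d2 [D2 K2]].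
  destruct (derivable_pt_lim_le sin 0 _ (derivable_pt_lim_sin 0) e He0) as [d3 [D3 K3]].
  rewrite exp_0 in K1. rewrite cos_0, sin_0 in K2. rewrite sin_0, cos_0 in K3.
  exists (Rmin (Rmin d1 d2) (Rmin d3 e)). split; [apply Rmin_pos; apply Rmin_pos; auto|].
  intros w Hw. replace (w - RtoC 0)%C with w in * by ring.
  assert (Hw1 : Cmod w < d1)
    by (eapply Rlt_le_trans; [exact Hw|eapply Rle_trans; [apply Rmin_l|apply Rmin_l]]).
  assert (Hw2 : Cmod w < d2)
    by (eapply Rlt_le_trans; [exact Hw|eapply Rle_trans; [apply Rmin_l|apply Rmin_r]]).
  assert (Hw3 : Cmod w < d3)
    by (eapply Rlt_le_trans; [exact Hw|eapply Rle_trans; [apply Rmin_r|apply Rmin_l]]).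
  assert (Hw4 : Cmod w < e)
    by (eapply Rlt_le_trans; [exact Hw|eapply Rle_trans; [apply Rmin_r|apply Rmin_r]]).
  assert (Rx := re_le_Cmod w). assert (Ry := im_le_Cmod w).
  set (x := Re w) in *. set (y := Im w) in *. set (m := Cmod w) in *.
  specialize (K1 x ltac:(lra)). specialize (K2 y ltac:(lra)). specialize (K3 y ltac:(lra)).
  rewrite Rplus_0_l in K1, K2, K3.
  replace (cos y - 1 - - 0 * y) with (cos y - 1) in K2 by ring.
  replace (sin y - 0 - 1 * y) with (sin y - y) in K3 by ring.
  replace (exp x - 1 - 1 * x) with (exp x - 1 - x) in K1 by ring.
  assert (Gx := Rabs_pos x). assert (Gy := Rabs_pos y).
  assert (X1 : Rabs (exp x - 1) <= 2 * m).
  { replace (exp x - 1) with ((exp x - 1 - x) + x) by ring.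
    eapply Rle_trans; [apply Rabs_triang|]. nra. }
  assert (X2 : Rabs (exp x) <= 2).
  { replace (exp x) with ((exp x - 1) + 1) by ring.
    eapply Rle_trans; [apply Rabs_triang|]. rewrite Rabs_R1. lra. }
  assert (A : Rabs (Re (Cexp w - Cexp (RtoC 0) - RtoC 1 * w)%C) <= 3 * e * m).
  { rewrite Cexp_0. replace (Re (Cexp w - RtoC 1 - RtoC 1 * w)%C)
      with ((exp x - 1 - x) + exp x * (cos y - 1)) by (unfold Cexp; simpl; fold x y; unfold x, Re; ring).
    eapply Rle_trans; [apply Rabs_triang|]. rewrite Rabs_mult.
    assert (Rabs (exp x) * Rabs (cos y - 1) <= 2 * (e * m)).
    { apply Rmult_le_compat; try apply Rabs_pos; auto. nra. }
    nra. }
  assert (B : Rabs (Im (Cexp w - Cexp (RtoC 0) - RtoC 1 * w)%C) <= 4 * e * m).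
  { rewrite Cexp_0. replace (Im (Cexp w - RtoC 1 - RtoC 1 * w)%C)
      with ((exp x) * (sin y - y) + (exp x - 1) * y)
      by (unfold Cexp; simpl; fold x y; unfold y, Im; ring).
    eapply Rle_trans; [apply Rabs_triang|]. rewrite !Rabs_mult.
    assert (Rabs (exp x) * Rabs (sin y - y) <= 2 * (e * m)).
    { apply Rmult_le_compat; try apply Rabs_pos; auto. nra. }
    assert (Rabs (exp x - 1) * Rabs y <= (2 * m) * e).
    { apply Rmult_le_compat; try apply Rabs_pos; auto. lra. }
    nra. }
  eapply Rle_trans; [apply Cmod_le_Re_Im|].
  assert (0 <= m) by apply Cmod_ge_0. nra.
Qed.

Lemma cderiv_Cexp z : cderiv Cexp z (Cexp z).
Proof.
  apply (cderiv_ext (fun w => Cexp z * Cexp (w - z))%C).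
  - intros w. rewrite <- Cexp_plus. f_equal. ring.
  - apply (cderiv_eq _ _ (Cexp z * (1 * (1 - 0)))%C); [ring|].
    apply cderiv_scal. apply (cderiv_comp (fun w => w - z)%C).
    + replace (z - z)%C with (RtoC 0) by ring. apply cderiv_Cexp_0.
    + apply cderiv_minus; [apply cderiv_id|apply cderiv_const].
Qed.

Lemma cdiff_Cexp f z : cdiff f z -> cdiff (fun w => Cexp (f w)) z.
Proof. intros H. apply cdiff_comp; auto. eexists; apply cderiv_Cexp. Qed.

Lemma Cexp_eq_1 z : Cexp z = RtoC 1 <-> exists m : Z, z = (RtoC 2 * RtoC PI * Ci * RtoC (IZR m))%C.
Proof.
  split.
  - intros E. assert (M := Cmod_Cexp z). rewrite E, Cmod_1 in M.
    assert (X : Re z = 0) by (apply exp_inv; rewrite exp_0; auto).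
    apply (f_equal Re) in E. unfold Cexp in E. rewrite X, exp_0 in E. simpl in E.
    rewrite Rmult_1_l in E.
    assert (S : sin (Im z / 2) = 0).
    { replace (Im z) with (2 * (Im z / 2)) in E by field. rewrite cos_2a_sin in E. nra. }
    destruct (sin_eq_0_0 _ S) as [k Hk]. exists k. apply C_ext; simpl.
    + change (fst z) with (Re z). rewrite X. ring.
    + change (snd z) with (Im z). replace (Im z) with (2 * (Im z / 2)) by field. rewrite Hk. ring.
  - intros [m ->]. unfold Cexp.
    replace (Re (RtoC 2 * RtoC PI * Ci * RtoC (IZR m))) with 0 by (simpl; ring).
    replace (Im (RtoC 2 * RtoC PI * Ci * RtoC (IZR m))) with (2 * (IZR m * PI)) by (simpl; ring).
    rewrite exp_0, cos_2a_sin, sin_2a.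
    rewrite (sin_eq_0_1 (IZR m * PI)) by (exists m; auto). apply C_ext; simpl; ring.
Qed.

Lemma Rpow_C_plus x s t : Rpow_C x (s + t) = (Rpow_C x s * Rpow_C x t)%C.
Proof. unfold Rpow_C. rewrite <- Cexp_plus. f_equal. ring. Qed.

Lemma Rpow_C_0 x : Rpow_C x (RtoC 0) = RtoC 1.
Proof. unfold Rpow_C. rewrite Cmult_0_l. apply Cexp_0. Qed.

Lemma Rpow_C_1_l s : Rpow_C 1 s = RtoC 1.
Proof. unfold Rpow_C. rewrite ln_1, Cmult_0_r. apply Cexp_0. Qed.

Lemma Rpow_C_RtoC x y : Rpow_C x (RtoC y) = RtoC (Rpower x y).
Proof.
  unfold Rpow_C, Rpower, Cexp. rewrite <- RtoC_mult. simpl.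
  rewrite cos_0, sin_0. apply C_ext; simpl; ring.
Qed.

Lemma Rpow_C_1 x : 0 < x -> Rpow_C x (RtoC 1) = RtoC x.
Proof. intros. rewrite Rpow_C_RtoC, Rpower_1; auto. Qed.

Lemma Rpow_C_mult x y s : 0 < x -> 0 < y ->
  Rpow_C (x * y) s = (Rpow_C x s * Rpow_C y s)%C.
Proof.
  intros. unfold Rpow_C. rewrite ln_mult, <- Cexp_plus by auto. f_equal.
  rewrite RtoC_plus. ring.
Qed.

Lemma Cmod_Rpow_C x s : Cmod (Rpow_C x s) = Rpower x (Re s).
Proof. unfold Rpow_C. rewrite Cmod_Cexp, re_scal_r. reflexivity. Qed.

Lemma Rpow_C_neq0 x s : Rpow_C x s <> RtoC 0.
Proof. apply Cexp_neq0. Qed.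

Lemma Rpow_C_opp x s : Rpow_C x (- s) = (/ Rpow_C x s)%C.
Proof. unfold Rpow_C. rewrite <- Cexp_opp. f_equal. ring. Qed.

Lemma cderiv_Rpow_C x f z l : cderiv f z l ->
  cderiv (fun s => Rpow_C x (f s)) z (Rpow_C x (f z) * (RtoC (ln x) * l))%C.
Proof.
  intros H. unfold Rpow_C. apply (cderiv_comp (fun s => f s * RtoC (ln x))%C Cexp).
  - apply cderiv_Cexp.
  - apply (cderiv_ext (fun s => RtoC (ln x) * f s)%C); [intros; ring|].
    apply cderiv_scal; auto.
Qed.

Lemma cdiff_Rpow_C x f z : cdiff f z -> cdiff (fun s => Rpow_C x (f s)) z.
Proof. intros [l H]. eexists. apply cderiv_Rpow_C; eauto. Qed.

Lemma Rpower_pos x y : 0 < Rpower x y.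
Proof. apply exp_pos. Qed.

(** * Finite sums and rising factorials *)

Fixpoint csum (f : nat -> C) (n : nat) : C :=
  match n with O => RtoC 0 | S n => (csum f n + f n)%C end.

Lemma csum_S f n : csum f (S n) = (csum f n + f n)%C.
Proof. reflexivity. Qed.

Lemma csum_ext f g n : (forall k, (k < n)%nat -> f k = g k) -> csum f n = csum g n.
Proof. induction n; simpl; intros H; [auto|]. rewrite IHn, H; auto. Qed.

Lemma csum_plus f g n : csum (fun k => f k + g k)%C n = (csum f n + csum g n)%C.
Proof. induction n; simpl; [ring|]. rewrite IHn. ring. Qed.

Lemma csum_scal c f n : csum (fun k => c * f k)%C n = (c * csum f n)%C.
Proof. induction n; simpl; [ring|]. rewrite IHn. ring. Qed.

Lemma csum_S_first f n : csum f (S n) = (f 0%nat + csum (fun k => f (S k)) n)%C.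
Proof. induction n; [simpl; ring|]. change (csum f (S (S n))) with (csum f (S n) + f (S n))%C. rewrite IHn. simpl. ring. Qed.

Lemma csum_split f n m : csum f (n + m) = (csum f n + csum (fun k => f (n + k)%nat) m)%C.
Proof.
  induction m; simpl.
  - rewrite Nat.add_0_r. ring.
  - rewrite Nat.add_succ_r. simpl. rewrite IHm. ring.
Qed.

Fixpoint rsum (f : nat -> R) (n : nat) : R :=
  match n with O => 0 | S n => rsum f n + f n end.

Lemma csum_bound f g n : (forall k, (k < n)%nat -> Cmod (f k) <= g k) ->
  Cmod (csum f n) <= rsum g n.
Proof.
  induction n; simpl; intros H; [rewrite Cmod_0; lra|].
  eapply Rle_trans; [apply Cmod_triangle|]. apply Rplus_le_compat; auto.
Qed.

Lemma csum_cdiff (f : nat -> C -> C) n z : (forall k, (k < n)%nat -> cdiff (f k) z) ->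
  cdiff (fun w => csum (fun k => f k w) n) z.
Proof.
  induction n; simpl; intros H; [apply cdiff_const|].
  apply cdiff_plus; [apply IHn; auto|apply H; auto].
Qed.

Fixpoint rising (v : C) (n : nat) : C :=
  match n with O => RtoC 1 | S n => (rising v n * (v + RtoC (INR n)))%C end.

Lemma rising_S v n : rising v (S n) = (v * rising (v + 1) n)%C.
Proof.
  induction n.
  - simpl. ring.
  - change (rising v (S (S n))) with (rising v (S n) * (v + RtoC (INR (S n))))%C.
    rewrite IHn. simpl rising. rewrite S_INR, RtoC_plus. ring.
Qed.

Lemma rising_add v k j : rising v (k + j) = (rising v k * rising (v + RtoC (INR k)) j)%C.
Proof.
  induction j; simpl.
  - rewrite Nat.add_0_r. ring.
  - rewrite Nat.add_succ_r. simpl. rewrite IHj, plus_INR, RtoC_plus. ring.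
Qed.

Lemma rising_cdiff n f z : cdiff f z -> cdiff (fun w => rising (f w) n) z.
Proof.
  intros H. induction n; simpl; [apply cdiff_const|].
  apply cdiff_mult; auto. apply cdiff_plus; [auto|apply cdiff_const].
Qed.

Lemma Cmod_rising_le v n B : Cmod v <= B -> Cmod (rising v n) <= (B + INR n) ^ n.
Proof.
  intros H. assert (0 <= B) by (generalize (Cmod_ge_0 v); lra). induction n.
  - simpl. rewrite Cmod_1. lra.
  - assert (Hn := pos_INR n). simpl rising. rewrite Cmod_mult, <- tech_pow_Rmult, S_INR, Rmult_comm.
    apply Rmult_le_compat; try apply Cmod_ge_0.
    + eapply Rle_trans; [apply Cmod_triangle|]. rewrite Cmod_R, Rabs_pos_eq by auto. lra.
    + eapply Rle_trans; [exact IHn|]. apply pow_incr. lra.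
Qed.

(** * Taylor expansion of [t -> (x + t)^(-v)] *)

Definition pderiv (g : R -> C) (t : R) (l : C) : Prop :=
  is_derive (fun s => Re (g s)) t (Re l) /\ is_derive (fun s => Im (g s)) t (Im l).

Lemma pderiv_plus f g t l m : pderiv f t l -> pderiv g t m ->
  pderiv (fun s => f s + g s)%C t (l + m)%C.
Proof.
  intros [H1 H2] [K1 K2]. split.
  - exact (is_derive_plus (fun s => Re (f s)) (fun s => Re (g s)) t _ _ H1 K1).
  - exact (is_derive_plus (fun s => Im (f s)) (fun s => Im (g s)) t _ _ H2 K2).
Qed.

Lemma pderiv_RtoC (u : R -> R) (t l : R) :
  is_derive u t l -> pderiv (fun s => RtoC (u s)) t (RtoC l).
Proof.
  intros H. split; simpl; [exact H|].
  exact (is_derive_const (K := R_AbsRing) (V := R_NormedModule) 0 t).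
Qed.

Lemma pderiv_scal c f t l : pderiv f t l -> pderiv (fun s => c * f s)%C t (c * l)%C.
Proof.
  intros [H1 H2]. split.
  - exact (is_derive_minus (fun s => Re c * Re (f s)) (fun s => Im c * Im (f s)) t _ _
      (is_derive_scal _ _ (Re c) _ H1) (is_derive_scal _ _ (Im c) _ H2)).
  - exact (is_derive_plus (fun s => Re c * Im (f s)) (fun s => Im c * Re (f s)) t _ _
      (is_derive_scal _ _ (Re c) _ H2) (is_derive_scal _ _ (Im c) _ H1)).
Qed.

Lemma pderiv_const c t : pderiv (fun _ => c) t (RtoC 0).
Proof.
  split; [exact (is_derive_const (K := R_AbsRing) (V := R_NormedModule) (Re c) t)
         |exact (is_derive_const (K := R_AbsRing) (V := R_NormedModule) (Im c) t)].
Qed.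

(** The mean value theorem is available for the real and the imaginary part only, at two different
    intermediate points; hence the factor 2. *)
Lemma pderiv_bound f df t M : 0 <= t ->
  (forall s, 0 <= s <= t -> pderiv f s (df s)) ->
  (forall s, 0 <= s <= t -> Cmod (df s) <= M) ->
  Cmod (f t - f 0) <= 2 * M * t.
Proof.
  intros Ht Hd HM.
  assert (B : forall u du : R -> R, (forall s, 0 <= s <= t -> is_derive u s (du s)) ->
    (forall s, 0 <= s <= t -> Rabs (du s) <= M) -> Rabs (u t - u 0) <= M * t).
  { intros u du Hu HB. destruct (MVT_gen u 0 t du) as [c [Hc E]].
    - intros s Hs. rewrite Rmin_left, Rmax_right in Hs by auto. apply Hu; lra.
    - intros s Hs. rewrite Rmin_left, Rmax_right in Hs by auto.
      apply continuity_pt_filterlim. apply (ex_derive_continuous u). eexists; apply Hu; lra.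
    - rewrite Rmin_left, Rmax_right in Hc by auto.
      rewrite E, Rabs_mult, (Rabs_pos_eq (t - 0)) by lra.
      rewrite Rminus_0_r. apply Rmult_le_compat_r; auto. }
  eapply Rle_trans; [apply Cmod_le_Re_Im|].
  assert (B1 := B (fun s => Re (f s)) (fun s => Re (df s)) (fun s Hs => proj1 (Hd s Hs))
    (fun s Hs => Rle_trans _ _ _ (re_le_Cmod _) (HM s Hs))).
  assert (B2 := B (fun s => Im (f s)) (fun s => Im (df s)) (fun s Hs => proj2 (Hd s Hs))
    (fun s Hs => Rle_trans _ _ _ (im_le_Cmod _) (HM s Hs))).
  change (Re (f t - f 0)) with (Re (f t) - Re (f 0)).
  change (Im (f t - f 0)) with (Im (f t) - Im (f 0)). simpl in B1, B2. lra.
Qed.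

Lemma pderiv_Rpow_C x v t : 0 < x + t ->
  pderiv (fun s => Rpow_C (x + s) v) t (v * Rpow_C (x + t) (v - 1))%C.
Proof.
  intros H. destruct v as [a b].
  assert (E : Rpow_C (x + t) ((a, b) - 1) = (Rpow_C (x + t) (a, b) * RtoC (/ (x + t)))%C).
  { unfold Cminus. rewrite Rpow_C_plus, Rpow_C_opp, Rpow_C_1, RtoC_inv by lra. reflexivity. }
  rewrite E. unfold Rpow_C, Cexp. split; simpl.
  - auto_derive; [lra|]. unfold Rminus. field. lra.
  - auto_derive; [lra|]. unfold Rminus. field. lra.
Qed.

Definition taylor_rem (J : nat) (v : C) (x t : R) : C :=
  (Rpow_C (x + t) (- v) -
   csum (fun j => (-1) ^ j * rising v j * RtoC (t ^ j / INR (fact j))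
                  * Rpow_C x (- v - RtoC (INR j))) J)%C.

Lemma taylor_rem_0 J v x : taylor_rem (S J) v x 0 = RtoC 0.
Proof.
  unfold taylor_rem. rewrite csum_S_first.
  rewrite (csum_ext _ (fun _ => RtoC 0 * RtoC 0)%C).
  - rewrite csum_scal. simpl. rewrite Rplus_0_r.
    replace (1 / 1) with 1 by field. replace (- v - 0)%C with (- v)%C by ring. ring.
  - intros k _. simpl pow. replace (0 * 0 ^ k / INR (fact (S k))) with 0; [ring|].
    field. apply INR_fact_neq_0.
Qed.

(** Differentiation in t lowers the order by one and replaces v by v + 1, which makes induction on
    the order possible. *)
Lemma pderiv_taylor_rem J v x t : 0 < x + t ->
  pderiv (taylor_rem (S J) v x) t (- v * taylor_rem J (v + 1) x t)%C.
Proof.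
  intros H. unfold taylor_rem.
  assert (P : pderiv (fun t => csum (fun j => (-1) ^ j * rising v j * RtoC (t ^ j / INR (fact j))
                  * Rpow_C x (- v - RtoC (INR j)))%C (S J)) t
     (- v * csum (fun j => (-1) ^ j * rising (v + 1) j * RtoC (t ^ j / INR (fact j))
                  * Rpow_C x (- (v + 1) - RtoC (INR j))) J)%C).
  { induction J as [|J IH].
    - simpl. replace (- v * 0)%C with (0 + 0)%C by ring. apply pderiv_plus; apply pderiv_const.
    - change (fun t => csum (fun j => (-1) ^ j * rising v j * RtoC (t ^ j / INR (fact j))
                  * Rpow_C x (- v - RtoC (INR j)))%C (S (S J)))
      with (fun t => csum (fun j => (-1) ^ j * rising v j * RtoC (t ^ j / INR (fact j))
                  * Rpow_C x (- v - RtoC (INR j)))%C (S J) +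
            (-1) ^ (S J) * rising v (S J) * RtoC (t ^ (S J) / INR (fact (S J)))
                  * Rpow_C x (- v - RtoC (INR (S J))))%C.
      simpl (csum _ (S J)) at 2.
      rewrite Cmult_plus_distr_l. apply pderiv_plus; [exact IH|].
      assert (D : pderiv (fun t => RtoC (t ^ (S J) / INR (fact (S J)))) t
         (RtoC (t ^ J / INR (fact J)))).
      { apply pderiv_RtoC.
        assert (Q := is_derive_scal (fun t : R => t ^ S J) t (/ INR (fact (S J))) _
          (is_derive_pow (fun t : R => t) (S J) t 1 (is_derive_id t))).
        replace (t ^ J / INR (fact J)) with (/ INR (fact (S J)) * (INR (S J) * 1 * t ^ pred (S J))).
        - eapply is_derive_ext; [|exact Q]. intros s. cbv beta. unfold Rdiv. apply Rmult_comm.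
        - rewrite fact_simpl, mult_INR. simpl pred.
          field. split; [apply INR_fact_neq_0|apply not_0_INR; lia]. }
      apply (pderiv_scal ((-1) ^ (S J) * rising v (S J) * Rpow_C x (- v - RtoC (INR (S J))))%C) in D.
      replace (- v * ((-1) ^ J * rising (v + 1) J * RtoC (t ^ J / INR (fact J))
         * Rpow_C x (- (v + 1) - RtoC (INR J))))%C with
        ((-1) ^ (S J) * rising v (S J) * Rpow_C x (- v - RtoC (INR (S J)))
          * RtoC (t ^ J / INR (fact J)))%C.
      + destruct D as [D1 D2]. split.
        * eapply is_derive_ext; [|exact D1]. intros s. cbv beta. f_equal. ring.
        * eapply is_derive_ext; [|exact D2]. intros s. cbv beta. f_equal. ring.
      + rewrite rising_S, S_INR, RtoC_plus.
        replace (- (v + 1) - RtoC (INR J))%C with (- v - (RtoC (INR J) + 1))%C by ring.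
        simpl Cpow. ring. }
  replace (- v * (Rpow_C (x + t) (- (v + 1)) - csum (fun j => (-1) ^ j * rising (v + 1) j
      * RtoC (t ^ j / INR (fact j)) * Rpow_C x (- (v + 1) - RtoC (INR j))) J))%C
   with (- v * Rpow_C (x + t) (- v - 1) + -1 * (- v * csum (fun j => (-1) ^ j * rising (v + 1) j
      * RtoC (t ^ j / INR (fact j)) * Rpow_C x (- (v + 1) - RtoC (INR j))) J))%C.
  - assert (Q := pderiv_plus _ _ _ _ _ (pderiv_Rpow_C x (- v) t H) (pderiv_scal (-1) _ _ _ P)).
    destruct Q as [Q1 Q2]. split.
    + eapply is_derive_ext; [|exact Q1]. intros s. cbv beta. f_equal. ring.
    + eapply is_derive_ext; [|exact Q2]. intros s. cbv beta. f_equal. ring.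
  - replace (- (v + 1))%C with (- v - 1)%C by ring. ring.
Qed.

Lemma exp_le_compat x y : x <= y -> exp x <= exp y.
Proof. intros [H| ->]; [left; apply exp_increasing; auto|lra]. Qed.

Lemma Rpower_le_antitone x y p : 0 < x <= y -> p <= 0 -> Rpower y p <= Rpower x p.
Proof.
  intros [Hx Hxy] Hp. unfold Rpower. apply exp_le_compat.
  assert (ln x <= ln y) by (apply ln_le; auto). nra.
Qed.

(** Each integration over [0, t] with t <= 1 costs the factor 2 of [pderiv_bound] and a factor v;
    the latter accumulate to the rising factorial. The sum Re v + J does not change along the
    induction. *)
Lemma taylor_rem_bound J : forall v x t, 0 < x -> 0 <= t <= 1 -> 0 <= Re v + INR J ->
  Cmod (taylor_rem J v x t) <= 2 ^ J * Cmod (rising v J) * Rpower x (- (Re v + INR J)).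
Proof.
  induction J as [|J IH]; intros v x t Hx Ht Hv.
  - unfold taylor_rem. simpl. rewrite Cmod_1.
    replace (Rpow_C (x + t) (- v) - 0)%C with (Rpow_C (x + t) (- v)) by ring.
    rewrite Cmod_Rpow_C, Rmult_1_l, Rmult_1_l. simpl in Hv.
    change (Re (- v)) with (- Re v). rewrite Rplus_0_r.
    apply Rpower_le_antitone; lra.
  - replace (taylor_rem (S J) v x t)
      with (taylor_rem (S J) v x t - taylor_rem (S J) v x 0)%C by (rewrite taylor_rem_0; ring).
    rewrite S_INR in *.
    set (M := Cmod v * (2 ^ J * Cmod (rising (v + 1) J) * Rpower x (- (Re (v + 1) + INR J)))).
    assert (HM : 0 <= M).
    { unfold M. apply Rmult_le_pos; [apply Cmod_ge_0|].
      apply Rmult_le_pos; [apply Rmult_le_pos; [apply pow_le; lra|apply Cmod_ge_0]|].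
      left; apply Rpower_pos. }
    eapply Rle_trans.
    + apply (pderiv_bound (taylor_rem (S J) v x) (fun t => - v * taylor_rem J (v + 1) x t)%C t M);
        [lra| |].
      * intros s Hs. apply pderiv_taylor_rem. lra.
      * intros s Hs. rewrite Cmod_mult, Cmod_opp. unfold M.
        apply Rmult_le_compat_l; [apply Cmod_ge_0|]. apply IH; [auto|lra|].
        change (Re (v + 1)) with (Re v + 1). lra.
    + apply Rle_trans with (2 * M); [nra|]. unfold M.
      rewrite rising_S, Cmod_mult. change (Re (v + 1)) with (Re v + 1).
      replace (- (Re v + (INR J + 1))) with (- (Re v + 1 + INR J)) by ring.
      simpl pow. right. ring.
Qed.

(** * Bernoulli numbers *)

Lemma CV_radius_of_ex_pseries a x : ex_pseries a x -> Rbar_le (Rabs x) (CV_radius a).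
Proof.
  intros H. apply Rbar_not_lt_le. intros N. apply (CV_disk_outside a x N).
  apply ex_series_lim_0. destruct H as [l Hl]. exists l. apply is_pseries_R, Hl.
Qed.

(** The generating function x / (e^x - 1) says nothing at x = 0; continuity of the power series
    recovers the value there before coefficients are compared. *)
Lemma pseries_eq_zero a r : 0 < r ->
  (forall x, x <> 0 -> Rabs x < r -> is_pseries a x 0) -> forall n : nat, a n = 0.
Proof.
  intros Hr H n.
  assert (C : Rbar_lt 0 (CV_radius a)).
  { apply Rbar_lt_le_trans with (Rabs (r / 2)).
    - simpl. apply Rabs_pos_lt. lra.
    - apply CV_radius_of_ex_pseries. exists 0. apply H; [lra|]. rewrite Rabs_pos_eq; lra. }
  assert (Z : forall x, x <> 0 -> Rabs x < r -> PSeries a x = 0)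
    by (intros x Nx Hx; apply is_pseries_unique; apply H; auto).
  apply (PSeries_ext_recip a (fun _ => 0) n C).
  - rewrite CV_radius_const_0. exact I.
  - exists (mkposreal r Hr). intros x Hx. rewrite PSeries_const_0.
    change (Rabs (x - 0) < r) in Hx. rewrite Rminus_0_r in Hx.
    destruct (Req_dec x 0) as [->|Nx]; [|auto].
    assert (K : continuity_pt (PSeries a) 0)
      by (apply PSeries_continuity; rewrite Rabs_R0; exact C).
    apply continuity_pt_filterlim in K.
    assert (K' := proj1 (continuous_eps (PSeries a) 0) K). clear K. rename K' into K.
    destruct (Req_dec (PSeries a 0) 0) as [E|N]; [auto|].
    assert (P := Rabs_pos_lt _ N).
    destruct (K (Rabs (PSeries a 0)) P) as [d [Hd Kd]].
    set (y := Rmin d r / 2).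
    assert (0 < Rmin d r) by (apply Rmin_pos; auto).
    assert (Rmin d r <= d) by apply Rmin_l. assert (Rmin d r <= r) by apply Rmin_r.
    assert (Hy : 0 < y) by (unfold y; lra).
    specialize (Kd y). rewrite Rminus_0_r, (Rabs_pos_eq y) in Kd by lra.
    rewrite (Z y) in Kd; [|lra|rewrite Rabs_pos_eq; unfold y; lra].
    rewrite Rminus_0_l, Rabs_Ropp in Kd. unfold y in *. lra.
Qed.

(* [inverse_approx a n] agrees up to index [n] with the coefficients of the
   inverse of the power series with coefficients [a], where [a 0 = 1]. *)
Fixpoint inverse_approx (a : nat -> R) (n : nat) : nat -> R :=
  match n with
  | O => fun _ => 1
  | S n => fun k => if (k <=? n)%nat then inverse_approx a n k
                    else - sum_f_R0 (fun j => inverse_approx a n j * a (S n - j)%nat) n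
  end.

Definition inverse_coef (a : nat -> R) (n : nat) : R := inverse_approx a n n.

Lemma inverse_approx_stable a n k : (k <= n)%nat -> inverse_approx a n k = inverse_coef a k.
Proof.
  induction n; intros H.
  - replace k with 0%nat by lia. reflexivity.
  - destruct (Nat.eq_dec k (S n)) as [->|N]; [reflexivity|].
    simpl. rewrite (proj2 (Nat.leb_le k n)) by lia. apply IHn. lia.
Qed.

Lemma inverse_coef_S a n :
  inverse_coef a (S n) = - sum_f_R0 (fun j => inverse_coef a j * a (S n - j)%nat) n.
Proof.
  unfold inverse_coef at 1. cbn [inverse_approx].
  rewrite (proj2 (Nat.leb_gt (S n) n)) by lia. f_equal.
  apply sum_eq. intros j Hj. rewrite inverse_approx_stable; auto.
Qed.

Lemma PS_mult_inverse_coef a : a 0%nat = 1 ->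
  forall n, PS_mult (inverse_coef a) a n = match n with O => 1 | _ => 0 end.
Proof.
  intros Ha [|n]; unfold PS_mult.
  - simpl. rewrite Ha. unfold inverse_coef; simpl. ring.
  - change (sum_f_R0 (fun k => inverse_coef a k * a (S n - k)%nat) (S n)) with
      (sum_f_R0 (fun k => inverse_coef a k * a (S n - k)%nat) n
       + inverse_coef a (S n) * a (S n - S n)%nat).
    rewrite inverse_coef_S, Nat.sub_diag, Ha. ring.
Qed.

Definition expm1_coef (j : nat) : R := / INR (fact (S j)).

Lemma sum_expm1_coef n : sum_f_R0 (fun j => expm1_coef (S n - j)) n <= 1 - / 2 ^ S n.
Proof.
  assert (F : forall k, / INR (fact (S (S k))) <= / 2 ^ S k).
  { intros k. apply Rinv_le_contravar; [apply pow_lt; lra|].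
    induction k.
    - simpl. lra.
    - rewrite fact_simpl, mult_INR. rewrite <- tech_pow_Rmult.
      apply Rmult_le_compat; [lra|apply pow_le; lra| |exact IHk].
      rewrite !S_INR. generalize (pos_INR k). lra. }
  assert (R : forall f m, sum_f_R0 (fun j => f (S m - j)%nat) m = sum_f_R0 (fun j => f (S j)) m).
  { intros f m. induction m.
    - reflexivity.
    - rewrite (decomp_sum (fun j => f (S (S m) - j)%nat)) by lia. simpl pred.
      rewrite Nat.sub_0_r. change (sum_f_R0 (fun j => f (S j)) (S m))
        with (sum_f_R0 (fun j => f (S j)) m + f (S (S m))). rewrite <- IHm. simpl. ring. }
  rewrite R. induction n.
  - simpl. unfold expm1_coef. simpl. lra.
  - simpl sum_f_R0. eapply Rle_trans; [apply Rplus_le_compat; [exact IHn|]|].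
    + unfold expm1_coef. apply F.
    + right. simpl. field. apply pow_nonzero; lra.
Qed.

(** In the recurrence the earlier coefficients are weighted by 1/2!, 1/3!, ..., whose sum stays
    below 1 by comparison with a geometric series. So the bound 1 reproduces itself, and the radius
    of convergence is at least 1. *)
Lemma inverse_expm1_coef_bound n : Rabs (inverse_coef expm1_coef n) <= 1.
Proof.
  induction n as [[|n] IH] using lt_wf_ind.
  - unfold inverse_coef; simpl. rewrite Rabs_R1. lra.
  - rewrite inverse_coef_S, Rabs_Ropp.
    eapply Rle_trans; [apply Rsum_abs|].
    apply Rle_trans with (sum_f_R0 (fun j => expm1_coef (S n - j)) n).
    + apply sum_Rle. intros j Hj. rewrite Rabs_mult.
      assert (P : 0 < expm1_coef (S n - j)) by (apply Rinv_0_lt_compat, INR_fact_lt_0).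
      rewrite (Rabs_pos_eq (expm1_coef _)) by lra.
      specialize (IH j ltac:(lia)). nra.
    + eapply Rle_trans; [apply sum_expm1_coef|].
      assert (0 < / 2 ^ S n) by (apply Rinv_0_lt_compat, pow_lt; lra). lra.
Qed.

Lemma CV_radius_ge_1 a : (forall n, Rabs (a n) <= 1) -> Rbar_le 1 (CV_radius a).
Proof.
  intros H. apply CV_radius_bounded. exists 1. intros n. rewrite pow1, Rmult_1_r. auto.
Qed.

Lemma is_pseries_expm1 x : x <> 0 -> is_pseries expm1_coef x ((exp x - 1) / x).
Proof.
  intros Hx.
  assert (E := is_pseries_decr_1 (K := R_AbsRing) (V := R_NormedModule) _ x (/ x) _
    (Rinv_l x Hx) (is_exp_Reals x)).
  replace ((exp x - 1) / x) with (scal (/ x) (plus (exp x) (opp (/ INR (fact 0))))).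
  - exact E.
  - unfold scal, plus, opp; simpl. unfold mult; simpl. field. auto.
Qed.

Lemma expm1_neq0 x : x <> 0 -> exp x - 1 <> 0.
Proof. intros Hx E. apply Hx, exp_inv. rewrite exp_0. lra. Qed.

Lemma inverse_expm1_pseries x : x <> 0 -> Rabs x < 1 ->
  is_pseries (inverse_coef expm1_coef) x (x / (exp x - 1)).
Proof.
  intros Nx Hx. set (e := inverse_coef expm1_coef).
  assert (C1 : Rbar_lt (Rabs x) (CV_radius e)).
  { apply Rbar_lt_le_trans with 1; [exact Hx|]. apply CV_radius_ge_1, inverse_expm1_coef_bound. }
  assert (C2 : Rbar_lt (Rabs x) (CV_radius expm1_coef)).
  { apply Rbar_lt_le_trans with 1; [exact Hx|]. apply CV_radius_ge_1. intros n.
    unfold expm1_coef. rewrite Rabs_pos_eq by (left; apply Rinv_0_lt_compat, INR_fact_lt_0).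
    rewrite <- Rinv_1. apply Rinv_le_contravar; [lra|].
    change 1 with (INR 1). apply le_INR. generalize (lt_O_fact (S n)). lia. }
  assert (P := is_pseries_mult _ _ x _ _ (PSeries_correct _ _ (CV_radius_inside _ _ C1))
     (is_pseries_expm1 x Nx) C1 C2).
  apply (is_pseries_ext _ (fun n => match n with O => 1 | _ => 0 end)) in P;
    [|intros n; apply PS_mult_inverse_coef; unfold expm1_coef; simpl; lra].
  assert (Q : is_pseries (fun n => match n with O => 1 | _ => 0 end) x 1).
  { apply is_pseries_R. apply is_series_Reals. intros eps He. exists 0%nat. intros n _.
    assert (S1 : forall m, sum_f_R0 (fun n => match n with O => 1 | _ => 0 end * x ^ n) m = 1).
    { induction m; simpl; [ring|]. rewrite IHm. ring. }
    rewrite S1. unfold Rdist. rewrite Rminus_diag, Rabs_R0. auto. }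
  assert (E : PSeries e x * ((exp x - 1) / x) = 1).
  { rewrite <- (is_pseries_unique _ _ _ P). apply is_pseries_unique, Q. }
  replace (x / (exp x - 1)) with (PSeries e x).
  - apply PSeries_correct, CV_radius_inside, C1.
  - assert (N := expm1_neq0 x Nx).
    replace (PSeries e x) with (PSeries e x * ((exp x - 1) / x) * (x / (exp x - 1)))
      by (field; auto). rewrite E. ring.
Qed.

Definition bern (k : nat) : R := bernoulli k / INR (fact k).

(** [bernoulli] is some sequence chosen by [epsilon]. The inverse series shows that a suitable one
    exists, and uniqueness of power series coefficients identifies the chosen one. *)
Lemma bern_inverse_coef n : bern n = inverse_coef expm1_coef n.
Proof.
  assert (X : exists B, is_bernoulli B).
  { exists (fun k => inverse_coef expm1_coef k * INR (fact k)). exists (mkposreal 1 Rlt_0_1).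
    intros x Nx Hx. apply is_pseries_ext with (a := inverse_coef expm1_coef).
    - intros k. change (inverse_coef expm1_coef k
        = inverse_coef expm1_coef k * INR (fact k) / INR (fact k)).
      field. apply INR_fact_neq_0.
    - apply inverse_expm1_pseries; auto. }
  destruct (epsilon_spec (inhabits (fun _ : nat => 0)) is_bernoulli X) as [r H].
  apply Rminus_diag_uniq.
  apply (pseries_eq_zero (PS_minus bern (inverse_coef expm1_coef)) (Rmin r 1)).
  - apply Rmin_pos; [apply cond_pos|lra].
  - intros x Nx Hx.
    replace 0 with (minus (x / (exp x - 1)) (x / (exp x - 1)) : R)
      by (unfold minus, plus, opp; simpl; ring).
    apply (is_pseries_minus (K := R_AbsRing) (V := R_NormedModule)).
    + apply H; auto. eapply Rlt_le_trans; [exact Hx|apply Rmin_l].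
    + apply inverse_expm1_pseries; auto. eapply Rlt_le_trans; [exact Hx|apply Rmin_r].
Qed.

Lemma bern_pseries x : x <> 0 -> Rabs x < 1 -> is_pseries bern x (x / (exp x - 1)).
Proof.
  intros. apply is_pseries_ext with (a := inverse_coef expm1_coef).
  - intros; symmetry; apply bern_inverse_coef.
  - apply inverse_expm1_pseries; auto.
Qed.

Lemma CV_radius_bern x : Rabs x < 1 -> Rbar_lt (Rabs x) (CV_radius bern).
Proof.
  intros H. apply Rbar_lt_le_trans with 1; [exact H|]. apply CV_radius_ge_1.
  intros n. rewrite bern_inverse_coef. apply inverse_expm1_coef_bound.
Qed.

Lemma bern_0 : bern 0 = 1.
Proof. rewrite bern_inverse_coef. reflexivity. Qed.

(** Comparison of coefficients in f(x) * (e^x - 1) / x = 1, where f is the series with coefficients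
    [bern]. *)
Lemma bern_recurrence n :
  sum_f_R0 (fun k => bern k / INR (fact (S n - k))) n = match n with O => 1 | _ => 0 end.
Proof.
  rewrite <- (PS_mult_inverse_coef expm1_coef) by (unfold expm1_coef; simpl; lra).
  unfold PS_mult. apply sum_eq. intros k Hk. rewrite bern_inverse_coef.
  unfold expm1_coef. replace (S (n - k)) with (S n - k)%nat by lia. reflexivity.
Qed.

(** The generating function f satisfies f(-x) = f(x) + x, and the summand x only touches index 1. *)
Lemma bern_parity n : (-1) ^ n * bern n = bern n + (if Nat.eqb n 1 then 1 else 0).
Proof.
  set (d := fun n => if Nat.eqb n 1 then 1 else 0).
  apply Rminus_diag_uniq.
  apply (pseries_eq_zero (PS_minus (fun n => (-1) ^ n * bern n) (PS_plus bern d)) 1); [lra|].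
  intros x Nx Hx.
  assert (N := expm1_neq0 x Nx).
  assert (N' := expm1_neq0 (- x) ltac:(lra)).
  assert (G := exp_pos x).
  replace 0 with (minus (- x / (exp (- x) - 1)) (plus (x / (exp x - 1)) x) : R).
  - apply (is_pseries_minus (K := R_AbsRing) (V := R_NormedModule)).
    + assert (P := bern_pseries (- x) ltac:(lra) ltac:(rewrite Rabs_Ropp; auto)).
      apply is_pseries_R in P. apply is_pseries_R.
      eapply is_series_ext; [|exact P]. intros k. cbv beta.
      replace (- x) with (-1 * x) by ring. rewrite Rpow_mult_distr.
      change ((bern k * ((-1) ^ k * x ^ k) = (-1) ^ k * bern k * x ^ k)). ring.
    + apply (is_pseries_plus (K := R_AbsRing) (V := R_NormedModule)); [apply bern_pseries; auto|].
      apply is_pseries_R, is_series_Reals. intros eps He. exists 1%nat. intros n0 Hn0.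
      assert (S1 : forall m, sum_f_R0 (fun n => d n * x ^ n) (S m) = x).
      { induction m; [unfold d; simpl; ring|].
        change (sum_f_R0 (fun n => d n * x ^ n) (S (S m)))
          with (sum_f_R0 (fun n => d n * x ^ n) (S m) + d (S (S m)) * x ^ (S (S m))).
        rewrite IHm. unfold d. simpl. ring. }
      destruct n0 as [|m]; [lia|].
      rewrite S1. unfold Rdist. rewrite Rminus_diag, Rabs_R0. auto.
  - unfold minus, plus, opp; simpl. rewrite exp_Ropp in *.
    field. split; [auto|split; [|lra]]. intros E. apply N. lra.
Qed.

Lemma bern_odd n : Nat.Odd n -> n <> 1%nat -> bern n = 0.
Proof.
  intros [k ->] H. assert (P := bern_parity (2 * k + 1)).
  rewrite (proj2 (Nat.eqb_neq _ _) H), pow_add, pow_1_even in P. lra.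
Qed.

(* The series [f] of [x / (e^x - 1)] satisfies [x f' = f - f^2 - x f]. *)
Lemma bern_quadratic n :
  INR n * bern n - bern n + PS_mult bern bern n + PS_incr_1 bern n = 0.
Proof.
  change (PS_plus (PS_plus (PS_minus (fun n => INR n * bern n) bern) (PS_mult bern bern))
    (PS_incr_1 bern) n = 0).
  apply (pseries_eq_zero _ 1); [lra|]. clear n. intros x Nx Hx.
  assert (N := expm1_neq0 x Nx).
  set (f := x / (exp x - 1)).
  assert (B := bern_pseries x Nx Hx).
  assert (CV := CV_radius_bern x Hx).
  assert (D : is_pseries (fun n => INR n * bern n) x
    (x * ((exp x - 1 - x * exp x) / (exp x - 1) ^ 2))).
  { assert (P := is_pseries_incr_1 _ x _ (is_pseries_derive _ _ CV)).
    replace (x * ((exp x - 1 - x * exp x) / (exp x - 1) ^ 2)) with (scal x (Derive (PSeries bern) x)).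
    - eapply is_pseries_ext; [|exact P]. intros [|n].
      + unfold PS_incr_1. simpl. symmetry. apply Rmult_0_l.
      + reflexivity.
    - change (scal x (Derive (PSeries bern) x)) with (x * Derive (PSeries bern) x). f_equal.
      rewrite (Derive_ext_loc (PSeries bern) (fun t => t / (exp t - 1))).
      + apply is_derive_unique. auto_derive; [auto|]. field. auto.
      + set (r := Rmin (Rabs x) (1 - Rabs x)).
        assert (Hr : 0 < r) by (apply Rmin_pos; [apply Rabs_pos_lt; auto|lra]).
        exists (mkposreal r Hr). intros t Ht. change (Rabs (t - x) < r) in Ht.
        assert (r <= Rabs x) by apply Rmin_l. assert (r <= 1 - Rabs x) by apply Rmin_r.
        apply is_pseries_unique, bern_pseries.
        * intros ->. rewrite Rminus_0_l, Rabs_Ropp in Ht. lra.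
        * replace t with ((t - x) + x) by ring.
          eapply Rle_lt_trans; [apply Rabs_triang|]. lra. }
  replace 0 with (plus (plus (minus (x * ((exp x - 1 - x * exp x) / (exp x - 1) ^ 2)) f) (f * f))
     (scal x f) : R).
  - apply (is_pseries_plus (K := R_AbsRing) (V := R_NormedModule)).
    + apply (is_pseries_plus (K := R_AbsRing) (V := R_NormedModule)).
      * apply (is_pseries_minus (K := R_AbsRing) (V := R_NormedModule)); auto.
      * apply is_pseries_mult; auto.
    + apply (is_pseries_incr_1 (K := R_AbsRing) (V := R_NormedModule)); auto.
  - unfold minus, plus, opp, scal, f; simpl. unfold mult; simpl. field. auto.
Qed.

Lemma bern_1 : bern 1 = - (1 / 2).
Proof.
  assert (P := bern_quadratic 1). unfold PS_mult, PS_incr_1 in P. simpl in P.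
  rewrite bern_0 in P. change zero with 0 in P. lra.
Qed.

Lemma bern_2 : bern 2 = 1 / 12.
Proof.
  assert (P := bern_quadratic 2). unfold PS_mult, PS_incr_1 in P. simpl in P.
  rewrite bern_0, bern_1 in P. lra.
Qed.

(** At the index 2m the quadratic recurrence reads (2m+1) b_(2m) = - sum of b_i b_(2m-i) over 0 < i
    < 2m. Terms with odd i vanish, and by induction those with even i all have the sign (-1)^m; so
    the signs alternate, which in particular excludes zeros. *)
Lemma bern_sign m : (1 <= m)%nat -> 0 < (-1) ^ (m + 1) * bern (2 * m).
Proof.
  induction m as [m IH] using lt_wf_ind. intros Hm.
  destruct (Nat.eq_dec m 1) as [->|N].
  { simpl (2 * 1)%nat. rewrite bern_2. simpl. lra. }
  assert (Hm2 : (2 <= m)%nat) by lia.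
  set (T := fun k => (-1) ^ m * (bern (S k) * bern (2 * m - S k))).
  assert (S1 : forall j, (-1) ^ (j + 1) * (-1) ^ (j + 1) = 1).
  { intros j. rewrite <- Rpow_mult_distr. replace (-1 * -1) with 1 by ring. apply pow1. }
  assert (TP : forall i, (1 <= i < m)%nat ->
     0 < (-1) ^ m * (bern (2 * i) * bern (2 * m - 2 * i))).
  { intros i Hi. assert (A := IH i ltac:(lia) ltac:(lia)).
    assert (B := IH (m - i)%nat ltac:(lia) ltac:(lia)).
    replace (2 * (m - i))%nat with (2 * m - 2 * i)%nat in B by lia.
    replace ((-1) ^ m) with ((-1) ^ (i + 1) * (-1) ^ (m - i + 1)).
    - apply Rlt_le_trans with (1 := Rmult_lt_0_compat _ _ A B). right. ring.
    - rewrite <- pow_add. replace (i + 1 + (m - i + 1))%nat with (m + 2)%nat by lia.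
      rewrite pow_add. simpl. ring. }
  assert (T0 : forall k, (k <= 2 * m - 2)%nat -> 0 <= T k).
  { intros k Hk. unfold T. destruct (Nat.Even_or_Odd (S k)) as [[i Hi]|O].
    - rewrite Hi. left. apply TP. lia.
    - right. destruct (Nat.eq_dec (S k) 1) as [E1|N1].
      (* [bern 1] is the only nonzero coefficient of odd index; its partner has the odd index 2m - 1
         >= 3 and vanishes. *)
      + rewrite (bern_odd (2 * m - S k)); [ring| |lia].
        exists (m - 1)%nat. lia.
      + rewrite (bern_odd (S k)); auto. ring. }
  assert (SP : 0 < sum_f_R0 T (2 * m - 2)).
  { apply Rlt_le_trans with (sum_f_R0 T 1).
    - simpl. assert (0 <= T 0%nat) by (apply T0; lia).
      assert (0 < T 1%nat) by (apply (TP 1%nat); lia). lra.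
    - assert (G : forall j, (1 + j <= 2 * m - 2)%nat -> sum_f_R0 T 1 <= sum_f_R0 T (1 + j)).
      { induction j; intros Hj; [simpl; lra|].
        rewrite Nat.add_succ_r. simpl sum_f_R0 at 2.
        assert (0 <= T (S (1 + j))) by (apply T0; lia).
        specialize (IHj ltac:(lia)). simpl in *. lra. }
      replace (2 * m - 2)%nat with (1 + (2 * m - 3))%nat by (lia).
      apply G. lia. }
  assert (Q := bern_quadratic (2 * m)).
  assert (E : PS_mult bern bern (2 * m) = 2 * bern (2 * m) +
     sum_f_R0 (fun k => bern (S k) * bern (2 * m - S k)) (2 * m - 2)).
  { assert (G : forall (g : nat -> R) n, sum_f_R0 g (S (S n)) =
      g 0%nat + sum_f_R0 (fun k => g (S k)) n + g (S (S n))).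
    { intros g n. rewrite decomp_sum by lia. simpl. ring. }
    unfold PS_mult. assert (N2 : (2 * m = S (S (2 * m - 2)))%nat) by lia.
    transitivity (sum_f_R0 (fun k => bern k * bern (2 * m - k)) (S (S (2 * m - 2)))).
    { rewrite <- N2. reflexivity. }
    rewrite G, <- N2, Nat.sub_0_r, Nat.sub_diag, bern_0. ring. }
  rewrite E in Q.
  assert (I : PS_incr_1 bern (2 * m) = 0).
  { replace (2 * m)%nat with (S (2 * m - 1)) by (lia). unfold PS_incr_1.
    apply bern_odd; [exists (m - 1)%nat; lia|lia]. }
  rewrite I in Q.
  assert (ET : sum_f_R0 T (2 * m - 2) =
    (-1) ^ m * sum_f_R0 (fun k => bern (S k) * bern (2 * m - S k)) (2 * m - 2)).
  { rewrite scal_sum. apply sum_eq. intros i _. unfold T. ring. }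
  assert (P : (INR (2 * m) + 1) * ((-1) ^ (m + 1) * bern (2 * m)) = sum_f_R0 T (2 * m - 2)).
  { rewrite ET, pow_add. simpl ((-1) ^ 1).
    replace (sum_f_R0 (fun k => bern (S k) * bern (2 * m - S k)) (2 * m - 2))
      with (- (INR (2 * m) + 1) * bern (2 * m)) by lra. ring. }
  assert (0 <= INR (2 * m)) by apply pos_INR.
  rewrite <- P in SP. apply (Rmult_lt_reg_l (INR (2 * m) + 1)); lra.
Qed.

Lemma bern_even_neq0 k : (2 <= k)%nat -> Nat.Even k -> bern k <> 0.
Proof.
  intros Hk [m ->] E. assert (P := bern_sign m ltac:(lia)). rewrite E in P. lra.
Qed.

(** * Complex series *)

Definition csums (a : nat -> C) (l : C) : Prop :=
  forall eps, 0 < eps -> exists N, forall n, (N <= n)%nat -> Cmod (csum a n - l) < eps.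

(** A total function of the sequence, so that sums depending on a parameter can be written down
    first; it is the sum as soon as a majorant is given. *)
Definition Cser (a : nat -> C) : C :=
  (Series (fun n => Re (a n)), Series (fun n => Im (a n))).

Lemma csums_unique a l m : csums a l -> csums a m -> l = m.
Proof.
  intros Hl Hm. apply Ceq_minus, Cmod_0_eq. intros eps He.
  destruct (Hl (eps / 2) ltac:(lra)) as [N K]. destruct (Hm (eps / 2) ltac:(lra)) as [N' K'].
  specialize (K (max N N') ltac:(lia)). specialize (K' (max N N') ltac:(lia)).
  replace (l - m)%C with ((csum a (max N N') - m) - (csum a (max N N') - l))%C by ring.
  eapply Rle_trans; [apply Cmod_triangle_minus|]. lra.
Qed.

Lemma csums_ext a b l : (forall n, a n = b n) -> csums a l -> csums b l.
Proof.
  intros E H eps He. destruct (H eps He) as [N K]. exists N. intros n Hn.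
  rewrite <- (csum_ext a b) by auto. auto.
Qed.

Lemma csums_plus a b l m : csums a l -> csums b m -> csums (fun n => a n + b n)%C (l + m)%C.
Proof.
  intros Hl Hm eps He.
  destruct (Hl (eps / 2) ltac:(lra)) as [N K]. destruct (Hm (eps / 2) ltac:(lra)) as [N' K'].
  exists (max N N'). intros n Hn. specialize (K n ltac:(lia)). specialize (K' n ltac:(lia)).
  rewrite csum_plus.
  replace (csum a n + csum b n - (l + m))%C with ((csum a n - l) + (csum b n - m))%C by ring.
  eapply Rle_lt_trans; [apply Cmod_triangle|]. lra.
Qed.

Lemma csums_scal c a l : csums a l -> csums (fun n => c * a n)%C (c * l)%C.
Proof.
  intros H eps He. assert (0 <= Cmod c) by apply Cmod_ge_0.
  destruct (H (eps / (Cmod c + 1))) as [N K]; [apply Rdiv_lt_0_compat; lra|].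
  exists N. intros n Hn. specialize (K n Hn). rewrite csum_scal.
  replace (c * csum a n - c * l)%C with (c * (csum a n - l))%C by ring. rewrite Cmod_mult.
  apply Rlt_div_r in K; [|lra]. generalize (Cmod_ge_0 (csum a n - l)). nra.
Qed.

Lemma csums_minus a b l m : csums a l -> csums b m -> csums (fun n => a n - b n)%C (l - m)%C.
Proof.
  intros Hl Hm. replace (l - m)%C with (l + RtoC (-1) * m)%C by ring.
  apply (csums_ext (fun n => a n + RtoC (-1) * b n)%C); [intros; ring|].
  apply csums_plus; auto. apply csums_scal; auto.
Qed.

Lemma csums_csum (a : nat -> nat -> C) l n : (forall k, (k < n)%nat -> csums (a k) (l k)) ->
  csums (fun j => csum (fun k => a k j) n) (csum l n).
Proof.
  induction n; intros H; simpl.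
  - intros eps He. exists 0%nat. intros n _. rewrite (csum_ext _ (fun _ => 0 * 0)%C).
    + rewrite csum_scal. replace (0 * csum (fun _ => RtoC 0) n - 0)%C with (RtoC 0) by ring.
      rewrite Cmod_0; auto.
    + intros; ring.
  - apply csums_plus; [apply IHn; auto|apply H; auto].
Qed.

Lemma csums_subseq a l (phi : nat -> nat) (b : nat -> C) :
  (forall n, (n <= phi n)%nat) -> (forall n, csum b n = csum a (phi n)) ->
  csums a l -> csums b l.
Proof.
  intros Hp E H eps He. destruct (H eps He) as [N K]. exists N. intros n Hn.
  rewrite E. apply K. specialize (Hp n). lia.
Qed.

Lemma csums_shift a l : csums (fun n => a (S n)) l -> csums a (a 0%nat + l)%C.
Proof.
  intros H eps He. destruct (H eps He) as [N K]. exists (S N). intros [|n] Hn; [lia|].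
  rewrite csum_S_first. specialize (K n ltac:(lia)).
  replace (a 0%nat + csum (fun k => a (S k)) n - (a 0%nat + l))%C
    with (csum (fun k => a (S k)) n - l)%C by ring. auto.
Qed.

Lemma rsum_sum_n f n : rsum f (S n) = sum_n f n.
Proof.
  induction n.
  - rewrite sum_O. simpl. ring.
  - rewrite sum_Sn, <- IHn. reflexivity.
Qed.

Lemma csum_re_im a n : csum a n = (rsum (fun k => Re (a k)) n, rsum (fun k => Im (a k)) n).
Proof. induction n; simpl; [reflexivity|]. rewrite IHn. reflexivity. Qed.

Lemma csums_is_series a l :
  csums a l <-> is_series (K := C_AbsRing) (V := C_NormedModule) a l.
Proof.
  assert (E : forall n, sum_n (G := C_AbelianMonoid) a n = csum a (S n)).
  { induction n.
    - rewrite sum_O. simpl. ring.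
    - rewrite sum_Sn, IHn. reflexivity. }
  split.
  - intros H P HP. apply locally_C_Cmod in HP. destruct HP as [d [Hd K]].
    destruct (H d Hd) as [N KN]. exists N. intros n Hn. apply K.
    change (Cmod (sum_n (G := C_AbelianMonoid) a n - l) < d). rewrite E. apply KN. lia.
  - intros H eps He.
    destruct (H (fun w : C => Cmod (w - l) < eps)) as [N K].
    { apply (locally_C_Cmod (fun w : C => Cmod (w - l) < eps)). exists eps. auto. }
    exists (S N). intros [|n] Hn; [lia|]. specialize (K n ltac:(lia)).
    change (Cmod (sum_n (G := C_AbelianMonoid) a n - l) < eps) in K. rewrite E in K. auto.
Qed.

Lemma is_series_tail (M : nat -> R) : ex_series M -> forall eps, 0 < eps -> exists N,
  forall n, (N <= n)%nat -> Rabs (rsum M n - Series M) < eps.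
Proof.
  intros HM eps He. apply Series_correct in HM. apply is_series_Reals in HM.
  destruct (HM eps He) as [N K]. exists (S N). intros [|n] Hn; [lia|].
  specialize (K n ltac:(lia)). rewrite rsum_sum_n, sum_n_Reals. exact K.
Qed.

Lemma rsum_scal c f n : rsum (fun k => c * f k) n = c * rsum f n.
Proof. induction n; simpl; [ring|]. rewrite IHn. ring. Qed.

Lemma rsum_le f g n : (forall k, (k < n)%nat -> f k <= g k) -> rsum f n <= rsum g n.
Proof. induction n; simpl; intros H; [lra|]. apply Rplus_le_compat; auto. Qed.

Lemma ex_series_dominated a (M : nat -> R) : (forall n, Cmod (a n) <= M n) -> ex_series M ->
  ex_series (fun n => Re (a n)) /\ ex_series (fun n => Im (a n)).
Proof.
  intros H HM. split; apply (ex_series_le (K := R_AbsRing) (V := R_CompleteNormedModule) _ M); auto;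
    intros n; (eapply Rle_trans; [|apply H]).
  - apply re_le_Cmod.
  - apply im_le_Cmod.
Qed.

Lemma Cser_correct a (M : nat -> R) : (forall n, Cmod (a n) <= M n) -> ex_series M ->
  csums a (Cser a).
Proof.
  intros H HM eps He. destruct (ex_series_dominated a M H HM) as [H1 H2].
  destruct (is_series_tail _ H1 (eps / 2) ltac:(lra)) as [N1 K1].
  destruct (is_series_tail _ H2 (eps / 2) ltac:(lra)) as [N2 K2].
  exists (max N1 N2). intros n Hn. specialize (K1 n ltac:(lia)). specialize (K2 n ltac:(lia)).
  rewrite csum_re_im. eapply Rle_lt_trans; [apply Cmod_le_Re_Im|].
  unfold Cser. simpl. unfold Rminus in *. lra.
Qed.

Lemma Cser_eq a l (M : nat -> R) : (forall n, Cmod (a n) <= M n) -> ex_series M ->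
  csums a l -> Cser a = l.
Proof. intros H HM K. apply (csums_unique a); auto. apply (Cser_correct a M); auto. Qed.

(** The bound depends on the majorant alone, so for a family of series with a common majorant the
    convergence is uniform. *)
Lemma Cser_tail a (M : nat -> R) n : (forall n, Cmod (a n) <= M n) -> ex_series M ->
  Cmod (csum a n - Cser a) <= Series M - rsum M n.
Proof.
  intros H HM. apply Rnot_lt_le. intros N.
  set (e := Cmod (csum a n - Cser a) - (Series M - rsum M n)).
  assert (He : 0 < e) by (unfold e; lra).
  destruct (Cser_correct a M H HM (e / 2) ltac:(lra)) as [N1 K1].
  destruct (is_series_tail _ HM (e / 2) ltac:(lra)) as [N2 K2].
  set (m := (n + N1 + N2)%nat). specialize (K1 m ltac:(unfold m; lia)).
  specialize (K2 m ltac:(unfold m; lia)). apply Rabs_lt_between in K2.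
  assert (D : forall k, Cmod (csum a (n + k) - csum a n) <= rsum M (n + k) - rsum M n).
  { induction k.
    - rewrite Nat.add_0_r, Cmod_self_minus. lra.
    - rewrite Nat.add_succ_r. simpl.
      replace (csum a (n + k) + a (n + k)%nat - csum a n)%C
        with ((csum a (n + k) - csum a n) + a (n + k)%nat)%C by ring.
      eapply Rle_trans; [apply Cmod_triangle|]. specialize (H (n + k)%nat). lra. }
  specialize (D (N1 + N2)%nat). rewrite Nat.add_assoc in D. fold m in D.
  assert (T : Cmod (csum a n - Cser a) <= Cmod (csum a m - Cser a) + Cmod (csum a m - csum a n)).
  { replace (csum a n - Cser a)%C with ((csum a m - Cser a) - (csum a m - csum a n))%C by ring.
    apply Cmod_triangle_minus. }
  unfold e in *. lra.
Qed.

Lemma Cser_bound a (M : nat -> R) : (forall n, Cmod (a n) <= M n) -> ex_series M ->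
  Cmod (Cser a) <= Series M.
Proof.
  intros H HM. generalize (Cser_tail a M 0 H HM). simpl.
  replace (0 - Cser a)%C with (- Cser a)%C by ring. rewrite Cmod_opp. lra.
Qed.

Theorem Cser_hol (f : nat -> C -> C) (M : nat -> R) z d : 0 < d ->
  (forall n w, Cmod (w - z) < d -> cdiff (f n) w) ->
  (forall n w, Cmod (w - z) < d -> Cmod (f n w) <= M n) -> ex_series M ->
  hol (fun w => Cser (fun n => f n w)) z.
Proof.
  intros Hd Hf HB HM.
  apply (uniform_limit_hol (fun n w => csum (fun k => f k w) n) _ z d Hd).
  - intros n w Hw. apply csum_cdiff. auto.
  - intros eps He. destruct (is_series_tail _ HM eps He) as [N K]. exists N. intros w Hw.
    eapply Rle_trans; [apply (Cser_tail (fun n => f n w) M); auto|].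
    specialize (K N (Nat.le_refl N)). apply Rabs_lt_between in K. lra.
Qed.

Lemma ex_series_pos_bounded (u : nat -> R) B : (forall n, 0 <= u n) ->
  (forall n, rsum u n <= B) -> ex_series u /\ Series u <= B.
Proof.
  intros Hp HB.
  assert (E : ex_finite_lim_seq (sum_n u)).
  { apply (ex_finite_lim_seq_incr (sum_n u) B).
    - intros n. rewrite sum_Sn. unfold plus; simpl. specialize (Hp (S n)). lra.
    - intros n. rewrite <- rsum_sum_n. apply HB. }
  destruct E as [l Hl]. assert (I : is_series u l) by exact Hl.
  split; [exists l; exact I|]. rewrite (is_series_unique u l I).
  apply (is_lim_seq_le (sum_n u) (fun _ => B) l B).
  - intros n. rewrite <- rsum_sum_n. apply HB.
  - exact Hl.
  - apply is_lim_seq_const.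
Qed.

(** The mean value theorem for x^(1-p) bounds a term by a telescoping difference, which replaces
    comparison with an integral. *)
Lemma Rpower_step x p : 1 < p -> 0 < x ->
  (p - 1) * Rpower (x + 1) (- p) <= Rpower x (1 - p) - Rpower (x + 1) (1 - p).
Proof.
  intros Hp Hx.
  destruct (MVT_cor2 (fun t => Rpower t (1 - p)) (fun t => (1 - p) * Rpower t (1 - p - 1)) x (x + 1))
    as [c [E [H1 H2]]]; [lra| |].
  - intros c Hc. apply derivable_pt_lim_power. lra.
  - simpl in E. assert (R := Rpower_le_antitone c (x + 1) (- p) ltac:(lra) ltac:(lra)).
    replace (1 - p - 1) with (- p) in E by ring. nra.
Qed.

Lemma ex_series_Rpower a p : 1 <= a -> 1 < p ->
  ex_series (fun n => Rpower (INR n + a) (- p)) /\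
  Series (fun n => Rpower (INR n + a) (- p)) <= Rpower a (- p) + / (p - 1) * Rpower a (1 - p).
Proof.
  intros Ha Hp. apply ex_series_pos_bounded.
  - intros n. left. apply Rpower_pos.
  - assert (I : 0 < / (p - 1)) by (apply Rinv_0_lt_compat; lra).
    assert (H : forall n, rsum (fun n => Rpower (INR n + a) (- p)) (S n) <=
      Rpower a (- p) + / (p - 1) * (Rpower a (1 - p) - Rpower (INR n + a) (1 - p))).
    { induction n.
      - simpl. rewrite !Rplus_0_l. lra.
      - change (rsum (fun n => Rpower (INR n + a) (- p)) (S (S n))) with
          (rsum (fun n => Rpower (INR n + a) (- p)) (S n) + Rpower (INR (S n) + a) (- p)).
        assert (Q := Rpower_step (INR n + a) p Hp ltac:(generalize (pos_INR n); lra)).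
        rewrite S_INR. replace (INR n + 1 + a) with (INR n + a + 1) by ring.
        apply (Rmult_le_compat_l (/ (p - 1))) in Q; [|lra].
        rewrite <- Rmult_assoc, Rinv_l, Rmult_1_l in Q by lra.
        rewrite !Rmult_minus_distr_l in *. lra. }
    intros [|n].
    + simpl. generalize (Rpower_pos a (- p)) (Rpower_pos a (1 - p)). nra.
    + eapply Rle_trans; [apply H|]. generalize (Rpower_pos (INR n + a) (1 - p)). nra.
Qed.

(** * Euler--Maclaurin continuation *)

Definition em_coef (k : nat) (u : C) : C := ((-1) ^ k * RtoC (bern k) * rising u k)%C.

(** The error at x when u x^(-u-1) is expanded in the differences x^(-u-k) - (x+1)^(-u-k), k <= K.
    It has the order x^(-u-K-2). *)
Definition em_diff (K : nat) (u : C) (x : R) : C :=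
  (csum (fun k => em_coef k u * (Rpow_C x (- u - RtoC (INR k))
                                 - Rpow_C (x + 1) (- u - RtoC (INR k)))) (S K)
   - u * Rpow_C x (- u - 1))%C.

Lemma csum_RtoC f n : csum (fun k => RtoC (f k)) n = RtoC (rsum f n).
Proof. induction n; simpl; [reflexivity|]. rewrite IHn, RtoC_plus. reflexivity. Qed.

Lemma rsum_sum_f_R0 f n : rsum f (S n) = sum_f_R0 f n.
Proof. rewrite rsum_sum_n. apply sum_n_Reals. Qed.

Lemma Cpow_m1_add (j k : nat) : ((-1) ^ (j + k) = (-1) ^ j * (-1) ^ k)%C.
Proof. apply Cpow_add_r. Qed.

(* The terms of order [x^(-u-n)], [n >= 2], cancel by the recurrence of the
   Bernoulli numbers. *)
Lemma em_cancellation K u x :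
  csum (fun k => em_coef k u *
     csum (fun j => (-1) ^ (S j) * rising (u + RtoC (INR k)) (S j) * RtoC (/ INR (fact (S j)))
                    * Rpow_C x (- (u + RtoC (INR k)) - RtoC (INR (S j)))) (S K - k))%C (S K)
  = (- u * Rpow_C x (- u - 1))%C.
Proof.
  set (t := fun k j => ((-1) ^ (S j) * rising (u + RtoC (INR k)) (S j) * RtoC (/ INR (fact (S j)))
                    * Rpow_C x (- (u + RtoC (INR k)) - RtoC (INR (S j))))%C).
  change (csum (fun k => em_coef k u * csum (t k) (S K - k))%C (S K) = (- u * Rpow_C x (- u - 1))%C).
  induction K as [|K IH].
  - unfold em_coef, t. simpl. rewrite bern_0.
    replace (- (u + 0) - 1)%C with (- u - 1)%C by ring.
    rewrite Rinv_1. ring.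
  (* Raising K adds exactly the terms with k + j = K + 1. They share the power x^(-u-K-2), and their
     coefficients add up to 0 by [bern_recurrence]. *)
  - assert (E : csum (fun k => em_coef k u * csum (t k) (S (S K) - k))%C (S (S K)) =
      (csum (fun k => em_coef k u * csum (t k) (S K - k)) (S K)
       + csum (fun k => em_coef k u * t k (S K - k)%nat) (S (S K)))%C).
    { change (csum (fun k => em_coef k u * t k (S K - k)%nat)%C (S (S K)))
       with (csum (fun k => em_coef k u * t k (S K - k)%nat) (S K)
            + em_coef (S K) u * t (S K) (S K - S K)%nat)%C.
      rewrite Cplus_assoc, <- csum_plus.
      change (csum (fun k => em_coef k u * csum (t k) (S (S K) - k))%C (S (S K)))
       with (csum (fun k => em_coef k u * csum (t k) (S (S K) - k)) (S K)
            + em_coef (S K) u * csum (t (S K)) (S (S K) - S K))%C.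
      f_equal.
      - apply csum_ext. intros k Hk. replace (S (S K) - k)%nat with (S (S K - k)) by lia.
        change (csum (t k) (S (S K - k))) with (csum (t k) (S K - k) + t k (S K - k)%nat)%C. ring.
      - replace (S (S K) - S K)%nat with 1%nat by lia. rewrite Nat.sub_diag. simpl. ring. }
    rewrite E, IH.
    rewrite (csum_ext (fun k => em_coef k u * t k (S K - k)%nat)%C
      (fun k => ((-1) ^ (S (S K)) * rising u (S (S K)) * Rpow_C x (- u - RtoC (INR (S (S K)))))
                * RtoC (bern k / INR (fact (S (S K) - k))))%C).
    + rewrite csum_scal, csum_RtoC, rsum_sum_f_R0, bern_recurrence. ring.
    + intros k Hk. unfold em_coef, t.
      replace (S (S K)) with (k + S (S K - k))%nat at 1 2 3 by lia.
      replace (S (S K) - k)%nat with (S (S K - k)) by lia.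
      rewrite Cpow_m1_add, rising_add, plus_INR, RtoC_plus.
      replace (- u - (RtoC (INR k) + RtoC (INR (S (S K - k)))))%C
        with (- (u + RtoC (INR k)) - RtoC (INR (S (S K - k))))%C by ring.
      unfold Rdiv. rewrite RtoC_mult. ring.
Qed.

Lemma taylor_rem_split J v x :
  taylor_rem (S J) v x 1 =
  (Rpow_C (x + 1) (- v) - Rpow_C x (- v) -
   csum (fun j => (-1) ^ (S j) * rising v (S j) * RtoC (/ INR (fact (S j)))
                  * Rpow_C x (- v - RtoC (INR (S j)))) J)%C.
Proof.
  unfold taylor_rem. rewrite csum_S_first.
  rewrite (csum_ext _ (fun j => (-1) ^ (S j) * rising v (S j) * RtoC (/ INR (fact (S j)))
                  * Rpow_C x (- v - RtoC (INR (S j))))%C).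
  - change (INR 0) with 0. replace (- v - 0)%C with (- v)%C by ring.
    replace (1 ^ 0 / INR (fact 0)) with 1 by (simpl; field). simpl. ring.
  - intros j _. rewrite pow1. unfold Rdiv. rewrite Rmult_1_l. reflexivity.
Qed.

(** The k-th difference is expanded just so far that its remainder has the order x^(-u-K-2), the
    same for all k. Everything before the remainders cancels. *)
Lemma em_diff_taylor K u x :
  em_diff K u x =
  (- csum (fun k => em_coef k u * taylor_rem (S (S K - k)) (u + RtoC (INR k)) x 1) (S K))%C.
Proof.
  unfold em_diff.
  replace (u * Rpow_C x (- u - 1))%C with (- (- u * Rpow_C x (- u - 1)))%C by ring.
  rewrite <- (em_cancellation K u x).
  match goal with |- (?A - - ?B = _)%C => replace (A - - B)%C with (A + B)%C by ring end.
  rewrite <- csum_plus.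
  match goal with |- (?A = - ?B)%C => replace (- B)%C with (RtoC (-1) * B)%C by ring end.
  rewrite <- csum_scal. apply csum_ext. intros k Hk.
  rewrite taylor_rem_split.
  replace (- (u + RtoC (INR k)))%C with (- u - RtoC (INR k))%C by ring. ring.
Qed.

(** One factor 2^(K+2) from [taylor_rem_bound] for each of the K + 1 terms; the coefficients
    [bern k] are at most 1 in modulus. *)
Definition em_const (K : nat) : R := rsum (fun _ => 2 ^ S (S K)) (S K).

Lemma bern_bound k : Rabs (bern k) <= 1.
Proof. rewrite bern_inverse_coef. apply inverse_expm1_coef_bound. Qed.

Lemma em_const_pos K : 0 <= em_const K.
Proof.
  unfold em_const. apply Rle_trans with (rsum (fun _ => 0) (S K)).
  - induction (S K); simpl; lra.
  - apply rsum_le. intros. apply pow_le. lra.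
Qed.

Lemma em_diff_bound K u x : 0 < x -> 0 <= Re u + INR (S (S K)) ->
  Cmod (em_diff K u x) <=
  em_const K * Cmod (rising u (S (S K))) * Rpower x (- (Re u + INR (S (S K)))).
Proof.
  intros Hx Hu. rewrite em_diff_taylor, Cmod_opp.
  set (X := Cmod (rising u (S (S K))) * Rpower x (- (Re u + INR (S (S K))))).
  assert (HX : 0 <= X) by (apply Rmult_le_pos; [apply Cmod_ge_0|left; apply Rpower_pos]).
  eapply Rle_trans; [apply csum_bound with (g := fun _ => X * 2 ^ S (S K))|].
  - intros k Hk. rewrite Cmod_mult. unfold em_coef.
    assert (I : INR (S (S K)) = INR k + INR (S (S K - k)))
      by (rewrite <- plus_INR; f_equal; lia).
    assert (R : Re (u + RtoC (INR k)) + INR (S (S K - k)) = Re u + INR (S (S K)))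
      by (rewrite I; simpl; unfold Re; ring).
    eapply Rle_trans.
    + apply Rmult_le_compat_l; [apply Cmod_ge_0|].
      apply (taylor_rem_bound (S (S K - k)) (u + RtoC (INR k)) x 1 Hx ltac:(lra)).
      rewrite R. exact Hu.
    + rewrite R, !Cmod_mult, Cmod_pow, !Cmod_R.
      replace (Rabs (-1)) with 1 by (rewrite Rabs_left; lra). rewrite pow1.
      assert (RA : rising u (S (S K)) = (rising u k * rising (u + RtoC (INR k)) (S (S K - k)))%C)
        by (rewrite <- rising_add; f_equal; lia).
      unfold X. rewrite RA, Cmod_mult.
      assert (B := bern_bound k). assert (P : 2 ^ S (S K - k) <= 2 ^ S (S K))
        by (apply Rle_pow; [lra|lia]).
      assert (0 <= 2 ^ S (S K - k)) by (apply pow_le; lra).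
      assert (Q := Rabs_pos (bern k)).
      set (A := Cmod (rising u k) * Cmod (rising (u + RtoC (INR k)) (S (S K - k)))
        * Rpower x (- (Re u + INR (S (S K))))).
      assert (0 <= A) by (repeat apply Rmult_le_pos; try apply Cmod_ge_0; left; apply Rpower_pos).
      apply Rle_trans with (A * (Rabs (bern k) * 2 ^ S (S K - k))); [right; unfold A; ring|].
      apply Rmult_le_compat_l; [auto|]. nra.
  - right. rewrite rsum_scal. unfold em_const, X. ring.
Qed.

Lemma em_diff_S K u x :
  (em_diff (S K) u x - em_diff K u x =
   em_coef (S K) u * (Rpow_C x (- u - RtoC (INR (S K))) - Rpow_C (x + 1) (- u - RtoC (INR (S K)))))%C.
Proof.
  unfold em_diff.
  match goal with |- ((csum ?f (S (S K)) - ?B) - _ = _)%C =>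
    change (csum f (S (S K))) with (csum f (S K) + f (S K))%C end.
  cbv beta. ring.
Qed.

Lemma em_coef_cdiff k f z : cdiff f z -> cdiff (fun w => em_coef k (f w)) z.
Proof.
  intros H. unfold em_coef. apply cdiff_mult; [apply cdiff_const|]. apply rising_cdiff; auto.
Qed.

Lemma em_diff_cdiff K x z : cdiff (fun u => em_diff K u x) z.
Proof.
  assert (P : forall y c, cdiff (fun u => Rpow_C y (- u - c)%C) z).
  { intros y c. apply cdiff_Rpow_C. apply cdiff_minus; [|apply cdiff_const].
    apply cdiff_opp, cdiff_id. }
  unfold em_diff. apply cdiff_minus.
  - apply csum_cdiff. intros k _. apply cdiff_mult; [apply (em_coef_cdiff k (fun u => u)), cdiff_id|].
    apply cdiff_minus; apply P.
  - apply cdiff_mult; [apply cdiff_id|apply P].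
Qed.

(* [d] is the coefficient sequence of the Dirichlet series over the points
   [n + a], and [g w] the sum of its first differences against [(n + a)^(-w)]. *)
Record em_data (d : nat -> R) (a : R) (g : C -> C) : Prop := {
  em_ge_1 : 1 <= a;
  em_summable : forall p, 1 < p -> ex_series (fun n => Rabs (d n) * Rpower (INR n + a) (- p));
  em_abel : forall w, 1 < Re w ->
    csums (fun n => RtoC (d n) * (Rpow_C (INR n + a) (- w) - Rpow_C (INR n + a + 1) (- w)))%C (g w);
  em_hol : forall w, 0 < Re w -> hol g w
}.

Definition em_tail (d : nat -> R) (a : R) (K : nat) (u : C) : C :=
  Cser (fun n => RtoC (d n) * em_diff K u (INR n + a))%C.

Definition em_sum (d : nat -> R) (a : R) (g : C -> C) (K : nat) (u : C) : C :=
  (csum (fun k => em_coef k u * g (u + RtoC (INR k))) (S K) - em_tail d a K u)%C.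

Lemma em_term_bound d a g K u p B n : em_data d a g -> 0 <= p ->
  p <= Re u + INR (S (S K)) -> Cmod u <= B ->
  Cmod (RtoC (d n) * em_diff K u (INR n + a)) <=
  em_const K * (B + INR (S (S K))) ^ S (S K) * (Rabs (d n) * Rpower (INR n + a) (- p)).
Proof.
  intros D Hp Hu HB. assert (H1 := em_ge_1 _ _ _ D). assert (Hn := pos_INR n).
  assert (HK := em_const_pos K).
  rewrite Cmod_mult, Cmod_R.
  rewrite <- Rmult_assoc, (Rmult_comm _ (Rabs (d n))), Rmult_assoc.
  apply Rmult_le_compat_l; [apply Rabs_pos|].
  eapply Rle_trans; [apply em_diff_bound; lra|].
  apply Rmult_le_compat.
  - apply Rmult_le_pos; [auto|apply Cmod_ge_0].
  - left; apply Rpower_pos.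
  - apply Rmult_le_compat_l; [auto|]. apply Cmod_rising_le; auto.
  - unfold Rpower. apply exp_le_compat.
    assert (0 <= ln (INR n + a)) by (rewrite <- ln_1; apply ln_le; lra). nra.
Qed.

Lemma em_tail_correct d a g K u : em_data d a g -> - INR (S K) < Re u ->
  csums (fun n => RtoC (d n) * em_diff K u (INR n + a))%C (em_tail d a K u).
Proof.
  intros D Hu. rewrite S_INR in Hu. unfold em_tail. eapply Cser_correct.
  - intros n. apply (em_term_bound d a g K u (Re u + INR (S (S K))) (Cmod u) n D); try lra.
    rewrite !S_INR. lra.
  - apply (ex_series_scal (K := R_AbsRing) (V := R_NormedModule)). apply (em_summable _ _ _ D).
    rewrite !S_INR. lra.
Qed.

Lemma em_tail_hol d a g K u : em_data d a g -> - INR (S K) < Re u ->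
  hol (em_tail d a K) u.
Proof.
  intros D Hu. set (r := (Re u + INR (S K)) / 2). assert (Hr : 0 < r) by (unfold r; lra).
  assert (Re_near : forall w, Cmod (w - u) < r -> Re u - r < Re w).
  { intros w Hw. generalize (re_le_Cmod (w - u)) (Rle_abs (- (Re w - Re u))).
    change (Re (w - u)) with (Re w - Re u). rewrite Rabs_Ropp. lra. }
  unfold em_tail.
  apply (Cser_hol (fun n u => RtoC (d n) * em_diff K u (INR n + a))%C
    (fun n => em_const K * ((Cmod u + r) + INR (S (S K))) ^ S (S K)
       * (Rabs (d n) * Rpower (INR n + a) (- (1 + r)))) u r Hr).
  - intros n w _. apply cdiff_mult; [apply cdiff_const|apply em_diff_cdiff].
  - intros n w Hw. apply (em_term_bound d a g); auto; try lra.
    + specialize (Re_near w Hw). rewrite (S_INR (S K)). unfold r in *. lra.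
    + generalize (Cmod_le_minus w u). lra.
  - apply (ex_series_scal (K := R_AbsRing) (V := R_NormedModule)). apply (em_summable _ _ _ D). lra.
Qed.

(** The change of the tail is a multiple of the sum of first differences at u + K + 1. There the
    real part exceeds 1, so [em_abel] evaluates it as the new term of the sum. *)
Lemma em_sum_S d a g K u : em_data d a g -> - INR K < Re u ->
  em_sum d a g (S K) u = em_sum d a g K u.
Proof.
  intros D Hu.
  assert (T := csums_minus _ _ _ _ (em_tail_correct d a g (S K) u D ltac:(rewrite !S_INR; lra))
    (em_tail_correct d a g K u D ltac:(rewrite !S_INR; lra))).
  assert (A := csums_scal (em_coef (S K) u) _ _ (em_abel _ _ _ D (u + RtoC (INR (S K)))
    ltac:(rewrite S_INR; simpl; fold (Re u); lra))).
  assert (E : (em_tail d a (S K) u - em_tail d a K u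
     = em_coef (S K) u * g (u + RtoC (INR (S K))))%C).
  { apply (csums_unique _ _ _ T). eapply csums_ext; [|exact A]. intros n. cbv beta.
    replace (RtoC (d n) * em_diff (S K) u (INR n + a) - RtoC (d n) * em_diff K u (INR n + a))%C
      with (RtoC (d n) * (em_diff (S K) u (INR n + a) - em_diff K u (INR n + a)))%C by ring.
    rewrite em_diff_S. replace (- (u + RtoC (INR (S K))))%C with (- u - RtoC (INR (S K)))%C by ring.
    ring. }
  unfold em_sum.
  change (csum (fun k => em_coef k u * g (u + RtoC (INR k)))%C (S (S K))) with
    (csum (fun k => em_coef k u * g (u + RtoC (INR k))) (S K)
     + em_coef (S K) u * g (u + RtoC (INR (S K))))%C.
  rewrite <- E. ring.
Qed.

(** The order has to grow as Re u decreases. Since any order K with -K < Re u gives the same value,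
    a choice depending on the point still yields one function that is locally an [em_sum] of fixed
    order. *)
Definition em_ext (d : nat -> R) (a : R) (g : C -> C) (u : C) : C :=
  em_sum d a g (Z.to_nat (up (- Re u))) u.

Lemma em_ext_eq d a g K u : em_data d a g -> - INR K < Re u ->
  em_ext d a g u = em_sum d a g K u.
Proof.
  intros D Hu. unfold em_ext. set (N := Z.to_nat (up (- Re u))).
  assert (HN : - INR N < Re u).
  { destruct (archimed (- Re u)) as [H _].
    assert (IZR (up (- Re u)) <= INR N); [|lra].
    unfold N. rewrite INR_IZR_INZ. apply IZR_le. lia. }
  assert (M : forall n k, - INR n < Re u -> em_sum d a g (n + k) u = em_sum d a g n u).
  { intros n k Hn. induction k.
    - rewrite Nat.add_0_r. reflexivity.
    - rewrite Nat.add_succ_r, em_sum_S; auto. rewrite plus_INR. generalize (pos_INR k). lra. }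
  rewrite <- (M N K HN), <- (M K N Hu), Nat.add_comm. reflexivity.
Qed.

Lemma em_ext_hol_right d a g u : em_data d a g -> 0 < Re u -> hol (em_ext d a g) u.
Proof.
  intros D Hu.
  apply (hol_ext_loc (em_sum d a g 0) _ u (Re u) Hu).
  - intros w Hw. symmetry. apply em_ext_eq; auto. simpl.
    generalize (re_le_Cmod (w - u)) (Rle_abs (- (Re w - Re u))).
    change (Re (w - u)) with (Re w - Re u). rewrite Rabs_Ropp. lra.
  - unfold em_sum. apply hol_minus.
    + simpl. apply hol_plus; [apply hol_const|]. apply hol_mult.
      * apply hol_everywhere. intros w. apply (em_coef_cdiff 0 (fun w => w)), cdiff_id.
      * apply (hol_comp (fun w => w + RtoC 0)%C g).
        -- apply (em_hol _ _ _ D). simpl. fold (Re u). lra.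
        -- apply hol_plus; [apply hol_id|apply hol_const].
    + apply (em_tail_hol d a g); auto. simpl. lra.
Qed.

Definition em_series (d : nat -> R) (a : R) (s : C) : C :=
  Cser (fun n => RtoC (d n) * Rpow_C (INR n + a) (- s))%C.

Lemma em_series_correct d a g s : em_data d a g -> 1 < Re s ->
  csums (fun n => RtoC (d n) * Rpow_C (INR n + a) (- s))%C (em_series d a s).
Proof.
  intros D Hs. eapply Cser_correct; [|apply (em_summable _ _ _ D (Re s) Hs)].
  intros n. rewrite Cmod_mult, Cmod_R, Cmod_Rpow_C. apply Rle_refl.
Qed.

Lemma em_series_hol d a g s : em_data d a g -> 1 < Re s -> hol (em_series d a) s.
Proof.
  intros D Hs. set (r := (Re s - 1) / 2). assert (Hr : 0 < r) by (unfold r; lra).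
  apply (Cser_hol (fun n s => RtoC (d n) * Rpow_C (INR n + a) (- s))%C
    (fun n => Rabs (d n) * Rpower (INR n + a) (- (1 + r))) s r Hr).
  - intros n w _. apply cdiff_mult; [apply cdiff_const|]. apply cdiff_Rpow_C, cdiff_opp, cdiff_id.
  - intros n w Hw. rewrite Cmod_mult, Cmod_R, Cmod_Rpow_C.
    apply Rmult_le_compat_l; [apply Rabs_pos|].
    unfold Rpower. apply exp_le_compat.
    assert (0 <= ln (INR n + a))
      by (rewrite <- ln_1; apply ln_le; generalize (em_ge_1 _ _ _ D) (pos_INR n); lra).
    generalize (re_le_Cmod (w - s)) (Rle_abs (- (Re w - Re s))).
    change (Re (w - s)) with (Re w - Re s). change (Re (- w)) with (- Re w).
    rewrite Rabs_Ropp. unfold r in *. nra.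
  - apply (em_summable _ _ _ D). lra.
Qed.

(** For Re u > 1 the definition of [em_diff 0], summed over n, is this identity, because the sum of
    first differences then converges. Both sides are holomorphic for Re u > 0, which removes the
    restriction. *)
Theorem em_ext_series d a g u : em_data d a g -> 0 < Re u ->
  (u * em_series d a (u + 1) = em_ext d a g u)%C.
Proof.
  intros D Hu. apply Ceq_minus.
  apply (zero_in_half_plane (fun u => u * em_series d a (u + 1) - em_ext d a g u)%C 0 1); auto.
  - intros w Hw. apply cdiff_minus; [|apply hol_cdiff, em_ext_hol_right; auto].
    apply cdiff_mult; [apply cdiff_id|]. apply (cdiff_comp (fun w => w + 1)%C (em_series d a)).
    + apply hol_cdiff, (em_series_hol d a g); auto. change (1 < Re w + 1). lra.
    + apply cdiff_plus; [apply cdiff_id|apply cdiff_const].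
  - intros w Hw. rewrite (em_ext_eq d a g 0 w D) by (simpl; lra).
    assert (S := csums_scal w _ _ (em_series_correct d a g (w + 1) D ltac:(change (1 < Re w + 1); lra))).
    assert (T := em_tail_correct d a g 0 w D ltac:(simpl; lra)).
    assert (A := csums_scal (em_coef 0 w) _ _ (em_abel _ _ _ D (w + RtoC (INR 0))
      ltac:(change (1 < Re w + 0); lra))).
    assert (AT := csums_minus _ _ _ _ A T).
    apply (fun E => csums_ext _ (fun n => w * (RtoC (d n) * Rpow_C (INR n + a) (- (w + 1))))%C _ E)
      in AT.
    + rewrite (csums_unique _ _ _ S AT). unfold em_sum. simpl. ring.
    + intros n. unfold em_diff. simpl csum.
      replace (- (w + RtoC (INR 0)))%C with (- w - RtoC (INR 0))%C by ring.
      replace (- (w + 1))%C with (- w - 1)%C by ring. simpl INR. ring.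
Qed.

(** * The Hurwitz and Riemann zeta functions *)

Lemma Re_near w z r : Cmod (w - z) < r -> Re z - r < Re w < Re z + r.
Proof.
  intros H. assert (K := re_le_Cmod (w - z)). change (Re (w - z)) with (Re w - Re z) in K.
  apply Rabs_le_between in K. lra.
Qed.

(** For the constant sequence the first differences telescope, and what remains is the entire
    function a^(-w). *)
Lemma hurwitz_data a : 1 <= a -> em_data (fun _ => 1) a (fun w => Rpow_C a (- w)).
Proof.
  intros Ha.
  assert (S : forall p, 1 < p -> ex_series (fun n => Rpower (INR n + a) (- p)))
    by (intros p Hp; apply ex_series_Rpower; auto).
  split; auto.
  - intros p Hp. eapply ex_series_ext; [|apply (S p Hp)]. intros n. cbv beta.
    rewrite Rabs_R1, Rmult_1_l. reflexivity.
  - intros w Hw eps He.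
    assert (T := ex_series_lim_0 _ (S (Re w) Hw)). apply is_lim_seq_Reals in T.
    destruct (T eps He) as [N K]. exists N. intros n Hn. specialize (K n Hn).
    assert (E : forall n, csum (fun n => RtoC 1 * (Rpow_C (INR n + a) (- w)
       - Rpow_C (INR n + a + 1) (- w)))%C n = (Rpow_C a (- w) - Rpow_C (INR n + a) (- w))%C).
    { induction n0.
      - simpl. rewrite Rplus_0_l. ring.
      - rewrite csum_S, IHn0, S_INR. replace (INR n0 + a + 1) with (INR n0 + 1 + a) by ring. ring. }
    rewrite E. replace (Rpow_C a (- w) - Rpow_C (INR n + a) (- w) - Rpow_C a (- w))%C
      with (- Rpow_C (INR n + a) (- w))%C by ring.
    rewrite Cmod_opp, Cmod_Rpow_C. change (Re (- w)) with (- Re w).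
    unfold Rdist in K. rewrite Rminus_0_r in K. apply Rle_lt_trans with (2 := K). apply Rle_abs.
  - intros w _. apply hol_everywhere. intros v. apply cdiff_Rpow_C, cdiff_opp, cdiff_id.
Qed.

(* [hurwitz1 a u] is [u * zeta (1 + u, a)], an entire function of [u]. *)
Definition hurwitz1 (a : R) (u : C) : C :=
  em_ext (fun _ => 1) a (fun w => Rpow_C a (- w)) u.

Lemma hurwitz1_eq a K u : 1 <= a -> - INR K < Re u ->
  hurwitz1 a u = em_sum (fun _ => 1) a (fun w => Rpow_C a (- w)) K u.
Proof. intros Ha Hu. apply em_ext_eq; auto. apply hurwitz_data; auto. Qed.

Lemma nat_above x : exists K : nat, x < INR K.
Proof.
  exists (Z.to_nat (up x)). destruct (archimed x) as [H _].
  apply Rlt_le_trans with (IZR (up x)); [lra|]. rewrite INR_IZR_INZ. apply IZR_le. lia.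
Qed.

Lemma hurwitz1_hol a u : 1 <= a -> hol (hurwitz1 a) u.
Proof.
  intros Ha. destruct (nat_above (1 - Re u)) as [K HK].
  apply (hol_ext_loc (em_sum (fun _ => 1) a (fun w => Rpow_C a (- w)) K) _ u 1 Rlt_0_1).
  - intros w Hw. symmetry. apply hurwitz1_eq; auto. apply Re_near in Hw. lra.
  - unfold em_sum. apply hol_minus.
    + apply hol_everywhere. intros w. apply csum_cdiff. intros k _. apply cdiff_mult.
      * apply (em_coef_cdiff k (fun w => w)), cdiff_id.
      * apply cdiff_Rpow_C, cdiff_opp, cdiff_plus; [apply cdiff_id|apply cdiff_const].
    + apply (em_tail_hol _ a (fun w => Rpow_C a (- w))); [apply hurwitz_data; auto|].
      rewrite S_INR. lra.
Qed.

Definition hurwitz_series (a : R) (s : C) : C := em_series (fun _ => 1) a s.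

Lemma hurwitz_series_correct a s : 1 <= a -> 1 < Re s ->
  csums (fun n => Rpow_C (INR n + a) (- s)) (hurwitz_series a s).
Proof.
  intros Ha Hs. eapply csums_ext; [|apply (em_series_correct _ _ _ s (hurwitz_data a Ha) Hs)].
  intros n. cbv beta. ring.
Qed.

Lemma hurwitz1_series a u : 1 <= a -> 0 < Re u ->
  hurwitz1 a u = (u * hurwitz_series a (u + 1))%C.
Proof. intros Ha Hu. symmetry. apply em_ext_series; auto. apply hurwitz_data; auto. Qed.

Definition hurwitz (a : R) (s : C) : C := (hurwitz1 a (s - 1) / (s - 1))%C.

Lemma Cminus_neq0 (x y : C) : x <> y -> (x - y)%C <> RtoC 0.
Proof. intros N E. apply N, Ceq_minus, E. Qed.

Lemma hurwitz_hol a s : 1 <= a -> s <> RtoC 1 -> hol (hurwitz a) s.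
Proof.
  intros Ha Hs. unfold hurwitz. apply hol_div; [|apply hol_minus; [apply hol_id|apply hol_const]|].
  - apply (hol_comp (fun s => s - 1)%C (hurwitz1 a)); [apply hurwitz1_hol; auto|].
    apply hol_minus; [apply hol_id|apply hol_const].
  - apply Cminus_neq0; auto.
Qed.

Lemma hurwitz_eq_series a s : 1 <= a -> 1 < Re s -> hurwitz a s = hurwitz_series a s.
Proof.
  intros Ha Hs. unfold hurwitz. rewrite hurwitz1_series; auto.
  - replace (s - 1 + 1)%C with s by ring. field. apply Cminus_neq0. intros ->. simpl in Hs. lra.
  - change (0 < Re s - 1). lra.
Qed.

Lemma hurwitz_correct a s : 1 <= a -> 1 < Re s ->
  csums (fun n => Rpow_C (INR n + a) (- s)) (hurwitz a s).
Proof. intros Ha Hs. rewrite hurwitz_eq_series; auto. apply hurwitz_series_correct; auto. Qed.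

Lemma is_dirichlet_series_csums a s l :
  is_dirichlet_series a s l <-> csums (fun n => a (S n) * Rpow_C (INR n + 1) (- s))%C l.
Proof.
  unfold is_dirichlet_series. rewrite <- csums_is_series.
  split; intros H; (eapply csums_ext; [|exact H]); intros n; cbv beta; rewrite S_INR; reflexivity.
Qed.

(** [zeta] is chosen by [epsilon]; the function [hurwitz 1] shows that there is something to
    choose. *)
Lemma zeta_spec : is_riemann_zeta zeta.
Proof.
  refine (epsilon_spec (inhabits (fun _ : C => RtoC 0)) is_riemann_zeta _).
  exists (hurwitz 1). split.
  - intros s Hs. apply holomorphic_at_hol, hurwitz_hol; [lra|auto].
  - intros s Hs. apply is_dirichlet_series_csums.
    eapply csums_ext; [|apply (hurwitz_correct 1 s ltac:(lra) Hs)]. intros n. cbv beta. ring.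
Qed.

(** Two continuations of the same series agree off 1. The half-plane Re s < 1 contains all points at
    which values of [zeta] occur later: 0 and the points [omega b m]. *)
Lemma zeta_hurwitz s : Re s < 1 -> zeta s = hurwitz 1 s.
Proof.
  intros Hs. apply Ceq_minus.
  apply (zero_off_one (fun s => zeta s - hurwitz 1 s)%C); auto.
  - intros w Hw. apply hol_cdiff, hol_minus.
    + apply holomorphic_at_hol, zeta_spec, Hw.
    + apply hurwitz_hol; [lra|auto].
  - intros w Hw. apply (proj1 (Ceq_minus _ _)).
    assert (H := proj2 zeta_spec w Hw). apply is_dirichlet_series_csums in H.
    apply (csums_unique _ _ _ H). eapply csums_ext; [|apply (hurwitz_correct 1 w ltac:(lra) Hw)].
    intros n. cbv beta. ring.
Qed.

(** * Values near s = 0: splitting off terms and the size of the tail *)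

Lemma hurwitz1_shift a N u : 1 <= a ->
  hurwitz1 a u = (u * csum (fun n => Rpow_C (INR n + a) (- (u + 1))) N + hurwitz1 (INR N + a) u)%C.
Proof.
  intros Ha. assert (HN := pos_INR N). apply Ceq_minus.
  apply (zero_in_half_plane (fun u => hurwitz1 a u -
     (u * csum (fun n => Rpow_C (INR n + a) (- (u + 1))) N + hurwitz1 (INR N + a) u))%C
     (Re u - 1) 0); [| |lra].
  - intros w _. apply cdiff_minus; [apply hol_cdiff, hurwitz1_hol; auto|].
    apply cdiff_plus; [|apply hol_cdiff, hurwitz1_hol; lra].
    apply cdiff_mult; [apply cdiff_id|]. apply csum_cdiff. intros k _.
    apply cdiff_Rpow_C, cdiff_opp, cdiff_plus; [apply cdiff_id|apply cdiff_const].
  - intros w Hw. rewrite !hurwitz1_series by (auto; lra).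
    assert (Hw' : 1 < Re (w + 1)) by (change (1 < Re w + 1); lra).
    assert (E : hurwitz_series a (w + 1) =
       (csum (fun n => Rpow_C (INR n + a) (- (w + 1))) N + hurwitz_series (INR N + a) (w + 1))%C).
    { apply (csums_unique _ _ _ (hurwitz_series_correct a (w + 1) Ha Hw')).
      intros eps He.
      destruct (hurwitz_series_correct (INR N + a) (w + 1) ltac:(lra) Hw' eps He) as [M K].
      exists (N + M)%nat. intros n Hn. replace n with (N + (n - N))%nat by lia.
      rewrite csum_split. specialize (K (n - N)%nat ltac:(lia)).
      rewrite (csum_ext (fun k => Rpow_C (INR (N + k) + a) (- (w + 1)))
        (fun k => Rpow_C (INR k + (INR N + a)) (- (w + 1)))).
      - match goal with |- Cmod ?X < _ => replace X with
          (csum (fun k => Rpow_C (INR k + (INR N + a)) (- (w + 1))) (n - N)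
           - hurwitz_series (INR N + a) (w + 1))%C by ring end. exact K.
      - intros k _. rewrite plus_INR. f_equal. ring. }
    rewrite E. ring.
Qed.

(** The exponent is at least 2, and the sum of (n + a)^(-2) is at most a^(-2) + a^(-1) <= 2 / a.
    Together with [hurwitz1_shift], which makes a large, this turns the expansion into an asymptotic
    one. *)
Lemma em_tail_small K a u : 1 <= a -> 2 <= Re u + INR (S (S K)) ->
  Cmod (em_tail (fun _ => 1) a K u) <= em_const K * Cmod (rising u (S (S K))) * (2 / a).
Proof.
  intros Ha Hu.
  destruct (ex_series_Rpower a 2 Ha ltac:(lra)) as [X1 X2].
  set (A := em_const K * Cmod (rising u (S (S K)))).
  assert (HA : 0 <= A) by (apply Rmult_le_pos; [apply em_const_pos|apply Cmod_ge_0]).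
  assert (P2 : Rpower a (- (2)) <= / a).
  { rewrite <- (Rpower_1 a) at 2 by lra. rewrite <- Rpower_Ropp.
    unfold Rpower. apply exp_le_compat. assert (0 <= ln a) by (rewrite <- ln_1; apply ln_le; lra).
    nra. }
  assert (P1 : Rpower a (1 - 2) = / a).
  { replace (1 - 2) with (- (1)) by ring. rewrite Rpower_Ropp, Rpower_1; lra. }
  eapply Rle_trans.
  - apply (Cser_bound _ (fun n => A * Rpower (INR n + a) (- (2)))).
    + intros n. assert (Hn := pos_INR n).
      replace (RtoC 1 * em_diff K u (INR n + a))%C with (em_diff K u (INR n + a)) by ring.
      eapply Rle_trans; [apply em_diff_bound; lra|]. fold A. apply Rmult_le_compat_l; auto.
      unfold Rpower. apply exp_le_compat.
      assert (0 <= ln (INR n + a)) by (rewrite <- ln_1; apply ln_le; lra). nra.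
    + apply (ex_series_scal (K := R_AbsRing) (V := R_NormedModule)). exact X1.
  - rewrite Series_scal_l. apply Rmult_le_compat_l; auto.
    rewrite P1 in X2. replace (/ (2 - 1)) with 1 in X2 by field.
    assert (0 < / a) by (apply Rinv_0_lt_compat; lra).
    change (Series (fun n : nat => Rpower (INR n + a) (- (2))) <= 2 * / a). lra.
Qed.

(** The point u = -1 corresponds to s = 0; order 2 is the least one for which [hurwitz1_eq] covers a
    neighbourhood of it. *)
Lemma hurwitz1_m1_expansion a u : 1 <= a -> - 2 < Re u ->
  hurwitz1 a u = (Rpow_C a (- u) + u / 2 * Rpow_C a (- (u + 1))
    + RtoC (1 / 12) * (u * (u + 1)) * Rpow_C a (- (u + 2)) - em_tail (fun _ => 1) a 2 u)%C.
Proof.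
  intros Ha Hu. rewrite (hurwitz1_eq a 2 u) by (auto; simpl; lra).
  unfold em_sum, em_coef. simpl csum. rewrite bern_0, bern_1, bern_2. simpl.
  replace (u + 0)%C with u by ring.
  replace (RtoC (- (1 / 2))) with (- (1 / 2))%C
    by (rewrite RtoC_opp, RtoC_div by lra; reflexivity).
  replace (RtoC (1 + 1)) with (RtoC 2) by (f_equal; ring).
  field.
Qed.

(** The tail is bounded by a multiple of the rising factorial, which contains the factor u + 1. So
    the expansion is exact at u = -1. *)
Lemma em_tail_m1 a : 1 <= a -> em_tail (fun _ => 1) a 2 (RtoC (-1)) = RtoC 0.
Proof.
  intros Ha. apply Cmod_eq_0. apply Rle_antisym; [|apply Cmod_ge_0].
  eapply Rle_trans; [apply em_tail_small; [auto|simpl; lra]|].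
  replace (rising (RtoC (-1)) 4) with (RtoC 0).
  - rewrite Cmod_0. right. ring.
  - simpl. ring.
Qed.

Lemma hurwitz1_m1 : hurwitz1 1 (RtoC (-1)) = RtoC (1 / 2).
Proof.
  rewrite hurwitz1_m1_expansion, em_tail_m1, !Rpow_C_1_l by (simpl; lra).
  rewrite !RtoC_div by lra. field.
Qed.

Lemma zeta_0 : zeta (RtoC 0) = RtoC (- (1 / 2)).
Proof.
  rewrite zeta_hurwitz by (simpl; lra). unfold hurwitz.
  replace (0 - 1)%C with (RtoC (-1)) by ring. rewrite hurwitz1_m1.
  rewrite RtoC_opp. field.
Qed.

(** * Wallis's product and the derivative of zeta at 0 *)

Definition wallis_int (n : nat) : R := RInt (fun x => sin x ^ n) 0 (PI / 2).

Lemma continuous_sin_pow n x : continuous (fun x => sin x ^ n) x.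
Proof. apply (ex_derive_continuous (fun x => sin x ^ n)). auto_derive. auto. Qed.

Lemma ex_RInt_sin_pow n : ex_RInt (fun x => sin x ^ n) 0 (PI / 2).
Proof.
  apply (ex_RInt_continuous (V := R_CompleteNormedModule)). intros; apply continuous_sin_pow.
Qed.

Lemma wallis_int_0 : wallis_int 0 = PI / 2.
Proof.
  unfold wallis_int. rewrite (RInt_ext _ (fun _ => 1)) by (intros; reflexivity).
  rewrite RInt_const. unfold scal; simpl. unfold mult; simpl. ring.
Qed.

Lemma wallis_int_1 : wallis_int 1 = 1.
Proof.
  unfold wallis_int.
  transitivity (minus (- cos (PI / 2)) (- cos 0) : R);
    [|rewrite cos_PI2, cos_0; unfold minus, plus, opp; simpl; ring].
  apply (is_RInt_unique (V := R_CompleteNormedModule)).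
  apply (is_RInt_derive (V := R_CompleteNormedModule) (fun x => - cos x)).
  - intros x _. auto_derive; [auto|ring].
  - intros x _. apply continuous_sin_pow.
Qed.

(** Integration by parts in the form of a primitive: the difference of the integrands is the
    derivative of - cos x * sin x ^ (n+1), which vanishes at 0 and at pi / 2. *)
Lemma wallis_int_SS n : INR (n + 2) * wallis_int (S (S n)) = INR (n + 1) * wallis_int n.
Proof.
  assert (D : is_RInt (fun x => INR (n + 2) * sin x ^ (S (S n)) - INR (n + 1) * sin x ^ n) 0 (PI / 2)
    (minus (- cos (PI / 2) * sin (PI / 2) ^ (S n)) (- cos 0 * sin 0 ^ (S n)))).
  { apply (is_RInt_derive (V := R_CompleteNormedModule) (fun x => - cos x * sin x ^ (S n))).
    - intros x _.
      replace (INR (n + 2) * sin x ^ (S (S n)) - INR (n + 1) * sin x ^ n) with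
        (- - sin x * sin x ^ (S n) + - cos x * (INR (S n) * cos x * sin x ^ n)).
      + auto_derive; auto. change (Init.Nat.pred (S n)) with n. simpl. ring.
      + rewrite !plus_INR, S_INR. replace (INR 2) with 2 by (simpl; ring). change (INR 1) with 1.
        assert (C := sin2_cos2 x). unfold Rsqr in C.
        replace (- cos x * ((INR n + 1) * cos x * sin x ^ n))
          with (- (INR n + 1) * (cos x * cos x) * sin x ^ n) by ring.
        replace (cos x * cos x) with (1 - sin x * sin x) by lra. simpl. ring.
    - intros x _. apply (ex_derive_continuous (fun x => INR (n + 2) * sin x ^ (S (S n)) - INR (n + 1) * sin x ^ n)).
      auto_derive. auto. }
  apply (is_RInt_unique (V := R_CompleteNormedModule)) in D.
  rewrite cos_PI2, sin_0 in D.
  assert (Sc : forall c k, RInt (fun x => c * sin x ^ k) 0 (PI / 2) = c * wallis_int k)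
    by (intros c k; exact (RInt_scal (V := R_CompleteNormedModule) (fun x => sin x ^ k) 0 (PI / 2) c
          (ex_RInt_sin_pow k))).
  assert (M : RInt (fun x => INR (n + 2) * sin x ^ (S (S n)) - INR (n + 1) * sin x ^ n) 0 (PI / 2)
    = INR (n + 2) * wallis_int (S (S n)) - INR (n + 1) * wallis_int n).
  { rewrite <- !Sc.
    exact (RInt_minus (V := R_CompleteNormedModule) (fun x => INR (n + 2) * sin x ^ (S (S n)))
      (fun x => INR (n + 1) * sin x ^ n) 0 (PI / 2)
      (ex_RInt_scal (V := R_NormedModule) (fun x => sin x ^ (S (S n))) 0 (PI / 2) _ (ex_RInt_sin_pow _))
      (ex_RInt_scal (V := R_NormedModule) (fun x => sin x ^ n) 0 (PI / 2) _ (ex_RInt_sin_pow _))). }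
  rewrite M in D. unfold minus, plus, opp in D; simpl in D. simpl. lra.
Qed.

Lemma wallis_int_decr n : wallis_int (S n) <= wallis_int n.
Proof.
  assert (P := PI_RGT_0).
  apply RInt_le; [lra|apply ex_RInt_sin_pow|apply ex_RInt_sin_pow|].
  intros x Hx. assert (0 <= sin x) by (apply sin_ge_0; lra).
  assert (sin x <= 1) by apply SIN_bound. simpl. assert (0 <= sin x ^ n) by (apply pow_le; auto). nra.
Qed.

(** The product of 2k / (2k - 1) over 1 <= k <= n, that is 4^n divided by the central binomial
    coefficient. *)
Fixpoint wallis (n : nat) : R :=
  match n with O => 1 | S n => wallis n * (2 * INR n + 2) / (2 * INR n + 1) end.

Lemma wallis_pos n : 0 < wallis n.
Proof.
  induction n; simpl; [lra|]. assert (H := pos_INR n).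
  apply Rdiv_lt_0_compat; [apply Rmult_lt_0_compat|]; lra.
Qed.

Lemma wallis_factorial n : wallis n * INR (fact (2 * n)) = INR (fact n) ^ 2 * 4 ^ n.
Proof.
  induction n.
  - simpl. ring.
  - replace (2 * S n)%nat with (S (S (2 * n))) by lia.
    rewrite !fact_simpl, !mult_INR, !S_INR, mult_INR. simpl wallis.
    assert (H := pos_INR n). replace (INR 2) with 2 by (simpl; ring).
    replace (wallis n * (2 * INR n + 2) / (2 * INR n + 1) *
      ((2 * INR n + 1 + 1) * ((2 * INR n + 1) * INR (fact (2 * n)))))
      with ((2 * INR n + 2) ^ 2 * (wallis n * INR (fact (2 * n)))) by (field; lra).
    rewrite IHn. change (4 ^ S n) with (4 * 4 ^ n). ring.
Qed.

Lemma wallis_int_even_odd n :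
  wallis_int (2 * n) * wallis n = PI / 2 /\ wallis_int (2 * n + 1) * (2 * INR n + 1) = wallis n.
Proof.
  induction n as [|n [I1 I2]].
  - simpl. rewrite wallis_int_0, wallis_int_1. lra.
  - assert (H := pos_INR n).
    assert (E1 := wallis_int_SS (2 * n)). assert (E2 := wallis_int_SS (2 * n + 1)).
    replace (S (S (2 * n))) with (2 * S n)%nat in E1 by lia.
    replace (S (S (2 * n + 1))) with (2 * S n + 1)%nat in E2 by lia.
    assert (N2 : INR 2 = 2) by (simpl; ring). assert (N1 : INR 1 = 1) by reflexivity.
    rewrite !plus_INR, mult_INR, N2, N1 in E1. rewrite !plus_INR, mult_INR, N2, N1 in E2.
    simpl wallis. rewrite S_INR. split.
    + rewrite <- I1. replace (wallis_int (2 * S n)) with ((2 * INR n + 1) * wallis_int (2 * n) / (2 * INR n + 2))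
        by (rewrite <- E1; field; lra). field. lra.
    + rewrite <- I2. replace (wallis_int (2 * S n + 1))
        with ((2 * INR n + 1 + 1) * wallis_int (2 * n + 1) / (2 * INR n + 1 + 2))
        by (rewrite <- E2; field; lra). field. lra.
Qed.

(** The integrals at 2n - 1, 2n and 2n + 1 decrease and equal w / (2n), pi / (2w) and w / (2n + 1)
    with w = [wallis n]; the two inequalities between neighbours are the two bounds. *)
Lemma wallis_bounds n : (1 <= n)%nat ->
  PI * INR n <= wallis n ^ 2 <= PI * INR n + PI / 2.
Proof.
  intros Hn. assert (W := wallis_pos n).
  destruct (wallis_int_even_odd n) as [A B].
  assert (N : 1 <= INR n) by (change 1 with (INR 1); apply le_INR; lia).
  split.
  - destruct n as [|m]; [lia|]. destruct (wallis_int_even_odd m) as [_ B'].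
    assert (M := pos_INR m).
    assert (D := wallis_int_decr (2 * m + 1)). replace (S (2 * m + 1)) with (2 * S m)%nat in D by lia.
    assert (E : wallis_int (2 * m + 1) = wallis (S m) / (2 * INR (S m))).
    { simpl wallis. rewrite S_INR, <- B'. field. lra. }
    rewrite E in D. apply (Rmult_le_compat_r (wallis (S m))) in D; [|lra]. rewrite A in D.
    replace (wallis (S m) / (2 * INR (S m)) * wallis (S m)) with (wallis (S m) ^ 2 / (2 * INR (S m))) in D
      by (field; lra).
    apply (proj2 (Rle_div_r _ _ (2 * INR (S m)) ltac:(lra))) in D. lra.
  - assert (D := wallis_int_decr (2 * n)). replace (S (2 * n)) with (2 * n + 1)%nat in D by lia.
    apply (Rmult_le_compat_r (wallis n)) in D; [|lra]. rewrite A in D.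
    replace (wallis_int (2 * n + 1)) with (wallis n / (2 * INR n + 1)) in D
      by (rewrite <- B; field; lra).
    replace (wallis n / (2 * INR n + 1) * wallis n) with (wallis n ^ 2 / (2 * INR n + 1)) in D
      by (field; lra).
    apply (proj1 (Rle_div_l _ _ (2 * INR n + 1) ltac:(lra))) in D. lra.
Qed.

(** The logarithm of n! e^n / (n^n sqrt n). *)
Definition stirling (n : nat) : R := ln (INR (fact n)) - (INR n + 1 / 2) * ln (INR n) + INR n.

(** In 2 sigma(n) - sigma(2n) the factorials combine to n!^2 / (2n)!, which is Wallis's product. If
    sigma has a limit, this combination has the same one. *)
Lemma stirling_duplication n : (1 <= n)%nat ->
  Rabs (2 * stirling n - stirling (2 * n) - 1 / 2 * ln (2 * PI)) <= / INR n.
Proof.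
  intros Hn. assert (W := wallis_pos n). assert (B := wallis_bounds n Hn).
  assert (N : 1 <= INR n) by (change 1 with (INR 1); apply le_INR; lia).
  assert (P := PI_RGT_0).
  assert (F := wallis_factorial n).
  apply (f_equal ln) in F.
  rewrite !ln_mult, !ln_pow in F; try apply INR_fact_lt_0; try lra;
    try (apply pow_lt; try apply INR_fact_lt_0; lra).
  replace (INR 2) with 2 in F by (simpl; ring).
  replace 4 with (2 * 2) in F by ring. rewrite (ln_mult 2 2) in F by lra.
  assert (E : 2 * stirling n - stirling (2 * n) = ln (wallis n) - 1 / 2 * ln (INR n) + 1 / 2 * ln 2).
  { unfold stirling. rewrite mult_INR. replace (INR 2) with 2 by (simpl; ring).
    rewrite (ln_mult 2 (INR n)) by lra. lra. }
  rewrite E, ln_mult by lra.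
  assert (L : ln (wallis n ^ 2) = 2 * ln (wallis n)).
  { rewrite ln_pow by lra. simpl. ring. }
  assert (L1 : ln PI + ln (INR n) <= 2 * ln (wallis n)).
  { rewrite <- L, <- ln_mult by lra. apply ln_le; [nra|lra]. }
  assert (L2 : 2 * ln (wallis n) <= ln PI + ln (INR n) + / INR n).
  { assert (IP : 0 < / INR n) by (apply Rinv_0_lt_compat; lra).
    rewrite <- L. apply Rle_trans with (ln (PI * INR n * (1 + / INR n))).
    - apply ln_le; [apply pow_lt; lra|].
      replace (PI * INR n * (1 + / INR n)) with (PI * INR n + PI) by (field; lra). lra.
    - rewrite !ln_mult by nra. apply Rplus_le_compat_l.
      rewrite <- (ln_exp (/ INR n)) at 2. apply ln_le; [lra|].
      left. apply exp_ineq1. lra. }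
  assert (0 < / INR n) by (apply Rinv_0_lt_compat; lra).
  apply Rabs_le. lra.
Qed.

(** Bounds the derivative of a remainder from its size alone; the Euler-Maclaurin tail is never
    differentiated termwise. *)
Lemma cderiv_lipschitz f z l c r : 0 < r -> 0 <= c -> cderiv f z l ->
  (forall w, Cmod (w - z) < r -> Cmod (f w - f z) <= c * Cmod (w - z)) -> Cmod l <= c.
Proof.
  intros Hr Hc Hd HL. apply Rnot_lt_le. intros N.
  destruct (Hd ((Cmod l - c) / 2) ltac:(lra)) as [d [Hd' K]].
  set (t := Rmin d r / 2).
  assert (0 < Rmin d r) by (apply Rmin_pos; auto).
  assert (Rmin d r <= d) by apply Rmin_l. assert (Rmin d r <= r) by apply Rmin_r.
  assert (Ht : 0 < t) by (unfold t; lra).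
  assert (E : Cmod ((z + RtoC t) - z) = t).
  { replace (z + RtoC t - z)%C with (RtoC t) by ring. rewrite Cmod_R, Rabs_pos_eq; lra. }
  specialize (K (z + RtoC t)%C ltac:(rewrite E; unfold t in *; lra)).
  specialize (HL (z + RtoC t)%C ltac:(rewrite E; unfold t in *; lra)).
  assert (T : Cmod (l * (z + RtoC t - z)) <= Cmod (f (z + RtoC t)%C - f z) +
     Cmod (f (z + RtoC t)%C - f z - l * (z + RtoC t - z))).
  { replace (l * (z + RtoC t - z))%C with ((f (z + RtoC t) - f z)
      - (f (z + RtoC t) - f z - l * (z + RtoC t - z)))%C at 1 by ring.
    apply Cmod_triangle_minus. }
  rewrite Cmod_mult in T. rewrite E in *. nra.
Qed.

Lemma rsum_ln_factorial N : rsum (fun n => 1 + ln (INR n + 1)) N = INR N + ln (INR (fact N)).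
Proof.
  induction N.
  - simpl. rewrite ln_1. ring.
  - change (rsum (fun n => 1 + ln (INR n + 1)) (S N))
      with (rsum (fun n => 1 + ln (INR n + 1)) N + (1 + ln (INR N + 1))).
    rewrite IHN, fact_simpl, mult_INR, S_INR, ln_mult.
    + ring.
    + generalize (pos_INR N); lra.
    + apply INR_fact_lt_0.
Qed.

(** After N terms are split off, the explicit part [E] at a = N + 1 has a derivative at -1 that is
    Stirling's quantity up to explicit terms. The rest is a tail of size at most a constant times |u
    + 1| / (N + 1) near -1, so its derivative there is of order 1 / (N + 1). *)
Lemma hurwitz1_deriv_m1_approx D N : cderiv (hurwitz1 1) (RtoC (-1)) D ->
  Cmod (D - RtoC (stirling (S N) - 1 / 2 - / (12 * INR (S N)))) <= 12 * em_const 2 / INR (S N).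
Proof.
  intros HD. set (M := INR (S N)).
  assert (HM : 1 <= M) by (unfold M; rewrite S_INR; generalize (pos_INR N); lra).
  assert (EM : INR N + 1 = M) by (unfold M; rewrite S_INR; ring).
  set (E := fun u => (u * csum (fun n => Rpow_C (INR n + 1) (- (u + 1))) N +
     (Rpow_C M (- u) + u / 2 * Rpow_C M (- (u + 1))
      + RtoC (1 / 12) * (u * (u + 1)) * Rpow_C M (- (u + 2))))%C).
  assert (X : forall u, - 2 < Re u -> hurwitz1 1 u = (E u - em_tail (fun _ => 1) M 2 u)%C).
  { intros u Hu. rewrite (hurwitz1_shift 1 N u) by lra. rewrite EM.
    rewrite (hurwitz1_m1_expansion M u HM Hu). unfold E. ring. }
  set (m := RtoC (-1)) in *.
  assert (P1 : forall x c, 0 < x -> cderiv (fun u => Rpow_C x (- (u + c))%C) m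
     (Rpow_C x (- (m + c)) * (RtoC (ln x) * - (1 + 0)))%C).
  { intros x c Hx. apply (cderiv_Rpow_C x (fun u => - (u + c))%C).
    apply cderiv_opp, cderiv_plus; [apply cderiv_id|apply cderiv_const]. }
  assert (P2 : forall n, cderiv (fun u => csum (fun n => Rpow_C (INR n + 1) (- (u + 1))) n) m
     (RtoC (- rsum (fun n => ln (INR n + 1)) n))).
  { induction n.
    - simpl. rewrite Ropp_0. apply cderiv_const.
    - simpl csum. simpl rsum. rewrite Ropp_plus_distr, RtoC_plus. apply cderiv_plus; [exact IHn|].
      eapply cderiv_eq; [|apply P1; generalize (pos_INR n); lra].
      replace (- (m + 1))%C with (RtoC 0) by (unfold m; ring). rewrite Rpow_C_0, RtoC_opp. ring. }
  assert (V : forall n, csum (fun n => Rpow_C (INR n + 1) (- (m + 1))) n = RtoC (INR n)).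
  { induction n; [reflexivity|]. rewrite csum_S, IHn, S_INR, RtoC_plus.
    replace (- (m + 1))%C with (RtoC 0) by (unfold m; ring). rewrite Rpow_C_0. reflexivity. }
  assert (DE : cderiv E m (RtoC (stirling (S N) - 1 / 2 - / (12 * M)))).
  { assert (Z1 : (- (m + 0))%C = RtoC 1) by (unfold m; ring).
    assert (Z2 : (- (m + 1))%C = RtoC 0) by (unfold m; ring).
    assert (Z3 : (- (m + 2))%C = (- RtoC 1)%C) by (unfold m; ring).
    eapply cderiv_eq.
    2:{ unfold E. apply cderiv_plus.
      - apply (cderiv_mult (fun u => u)); [apply cderiv_id|apply P2].
      - apply cderiv_plus; [apply cderiv_plus|].
        + apply (cderiv_ext (fun u => Rpow_C M (- (u + 0)))).
          * intros u. f_equal. ring.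
          * apply P1. lra.
        + apply (cderiv_mult (fun u => u / 2)%C); [|apply P1; lra].
          apply (cderiv_mult (fun u => u) (fun _ => / 2)%C); [apply cderiv_id|apply cderiv_const].
        + apply (cderiv_mult (fun u => RtoC (1 / 12) * (u * (u + 1)))%C); [|apply P1; lra].
          apply cderiv_scal. apply (cderiv_mult (fun u => u) (fun u => u + 1)%C).
          * apply cderiv_id.
          * apply cderiv_plus; [apply cderiv_id|apply cderiv_const]. }
    cbv beta. rewrite V, Z1, Z2, Z3, Rpow_C_0, Rpow_C_opp, !Rpow_C_1 by lra.
    unfold stirling. fold M.
    assert (R := rsum_ln_factorial N).
    assert (R' : rsum (fun n => 1 + ln (INR n + 1)) N = INR N + rsum (fun n => ln (INR n + 1)) N).
    { clear. induction N; [simpl; ring|].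
      change (rsum (fun n => 1 + ln (INR n + 1)) (S N))
        with (rsum (fun n => 1 + ln (INR n + 1)) N + (1 + ln (INR N + 1))).
      change (rsum (fun n => ln (INR n + 1)) (S N))
        with (rsum (fun n => ln (INR n + 1)) N + ln (INR N + 1)).
      rewrite IHN, S_INR. ring. }
    assert (R2 : rsum (fun n => ln (INR n + 1)) N = ln (INR (fact N))) by lra.
    rewrite R2.
    assert (F : ln (INR (fact (S N))) = ln M + ln (INR (fact N))).
    { rewrite fact_simpl, mult_INR, ln_mult; [reflexivity|fold M; lra|apply INR_fact_lt_0]. }
    rewrite F. replace (INR N) with (M - 1) by lra. unfold m.
    apply C_ext; simpl; field; lra. }
  assert (DR : cderiv (fun u => hurwitz1 1 u - E u)%C m
      (D - RtoC (stirling (S N) - 1 / 2 - / (12 * M)))%C)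
    by (apply cderiv_minus; auto).
  assert (EC : 0 <= em_const 2) by apply em_const_pos.
  apply (cderiv_lipschitz _ m _ (12 * em_const 2 / M) (1 / 2) ltac:(lra)
    ltac:(apply Rmult_le_pos; [lra|left; apply Rinv_0_lt_compat; lra]) DR).
  intros w Hw. assert (Rw := Re_near _ _ _ Hw). simpl in Rw.
  assert (Xm : hurwitz1 1 m = E m).
  { rewrite X by (simpl; lra). rewrite (em_tail_m1 M HM : em_tail (fun _ => 1) M 2 m = _). ring. }
  rewrite Xm, X by lra.
  replace (E w - em_tail (fun _ => 1) M 2 w - E w - (E m - E m))%C
    with (- em_tail (fun _ => 1) M 2 w)%C by ring.
  rewrite Cmod_opp. eapply Rle_trans; [apply em_tail_small; [auto|simpl; lra]|].
  set (q := Cmod (w - m)) in *.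
  assert (H0 : Cmod (w + RtoC 0) <= 3 / 2).
  { replace (w + RtoC 0)%C with ((w - m) + m)%C by ring. eapply Rle_trans; [apply Cmod_triangle|].
    fold q. unfold m. rewrite Cmod_R, Rabs_left; lra. }
  assert (H1 : Cmod (w + RtoC 1) = q) by (unfold q, m; f_equal; ring).
  assert (H2 : Cmod (w + RtoC (1 + 1)) <= 3 / 2).
  { replace (w + RtoC (1 + 1))%C with ((w - m) + RtoC 1)%C by (unfold m; apply C_ext; simpl; ring).
    eapply Rle_trans; [apply Cmod_triangle|].
    fold q. rewrite Cmod_R, Rabs_pos_eq; lra. }
  assert (H3 : Cmod (w + RtoC (1 + 1 + 1)) <= 5 / 2).
  { replace (w + RtoC (1 + 1 + 1))%C with ((w - m) + RtoC 2)%C by (unfold m; apply C_ext; simpl; ring).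
    eapply Rle_trans; [apply Cmod_triangle|].
    fold q. rewrite Cmod_R, Rabs_pos_eq; lra. }
  (* Within 1/2 of -1 the factors u, u + 2, u + 3 are at most 3/2, 3/2, 5/2, whose product is below
     6. The 6 and the 2 / M of [em_tail_small] make the 12 of the statement. *)
  assert (HR : Cmod (rising w 4) <= 6 * q).
  { simpl rising. rewrite !Cmod_mult, Cmod_1. simpl INR. rewrite H1.
    generalize (Cmod_ge_0 (w + RtoC 0)) (Cmod_ge_0 (w + RtoC (1 + 1)))
      (Cmod_ge_0 (w + RtoC (1 + 1 + 1))). intros G0 G2 G3.
    assert (Gq : 0 <= q) by apply Cmod_ge_0.
    set (A0 := Cmod (w + RtoC 0)) in *. set (A2 := Cmod (w + RtoC (1 + 1))) in *.
    set (A3 := Cmod (w + RtoC (1 + 1 + 1))) in *.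
    assert (A0 * A2 <= 3 / 2 * (3 / 2)) by (apply Rmult_le_compat; lra).
    assert (A0 * A2 * A3 <= 3 / 2 * (3 / 2) * (5 / 2))
      by (apply Rmult_le_compat; try lra; apply Rmult_le_pos; auto).
    replace (1 * A0 * q * A2 * A3) with (A0 * A2 * A3 * q) by ring. nra. }
  apply Rle_trans with (em_const 2 * (6 * q) * (2 / M)).
  - apply Rmult_le_compat_r; [apply Rmult_le_pos; [lra|left; apply Rinv_0_lt_compat; lra]|].
    apply Rmult_le_compat_l; auto.
  - right. field. lra.
Qed.

(** The derivative D is within c / n of sigma(n) - 1/2 for every n >= 1. Taking twice this at n
    minus the same at 2n leaves D against the explicit combination of [stirling_duplication]. *)
Lemma hurwitz1_deriv_m1 : cderiv (hurwitz1 1) (RtoC (-1)) (RtoC (1 / 2 * ln (2 * PI) - 1 / 2)).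
Proof.
  destruct (hol_cdiff _ _ (hurwitz1_hol 1 (RtoC (-1)) ltac:(lra))) as [D HD].
  eapply cderiv_eq; [|exact HD]. apply Ceq_minus, Cmod_0_eq. intros eps He.
  set (c := 12 * em_const 2 + 1).
  assert (Hc : 1 <= c) by (unfold c; generalize (em_const_pos 2); lra).
  assert (A : forall n, (1 <= n)%nat -> Cmod (D - RtoC (stirling n - 1 / 2)) <= c / INR n).
  { intros [|N] Hn; [lia|].
    assert (H := hurwitz1_deriv_m1_approx D N HD).
    set (M := INR (S N)) in *.
    assert (HM : 1 <= M) by (unfold M; rewrite S_INR; generalize (pos_INR N); lra).
    assert (0 < / M) by (apply Rinv_0_lt_compat; lra).
    eapply Rle_trans; [apply (Cmod_le_minus _ (D - RtoC (stirling (S N) - 1 / 2 - / (12 * M))))|].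
    replace (D - RtoC (stirling (S N) - 1 / 2) - (D - RtoC (stirling (S N) - 1 / 2 - / (12 * M))))%C
      with (RtoC (- / (12 * M))) by (apply C_ext; simpl; ring).
    rewrite Cmod_R, Rabs_Ropp, Rabs_pos_eq by (left; apply Rinv_0_lt_compat; lra).
    assert (/ (12 * M) = / M / 12) by (field; lra).
    replace (c / M) with (12 * em_const 2 / M + / M) by (unfold c; field; lra). lra. }
  destruct (nat_above (4 * c / eps)) as [n Hn].
  assert (Hn0 : 0 < INR n).
  { apply Rle_lt_trans with (2 := Hn). apply Rmult_le_pos; [lra|left; apply Rinv_0_lt_compat; auto]. }
  assert (Hn1 : (1 <= n)%nat) by (destruct n; [simpl in Hn0; lra|lia]).
  assert (A1 := A n Hn1). assert (A2 := A (2 * n)%nat ltac:(lia)).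
  assert (W := stirling_duplication n Hn1).
  rewrite mult_INR in A2. replace (INR 2) with 2 in A2 by (simpl; ring).
  replace (D - RtoC (1 / 2 * ln (2 * PI) - 1 / 2))%C with
    (2 * (D - RtoC (stirling n - 1 / 2)) - (D - RtoC (stirling (2 * n) - 1 / 2))
     + RtoC (2 * stirling n - stirling (2 * n) - 1 / 2 * ln (2 * PI)))%C
    by (apply C_ext; simpl; ring).
  eapply Rle_trans; [apply Cmod_triangle|].
  eapply Rle_trans; [apply Rplus_le_compat_r, Cmod_triangle_minus|].
  rewrite Cmod_mult, !Cmod_R, (Rabs_pos_eq 2) by lra.
  assert (IN : 0 < / INR n) by (apply Rinv_0_lt_compat; auto).
  replace (c / (2 * INR n)) with (c * / INR n / 2) in A2 by (field; lra).
  unfold Rdiv at 1 in A1.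
  apply Rlt_div_l in Hn; [|auto].
  apply (Rmult_lt_compat_r (/ INR n)) in Hn; [|auto].
  replace (INR n * eps * / INR n) with eps in Hn by (field; lra). nra.
Qed.

Lemma cderiv_zeta_0 : cderiv zeta (RtoC 0) (RtoC (- (1 / 2) * ln (2 * PI))).
Proof.
  assert (H : cderiv (fun s => hurwitz1 1 (s - 1) * / (s - 1))%C (RtoC 0)
    (RtoC (1 / 2 * ln (2 * PI) - 1 / 2) * (1 - 0) * / (RtoC 0 - 1)
     + hurwitz1 1 (RtoC 0 - 1) * (- (1 - 0) / ((RtoC 0 - 1) * (RtoC 0 - 1))))%C).
  { assert (E : (RtoC 0 - 1)%C = RtoC (-1)) by ring.
    assert (S : cderiv (fun s => s - 1)%C (RtoC 0) (1 - 0)%C)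
      by (apply cderiv_minus; [apply cderiv_id|apply cderiv_const]).
    apply (cderiv_mult (fun s => hurwitz1 1 (s - 1)) (fun s => / (s - 1))%C).
    - apply (cderiv_comp (fun s => s - 1)%C (hurwitz1 1) (RtoC 0)); auto. rewrite E.
      apply hurwitz1_deriv_m1.
    - apply (cderiv_inv (fun s => s - 1)%C (RtoC 0)); auto. rewrite E.
      intros H. apply (f_equal Re) in H. simpl in H. lra. }
  apply (cderiv_ext_loc _ zeta _ _ 1 Rlt_0_1) in H.
  - eapply cderiv_eq; [|exact H].
    replace (RtoC 0 - 1)%C with (RtoC (-1)) by ring. rewrite hurwitz1_m1.
    apply C_ext; simpl; field.
  - intros w Hw. apply Re_near in Hw. simpl in Hw. rewrite zeta_hurwitz by lra. reflexivity.
Qed.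

(** * Non-vanishing of zeta on the line of real part 1 *)

(** Index n stands for the integer n + 1, so the multiples of q sit at the indices q (m + 1) - 1,
    and n / q of them occur among the first n terms. *)
Lemma csum_multiples q (a b : nat -> C) : (1 <= q)%nat ->
  (forall m, b (q * S m - 1)%nat = a m) -> (forall n, ~ Nat.divide q (S n) -> b n = RtoC 0) ->
  forall n, csum b n = csum a (n / q).
Proof.
  intros Hq Ha Hb. induction n.
  - rewrite Nat.Div0.div_0_l. reflexivity.
  - rewrite csum_S, IHn.
    assert (D := Nat.div_mod_eq n q). assert (M := Nat.mod_upper_bound n q ltac:(lia)).
    destruct (Nat.eq_dec (n mod q) (q - 1)) as [E|E].
    + assert (E1 : (S n = q * S (n / q))%nat) by nia.
      replace (S n / q)%nat with (S (n / q))
        by (apply (Nat.div_unique (S n) q (S (n / q)) 0); lia).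
      rewrite csum_S, <- Ha. f_equal. f_equal. lia.
    + replace (S n / q)%nat with (n / q)%nat
        by (apply (Nat.div_unique (S n) q (n / q) (S (n mod q))); lia).
      rewrite Hb; [ring|]. intros [m Hm].
      assert (m = S (n / q) \/ (m <= n / q)%nat \/ (S (S (n / q)) <= m)%nat) as [->|[H|H]] by lia; nia.
Qed.

Lemma csums_multiples q (a b : nat -> C) l : (1 <= q)%nat ->
  (forall m, b (q * S m - 1)%nat = a m) -> (forall n, ~ Nat.divide q (S n) -> b n = RtoC 0) ->
  csums a l -> csums b l.
Proof.
  intros Hq Ha Hb H eps He. destruct (H eps He) as [N K]. exists (N * q)%nat. intros n Hn.
  rewrite (csum_multiples q a b Hq Ha Hb). apply K. apply Nat.div_le_lower_bound; lia.
Qed.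

(** * The sieve and the Euler product *)

Definition sieve (P n : nat) : bool :=
  forallb (fun d => negb (n mod d =? 0)%nat) (seq 2 (P - 1)).

Lemma sieve_spec P n :
  sieve P n = true <-> forall d, (2 <= d <= P)%nat -> ~ Nat.divide d n.
Proof.
  unfold sieve. rewrite forallb_forall. split.
  - intros H d Hd D. specialize (H d ltac:(apply in_seq; lia)).
    apply (Nat.Lcm0.mod_divide n d) in D. rewrite D in H. simpl in H. discriminate.
  - intros H d Hd. apply in_seq in Hd. destruct (n mod d =? 0)%nat eqn:E; [|reflexivity].
    apply Nat.eqb_eq in E. apply Nat.Lcm0.mod_divide in E. exfalso. apply (H d); [lia|auto].
Qed.

(** A number d <= P is coprime to q, since a common divisor above 1 would be a divisor of q that the
    sieve excludes. Hence d divides q m only if it divides m. *)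
Lemma sieve_mult P q m : sieve P q = true -> sieve P (q * m) = sieve P m.
Proof.
  intros Hq. apply Bool.eq_iff_eq_true. rewrite !sieve_spec. rewrite sieve_spec in Hq.
  split; intros H d Hd D.
  - apply (H d Hd). apply Nat.divide_mul_r, D.
  - assert (G : Nat.gcd d q = 1%nat).
    { destruct (Nat.eq_dec (Nat.gcd d q) 1) as [|N]; auto. exfalso.
      assert (G1 := Nat.gcd_divide_l d q). assert (G2 := Nat.gcd_divide_r d q).
      assert (G0 : Nat.gcd d q <> 0%nat) by (intros E; apply Nat.gcd_eq_0_l in E; lia).
      apply Nat.divide_pos_le in G1; [|lia].
      apply (Hq (Nat.gcd d q)); [lia|auto]. }
    apply (H d Hd). apply (Nat.gauss d q m); auto.
Qed.

Lemma sieve_S P n : (1 <= P)%nat ->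
  sieve (S P) n = (sieve P n && negb (n mod (S P) =? 0)%nat)%bool.
Proof.
  intros HP. unfold sieve. replace (S P - 1)%nat with (S (P - 1)) by lia.
  rewrite seq_S, forallb_app. cbn [forallb]. replace (2 + (P - 1))%nat with (S P) by lia.
  rewrite Bool.andb_true_r. reflexivity.
Qed.

Definition sieve_term (P : nat) (s : C) (n : nat) : C :=
  if sieve P (S n) then Rpow_C (INR n + 1) (- s) else RtoC 0.

(* One step of the sieve multiplies the series by the Euler factor of [S P]
   when [S P] is prime, and does nothing otherwise. *)
Definition euler_factor (P : nat) (s : C) : C :=
  if sieve P (S P) then (1 - Rpow_C (INR (S P)) (- s))%C else RtoC 1.

Fixpoint euler_product (P : nat) (s : C) : C :=
  match P with
  | O => RtoC 1
  | S P => (euler_product P s * euler_factor (S P) s)%C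
  end.

(** If P + 1 survived, its surviving multiples form the whole sieved series scaled by (P + 1)^(-s),
    and they are subtracted. If not, a smaller divisor of P + 1 has already removed all its
    multiples. *)
Lemma sieve_step P s l : (1 <= P)%nat -> csums (sieve_term P s) l ->
  csums (sieve_term (S P) s) (euler_factor P s * l)%C.
Proof.
  intros HP H. unfold euler_factor. destruct (sieve P (S P)) eqn:E.
  - set (q := S P) in *.
    set (b := fun n => if (S n mod q =? 0)%nat then sieve_term P s n else RtoC 0).
    assert (B : csums b (Rpow_C (INR q) (- s) * l)%C).
    { apply (csums_multiples q (fun m => Rpow_C (INR q) (- s) * sieve_term P s m)%C).
      - unfold q; lia.
      - intros m. unfold b. replace (S (q * S m - 1)) with (q * S m)%nat by (unfold q; lia).
        replace ((q * S m) mod q)%nat with 0%nat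
          by (rewrite Nat.mul_comm, Nat.Div0.mod_mul; reflexivity).
        cbn [Nat.eqb]. unfold sieve_term.
        replace (S (q * S m - 1)) with (q * S m)%nat by (unfold q; lia).
        rewrite (sieve_mult P q (S m) E). destruct (sieve P (S m)); [|ring].
        rewrite <- Rpow_C_mult.
        + f_equal. rewrite minus_INR by (unfold q; lia). rewrite mult_INR, S_INR. simpl INR at 3. ring.
        + apply lt_0_INR. unfold q; lia.
        + generalize (pos_INR m); lra.
      - intros n Hn. unfold b. destruct (S n mod q =? 0)%nat eqn:D; [|reflexivity].
        apply Nat.eqb_eq, Nat.Lcm0.mod_divide in D. contradiction.
      - apply csums_scal; auto. }
    replace ((1 - Rpow_C (INR q) (- s)) * l)%C with (l - Rpow_C (INR q) (- s) * l)%C by ring.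
    eapply csums_ext; [|apply (csums_minus _ _ _ _ H B)]. intros n. cbv beta. unfold b, sieve_term.
    unfold q. rewrite sieve_S by auto.
    destruct (sieve P (S n)); destruct (S n mod S P =? 0)%nat; cbn [andb negb]; ring.
  - rewrite Cmult_1_l. eapply csums_ext; [|exact H]. intros n. unfold sieve_term.
    rewrite sieve_S by auto. destruct (S n mod S P =? 0)%nat eqn:D.
    + simpl negb. rewrite Bool.andb_false_r.
      apply Nat.eqb_eq, Nat.Lcm0.mod_divide in D.
      destruct (sieve P (S n)) eqn:F; [|reflexivity].
      assert (sieve P (S P) = true); [|congruence].
      rewrite sieve_spec in *. intros d Hd X. apply (F d Hd). apply (Nat.divide_trans _ _ _ X D).
    + simpl negb. rewrite Bool.andb_true_r. reflexivity.
Qed.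

(** [euler_factor P] concerns the number P + 1, so [euler_product P] belongs to the sieve up to P +
    1. *)
Lemma sieve_series P s : 1 < Re s ->
  csums (sieve_term (S P) s) (euler_product P s * hurwitz 1 s)%C.
Proof.
  intros Hs. induction P.
  - simpl. rewrite Cmult_1_l. eapply csums_ext; [|apply (hurwitz_correct 1 s ltac:(lra) Hs)].
    intros n. unfold sieve_term, sieve. simpl. reflexivity.
  - simpl euler_product.
    replace (euler_product P s * euler_factor (S P) s * hurwitz 1 s)%C
      with (euler_factor (S P) s * (euler_product P s * hurwitz 1 s))%C by ring.
    apply sieve_step; [lia|auto].
Qed.

Lemma sieve_term_small P s n : (1 <= n <= P)%nat -> sieve_term (S P) s n = RtoC 0.
Proof.
  intros Hn. unfold sieve_term. destruct (sieve (S P) (S n)) eqn:E; [|reflexivity].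
  exfalso. rewrite sieve_spec in E. apply (E (S n)); [lia|]. apply Nat.divide_refl.
Qed.

(** Of the integers up to P + 1 only 1 survives the sieve, so the difference from 1 is bounded by a
    tail of the majorant series. *)
Lemma euler_product_limit s eps : 1 < Re s -> 0 < eps -> exists N, forall P, (N <= P)%nat ->
  Cmod (euler_product P s * hurwitz 1 s - 1) <= eps.
Proof.
  intros Hs He.
  destruct (ex_series_Rpower 1 (Re s) ltac:(lra) Hs) as [X _].
  set (M := fun n => Rpower (INR n + 1) (- Re s)) in *.
  destruct (is_series_tail M X eps He) as [N K]. exists N. intros P HP.
  assert (HB : forall n, Cmod (sieve_term (S P) s n) <= M n).
  { intros n. unfold sieve_term, M. destruct (sieve (S P) (S n)).
    - rewrite Cmod_Rpow_C. apply Rle_refl.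
    - rewrite Cmod_0. left; apply Rpower_pos. }
  rewrite <- (Cser_eq _ _ M HB X (sieve_series P s Hs)).
  assert (C1 : csum (sieve_term (S P) s) (S P) = RtoC 1).
  { assert (G : forall n, (n <= P)%nat -> csum (sieve_term (S P) s) (S n) = RtoC 1).
    { induction n; intros Hn.
      - simpl csum. unfold sieve_term. replace (sieve (S P) 1) with true.
        + simpl. rewrite Rplus_0_l, Rpow_C_1_l. ring.
        + symmetry. apply sieve_spec. intros d Hd D. apply Nat.divide_1_r in D. lia.
      - rewrite csum_S, IHn, sieve_term_small by lia. ring. }
    apply G. lia. }
  rewrite <- C1, Cmod_minus_sym. eapply Rle_trans; [apply (Cser_tail _ M); auto|].
  specialize (K (S P) ltac:(lia)). apply Rabs_lt_between in K. lra.
Qed.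

(* [3 + 4 cos t + cos 2t >= 0] in integrated form: the logarithmic derivative in
   [r] of the product is a polynomial whose Bernstein coefficients in [r] are
   nonnegative for [-1 <= c <= 1]. *)
Lemma three_four_one_real r c : 0 <= r < 1 -> -1 <= c <= 1 ->
  (1 - r) ^ 6 * (1 - 2 * r * c + r ^ 2) ^ 4 * (1 - 2 * r * (2 * c ^ 2 - 1) + r ^ 2) <= 1.
Proof.
  intros Hr Hc.
  set (U := fun r => 1 - 2 * r * c + r ^ 2). set (V := fun r => 1 - 2 * r * (2 * c ^ 2 - 1) + r ^ 2).
  assert (HU : forall t, 0 <= t < 1 -> 0 < U t).
  { intros t Ht. unfold U. assert (0 < (1 - t) ^ 2) by (apply pow2_gt_0; lra). nra. }
  assert (HV : forall t, 0 <= t < 1 -> 0 < V t).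
  { intros t Ht. unfold V. assert (0 < (1 - t) ^ 2) by (apply pow2_gt_0; lra).
    assert (2 * c ^ 2 - 1 <= 1) by nra. nra. }
  set (phi := fun r => 6 * ln (1 - r) + 4 * ln (U r) + ln (V r)).
  set (dphi := fun r => - 6 / (1 - r) + 4 * (2 * r - 2 * c) / U r + (2 * r - 2 * (2 * c ^ 2 - 1)) / V r).
  assert (D : forall t, 0 <= t < 1 -> is_derive phi t (dphi t)).
  { intros t Ht. assert (A := HU t Ht). assert (B := HV t Ht). unfold phi, dphi, U, V in *.
    auto_derive.
    - repeat split; lra.
    - field. repeat split; lra. }
  assert (N : forall t, 0 <= t < 1 -> dphi t <= 0).
  { intros t Ht. assert (A := HU t Ht). assert (B := HV t Ht).
    set (k := 1 + c). assert (Hk : 0 <= k <= 2) by (unfold k; lra).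
    assert (E : dphi t = - (4 * k ^ 2 * (1 - t) ^ 4 + 4 * ((2 - k) * (10 * k ^ 2 - 7 * k + 2)) * (t * (1 - t) ^ 3)
      + 8 * ((2 - k) * (4 * k ^ 2 - k + 2)) * (t ^ 2 * (1 - t) ^ 2)
      + 56 * (k * (2 - k) ^ 2) * (t ^ 3 * (1 - t)) + 48 * (k * (2 - k) ^ 2) * t ^ 4) / ((1 - t) * U t * V t)).
    { unfold dphi, k, U, V in *. field. repeat split; lra. }
    rewrite E. rewrite Rdiv_opp_l. apply Ropp_le_cancel. rewrite Ropp_0, Ropp_involutive.
    apply Rmult_le_pos.
    - assert (0 <= 1 - t) by lra. assert (0 <= 2 - k) by lra.
      (* Both quadratic factors have negative discriminant; the squares are the completed ones. *)
      assert (0 <= 10 * k ^ 2 - 7 * k + 2)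
        by (clear; generalize (pow2_ge_0 (k - 7 / 20)); clearbody k; lra).
      assert (0 <= 4 * k ^ 2 - k + 2)
        by (clear; generalize (pow2_ge_0 (k - 1 / 8)); clearbody k; lra).
      destruct Hk, Ht.
      repeat apply Rplus_le_le_0_compat; repeat apply Rmult_le_pos; try apply pow_le; auto; lra.
    - left. apply Rinv_0_lt_compat. repeat apply Rmult_lt_0_compat; lra. }
  assert (L : phi r <= 0).
  { assert (P0 : phi 0 = 0).
    { unfold phi, U, V. replace (1 - 0) with 1 by ring.
      replace (1 - 2 * 0 * c + 0 ^ 2) with 1 by ring.
      replace (1 - 2 * 0 * (2 * c ^ 2 - 1) + 0 ^ 2) with 1 by ring. rewrite ln_1. ring. }
    rewrite <- P0. destruct (MVT_gen phi 0 r dphi) as [x [Hx E]].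
    - intros x Hx. rewrite Rmin_left, Rmax_right in Hx by lra. apply D. lra.
    - intros x Hx. rewrite Rmin_left, Rmax_right in Hx by lra.
      apply continuity_pt_filterlim, (ex_derive_continuous phi). eexists; apply D; lra.
    - rewrite Rmin_left, Rmax_right in Hx by lra. assert (dphi x <= 0) by (apply N; lra). nra. }
  assert (A := HU r Hr). assert (B := HV r Hr).
  change ((1 - r) ^ 6 * U r ^ 4 * V r <= 1).
  assert (P6 : 0 < (1 - r) ^ 6) by (apply pow_lt; lra).
  assert (P4 : 0 < U r ^ 4) by (apply pow_lt; lra).
  rewrite <- (exp_ln ((1 - r) ^ 6 * U r ^ 4 * V r))
    by (apply Rmult_lt_0_compat; [apply Rmult_lt_0_compat|]; auto).
  apply Rle_trans with (exp 0); [apply exp_le_compat|rewrite exp_0; lra].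
  rewrite (ln_mult ((1 - r) ^ 6 * U r ^ 4)), (ln_mult ((1 - r) ^ 6)), !ln_pow;
    [|lra|lra|auto|auto|apply Rmult_lt_0_compat; auto|auto].
  replace (INR 6) with 6 by (simpl; ring). replace (INR 4) with 4 by (simpl; ring). exact L.
Qed.

(** Squaring turns the moduli into polynomials in r and c = Re z, with Re (z^2) = 2 c^2 - 1 on the
    unit circle; this doubles the exponent 3 to 6. *)
Lemma three_four_one r z : 0 <= r < 1 -> Cmod z = 1 ->
  Cmod (1 - RtoC r) ^ 3 * Cmod (1 - RtoC r * z) ^ 4 * Cmod (1 - RtoC r * (z * z)) <= 1.
Proof.
  intros Hr Hz. assert (Z2 := Cmod2_alt z). rewrite Hz in Z2.
  assert (H := three_four_one_real r (Re z) Hr).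
  assert (Hc : -1 <= Re z <= 1).
  { assert (K := re_le_Cmod z). rewrite Hz in K. apply Rabs_le_between in K. lra. }
  specialize (H Hc).
  apply Rsqr_incr_0_var; [|lra]. rewrite Rsqr_1. apply Rle_trans with (2 := H). right.
  unfold Rsqr.
  transitivity ((Cmod (1 - RtoC r) ^ 2) ^ 3 * (Cmod (1 - RtoC r * z) ^ 2) ^ 4
    * Cmod (1 - RtoC r * (z * z)) ^ 2); [ring|].
  rewrite !Cmod2_alt.
  replace (Re (1 - RtoC r) ^ 2 + Im (1 - RtoC r) ^ 2) with ((1 - r) ^ 2) by (simpl; ring).
  replace (Re (1 - RtoC r * z) ^ 2 + Im (1 - RtoC r * z) ^ 2)
    with (1 - 2 * r * Re z + r ^ 2 * (Re z ^ 2 + Im z ^ 2)) by (destruct z; simpl; ring).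
  replace (Re (1 - RtoC r * (z * z)) ^ 2 + Im (1 - RtoC r * (z * z)) ^ 2)
    with (1 - 2 * r * (2 * Re z ^ 2 - (Re z ^ 2 + Im z ^ 2)) + r ^ 2 * (Re z ^ 2 + Im z ^ 2) ^ 2)
    by (destruct z; simpl; ring).
  rewrite <- Z2. ring.
Qed.

Lemma euler_factor_bound P x t : 1 < x ->
  Cmod (euler_factor (S P) (RtoC x)) ^ 3 * Cmod (euler_factor (S P) (x, t)) ^ 4
    * Cmod (euler_factor (S P) (x, 2 * t)) <= 1.
Proof.
  intros Hx. unfold euler_factor. destruct (sieve (S P) (S (S P))).
  - set (q := INR (S (S P))).
    assert (Hq : 2 <= q) by (unfold q; rewrite !S_INR; generalize (pos_INR P); lra).
    set (r := Rpower q (- x)). set (z := Rpow_C q (0, - t)).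
    assert (E1 : Rpow_C q (- RtoC x) = RtoC r)
      by (rewrite <- RtoC_opp; apply Rpow_C_RtoC).
    assert (E2 : Rpow_C q (- ((x, t) : C)) = (RtoC r * z)%C).
    { unfold z. rewrite <- E1, <- Rpow_C_plus. f_equal. apply C_ext; simpl; ring. }
    assert (E3 : Rpow_C q (- ((x, 2 * t) : C)) = (RtoC r * (z * z))%C).
    { unfold z. rewrite <- E1, <- !Rpow_C_plus. f_equal. apply C_ext; simpl; ring. }
    rewrite E1, E2, E3. apply three_four_one.
    + split; [left; apply Rpower_pos|]. unfold r, Rpower. rewrite <- exp_0.
      apply exp_increasing. assert (0 < ln q) by (rewrite <- ln_1; apply ln_increasing; lra). nra.
    + unfold z. rewrite Cmod_Rpow_C. simpl. apply Rpower_O. lra.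
  - rewrite Cmod_1. right. ring.
Qed.

(** Each Euler factor contributes at most 1 to the product with exponents 3, 4, 1, while Euler
    product times zeta tends to 1 at all three points. Working with finite products avoids
    logarithms of zeta. *)
Lemma zeta_product_ge_1 x t : 1 < x ->
  1 <= Cmod (hurwitz 1 (RtoC x)) ^ 3 * Cmod (hurwitz 1 (x, t)) ^ 4 * Cmod (hurwitz 1 (x, 2 * t)).
Proof.
  intros Hx.
  set (W := Cmod (hurwitz 1 (RtoC x)) ^ 3 * Cmod (hurwitz 1 (x, t)) ^ 4 * Cmod (hurwitz 1 (x, 2 * t))).
  assert (TP : forall a b c, 0 <= a -> 0 <= b -> 0 <= c -> 0 <= a ^ 3 * b ^ 4 * c).
  { intros. apply Rmult_le_pos; [apply Rmult_le_pos; apply pow_le; auto|auto]. }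
  assert (HW : 0 <= W).
  { apply TP; apply Cmod_ge_0. }
  assert (EP : forall P, Cmod (euler_product P (RtoC x)) ^ 3 * Cmod (euler_product P (x, t)) ^ 4
    * Cmod (euler_product P (x, 2 * t)) <= 1).
  { induction P.
    - simpl. rewrite Cmod_1. lra.
    - simpl euler_product. rewrite !Cmod_mult.
      match goal with |- ?L <= 1 => replace L with
        ((Cmod (euler_product P (RtoC x)) ^ 3 * Cmod (euler_product P (x, t)) ^ 4
          * Cmod (euler_product P (x, 2 * t))) *
         (Cmod (euler_factor (S P) (RtoC x)) ^ 3 * Cmod (euler_factor (S P) (x, t)) ^ 4
          * Cmod (euler_factor (S P) (x, 2 * t)))) by ring end.
      rewrite <- (Rmult_1_l 1). apply Rmult_le_compat; auto.
      + apply TP; apply Cmod_ge_0.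
      + apply TP; apply Cmod_ge_0.
      + apply euler_factor_bound; auto. }
  apply Rnot_lt_le. intros N.
  (* The exponents add up to 3 + 4 + 1 = 8, and (1 - e)^8 > 1 - 8 e = W contradicts the upper bound
     W. *)
  set (e := (1 - W) / 8). assert (He : 0 < e <= 1 / 8) by (unfold e; lra).
  destruct (euler_product_limit (RtoC x) e ltac:(simpl; lra) ltac:(lra)) as [N1 K1].
  destruct (euler_product_limit (x, t) e ltac:(simpl; lra) ltac:(lra)) as [N2 K2].
  destruct (euler_product_limit (x, 2 * t) e ltac:(simpl; lra) ltac:(lra)) as [N3 K3].
  set (P := (N1 + N2 + N3)%nat).
  specialize (K1 P ltac:(unfold P; lia)). specialize (K2 P ltac:(unfold P; lia)).
  specialize (K3 P ltac:(unfold P; lia)). specialize (EP P).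
  assert (L : forall w : C, Cmod (w - 1) <= e -> 1 - e <= Cmod w).
  { intros w Hw. generalize (Cmod_le_minus 1 w). rewrite Cmod_1, Cmod_minus_sym. lra. }
  apply L in K1. apply L in K2. apply L in K3. rewrite Cmod_mult in K1, K2, K3.
  assert (Q : (1 - e) ^ 3 * (1 - e) ^ 4 * (1 - e) <= W).
  { apply Rle_trans with
     ((Cmod (euler_product P (RtoC x)) * Cmod (hurwitz 1 (RtoC x))) ^ 3
      * (Cmod (euler_product P (x, t)) * Cmod (hurwitz 1 (x, t))) ^ 4
      * (Cmod (euler_product P (x, 2 * t)) * Cmod (hurwitz 1 (x, 2 * t)))).
    - apply Rmult_le_compat; [| | apply Rmult_le_compat|auto].
      + apply Rmult_le_pos; apply pow_le; lra.
      + lra.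
      + apply pow_le; lra.
      + apply pow_le; lra.
      + apply pow_incr; lra.
      + apply pow_incr; lra.
    - match goal with |- ?L <= W => replace L with
        ((Cmod (euler_product P (RtoC x)) ^ 3 * Cmod (euler_product P (x, t)) ^ 4
          * Cmod (euler_product P (x, 2 * t))) * W) by (unfold W; ring) end.
      rewrite <- (Rmult_1_l W) at 2. apply Rmult_le_compat_r; auto. }
  assert (B : 1 - 8 * e < (1 - e) ^ 3 * (1 - e) ^ 4 * (1 - e)).
  { replace ((1 - e) ^ 3 * (1 - e) ^ 4 * (1 - e)) with ((((1 - e) ^ 2) ^ 2) ^ 2) by ring.
    assert (B1 : 1 - 2 * e < (1 - e) ^ 2) by nra.
    assert (B2 : 1 - 4 * e < ((1 - e) ^ 2) ^ 2) by nra. nra. }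
  unfold e in *. lra.
Qed.

Lemma ccont_bounded f z : ccont f z -> exists d B, 0 < d /\ 0 < B /\
  forall w, Cmod (w - z) < d -> Cmod (f w) <= B.
Proof.
  intros H. destruct (H 1 Rlt_0_1) as [d [Hd K]]. exists d, (Cmod (f z) + 1).
  generalize (Cmod_ge_0 (f z)). intros G. split; [auto|split; [lra|]].
  intros w Hw. specialize (K w Hw). generalize (Cmod_le_minus (f w) (f z)). lra.
Qed.

Lemma Cmod_vertical x t : Cmod ((x, t) - ((1, t) : C)) = Rabs (x - 1).
Proof.
  replace ((x, t) - ((1, t) : C))%C with (RtoC (x - 1)) by (apply C_ext; simpl; ring).
  apply Cmod_R.
Qed.

(** At distance h from the line the simple pole at 1 contributes h^(-3), a zero at 1 + i t would
    contribute h^4, and zeta is bounded near 1 + 2 i t. The product would be of order h, against the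
    lower bound 1. *)
Theorem zeta_line_1_neq0 t : t <> 0 -> hurwitz 1 (1, t) <> RtoC 0.
Proof.
  intros Ht E.
  assert (N1 : ((1, t) : C) <> RtoC 1) by (intros H; apply (f_equal Im) in H; simpl in H; lra).
  assert (N2 : ((1, 2 * t) : C) <> RtoC 1) by (intros H; apply (f_equal Im) in H; simpl in H; lra).
  destruct (ccont_bounded (hurwitz1 1) (RtoC 0)) as [d1 [B1 [D1 [P1 K1]]]].
  { apply cdiff_ccont, hol_cdiff, hurwitz1_hol. lra. }
  destruct (ccont_bounded (hurwitz 1) (1, 2 * t)) as [d2 [B2 [D2 [P2 K2]]]].
  { apply cdiff_ccont, hol_cdiff, hurwitz_hol; [lra|auto]. }
  destruct (hol_cdiff _ _ (hurwitz_hol 1 (1, t) ltac:(lra) N1)) as [l Hl].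
  destruct (Hl 1 Rlt_0_1) as [d3 [D3 K3]].
  set (L := Cmod l + 1). assert (HL : 1 <= L) by (unfold L; generalize (Cmod_ge_0 l); lra).
  (* The three estimates multiply to Q * h, and h is taken below 1 / Q. *)
  set (Q := B1 ^ 3 * L ^ 4 * B2).
  assert (HQ : 0 < Q) by (unfold Q; apply Rmult_lt_0_compat; [apply Rmult_lt_0_compat; apply pow_lt|]; lra).
  set (h := Rmin (Rmin d1 d2) (Rmin d3 (/ Q)) / 2).
  assert (Hm : 0 < Rmin (Rmin d1 d2) (Rmin d3 (/ Q))).
  { apply Rmin_pos; apply Rmin_pos; auto. apply Rinv_0_lt_compat; auto. }
  assert (M1 : Rmin (Rmin d1 d2) (Rmin d3 (/ Q)) <= d1)
    by (eapply Rle_trans; [apply Rmin_l|apply Rmin_l]).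
  assert (M2 : Rmin (Rmin d1 d2) (Rmin d3 (/ Q)) <= d2)
    by (eapply Rle_trans; [apply Rmin_l|apply Rmin_r]).
  assert (M3 : Rmin (Rmin d1 d2) (Rmin d3 (/ Q)) <= d3)
    by (eapply Rle_trans; [apply Rmin_r|apply Rmin_l]).
  assert (M4 : Rmin (Rmin d1 d2) (Rmin d3 (/ Q)) <= / Q)
    by (eapply Rle_trans; [apply Rmin_r|apply Rmin_r]).
  assert (Hh : 0 < h) by (unfold h; lra).
  assert (W := zeta_product_ge_1 (1 + h) t ltac:(lra)).
  assert (A1 : Cmod (hurwitz 1 (RtoC (1 + h))) <= B1 / h).
  { unfold hurwitz. replace (RtoC (1 + h) - 1)%C with (RtoC h) by (apply C_ext; simpl; ring).
    rewrite Cmod_div by (intros H; apply (f_equal Re) in H; simpl in H; lra).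
    rewrite Cmod_R, (Rabs_pos_eq h) by lra.
    apply Rmult_le_compat_r; [left; apply Rinv_0_lt_compat; auto|]. apply K1.
    replace (RtoC h - RtoC 0)%C with (RtoC h) by ring. rewrite Cmod_R, Rabs_pos_eq; unfold h in *; lra. }
  assert (A2 : Cmod (hurwitz 1 (1 + h, 2 * t)) <= B2).
  { apply K2. rewrite Cmod_vertical. replace (1 + h - 1) with h by ring.
    rewrite Rabs_pos_eq; unfold h in *; lra. }
  assert (A3 : Cmod (hurwitz 1 (1 + h, t)) <= L * h).
  { set (w := (1 + h, t) : C). specialize (K3 w).
    assert (V : Cmod (w - ((1, t) : C)) = h)
      by (unfold w; rewrite Cmod_vertical; replace (1 + h - 1) with h by ring; rewrite Rabs_pos_eq; lra).
    rewrite V, E in K3. specialize (K3 ltac:(unfold h in *; lra)).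
    generalize (Cmod_le_minus (hurwitz 1 w) (l * (w - ((1, t) : C)))).
    rewrite Cmod_mult, V.
    replace (hurwitz 1 w - l * (w - ((1, t) : C)))%C
      with (hurwitz 1 w - 0 - l * (w - ((1, t) : C)))%C by ring.
    unfold L. lra. }
  assert (F : 1 <= (B1 / h) ^ 3 * (L * h) ^ 4 * B2).
  { eapply Rle_trans; [exact W|].
    assert (G1 := Cmod_ge_0 (hurwitz 1 (RtoC (1 + h)))).
    assert (G2 := Cmod_ge_0 (hurwitz 1 (1 + h, t))).
    apply Rmult_le_compat; [| | apply Rmult_le_compat|auto].
    - apply Rmult_le_pos; apply pow_le; auto.
    - apply Cmod_ge_0.
    - apply pow_le; auto.
    - apply pow_le; auto.
    - apply pow_incr; auto.
    - apply pow_incr; auto. }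
  replace ((B1 / h) ^ 3 * (L * h) ^ 4 * B2) with (Q * h) in F by (unfold Q; field; lra).
  assert (Q * h < 1); [|lra].
  apply Rlt_le_trans with (Q * / Q); [|right; field; lra].
  apply Rmult_lt_compat_l; auto. unfold h. assert (0 < / Q) by (apply Rinv_0_lt_compat; auto). lra.
Qed.

(** * The even Hurwitz zeta function on the circle *)

Lemma pcont_RtoC (u : R -> R) t : continuous u t -> pcont (fun s => RtoC (u s)) t.
Proof. intros H. split; simpl; [exact H|apply continuous_const]. Qed.

Lemma pcont_Rpow_C (x : R -> R) v t : continuous x t -> 0 < x t -> pcont (fun s => Rpow_C (x s) v) t.
Proof.
  intros Hx Hp. unfold Rpow_C.
  apply (pcont_comp Cexp (fun s => v * RtoC (ln (x s)))%C).
  - eapply cderiv_ccont, cderiv_Cexp.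
  - apply pcont_mult; [apply pcont_const|]. apply pcont_RtoC.
    apply (continuous_comp x ln); auto. apply (ex_derive_continuous ln).
    auto_derive. auto.
Qed.

Lemma pcont_csum (f : nat -> R -> C) n t : (forall k, (k < n)%nat -> pcont (f k) t) ->
  pcont (fun s => csum (fun k => f k s) n) t.
Proof.
  induction n; simpl; intros H; [apply pcont_const|]. apply pcont_plus; auto.
Qed.

Lemma pcont_opp f t : pcont f t -> pcont (fun s => - f s)%C t.
Proof.
  intros H. assert (K := pcont_mult (fun _ => RtoC (-1)) f t (pcont_const _ t) H).
  apply pcont_eps. intros eps He. destruct (proj1 (pcont_eps _ t) K eps He) as [d [Hd L]].
  exists d. split; auto. intros s Hs. specialize (L s Hs).
  replace (- f s - - f t)%C with (RtoC (-1) * f s - RtoC (-1) * f t)%C by ring. auto.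
Qed.

Lemma pcont_minus f g t : pcont f t -> pcont g t -> pcont (fun s => f s - g s)%C t.
Proof. intros. apply pcont_plus; auto. apply pcont_opp; auto. Qed.

Lemma Cser_pcont (f : nat -> R -> C) (M : nat -> R) t d : 0 < d ->
  (forall n, pcont (f n) t) -> (forall n s, Rabs (s - t) < d -> Cmod (f n s) <= M n) ->
  ex_series M -> pcont (fun s => Cser (fun n => f n s)) t.
Proof.
  intros Hd Hf HB HM. apply pcont_eps. intros eps He.
  destruct (is_series_tail M HM (eps / 4) ltac:(lra)) as [N K].
  specialize (K N (Nat.le_refl N)). apply Rabs_lt_between in K.
  destruct (proj1 (pcont_eps _ t) (pcont_csum f N t (fun k _ => Hf k)) (eps / 2) ltac:(lra))
    as [d' [Hd' L]].
  exists (Rmin d d'). split; [apply Rmin_pos; auto|]. intros s Hs.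
  specialize (L s (Rlt_le_trans _ _ _ Hs (Rmin_r _ _))).
  assert (Hs' := Rlt_le_trans _ _ _ Hs (Rmin_l _ _)).
  assert (A := Cser_tail (fun n => f n s) M N (fun n => HB n s Hs') HM).
  assert (B := Cser_tail (fun n => f n t) M N
    (fun n => HB n t ltac:(rewrite Rminus_diag, Rabs_R0; auto)) HM).
  cbv beta in A, B.
  match goal with |- Cmod (?X - ?Y) < _ => replace (X - Y)%C with
    ((csum (fun k => f k s) N - csum (fun k => f k t) N) - (csum (fun k => f k s) N - X)
     + (csum (fun k => f k t) N - Y))%C by ring end.
  eapply Rle_lt_trans; [apply Cmod_triangle|].
  eapply Rle_lt_trans; [apply Rplus_le_compat_r, Cmod_triangle_minus|]. lra.
Qed.

Lemma continuous_shift c t : continuous (fun s : R => s + c) t.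
Proof. apply (ex_derive_continuous (fun s : R => s + c)). auto_derive. auto. Qed.

(** At a fixed order K depending only on s, the expansion is a finite sum plus a series with a
    majorant that holds for all parameters above 1. *)
Lemma hurwitz_pcont s a : 1 < a -> pcont (fun a => hurwitz a s) a.
Proof.
  intros Ha. set (u := (s - 1)%C). destruct (nat_above (1 - Re u)) as [K HK].
  assert (HI := pos_INR K).
  assert (G : pcont (fun a => em_sum (fun _ => 1) a (fun w => Rpow_C a (- w)) K u * / u)%C a).
  { apply pcont_mult; [|apply pcont_const]. unfold em_sum. apply pcont_minus.
    - apply pcont_csum. intros k _. apply pcont_mult; [apply pcont_const|].
      apply (pcont_Rpow_C (fun a => a)); [apply continuous_id|lra].
    - unfold em_tail.
      apply (Cser_pcont (fun n a => RtoC 1 * em_diff K u (INR n + a))%C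
        (fun n => em_const K * Cmod (rising u (S (S K))) * Rpower (INR n + 1) (- (Re u + INR (S (S K)))))
        a (a - 1) ltac:(lra)).
      + intros n. assert (Hn := pos_INR n). apply pcont_mult; [apply pcont_const|].
        assert (C1 : forall c, continuous (fun t : R => INR n + t + c) a)
          by (intros c; apply (ex_derive_continuous (fun t : R => INR n + t + c)); auto_derive; auto).
        assert (C0 : continuous (fun t : R => INR n + t) a)
          by (apply (ex_derive_continuous (fun t : R => INR n + t)); auto_derive; auto).
        unfold em_diff. apply pcont_minus.
        * apply pcont_csum. intros k _. apply pcont_mult; [apply pcont_const|].
          apply pcont_minus.
          -- apply (pcont_Rpow_C (fun t => INR n + t)); [exact C0|lra].
          -- apply (pcont_Rpow_C (fun t => INR n + t + 1)); [exact (C1 1)|lra].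
        * apply pcont_mult; [apply pcont_const|].
          apply (pcont_Rpow_C (fun t => INR n + t)); [exact C0|lra].
      + intros n b Hb. assert (Hn := pos_INR n). apply Rabs_lt_between in Hb.
        rewrite Cmult_1_l. eapply Rle_trans; [apply em_diff_bound; [lra|rewrite !S_INR; lra]|].
        apply Rmult_le_compat_l.
        * apply Rmult_le_pos; [apply em_const_pos|apply Cmod_ge_0].
        * apply Rpower_le_antitone; [lra|rewrite !S_INR; lra].
      + apply (ex_series_scal (K := R_AbsRing) (V := R_NormedModule)).
        apply ex_series_Rpower; [lra|rewrite !S_INR; lra]. }
  apply pcont_eps. intros eps He. destruct (proj1 (pcont_eps _ a) G eps He) as [d [Hd L]].
  exists (Rmin d (a - 1)). split; [apply Rmin_pos; lra|]. intros b Hb.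
  specialize (L b (Rlt_le_trans _ _ _ Hb (Rmin_l _ _))).
  assert (Hb' := Rlt_le_trans _ _ _ Hb (Rmin_r _ _)). apply Rabs_lt_between in Hb'.
  unfold hurwitz. fold u. rewrite (hurwitz1_eq a K u), (hurwitz1_eq b K u) by lra. exact L.
Qed.

(* [x^(-s)] for [x > 0], extended by its limit 0 at 0 when [Re s < 0]. *)
Definition pow0 (s : C) (x : R) : C := if Rle_dec x 0 then RtoC 0 else Rpow_C x (- s).

Lemma pow0_pos s x : 0 < x -> pow0 s x = Rpow_C x (- s).
Proof. intros H. unfold pow0. destruct (Rle_dec x 0); [lra|reflexivity]. Qed.

Lemma pow0_pcont s x : Re s < 0 -> pcont (pow0 s) x.
Proof.
  intros Hs. apply pcont_eps. intros eps He.
  destruct (Rlt_dec 0 x) as [Hx|Hx].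
  - destruct (proj1 (pcont_eps _ x) (pcont_Rpow_C (fun t => t) (- s) x (continuous_id x) Hx) eps He)
      as [d [Hd K]].
    exists (Rmin d x). split; [apply Rmin_pos; auto|]. intros y Hy.
    specialize (K y (Rlt_le_trans _ _ _ Hy (Rmin_l _ _))).
    assert (Hy' := Rlt_le_trans _ _ _ Hy (Rmin_r _ _)). apply Rabs_lt_between in Hy'.
    rewrite !pow0_pos by lra. exact K.
  - set (d := Rpower eps (/ - Re s)). assert (Hd : 0 < d) by apply Rpower_pos.
    exists d. split; auto. intros y Hy. apply Rabs_lt_between in Hy.
    unfold pow0 at 2. destruct (Rle_dec x 0) as [_|]; [|lra].
    unfold pow0. destruct (Rle_dec y 0) as [Hy0|Hy0].
    + rewrite Cmod_self_minus. auto.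
    + replace (Rpow_C y (- s) - 0)%C with (Rpow_C y (- s)) by ring.
      rewrite Cmod_Rpow_C. change (Re (- s)) with (- Re s).
      replace eps with (Rpower d (- Re s)).
      * unfold Rpower. apply exp_increasing. apply Rmult_lt_compat_l; [lra|].
        apply ln_increasing; lra.
      * unfold d. rewrite Rpower_mult, Rinv_l, Rpower_1; lra.
Qed.

(** zeta(s, a) with two terms split off. Splitting one would give the parameter a + 1, which is not
    above 1 at a = 0; with two, [hurwitz_pcont] applies on a two-sided neighbourhood of 0, and the
    singular term a^(-s) stands alone. *)
Definition hz (s : C) (a : R) : C :=
  (pow0 s a + (Rpow_C (a + 1) (- s) + hurwitz (a + 2) s))%C.

Definition hz_even (s : C) (a : R) : C := (hz s a + hz s (1 - a))%C.

Lemma hz_regular_pcont s a : - 1 < a ->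
  pcont (fun a => Rpow_C (a + 1) (- s) + hurwitz (a + 2) s)%C a.
Proof.
  intros Ha. apply pcont_plus.
  - apply (pcont_Rpow_C (fun a => a + 1)); [apply continuous_shift|lra].
  - apply pcont_eps. intros eps He.
    destruct (proj1 (pcont_eps _ _) (hurwitz_pcont s (a + 2) ltac:(lra)) eps He) as [d [Hd K]].
    exists d. split; auto. intros b Hb. apply K. replace (b + 2 - (a + 2)) with (b - a) by ring. auto.
Qed.

Lemma pcont_reflect f t : pcont f (1 - t) -> pcont (fun s => f (1 - s)) t.
Proof.
  rewrite !pcont_eps. intros H eps He. destruct (H eps He) as [d [Hd K]]. exists d.
  split; auto. intros s Hs. apply K. replace (1 - s - (1 - t)) with (- (s - t)) by ring.
  rewrite Rabs_Ropp. auto.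
Qed.

Lemma hz_pcont s a : Re s < 0 -> - 1 < a -> pcont (hz s) a.
Proof. intros Hs Ha. apply pcont_plus; [apply pow0_pcont; auto|apply hz_regular_pcont; auto]. Qed.

Lemma hz_even_pcont s a : Re s < 0 -> 0 <= a <= 1 -> pcont (hz_even s) a.
Proof.
  intros Hs Ha. apply pcont_plus; [apply hz_pcont; auto; lra|].
  apply (pcont_reflect (hz s)). apply hz_pcont; auto. lra.
Qed.

Lemma hz_even_sym s a : hz_even s (1 - a) = hz_even s a.
Proof. unfold hz_even. replace (1 - (1 - a)) with a by ring. ring. Qed.

Lemma hz_cdiff a s : 0 < a -> s <> RtoC 1 -> cdiff (fun s => hz s a) s.
Proof.
  intros Ha Hs.
  apply (cdiff_ext (fun s => Rpow_C a (- s) + (Rpow_C (a + 1) (- s) + hurwitz (a + 2) s))%C).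
  - intros w. unfold hz. rewrite pow0_pos; auto.
  - apply cdiff_plus; [|apply cdiff_plus].
    + apply cdiff_Rpow_C, cdiff_opp, cdiff_id.
    + apply cdiff_Rpow_C, cdiff_opp, cdiff_id.
    + apply hol_cdiff, hurwitz_hol; [lra|auto].
Qed.

Lemma hz_series a s : 0 < a -> 1 < Re s -> csums (fun n => Rpow_C (INR n + a) (- s)) (hz s a).
Proof.
  intros Ha Hs. unfold hz. rewrite pow0_pos by auto.
  assert (H := hurwitz_correct (a + 2) s ltac:(lra) Hs).
  replace (Rpow_C a (- s)) with (Rpow_C (INR 0 + a) (- s)) by (f_equal; simpl; ring).
  apply (csums_shift (fun n => Rpow_C (INR n + a) (- s))).
  replace (Rpow_C (a + 1) (- s)) with (Rpow_C (INR 1 + a) (- s)) by (f_equal; simpl; ring).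
  apply (csums_shift (fun n => Rpow_C (INR (S n) + a) (- s))).
  eapply csums_ext; [|exact H]. intros n. cbv beta. f_equal. rewrite !S_INR. ring.
Qed.

Lemma csum_regroup (x : nat -> C) N M :
  csum (fun n => csum (fun k => x (n * N + k)%nat) N) M = csum x (M * N).
Proof.
  induction M; simpl; [reflexivity|]. rewrite IHM, Nat.add_comm, csum_split. reflexivity.
Qed.

(** In the half-plane of convergence the integers are grouped by residues, m N + k + a = N (m + (a +
    k) / N). Both sides continue off 1, so the relation holds for Re s < 1 too. *)
Lemma hz_distribution N a s : (1 <= N)%nat -> 0 < a -> Re s < 1 ->
  csum (fun k => hz s ((a + INR k) / INR N)) N = (Rpow_C (INR N) s * hz s a)%C.
Proof.
  intros HN Ha Hs.
  assert (HN0 : 0 < INR N) by (apply lt_0_INR; lia).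
  assert (Hk : forall k, 0 < (a + INR k) / INR N)
    by (intros k; apply Rdiv_lt_0_compat; [generalize (pos_INR k); lra|auto]).
  apply Ceq_minus.
  apply (zero_off_one (fun s => csum (fun k => hz s ((a + INR k) / INR N)) N
    - Rpow_C (INR N) s * hz s a)%C); auto.
  - intros w Hw. apply cdiff_minus.
    + apply csum_cdiff. intros k _. apply hz_cdiff; auto.
    + apply cdiff_mult; [apply cdiff_Rpow_C, cdiff_id|apply hz_cdiff; auto].
  - intros w Hw. apply (proj1 (Ceq_minus _ _)).
    apply (csums_unique (fun n => csum (fun k => Rpow_C (INR n + (a + INR k) / INR N) (- w)) N)).
    + apply (csums_csum (fun k n => Rpow_C (INR n + (a + INR k) / INR N) (- w))).
      intros k _. apply hz_series; auto.
    + assert (H := csums_scal (Rpow_C (INR N) w) _ _ (hz_series a w Ha Hw)).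
      apply (csums_subseq _ _ (fun n => n * N)%nat) with (3 := H); [intros n; nia|].
      intros n. rewrite <- csum_regroup. apply csum_ext. intros m _. apply csum_ext. intros k _.
      replace (INR (m * N + k) + a) with (INR N * (INR m + (a + INR k) / INR N))
        by (rewrite plus_INR, mult_INR; field; lra).
      rewrite Rpow_C_mult; auto.
      * rewrite (Rpow_C_opp (INR N)). field. apply Rpow_C_neq0.
      * generalize (pos_INR m) (Hk k). lra.
Qed.

Lemma csum_rev f N : csum f N = csum (fun k => f (N - 1 - k)%nat) N.
Proof.
  induction N; [reflexivity|]. rewrite (csum_S_first (fun k => f (S N - 1 - k)%nat)).
  rewrite csum_S, IHN. replace (S N - 1 - 0)%nat with N by lia. rewrite Cplus_comm. f_equal.
  apply csum_ext. intros k Hk. f_equal. lia.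
Qed.

Lemma hz_even_distribution N a s : (1 <= N)%nat -> 0 < a < 1 -> Re s < 1 ->
  csum (fun k => hz_even s ((a + INR k) / INR N)) N = (Rpow_C (INR N) s * hz_even s a)%C.
Proof.
  intros HN Ha Hs. assert (HN0 : 0 < INR N) by (apply lt_0_INR; lia).
  unfold hz_even. rewrite csum_plus, hz_distribution by (auto; lra).
  rewrite (csum_rev (fun k => hz s (1 - (a + INR k) / INR N))).
  rewrite (csum_ext _ (fun k => hz s ((1 - a + INR k) / INR N))).
  - rewrite hz_distribution by (auto; lra). ring.
  - intros k Hk. f_equal. rewrite !minus_INR by lia. simpl. field. lra.
Qed.

(** * Fourier coefficients of the even Hurwitz zeta function *)

Lemma cint_ext_open f g a b : a <= b -> (forall t, a < t < b -> f t = g t) ->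
  cint f a b = cint g a b.
Proof.
  intros Hab H. unfold cint. f_equal; apply RInt_ext; intros t Ht;
    rewrite Rmin_left, Rmax_right in Ht by auto; rewrite (H t Ht); reflexivity.
Qed.

Lemma cint_csum (f : nat -> R -> C) n a b : a <= b ->
  (forall k t, (k < n)%nat -> a <= t <= b -> pcont (f k) t) ->
  cint (fun t => csum (fun k => f k t) n) a b = csum (fun k => cint (f k) a b) n.
Proof.
  intros Hab. induction n; intros H; simpl.
  - unfold cint. rewrite !RInt_const. apply C_ext; unfold scal; simpl; unfold mult; simpl; ring.
  - rewrite cint_plus, IHn; auto. intros t Ht. apply pcont_csum. intros; apply H; auto.
Qed.

Lemma cint_comp_lin f u v a b : 0 < u -> a <= b ->
  (forall t, u * a + v <= t <= u * b + v -> pcont f t) ->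
  (RtoC u * cint (fun t => f (u * t + v)%R) a b = cint f (u * a + v) (u * b + v))%C.
Proof.
  intros Hu Hab H.
  assert (L : u * a + v <= u * b + v) by nra.
  destruct (ex_RInt_pcont f _ _ L H) as [H1 H2].
  assert (C0 : forall t, a <= t <= b -> pcont (fun t => f (u * t + v)) t).
  { intros t Ht. assert (K := H (u * t + v) ltac:(nra)). rewrite pcont_eps in *.
    intros eps He. destruct (K eps He) as [d [Hd Q]]. exists (d / u).
    split; [apply Rdiv_lt_0_compat; auto|]. intros s Hs. apply Q.
    replace (u * s + v - (u * t + v)) with (u * (s - t)) by ring.
    rewrite Rabs_mult, (Rabs_pos_eq u) by lra. apply Rlt_div_r in Hs; [lra|auto]. }
  rewrite <- cint_scal by auto. unfold cint. apply C_ext; simpl.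
  - rewrite <- (RInt_comp_lin (V := R_CompleteNormedModule) (fun t => Re (f t)) u v a b H1).
    apply RInt_ext. intros t _. unfold scal; simpl; unfold mult; simpl. unfold Re. ring.
  - rewrite <- (RInt_comp_lin (V := R_CompleteNormedModule) (fun t => Im (f t)) u v a b H2).
    apply RInt_ext. intros t _. unfold scal; simpl; unfold mult; simpl. unfold Im. ring.
Qed.

Lemma cint_subdivide f (x : nat -> R) n : (forall k, x k <= x (S k)) ->
  (forall t, x 0%nat <= t <= x n -> pcont f t) ->
  csum (fun k => cint f (x k) (x (S k))) n = cint f (x 0%nat) (x n).
Proof.
  intros Hx. assert (M : forall n, x 0%nat <= x n)
    by (induction n0; [lra|specialize (Hx n0); lra]).
  induction n; intros H; simpl.
  - unfold cint. rewrite !RInt_point. reflexivity.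
  - rewrite IHn; [|intros t Ht; apply H; specialize (Hx n); lra].
    apply cint_Chasles; auto.
Qed.

Definition wave (n : nat) (x : R) : C := RtoC (cos (2 * PI * INR n * x)).

Lemma wave_pcont n x : pcont (wave n) x.
Proof.
  apply pcont_RtoC. apply (ex_derive_continuous (fun x => cos (2 * PI * INR n * x))).
  auto_derive. auto.
Qed.

Lemma cos_2PI_nat x k : cos (x - 2 * PI * INR k) = cos x.
Proof.
  rewrite <- (cos_period (x - 2 * PI * INR k) k). f_equal. ring.
Qed.

Definition fourier (f : R -> C) (n : nat) : C := cint (fun x => f x * wave n x)%C 0 1.

(** The wave of frequency m at a equals the wave of frequency m N at (a + k) / N, for every k. So
    the N summands become integrals of one function over the consecutive intervals
    [k/N, (k+1)/N]. *)
Lemma fourier_distribution f N m : (1 <= N)%nat ->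
  (forall x, 0 <= x <= 1 -> pcont f x) ->
  cint (fun a => csum (fun k => f ((a + INR k) / INR N)%R) N * wave m a)%C 0 1
  = (RtoC (INR N) * fourier f (m * N))%C.
Proof.
  intros HN Hf. assert (HN0 : 0 < INR N) by (apply lt_0_INR; lia).
  assert (W : forall k a, wave m a = wave (m * N) (/ INR N * a + INR k / INR N)).
  { intros k a. unfold wave. f_equal. symmetry. rewrite <- (cos_2PI_nat _ (m * k)). f_equal.
    rewrite !mult_INR. field. lra. }
  assert (IK : forall k, (k < N)%nat -> INR k + 1 <= INR N).
  { intros k Hk. rewrite <- S_INR. apply le_INR. lia. }
  set (h := fun x => (f x * wave (m * N) x)%C).
  assert (Hh : forall x, 0 <= x <= 1 -> pcont h x)
    by (intros; apply pcont_mult; [auto|apply wave_pcont]).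
  assert (Hi : 0 < / INR N) by (apply Rinv_0_lt_compat; auto).
  assert (B : forall k t, (k < N)%nat -> / INR N * 0 + INR k / INR N <= t <= / INR N * 1 + INR k / INR N ->
     0 <= t <= 1).
  { intros k t Hk Ht. specialize (IK k Hk). assert (P := pos_INR k).
    replace (/ INR N * 0 + INR k / INR N) with (INR k * / INR N) in Ht by (field; lra).
    replace (/ INR N * 1 + INR k / INR N) with ((INR k + 1) * / INR N) in Ht by (field; lra).
    assert (0 <= INR k * / INR N) by nra.
    assert ((INR k + 1) * / INR N <= INR N * / INR N) by (apply Rmult_le_compat_r; lra).
    rewrite Rinv_r in H0 by lra. lra. }
  rewrite (cint_ext _ (fun a => csum (fun k => h (/ INR N * a + INR k / INR N)) N)); [|lra|].
  - rewrite cint_csum; [|lra|].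
    + rewrite (csum_ext _ (fun k => RtoC (INR N) *
        cint h (INR k / INR N) (INR (S k) / INR N))%C).
      * rewrite csum_scal. f_equal.
        rewrite (cint_subdivide h (fun k => INR k / INR N)).
        -- unfold fourier. f_equal; [simpl; field|field]; lra.
        -- intros k. apply Rmult_le_compat_r; [lra|]. apply le_INR; lia.
        -- intros t Ht. apply Hh. simpl in Ht. replace (0 / INR N) with 0 in Ht by (field; lra).
           replace (INR N / INR N) with 1 in Ht by (field; lra). auto.
      * intros k Hk.
        assert (E := cint_comp_lin h (/ INR N) (INR k / INR N) 0 1 Hi ltac:(lra)
          (fun t Ht => Hh t (B k t Hk Ht))).
        replace (/ INR N * 0 + INR k / INR N) with (INR k / INR N) in E by (field; lra).
        replace (/ INR N * 1 + INR k / INR N) with (INR (S k) / INR N) in E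
          by (rewrite S_INR; field; lra).
        rewrite <- E. rewrite Cmult_assoc, <- RtoC_mult, Rinv_r by lra. ring.
    + intros k t Hk Ht.
      assert (K := Hh (/ INR N * t + INR k / INR N) (B k (/ INR N * t + INR k / INR N)
        Hk ltac:(split; apply Rplus_le_compat_r, Rmult_le_compat_l; lra))).
      rewrite pcont_eps in *. intros eps He. destruct (K eps He) as [d [Hd Q]].
      exists d. split; auto. intros s Hs. apply Q.
      replace (/ INR N * s + INR k / INR N - (/ INR N * t + INR k / INR N))
        with (/ INR N * (s - t)) by ring.
      rewrite Rabs_mult, (Rabs_pos_eq (/ INR N)) by lra.
      assert (/ INR N <= 1).
      { rewrite <- Rinv_1. apply Rinv_le_contravar; [lra|].
        change 1 with (INR 1). apply le_INR; auto. }
      generalize (Rabs_pos (s - t)). nra.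
  - intros a Ha. rewrite Cmult_comm, <- csum_scal. apply csum_ext. intros k Hk. unfold h.
    rewrite <- W. replace (/ INR N * a + INR k / INR N) with ((a + INR k) / INR N) by (field; lra).
    ring.
Qed.

Lemma hz_even_fourier_scaling N m s : (1 <= N)%nat -> Re s < 0 ->
  (RtoC (INR N) * fourier (hz_even s) (m * N) = Rpow_C (INR N) s * fourier (hz_even s) m)%C.
Proof.
  intros HN Hs.
  assert (Hf : forall x, 0 <= x <= 1 -> pcont (hz_even s) x)
    by (intros; apply hz_even_pcont; auto).
  rewrite <- fourier_distribution by auto. unfold fourier. rewrite <- cint_scal; [|lra|].
  - apply cint_ext_open; [lra|]. intros t Ht. rewrite hz_even_distribution by (auto; lra). ring.
  - intros t Ht. apply pcont_mult; [auto|apply wave_pcont].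
Qed.

(** Scaling with N = 2 at frequency 0 gives (2 - 2^s) c_0 = 0, and |2^s| < 1. *)
Lemma hz_even_fourier_0 s : Re s < 0 -> fourier (hz_even s) 0 = RtoC 0.
Proof.
  intros Hs. assert (H := hz_even_fourier_scaling 2 0 s ltac:(lia) Hs). simpl (0 * 2)%nat in H.
  assert (E : ((RtoC (INR 2) - Rpow_C (INR 2) s) * fourier (hz_even s) 0 = 0)%C)
    by (rewrite Cmult_comm; transitivity (RtoC (INR 2) * fourier (hz_even s) 0
      - Rpow_C (INR 2) s * fourier (hz_even s) 0)%C; [ring|rewrite H; ring]).
  destruct (Req_dec (Cmod (fourier (hz_even s) 0)) 0) as [Z|Z]; [apply Cmod_eq_0; auto|].
  exfalso. apply (f_equal Cmod) in E. rewrite Cmod_mult, Cmod_0 in E.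
  apply Rmult_integral in E. destruct E as [E|E]; [|auto].
  apply Cmod_eq_0, Ceq_minus, (f_equal Cmod) in E.
  rewrite Cmod_R, Cmod_Rpow_C in E. replace (INR 2) with 2 in E by (simpl; ring).
  rewrite Rabs_pos_eq in E by lra.
  assert (Rpower 2 (Re s) < Rpower 2 0) by (apply Rpower_lt; lra).
  rewrite Rpower_O in H0 by lra. lra.
Qed.

(** Scaling from frequency 1 with N = n + 1: one coefficient determines all the others. *)
Lemma hz_even_fourier_S n s : Re s < 0 ->
  fourier (hz_even s) (S n) = (Rpow_C (INR n + 1) (s - 1) * fourier (hz_even s) 1)%C.
Proof.
  intros Hs. assert (H := hz_even_fourier_scaling (S n) 1 s ltac:(lia) Hs).
  rewrite Nat.mul_1_l in H. unfold Cminus. rewrite Rpow_C_plus, Rpow_C_opp, <- S_INR.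
  rewrite Rpow_C_1 by (apply lt_0_INR; lia).
  assert (N : RtoC (INR (S n)) <> RtoC 0).
  { intros E. apply RtoC_inj in E. generalize (lt_0_INR (S n) ltac:(lia)). lra. }
  transitivity (/ RtoC (INR (S n)) * (RtoC (INR (S n)) * fourier (hz_even s) (S n)))%C.
  - field. auto.
  - rewrite H. field. auto.
Qed.

(** * Uniqueness of cosine coefficients *)

Lemma ex_RInt_cont (f : R -> R) a b : a <= b -> (forall x, a <= x <= b -> continuous f x) ->
  ex_RInt f a b.
Proof.
  intros Hab H. apply (ex_RInt_continuous (V := R_CompleteNormedModule)). intros x Hx.
  rewrite Rmin_left, Rmax_right in Hx by auto. auto.
Qed.

Lemma RInt_lower_bound (f : R -> R) a b m : a <= b -> (forall x, a <= x <= b -> continuous f x) ->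
  (forall x, a <= x <= b -> m <= f x) -> m * (b - a) <= RInt f a b.
Proof.
  intros Hab Hc Hm.
  assert (E : RInt (fun _ => m) a b = m * (b - a))
    by (etransitivity; [apply (RInt_const (V := R_CompleteNormedModule))|apply Rmult_comm]).
  rewrite <- E.
  apply RInt_le; auto.
  - apply ex_RInt_const.
  - apply ex_RInt_cont; auto.
  - intros x Hx. apply Hm. lra.
Qed.

Lemma RInt_eq_fun (f g : R -> R) a b : (forall x, f x = g x) -> RInt f a b = RInt g a b.
Proof. intros H. apply RInt_ext. intros x _. apply H. Qed.

Definition cosn (n : nat) (x : R) : R := cos (2 * PI * INR n * x).

Lemma cosn_continuous n x : continuous (cosn n) x.
Proof. apply (ex_derive_continuous (cosn n)). unfold cosn. auto_derive. auto. Qed.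

Lemma cosn_1_mult n x : cosn 1 x * cosn n x =
  match n with O => cosn 1 x | S m => / 2 * (cosn (S n) x + cosn m x) end.
Proof.
  destruct n as [|m]; unfold cosn.
  - simpl. rewrite Rmult_0_r, Rmult_0_l, cos_0. ring.
  - change (INR 1) with 1. rewrite !S_INR.
    replace (2 * PI * (INR m + 1 + 1) * x) with (2 * PI * (INR m + 1) * x + 2 * PI * 1 * x) by ring.
    replace (2 * PI * INR m * x) with (2 * PI * (INR m + 1) * x - 2 * PI * 1 * x) by ring.
    rewrite cos_plus, cos_minus. field.
Qed.

Definition cos_orthogonal (g h : R -> R) : Prop :=
  (forall x, 0 <= x <= 1 -> continuous h x) /\
  forall n, RInt (fun x => g x * h x * cosn n x) 0 1 = 0.

Lemma cos_orthogonal_lin (g h k : R -> R) a b :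
  (forall x, 0 <= x <= 1 -> continuous g x) ->
  cos_orthogonal g h -> cos_orthogonal g k -> cos_orthogonal g (fun x => a * h x + b * k x).
Proof.
  intros Hg [Ch Oh] [Ck Ok].
  assert (C : forall u : R -> R, (forall x, 0 <= x <= 1 -> continuous u x) -> forall n,
    ex_RInt (fun x => g x * u x * cosn n x) 0 1).
  { intros u Hu n. apply ex_RInt_cont; [lra|]. intros x Hx.
    apply (continuous_mult (fun x => g x * u x) (cosn n)); [|apply cosn_continuous].
    apply (continuous_mult g u); auto. }
  split.
  - intros x Hx. apply (continuous_plus (fun x => a * h x) (fun x => b * k x)).
    + apply (continuous_scal_r a h). auto.
    + apply (continuous_scal_r b k). auto.
  - intros n.
    transitivity (RInt (fun x => a * (g x * h x * cosn n x) + b * (g x * k x * cosn n x)) 0 1).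
    + apply RInt_eq_fun. intros; ring.
    + assert (E := RInt_plus (V := R_CompleteNormedModule) (fun x => scal a (g x * h x * cosn n x))
        (fun x => scal b (g x * k x * cosn n x)) 0 1
        (ex_RInt_scal (V := R_NormedModule) _ 0 1 a (C h Ch n))
        (ex_RInt_scal (V := R_NormedModule) _ 0 1 b (C k Ck n))).
      rewrite !(RInt_scal (V := R_CompleteNormedModule)), Oh, Ok in E by auto.
      etransitivity; [exact E|]. unfold plus, scal; simpl; unfold mult; simpl. ring.
Qed.

(** The product of two cosines is half a sum of cosines, so orthogonality to all of them survives
    multiplication by cos(2 pi x), hence by every polynomial in it. *)
Lemma cos_orthogonal_mult (g h : R -> R) :
  (forall x, 0 <= x <= 1 -> continuous g x) ->
  cos_orthogonal g h -> cos_orthogonal g (fun x => cosn 1 x * h x).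
Proof.
  intros Hg [Ch Oh].
  assert (C : forall n, ex_RInt (fun x => g x * h x * cosn n x) 0 1).
  { intros n. apply ex_RInt_cont; [lra|]. intros x Hx.
    apply (continuous_mult (fun x => g x * h x) (cosn n)); [|apply cosn_continuous].
    apply (continuous_mult g h); auto. }
  split.
  - intros x Hx. apply (continuous_mult (cosn 1) h); [apply cosn_continuous|auto].
  - intros [|m].
    + etransitivity; [|exact (Oh 1%nat)]. apply RInt_eq_fun. intros x.
      assert (Q := cosn_1_mult 0 x). simpl in Q.
      replace (g x * (cosn 1 x * h x) * cosn 0 x) with (g x * h x * (cosn 1 x * cosn 0 x)) by ring.
      rewrite Q. reflexivity.
    + transitivity (RInt (fun x => / 2 * (g x * h x * cosn (S (S m)) x) + / 2 * (g x * h x * cosn m x)) 0 1).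
      * apply RInt_eq_fun. intros x. assert (Q := cosn_1_mult (S m) x). cbv iota in Q.
        transitivity (g x * h x * (cosn 1 x * cosn (S m) x)); [ring|]. rewrite Q. ring.
      * assert (E := RInt_plus (V := R_CompleteNormedModule)
          (fun x => scal (/ 2) (g x * h x * cosn (S (S m)) x))
          (fun x => scal (/ 2) (g x * h x * cosn m x)) 0 1
          (ex_RInt_scal (V := R_NormedModule) _ 0 1 (/ 2) (C (S (S m))))
          (ex_RInt_scal (V := R_NormedModule) _ 0 1 (/ 2) (C m))).
        rewrite !(RInt_scal (V := R_CompleteNormedModule)), !Oh in E by auto.
        etransitivity; [exact E|]. unfold plus, scal; simpl; unfold mult; simpl. ring.
Qed.

Lemma cos_orthogonal_pow (g : R -> R) y0 k :
  (forall x, 0 <= x <= 1 -> continuous g x) ->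
  (forall n, RInt (fun x => g x * cosn n x) 0 1 = 0) ->
  cos_orthogonal g (fun x => (1 - (cosn 1 x - y0) ^ 2 / 4) ^ k).
Proof.
  intros Hg H0. induction k as [|k IH].
  - split.
    + intros x _. apply continuous_const.
    + intros n. etransitivity; [|exact (H0 n)]. apply RInt_eq_fun. intros; simpl; ring.
  - set (h := fun x => (1 - (cosn 1 x - y0) ^ 2 / 4) ^ k) in *.
    assert (Y1 := cos_orthogonal_mult g h Hg IH).
    assert (Y2 := cos_orthogonal_mult g _ Hg Y1).
    assert (L := cos_orthogonal_lin g _ _ 1 (- / 4) Hg
       (cos_orthogonal_lin g _ _ (1 - y0 ^ 2 / 4) (y0 / 2) Hg IH Y1) Y2).
    assert (E : (fun x => (1 - (cosn 1 x - y0) ^ 2 / 4) ^ S k) =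
      (fun x => 1 * ((1 - y0 ^ 2 / 4) * h x + y0 / 2 * (cosn 1 x * h x))
         + - / 4 * (cosn 1 x * (cosn 1 x * h x)))).
    { apply functional_extensionality. intros x. unfold h. simpl. field. }
    rewrite E. exact L.
Qed.

Lemma cos_lipschitz a b : Rabs (cos a - cos b) <= Rabs (a - b).
Proof.
  destruct (MVT_gen cos b a (fun x => - sin x)) as [c [_ E]].
  - intros x _. auto_derive; [auto|ring].
  - intros x _. apply continuity_cos.
  - rewrite E, Rabs_mult, Rabs_Ropp.
    assert (Rabs (sin c) <= 1) by (apply Rabs_le, SIN_bound).
    generalize (Rabs_pos (a - b)). nra.
Qed.

(* The powers of [1 - (cos 2 pi x - cos 2 pi x0)^2 / 4] concentrate at [x0] and
   [1 - x0]. *)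
Lemma even_positive_contradiction (g : R -> R) x0 :
  (forall x, 0 <= x <= 1 -> continuous g x) -> (forall x, g (1 - x) = g x) ->
  (forall n, RInt (fun x => g x * cosn n x) 0 1 = 0) ->
  0 < x0 < 1 / 2 -> 0 < g x0 -> False.
Proof.
  intros Hg Hs H0 Hx Hp. assert (PP := PI_RGT_0).
  set (c := g x0 / 2).
  destruct (proj1 (continuous_eps g x0) (Hg x0 ltac:(lra)) c ltac:(unfold c; lra)) as [d0 [Hd0 K0]].
  set (d := Rmin (d0 / 2) (Rmin (x0 / 2) ((1 / 2 - x0) / 2))).
  assert (Hd : 0 < d) by (unfold d; apply Rmin_pos; [lra|apply Rmin_pos; lra]).
  assert (d1 : d <= d0 / 2) by apply Rmin_l.
  assert (d2 : d <= x0 / 2) by (eapply Rle_trans; [apply Rmin_r|apply Rmin_l]).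
  assert (d3 : d <= (1 / 2 - x0) / 2) by (eapply Rle_trans; [apply Rmin_r|apply Rmin_r]).
  assert (G1 : forall x, Rabs (x - x0) <= d -> c < g x).
  { intros x Hxx. specialize (K0 x ltac:(lra)). apply Rabs_lt_between in K0. unfold c in *. lra. }
  set (y0 := cosn 1 x0). set (Q := fun x => 1 - (cosn 1 x - y0) ^ 2 / 4).
  assert (CE : forall x, cosn 1 x = cos (2 * PI * x)) by (intros; unfold cosn; f_equal; simpl; ring).
  (* The cosine is strictly monotone on [0, 1/2], so on this half points farther than d from x0 have
     cosines at least m away from y0. *)
  set (m := Rmin (cos (2 * PI * (x0 - d)) - y0) (y0 - cos (2 * PI * (x0 + d)))).
  assert (Dec : forall a b, 0 <= a -> b <= 1 / 2 -> a < b -> cos (2 * PI * b) < cos (2 * PI * a)).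
  { intros a b Ha Hb Hab. apply cos_decreasing_1; nra. }
  assert (Hm : 0 < m).
  { unfold m, y0. rewrite CE. apply Rmin_pos.
    - assert (D := Dec (x0 - d) x0 ltac:(lra) ltac:(lra) ltac:(lra)). lra.
    - assert (D := Dec x0 (x0 + d) ltac:(lra) ltac:(lra) ltac:(lra)). lra. }
  assert (m1 : m <= cos (2 * PI * (x0 - d)) - y0) by apply Rmin_l.
  assert (m2 : m <= y0 - cos (2 * PI * (x0 + d))) by apply Rmin_r.
  assert (Far1 : forall x, 0 <= x <= 1 / 2 -> d < Rabs (x - x0) -> m <= Rabs (cosn 1 x - y0)).
  { intros x Hxx Hfar. rewrite CE. destruct (Rle_dec x x0).
    - rewrite Rabs_left1 in Hfar by lra.
      assert (D := Dec x (x0 - d) ltac:(lra) ltac:(lra) ltac:(lra)).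
      rewrite Rabs_pos_eq; lra.
    - rewrite Rabs_pos_eq in Hfar by lra.
      assert (D := Dec (x0 + d) x ltac:(lra) ltac:(lra) ltac:(lra)).
      rewrite Rabs_left1; lra. }
  assert (CS : forall x, cosn 1 (1 - x) = cosn 1 x).
  { intros x. rewrite !CE. replace (2 * PI * (1 - x)) with (- (2 * PI * x) + 2 * INR 1 * PI)
      by (simpl; ring). rewrite cos_period, cos_neg. reflexivity. }
  assert (B1 : forall x, -1 <= cosn 1 x <= 1) by (intros; apply COS_bound).
  assert (Q01 : forall x, 0 <= Q x).
  { intros x. unfold Q. generalize (B1 x) (B1 x0). fold y0. intros.
    assert ((cosn 1 x - y0) ^ 2 <= 4) by nra. lra. }
  (* Far points have cosines at least m from y0, which gives [Q <= q0]; near points have them at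
     most m / 2 away, which gives [Q >= q1]. The gap q0 < q1 drives the contradiction. *)
  set (q0 := 1 - m ^ 2 / 4). set (q1 := 1 - m ^ 2 / 16).
  assert (Hm2 : m <= 2).
  { unfold y0 in m1. generalize (B1 x0) (COS_bound (2 * PI * (x0 - d))). lra. }
  assert (Hm3 : 0 < m ^ 2) by (apply pow2_gt_0; lra).
  assert (Hq : 0 <= q0 < q1) by (unfold q0, q1; nra).
  destruct (continuity_ab_maj (fun x => Rabs (g x)) 0 1 ltac:(lra)) as [xm [Mx _]].
  { intros x Hxx. apply continuity_pt_filterlim. apply (continuous_comp g Rabs); auto.
    apply continuous_Rabs. }
  set (M := Rabs (g xm)) in *. assert (HM : 0 <= M) by apply Rabs_pos.
  (* A lower bound is enough: [Q] exceeds [q0] only near x0 or its mirror image 1 - x0, and there g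
     is positive. *)
  assert (Low : forall k x, 0 <= x <= 1 -> - (M * q0 ^ k) <= g x * Q x ^ k).
  { intros k x Hxx.
    assert (Qk : 0 <= Q x ^ k) by (apply pow_le; auto).
    assert (q0k : 0 <= q0 ^ k) by (apply pow_le; lra).
    assert (Far : forall z, 0 <= z <= 1 / 2 -> d < Rabs (z - x0) -> Q z ^ k <= q0 ^ k).
    { intros z Hz Hf. apply pow_incr. split; auto. assert (F := Far1 z Hz Hf).
      unfold Q, q0. rewrite <- (pow2_abs (cosn 1 z - y0)).
      assert (m ^ 2 <= Rabs (cosn 1 z - y0) ^ 2) by (apply pow_incr; lra). lra. }
    assert (QS : Q (1 - x) = Q x) by (unfold Q; rewrite CS; reflexivity).
    assert (Gx := Mx x Hxx). apply Rabs_le_between in Gx.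
    assert (T : (Q x ^ k <= q0 ^ k) \/ 0 <= g x).
    { destruct (Rle_dec x (1 / 2)).
      - destruct (Rle_dec (Rabs (x - x0)) d) as [Hn|Hn].
        + right. specialize (G1 x Hn). unfold c in *. lra.
        + left. apply Far; lra.
      - destruct (Rle_dec (Rabs (1 - x - x0)) d) as [Hn|Hn].
        + right. specialize (G1 (1 - x) Hn). rewrite Hs in G1. unfold c in *. lra.
        + left. rewrite <- QS. apply Far; lra. }
    destruct T as [T|T].
    - assert (M * Q x ^ k <= M * q0 ^ k) by (apply Rmult_le_compat_l; auto). nra.
    - assert (0 <= M * q0 ^ k) by (apply Rmult_le_pos; auto).
      assert (0 <= g x * Q x ^ k) by (apply Rmult_le_pos; auto). lra. }
  (* The function cos(2 pi x) has Lipschitz constant 2 pi, so within m / (4 pi) of x0 it changes by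
     at most m / 2. *)
  set (e := Rmin d (m / (4 * PI))).
  assert (He : 0 < e) by (unfold e; apply Rmin_pos; [auto|apply Rdiv_lt_0_compat; lra]).
  assert (e1 : e <= d) by apply Rmin_l. assert (e2 : e <= m / (4 * PI)) by apply Rmin_r.
  assert (Near : forall k x, x0 - e <= x <= x0 + e -> c * q1 ^ k <= g x * Q x ^ k).
  { intros k x Hxx. assert (Rabs (x - x0) <= e) by (apply Rabs_le; lra).
    specialize (G1 x ltac:(lra)).
    apply Rmult_le_compat; [unfold c; lra|apply pow_le; lra|lra|].
    apply pow_incr. split; [lra|]. unfold Q, q1.
    assert (L := cos_lipschitz (2 * PI * x) (2 * PI * x0)). rewrite <- !CE in L. fold y0 in L.
    replace (2 * PI * x - 2 * PI * x0) with (2 * PI * (x - x0)) in L by ring.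
    rewrite Rabs_mult, (Rabs_pos_eq (2 * PI)) in L by lra.
    assert (2 * PI * Rabs (x - x0) <= 2 * PI * (m / (4 * PI)))
      by (apply Rmult_le_compat_l; lra).
    replace (2 * PI * (m / (4 * PI))) with (m / 2) in H1 by (field; lra).
    rewrite <- (pow2_abs (cosn 1 x - y0)).
    assert (Rabs (cosn 1 x - y0) ^ 2 <= (m / 2) ^ 2)
      by (apply pow_incr; split; [apply Rabs_pos|lra]). lra. }
  (* The integral of [g * Q ^ k] is 0; its part near x0 is at least 2 e c q1^k, and the remainder is
     at least - M q0^k. As k grows the first must win. *)
  assert (Ineq : forall k, 2 * e * c * q1 ^ k <= M * q0 ^ k).
  { intros k. destruct (cos_orthogonal_pow g y0 k Hg H0) as [CQ OQ].
    assert (OQ' : RInt (fun x => g x * Q x ^ k) 0 1 = 0).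
    { etransitivity; [|exact (OQ 0%nat)]. apply RInt_eq_fun. intros x.
      unfold cosn at 2. simpl INR. rewrite Rmult_0_r, Rmult_0_l, cos_0. unfold Q. ring. }
    clear OQ. rename OQ' into OQ.
    assert (Cq : forall x, 0 <= x <= 1 -> continuous (fun x => g x * Q x ^ k) x)
      by (intros x Hxx; apply (continuous_mult g (fun x => Q x ^ k)); auto).
    set (a := x0 - e) in *. set (b := x0 + e) in *.
    assert (Ha : 0 <= a) by (unfold a; lra). assert (Hb : b <= 1) by (unfold b; lra).
    assert (Hab : a <= b) by (unfold a, b; lra).
    rewrite <- (RInt_Chasles (V := R_CompleteNormedModule) _ 0 a 1) in OQ
      by (apply ex_RInt_cont; [lra|intros; apply Cq; lra]).
    rewrite <- (RInt_Chasles (V := R_CompleteNormedModule) _ a b 1) in OQ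
      by (apply ex_RInt_cont; [lra|intros; apply Cq; lra]).
    unfold plus in OQ; simpl in OQ.
    assert (q0k : 0 <= q0 ^ k) by (apply pow_le; lra).
    assert (I1 := RInt_lower_bound (fun x => g x * Q x ^ k) 0 a (- (M * q0 ^ k)) ltac:(lra)
      ltac:(intros; apply Cq; lra) ltac:(intros; apply Low; lra)).
    assert (I2 := RInt_lower_bound (fun x => g x * Q x ^ k) a b (c * q1 ^ k) ltac:(lra)
      ltac:(intros; apply Cq; lra) ltac:(intros; apply Near; auto)).
    assert (I3 := RInt_lower_bound (fun x => g x * Q x ^ k) b 1 (- (M * q0 ^ k)) ltac:(lra)
      ltac:(intros; apply Cq; lra) ltac:(intros; apply Low; lra)).
    assert (0 <= M * q0 ^ k) by (apply Rmult_le_pos; auto).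
    replace (b - a) with (2 * e) in I2 by (unfold a, b; ring). nra. }
  destruct (pow_lt_1_zero (q0 / q1)) with (y := 2 * e * c / (M + 1)) as [k Hk].
  - rewrite Rabs_pos_eq.
    + apply Rlt_div_l; lra.
    + apply Rmult_le_pos; [lra|left; apply Rinv_0_lt_compat; lra].
  - apply Rdiv_lt_0_compat; [|lra]. unfold c. repeat apply Rmult_lt_0_compat; lra.
  - specialize (Hk k (Nat.le_refl k)). specialize (Ineq k).
    assert (q1k : 0 < q1 ^ k) by (apply pow_lt; lra).
    rewrite Rabs_pos_eq in Hk
      by (apply pow_le, Rmult_le_pos; [lra|left; apply Rinv_0_lt_compat; lra]).
    unfold Rdiv at 1 in Hk. rewrite Rpow_mult_distr, pow_inv in Hk.
    apply Rlt_div_r in Hk; [|lra].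
    assert (q0k : 0 <= q0 ^ k * / q1 ^ k)
      by (apply Rmult_le_pos; [apply pow_le; lra|left; apply Rinv_0_lt_compat; auto]).
    assert (F : M * (q0 ^ k * / q1 ^ k) < 2 * e * c) by nra.
    apply (Rmult_lt_compat_r (q1 ^ k)) in F; auto.
    replace (M * (q0 ^ k * / q1 ^ k) * q1 ^ k) with (M * q0 ^ k) in F by (field; lra). lra.
Qed.

(** Both signs are excluded on (0, 1/2) and reflection covers (1/2, 1). The exceptional points 0,
    1/2 and 1, where the concentration argument degenerates, follow by continuity. *)
Lemma cos_coefficients_unique (g : R -> R) :
  (forall x, 0 <= x <= 1 -> continuous g x) -> (forall x, g (1 - x) = g x) ->
  (forall n, RInt (fun x => g x * cosn n x) 0 1 = 0) ->
  forall x, 0 <= x <= 1 -> g x = 0.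
Proof.
  intros Hg Hs H0.
  assert (A : forall x, 0 < x < 1 / 2 -> g x = 0).
  { intros x Hx. destruct (Rtotal_order (g x) 0) as [L|[E|G]]; auto; exfalso.
    - apply (even_positive_contradiction (fun x => - g x) x); auto; [| | |lra].
      + intros y Hy. apply (continuous_opp g). auto.
      + intros y. rewrite Hs. reflexivity.
      + intros n. transitivity (- RInt (fun x => g x * cosn n x) 0 1); [|rewrite H0; apply Ropp_0].
        rewrite <- (RInt_opp (V := R_CompleteNormedModule)).
        * apply RInt_eq_fun. intros y. change (- g y * cosn n y = - (g y * cosn n y)). ring.
        * apply ex_RInt_cont; [lra|]. intros y Hy.
          apply (continuous_mult g (cosn n)); [auto|apply cosn_continuous].
    - apply (even_positive_contradiction g x); auto. }
  assert (B : forall x, 1 / 2 < x < 1 -> g x = 0)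
    by (intros x Hx; rewrite <- Hs; apply A; lra).
  intros x Hx. destruct (Req_dec (g x) 0) as [E|N]; auto. exfalso.
  destruct (proj1 (continuous_eps g x) (Hg x Hx) (Rabs (g x)) (Rabs_pos_lt _ N)) as [d [Hd K]].
  set (h := Rmin (d / 2) (1 / 8)).
  assert (0 < h) by (unfold h; apply Rmin_pos; lra).
  assert (h <= d / 2) by apply Rmin_l. assert (h <= 1 / 8) by apply Rmin_r.
  assert (Z : forall y, Rabs (y - x) <= h -> g y <> 0).
  { intros y Hy E. specialize (K y ltac:(lra)). rewrite E, Rminus_0_l, Rabs_Ropp in K. lra. }
  destruct (Rlt_dec x (1 / 2)) as [L|L].
  - destruct (Rlt_dec x (1 / 4)).
    + apply (Z (x + h)); [rewrite Rabs_pos_eq; lra|]. apply A. lra.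
    + apply (Z x); [rewrite Rminus_diag, Rabs_R0; lra|]. apply A. lra.
  - destruct (Rlt_dec x (3 / 4)).
    + apply (Z (x + h)); [rewrite Rabs_pos_eq; lra|]. apply B. lra.
    + apply (Z (x - h)); [rewrite Rabs_left; lra|]. apply B. lra.
Qed.

(** * Hurwitz's formula and non-vanishing of zeta on the imaginary axis *)

Lemma cint_Cser (f : nat -> R -> C) (M : nat -> R) a b : a <= b ->
  (forall n t, pcont (f n) t) -> (forall n t, Cmod (f n t) <= M n) -> ex_series M ->
  csums (fun n => cint (f n) a b) (cint (fun t => Cser (fun n => f n t)) a b).
Proof.
  intros Hab Hf HB HM eps He.
  assert (HD : 0 < eps / (2 * (b - a) + 1)) by (apply Rdiv_lt_0_compat; lra).
  destruct (is_series_tail M HM _ HD) as [N K]. exists N. intros n Hn. specialize (K n Hn).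
  assert (C0 : forall t, pcont (fun t => Cser (fun n => f n t)) t)
    by (intros t; apply (Cser_pcont f M t 1); auto; lra).
  assert (C1 : forall t, pcont (fun t => csum (fun k => f k t) n) t)
    by (intros t; apply pcont_csum; auto).
  rewrite <- cint_csum by auto.
  assert (E : (cint (fun t => csum (fun k => f k t) n) a b - cint (fun t => Cser (fun n => f n t)) a b
     = cint (fun t => csum (fun k => f k t) n + RtoC (-1) * Cser (fun n => f n t)) a b)%C).
  { rewrite cint_plus, cint_scal; auto.
    - ring.
    - intros t _. apply pcont_mult; [apply pcont_const|auto]. }
  rewrite E. apply Rabs_lt_between in K.
  eapply Rle_lt_trans; [apply (cint_bound _ a b (Series M - rsum M n) Hab)|].
  - intros t _. apply pcont_plus; auto. apply pcont_mult; [apply pcont_const|auto].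
  - intros t _. replace (csum (fun k => f k t) n + RtoC (-1) * Cser (fun n => f n t))%C
      with (csum (fun k => f k t) n - Cser (fun n => f n t))%C by ring.
    apply (Cser_tail (fun n => f n t)); auto.
  - apply Rle_lt_trans with (2 * (eps / (2 * (b - a) + 1)) * (b - a)).
    + apply Rmult_le_compat_r; lra.
    + replace (2 * (eps / (2 * (b - a) + 1)) * (b - a))
        with (eps * (2 * (b - a) / (2 * (b - a) + 1))) by (field; lra).
      assert (2 * (b - a) / (2 * (b - a) + 1) < 1) by (apply Rlt_div_l; lra). nra.
Qed.

Lemma Cmod_wave n x : Cmod (wave n x) <= 1.
Proof. unfold wave. rewrite Cmod_R. apply Rabs_le, COS_bound. Qed.

Lemma cint_wave n : cint (wave n) 0 1 = RtoC (if Nat.eqb n 0 then 1 else 0).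
Proof.
  destruct n as [|n]; unfold cint, wave; simpl Nat.eqb.
  - apply C_ext; simpl.
    + rewrite (RInt_eq_fun _ (fun _ => 1)) by (intros; rewrite Rmult_0_r, Rmult_0_l; apply cos_0).
      rewrite RInt_const. unfold scal; simpl; unfold mult; simpl. ring.
    + rewrite RInt_const. unfold scal; simpl; unfold mult; simpl. ring.
  - set (w := 2 * PI * INR (S n)). assert (PP := PI_RGT_0).
    assert (Hw : 0 < w) by (unfold w; apply Rmult_lt_0_compat; [lra|apply lt_0_INR; lia]).
    apply C_ext.
    + change (RInt (fun t => cos (w * t)) 0 1 = 0).
      transitivity (minus (sin (w * 1) / w) (sin (w * 0) / w) : R).
      * apply (is_RInt_unique (V := R_CompleteNormedModule)).
        apply (is_RInt_derive (V := R_CompleteNormedModule) (fun t => sin (w * t) / w)).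
        -- intros t _. auto_derive; [auto|]. field. lra.
        -- intros t _. apply (ex_derive_continuous (fun t => cos (w * t))). auto_derive. auto.
      * rewrite Rmult_0_r, sin_0. replace (sin (w * 1)) with 0.
        -- unfold minus, plus, opp; simpl. field. lra.
        -- replace (w * 1) with (0 + 2 * INR (S n) * PI) by (unfold w; ring).
           rewrite sin_period, sin_0. reflexivity.
    + change (RInt (fun _ => 0) 0 1 = 0).
      rewrite RInt_const. unfold scal; simpl; unfold mult; simpl. ring.
Qed.

Lemma wave_mult_le n m x : (n <= m)%nat ->
  (wave n x * wave m x = / 2 * (wave (m + n) x + wave (m - n) x))%C.
Proof.
  intros H. unfold wave. rewrite plus_INR, minus_INR by auto.
  rewrite <- RtoC_mult, <- RtoC_plus.
  replace (2 * PI * (INR m + INR n) * x) with (2 * PI * INR m * x + 2 * PI * INR n * x) by ring.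
  replace (2 * PI * (INR m - INR n) * x) with (2 * PI * INR m * x - 2 * PI * INR n * x) by ring.
  rewrite cos_plus, cos_minus. apply C_ext; simpl; field.
Qed.

Lemma cint_wave_mult n m : cint (fun x => wave n x * wave m x)%C 0 1 =
  (/ 2 * (RtoC (if Nat.eqb (n + m) 0 then 1 else 0) + RtoC (if Nat.eqb n m then 1 else 0)))%C.
Proof.
  assert (A : forall n m, (n <= m)%nat -> cint (fun x => wave n x * wave m x)%C 0 1 =
   (/ 2 * (RtoC (if Nat.eqb (n + m) 0 then 1 else 0) + RtoC (if Nat.eqb n m then 1 else 0)))%C).
  { intros i j H. rewrite (cint_ext _ (fun x => / 2 * (wave (j + i) x + wave (j - i) x))%C);
      [|lra|intros; apply wave_mult_le; auto].
    rewrite cint_scal; [|lra|intros; apply pcont_plus; apply wave_pcont].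
    rewrite cint_plus; [|lra|intros; apply wave_pcont|intros; apply wave_pcont].
    rewrite !cint_wave.
    rewrite Nat.add_comm. f_equal. f_equal. f_equal.
    destruct (Nat.eqb_spec (j - i) 0); destruct (Nat.eqb_spec i j); auto; lia. }
  destruct (Nat.le_ge_cases n m) as [H|H]; [apply A; auto|].
  rewrite (cint_ext _ (fun x => wave m x * wave n x)%C); [|lra|intros; ring].
  rewrite A by auto. rewrite (Nat.add_comm m n), (Nat.eqb_sym m n). reflexivity.
Qed.

Lemma csums_single j v : csums (fun n => if Nat.eqb n j then v else RtoC 0) v.
Proof.
  intros eps He. exists (S j). intros n Hn.
  replace (csum (fun n => if Nat.eqb n j then v else RtoC 0) n) with v.
  - rewrite Cmod_self_minus. auto.
  - replace n with (j + S (n - S j))%nat by lia. rewrite csum_split, csum_S_first.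
    rewrite Nat.add_0_r, Nat.eqb_refl.
    rewrite (csum_ext _ (fun _ => 0 * 0)%C).
    + rewrite (csum_ext (fun k => if (j + S k =? j)%nat then v else RtoC 0) (fun _ => 0 * 0)%C).
      * rewrite !csum_scal. ring.
      * intros k _. destruct (Nat.eqb_spec (j + S k) j); [lia|ring].
    + intros k Hk. destruct (Nat.eqb_spec k j); [lia|ring].
Qed.

(** The sum of cos(2 pi n x) n^(s-1) over n >= 1, the cosine part of the periodic zeta function at 1
    - s; it converges absolutely for Re s < 0. *)
Definition periodic_zeta (s : C) (x : R) : C :=
  Cser (fun n => Rpow_C (INR n + 1) (s - 1) * wave (S n) x)%C.

Lemma periodic_zeta_bound s n x :
  Cmod (Rpow_C (INR n + 1) (s - 1) * wave (S n) x) <= Rpower (INR n + 1) (- (1 - Re s)).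
Proof.
  rewrite Cmod_mult, Cmod_Rpow_C. change (Re (s - 1)) with (Re s - 1).
  replace (- (1 - Re s)) with (Re s - 1) by ring.
  generalize (Cmod_wave (S n) x) (Rpower_pos (INR n + 1) (Re s - 1)) (Cmod_ge_0 (wave (S n) x)). nra.
Qed.

Lemma periodic_zeta_summable s : Re s < 0 ->
  ex_series (fun n => Rpower (INR n + 1) (- (1 - Re s))).
Proof. intros Hs. apply ex_series_Rpower; lra. Qed.

Lemma periodic_zeta_pcont s x : Re s < 0 -> pcont (periodic_zeta s) x.
Proof.
  intros Hs. apply (Cser_pcont (fun n x => Rpow_C (INR n + 1) (s - 1) * wave (S n) x)%C
    (fun n => Rpower (INR n + 1) (- (1 - Re s))) x 1); [lra| | |apply periodic_zeta_summable; auto].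
  - intros n. apply pcont_mult; [apply pcont_const|apply wave_pcont].
  - intros n t _. apply periodic_zeta_bound.
Qed.

Lemma periodic_zeta_correct s x : Re s < 0 ->
  csums (fun n => Rpow_C (INR n + 1) (s - 1) * wave (S n) x)%C (periodic_zeta s x).
Proof.
  intros Hs. apply Cser_correct with (M := fun n => Rpower (INR n + 1) (- (1 - Re s))).
  - intros n. apply periodic_zeta_bound.
  - apply periodic_zeta_summable; auto.
Qed.

Lemma fourier_periodic_zeta s m : Re s < 0 -> fourier (periodic_zeta s) m =
  match m with O => RtoC 0 | S j => (/ 2 * Rpow_C (INR j + 1) (s - 1))%C end.
Proof.
  intros Hs. set (M := fun n => Rpower (INR n + 1) (- (1 - Re s))).
  set (f := fun n x => (Rpow_C (INR n + 1) (s - 1) * wave (S n) x * wave m x)%C).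
  assert (FB : forall n x, Cmod (f n x) <= M n).
  { intros n x. unfold f. rewrite Cmod_mult. assert (A := periodic_zeta_bound s n x).
    generalize (Cmod_wave m x) (Cmod_ge_0 (wave m x))
      (Cmod_ge_0 (Rpow_C (INR n + 1) (s - 1) * wave (S n) x)).
    unfold M. nra. }
  assert (FC : forall n x, pcont (f n) x).
  { intros n x. apply pcont_mult; [apply pcont_mult; [apply pcont_const|]|]; apply wave_pcont. }
  assert (H := cint_Cser f M 0 1 ltac:(lra) FC FB (periodic_zeta_summable s Hs)).
  assert (E : fourier (periodic_zeta s) m = cint (fun t => Cser (fun n => f n t)) 0 1).
  { unfold fourier. apply cint_ext; [lra|]. intros t _. symmetry.
    apply (Cser_eq _ _ M); [intros; apply FB|apply periodic_zeta_summable; auto|].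
    assert (G := csums_scal (wave m t) _ _ (periodic_zeta_correct s t Hs)).
    rewrite Cmult_comm. eapply csums_ext; [|exact G]. intros n. unfold f. ring. }
  rewrite E. apply (csums_unique _ _ _ H).
  assert (T : forall n, cint (f n) 0 1 =
     (Rpow_C (INR n + 1) (s - 1) * (/ 2 * RtoC (if Nat.eqb (S n) m then 1 else 0)))%C).
  { intros n. unfold f.
    rewrite (cint_ext _ (fun x => Rpow_C (INR n + 1) (s - 1) * (wave (S n) x * wave m x))%C);
      [|lra|intros; ring].
    rewrite cint_scal, cint_wave_mult; [|lra|intros; apply pcont_mult; apply wave_pcont].
    change (S n + m =? 0)%nat with false. cbv iota. ring. }
  destruct m as [|j].
  - apply (csums_ext (fun n => if Nat.eqb n 0 then 0 else 0)%C).
    + intros n. rewrite T. simpl (S n =? 0)%nat. destruct (n =? 0)%nat; ring.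
    + apply csums_single.
  - apply (csums_ext (fun n => if Nat.eqb n j then / 2 * Rpow_C (INR j + 1) (s - 1) else 0)%C).
    + intros n. rewrite T. simpl (S n =? S j)%nat. destruct (Nat.eqb_spec n j) as [->|]; ring.
    + apply csums_single.
Qed.

Lemma wave_reflect n x : wave n (1 - x) = wave n x.
Proof.
  unfold wave. f_equal. replace (2 * PI * INR n * (1 - x)) with (- (2 * PI * INR n * x) + 2 * INR n * PI)
    by ring. rewrite cos_period, cos_neg. reflexivity.
Qed.

Lemma complex_cos_coefficients_unique (g : R -> C) :
  (forall x, 0 <= x <= 1 -> pcont g x) -> (forall x, g (1 - x) = g x) ->
  (forall n, fourier g n = RtoC 0) -> forall x, 0 <= x <= 1 -> g x = RtoC 0.
Proof.
  intros Hg Hs H0 x Hx. apply C_ext.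
  - apply (cos_coefficients_unique (fun x => Re (g x))); auto.
    + intros y Hy. apply (Hg y Hy).
    + intros y. rewrite Hs. reflexivity.
    + intros n. assert (E := f_equal Re (H0 n)). simpl in E. etransitivity; [|exact E].
      apply RInt_eq_fun. intros y. unfold wave, cosn. simpl. unfold Re. ring.
  - apply (cos_coefficients_unique (fun x => Im (g x))); auto.
    + intros y Hy. apply (Hg y Hy).
    + intros y. rewrite Hs. reflexivity.
    + intros n. assert (E := f_equal Im (H0 n)). simpl in E. etransitivity; [|exact E].
      apply RInt_eq_fun. intros y. unfold wave, cosn. simpl. unfold Im. ring.
Qed.

(** Both sides are continuous, even about 1/2, and have the same cosine coefficients, by
    [hz_even_fourier_S] on the left and termwise integration on the right. The 2 compensates the
    integral 1/2 of a squared cosine. *)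
Theorem hurwitz_formula s a : Re s < 0 -> 0 <= a <= 1 ->
  hz_even s a = (2 * fourier (hz_even s) 1 * periodic_zeta s a)%C.
Proof.
  intros Hs Ha. set (c := (2 * fourier (hz_even s) 1)%C). apply Ceq_minus.
  assert (Hz : forall x, 0 <= x <= 1 -> pcont (hz_even s) x) by (intros; apply hz_even_pcont; auto).
  apply (complex_cos_coefficients_unique (fun a => hz_even s a - c * periodic_zeta s a)%C); auto.
  - intros x Hx. apply pcont_minus; auto. apply pcont_mult; [apply pcont_const|].
    apply periodic_zeta_pcont; auto.
  - intros x. rewrite hz_even_sym. replace (periodic_zeta s (1 - x)) with (periodic_zeta s x); [reflexivity|].
    unfold periodic_zeta. f_equal.
    apply functional_extensionality. intros n. rewrite wave_reflect. reflexivity.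
  - intros n. unfold fourier.
    rewrite (cint_ext _ (fun x => hz_even s x * wave n x + - c * (periodic_zeta s x * wave n x))%C);
      [|lra|intros; ring].
    assert (C1 : forall t, 0 <= t <= 1 -> pcont (fun x => hz_even s x * wave n x)%C t)
      by (intros; apply pcont_mult; [auto|apply wave_pcont]).
    assert (C2 : forall t, 0 <= t <= 1 -> pcont (fun x => periodic_zeta s x * wave n x)%C t)
      by (intros; apply pcont_mult; [apply periodic_zeta_pcont; auto|apply wave_pcont]).
    rewrite cint_plus, cint_scal; auto; try lra.
    + fold (fourier (hz_even s) n) (fourier (periodic_zeta s) n).
      rewrite fourier_periodic_zeta by auto. destruct n as [|n].
      * rewrite hz_even_fourier_0 by auto. ring.
      * rewrite hz_even_fourier_S by auto. unfold c.
        set (U := Rpow_C (INR n + 1) (s - 1)). set (V := fourier (hz_even s) 1).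
        transitivity (U * V * (1 - 2 * / 2))%C; [ring|].
        rewrite Cinv_r by (intros Z; apply RtoC_inj in Z; lra). ring.
    + intros t Ht. apply pcont_mult; [apply pcont_const|auto].
Qed.

Lemma hurwitz_shift a s : 1 <= a -> s <> RtoC 1 ->
  hurwitz a s = (Rpow_C a (- s) + hurwitz (a + 1) s)%C.
Proof.
  intros Ha Hs. unfold hurwitz. rewrite (hurwitz1_shift a 1) by auto.
  rewrite csum_S. change (INR 0) with 0. change (INR 1) with 1. rewrite Rplus_0_l, (Rplus_comm 1 a).
  simpl csum.
  replace (s - 1 + 1)%C with s by ring. field. apply Cminus_neq0; auto.
Qed.

(** Hurwitz's formula at the endpoint a = 0. There [pow0] contributes 0, so both halves of [hz_even]
    equal zeta(s), and the cosine series becomes the series of zeta(1 - s). *)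
Theorem zeta_functional_equation s : Re s < 0 ->
  hurwitz 1 s = (fourier (hz_even s) 1 * hurwitz 1 (1 - s))%C.
Proof.
  intros Hs. assert (N : s <> RtoC 1) by (intros ->; simpl in Hs; lra).
  assert (E := hurwitz_formula s 0 Hs ltac:(lra)).
  assert (L : hz_even s 0 = (2 * hurwitz 1 s)%C).
  { unfold hz_even, hz. rewrite Rminus_0_r, (pow0_pos s 1) by lra.
    unfold pow0. destruct (Rle_dec 0 0) as [_|]; [|lra].
    rewrite (hurwitz_shift 1 s) by (auto; lra). rewrite (hurwitz_shift (1 + 1) s) by (auto; lra).
    replace (0 + 1) with 1 by ring. replace (0 + 2) with (1 + 1) by ring.
    replace (1 + 1 + 1) with (1 + 2) by ring. rewrite !Rpow_C_1_l.
    rewrite (hurwitz_shift (1 + 1) s) by (auto; lra). replace (1 + 1 + 1) with (1 + 2) by ring. ring. }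
  assert (R : periodic_zeta s 0 = hurwitz 1 (1 - s)).
  { apply (csums_unique _ _ _ (periodic_zeta_correct s 0 Hs)).
    eapply csums_ext; [|apply (hurwitz_correct 1 (1 - s)); [lra|change (1 < 1 - Re s); lra]].
    intros n. cbv beta. unfold wave. rewrite Rmult_0_r, cos_0.
    replace (- (1 - s))%C with (s - 1)%C by ring. ring. }
  rewrite L, R in E. assert (I2 : (/ 2 * 2 = 1)%C) by (apply Cinv_l; intros Z; apply RtoC_inj in Z; lra).
  transitivity (/ 2 * 2 * hurwitz 1 s)%C; [rewrite I2; ring|].
  rewrite <- Cmult_assoc, E. transitivity (/ 2 * 2 * (fourier (hz_even s) 1 * hurwitz 1 (1 - s)))%C;
    [ring|rewrite I2; ring].
Qed.

(** Multiplying by 2 sin(pi a) makes the sum telescope to a difference of two sines. *)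
Lemma cos_partial_sums a n : sin (PI * a) <> 0 ->
  Rabs (rsum (fun k => cos (2 * PI * INR (S k) * a)) n) <= / Rabs (sin (PI * a)).
Proof.
  intros Hs. set (S0 := sin (PI * a)) in *.
  assert (E : forall n, 2 * S0 * rsum (fun k => cos (2 * PI * INR (S k) * a)) n =
     sin (PI * (2 * INR n + 1) * a) - S0).
  { induction n0.
    - simpl. replace (PI * (2 * 0 + 1) * a) with (PI * a) by ring. fold S0. ring.
    - change (rsum (fun k => cos (2 * PI * INR (S k) * a)) (S n0)) with
        (rsum (fun k => cos (2 * PI * INR (S k) * a)) n0 + cos (2 * PI * INR (S n0) * a)).
      rewrite Rmult_plus_distr_l, IHn0, S_INR. unfold S0.
      replace (PI * (2 * INR n0 + 1) * a) with (2 * PI * (INR n0 + 1) * a - PI * a) by ring.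
      replace (PI * (2 * (INR n0 + 1) + 1) * a) with (2 * PI * (INR n0 + 1) * a + PI * a) by ring.
      rewrite sin_plus, sin_minus. ring. }
  specialize (E n). set (T := rsum (fun k => cos (2 * PI * INR (S k) * a)) n) in *.
  assert (P := Rabs_pos_lt _ Hs).
  assert (B : Rabs (2 * S0 * T) <= 2).
  { rewrite E. generalize (SIN_bound (PI * (2 * INR n + 1) * a)) (SIN_bound (PI * a)).
    fold S0. intros. apply Rabs_le. lra. }
  rewrite !Rabs_mult, (Rabs_pos_eq 2) in B by lra.
  apply (Rmult_le_reg_l (Rabs S0)); auto. rewrite Rinv_r by lra. lra.
Qed.

(* Summation by parts, uniform as [Re s] tends to 0 from the left. *)
Lemma periodic_zeta_uniform s a : Re s < 0 -> sin (PI * a) <> 0 ->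
  Cmod (periodic_zeta s a) <= / Rabs (sin (PI * a)) * (1 + 4 * Cmod (s - 1)).
Proof.
  intros Hs Ha. set (B := / Rabs (sin (PI * a))).
  assert (HB : 0 < B) by (apply Rinv_0_lt_compat, Rabs_pos_lt; auto).
  set (b := fun n => Rpow_C (INR n + 1) (s - 1)).
  set (T := fun n => rsum (fun k => cos (2 * PI * INR (S k) * a)) n).
  assert (HT : forall n, Rabs (T n) <= B) by (intros; apply cos_partial_sums; auto).
  assert (E : forall n, csum (fun n => b n * wave (S n) a)%C n =
     (RtoC (T n) * b n + csum (fun k => RtoC (T (S k)) * (b k - b (S k))) n)%C).
  { induction n.
    - simpl. unfold T. simpl. ring.
    - rewrite !csum_S, IHn. unfold wave.
      change (T (S n)) with (T n + cos (2 * PI * INR (S n) * a)). rewrite RtoC_plus. ring. }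
  assert (Hb : forall n, Cmod (b n) <= 1).
  { intros n. unfold b. rewrite Cmod_Rpow_C. change (Re (s - 1)) with (Re s - 1).
    assert (Hn := pos_INR n). unfold Rpower. apply Rle_trans with (exp 0); [|right; apply exp_0]. apply exp_le_compat.
    assert (A : ln 1 <= ln (INR n + 1)) by (apply ln_le; lra). rewrite ln_1 in A.
    generalize (Rmult_le_compat_l (1 - Re s) _ _ ltac:(lra) A). lra. }
  (* This estimate makes the bound uniform: for Re s < 0 the derivative of x^(s-1) is at most |s-1|
     x^(-2). The mean value bound gives the factor 2, the sum of n^(-2) is at most 2, whence the 4
     in the statement. *)
  assert (Db : forall n, Cmod (b n - b (S n)) <= 2 * Cmod (s - 1) * Rpower (INR n + 1) (- (2))).
  { intros n. assert (Hn := pos_INR n). unfold b. rewrite Cmod_minus_sym.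
    assert (D := pderiv_bound (fun t => Rpow_C (INR n + 1 + t) (s - 1))
      (fun t => (s - 1) * Rpow_C (INR n + 1 + t) (s - 1 - 1))%C 1
      (Cmod (s - 1) * Rpower (INR n + 1) (- (2))) ltac:(lra)).
    cbv beta in D. rewrite S_INR. rewrite Rplus_0_r in D.
    eapply Rle_trans; [apply D|right; ring].
    - intros t Ht. apply pderiv_Rpow_C. lra.
    - intros t Ht. rewrite Cmod_mult, Cmod_Rpow_C.
      apply Rmult_le_compat_l; [apply Cmod_ge_0|].
      change (Re (s - 1 - 1)) with (Re s - 1 - 1).
      apply Rle_trans with (Rpower (INR n + 1) (Re s - 1 - 1)).
      + apply Rpower_le_antitone; lra.
      + unfold Rpower. apply exp_le_compat.
        assert (0 <= ln (INR n + 1)) by (rewrite <- ln_1; apply ln_le; lra). nra. }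
  destruct (ex_series_Rpower 1 2 ltac:(lra) ltac:(lra)) as [X1 X2].
  assert (P1 : forall p, Rpower 1 p = 1)
    by (intros p; unfold Rpower; rewrite ln_1, Rmult_0_r; apply exp_0).
  rewrite !P1 in X2. replace (/ (2 - 1)) with 1 in X2 by field.
  apply Rnot_lt_le. intros N.
  set (e := Cmod (periodic_zeta s a) - B * (1 + 4 * Cmod (s - 1))).
  destruct (periodic_zeta_correct s a Hs e ltac:(unfold e; lra)) as [n0 K].
  destruct (is_series_tail _ X1 1 Rlt_0_1) as [n1 K1].
  specialize (K n0 (Nat.le_refl n0)). change (csum (fun n => b n * wave (S n) a)%C n0) with
    (csum (fun n => b n * wave (S n) a)%C n0) in K.
  assert (F : Cmod (csum (fun n => b n * wave (S n) a)%C n0) <= B * (1 + 4 * Cmod (s - 1))).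
  { rewrite E. eapply Rle_trans; [apply Cmod_triangle|].
    assert (F1 : Cmod (RtoC (T n0) * b n0) <= B).
    { rewrite Cmod_mult, Cmod_R. generalize (HT n0) (Hb n0) (Cmod_ge_0 (b n0)) (Rabs_pos (T n0)). nra. }
    assert (F2 : Cmod (csum (fun k => RtoC (T (S k)) * (b k - b (S k)))%C n0) <=
       rsum (fun k => B * (2 * Cmod (s - 1)) * Rpower (INR k + 1) (- (2))) n0).
    { apply csum_bound. intros k _. rewrite Cmod_mult, Cmod_R.
      rewrite Rmult_assoc. apply Rmult_le_compat; auto using Rabs_pos, Cmod_ge_0. }
    rewrite rsum_scal in F2.
    assert (F3 : rsum (fun k => Rpower (INR k + 1) (- (2))) n0 <= 2).
    { assert (G := Cser_tail (fun _ => RtoC 0) (fun k => Rpower (INR k + 1) (- (2))) n0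
        ltac:(intros; cbv beta; rewrite Cmod_0; left; apply Rpower_pos) X1).
      generalize (Cmod_ge_0 (csum (fun _ => RtoC 0) n0 - Cser (fun _ => RtoC 0))). lra. }
    assert (0 <= B * (2 * Cmod (s - 1)))
      by (apply Rmult_le_pos; [lra|apply Rmult_le_pos; [lra|apply Cmod_ge_0]]).
    nra. }
  generalize (Cmod_le_minus (periodic_zeta s a) (csum (fun n => b n * wave (S n) a)%C n0)).
  rewrite Cmod_minus_sym in K. unfold e in *. fold b in K.
  change (csum (fun n => (Rpow_C (INR n + 1) (s - 1) * wave (S n) a)%C) n0) with
    (csum (fun n => b n * wave (S n) a)%C n0) in K. lra.
Qed.

(* If zeta vanished at [i t], then so would [hz_even (i t) a] for [0 < a < 1];
   but it is the sum of [a^(-i t)], which oscillates at 0, and a function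
   continuous at [a = 0]. *)
Theorem zeta_imaginary_axis_neq0 t : t <> 0 -> hurwitz 1 (0, t) <> RtoC 0.
Proof.
  intros Ht E. set (s0 := (0, t) : C) in *.
  assert (N0 : s0 <> RtoC 1) by (intros H; apply (f_equal Re) in H; simpl in H; lra).
  assert (E1 : (1 - s0)%C = (1, - t)) by (apply C_ext; simpl; ring).
  assert (N1 : (1 - s0)%C <> RtoC 1)
    by (rewrite E1; intros H; apply (f_equal Im) in H; simpl in H; lra).
  assert (Z1 : hurwitz 1 (1 - s0) <> RtoC 0) by (rewrite E1; apply zeta_line_1_neq0; lra).
  assert (C0 : ccont (hurwitz 1) s0) by (apply cdiff_ccont, hol_cdiff, hurwitz_hol; [lra|auto]).
  assert (C1 : ccont (fun s => hurwitz 1 (1 - s)) s0).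
  { apply cdiff_ccont, (cdiff_comp (fun s => 1 - s)%C (hurwitz 1)).
    - apply hol_cdiff, hurwitz_hol; [lra|auto].
    - apply cdiff_minus; [apply cdiff_const|apply cdiff_id]. }
  assert (V : forall a, 0 < a < 1 -> hz_even s0 a = RtoC 0).
  { intros a Ha.
    assert (Sa : sin (PI * a) <> 0).
    { apply Rgt_not_eq, sin_gt_0; generalize PI_RGT_0; nra. }
    assert (C2 : ccont (fun s => hz_even s a) s0).
    { apply cdiff_ccont, cdiff_plus; apply hz_cdiff; auto; lra. }
    set (B := / Rabs (sin (PI * a)) * (1 + 4 * (Cmod (s0 - 1) + 1))).
    assert (HB : 0 < B).
    { unfold B. apply Rmult_lt_0_compat; [apply Rinv_0_lt_compat, Rabs_pos_lt; auto|].
      generalize (Cmod_ge_0 (s0 - 1)). lra. }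
    destruct (ccont_neq0 _ _ C1 Z1) as [d1 [D1 K1]].
    assert (HZ : 0 < Cmod (hurwitz 1 (1 - s0))) by (apply Cmod_gt_0; auto).
    set (z := Cmod (hurwitz 1 (1 - s0))) in *.
    apply Cmod_0_eq. intros eps He.
    destruct (C2 (eps / 2) ltac:(lra)) as [d2 [D2 K2]].
    destruct (C0 (eps / 2 * (z / (4 * B)))) as [d3 [D3 K3]].
    { apply Rmult_lt_0_compat; [lra|apply Rdiv_lt_0_compat; lra]. }
    set (h := Rmin (Rmin d1 1) (Rmin d2 d3) / 2).
    assert (Hm : 0 < Rmin (Rmin d1 1) (Rmin d2 d3)) by (apply Rmin_pos; apply Rmin_pos; lra).
    assert (M1 : Rmin (Rmin d1 1) (Rmin d2 d3) <= d1) by (eapply Rle_trans; [apply Rmin_l|apply Rmin_l]).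
    assert (M0 : Rmin (Rmin d1 1) (Rmin d2 d3) <= 1) by (eapply Rle_trans; [apply Rmin_l|apply Rmin_r]).
    assert (M2 : Rmin (Rmin d1 1) (Rmin d2 d3) <= d2) by (eapply Rle_trans; [apply Rmin_r|apply Rmin_l]).
    assert (M3 : Rmin (Rmin d1 1) (Rmin d2 d3) <= d3) by (eapply Rle_trans; [apply Rmin_r|apply Rmin_r]).
    assert (Hh : 0 < h) by (unfold h; lra).
    set (s := (- h, t) : C).
    assert (Hs : Re s < 0) by (simpl; lra).
    assert (Ds : Cmod (s - s0) = h).
    { replace (s - s0)%C with (RtoC (- h)) by (apply C_ext; simpl; ring).
      rewrite Cmod_R, Rabs_Ropp, Rabs_pos_eq; lra. }
    specialize (K1 s ltac:(rewrite Ds; unfold h in *; lra)).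
    specialize (K2 s ltac:(rewrite Ds; unfold h in *; lra)).
    specialize (K3 s ltac:(rewrite Ds; unfold h in *; lra)).
    rewrite E in K3. replace (hurwitz 1 s - 0)%C with (hurwitz 1 s) in K3 by ring.
    rewrite (zeta_functional_equation s Hs), Cmod_mult in K3.
    set (c := fourier (hz_even s) 1) in *.
    (* As s tends to i t from the left, zeta(s) = c(s) zeta(1 - s) tends to 0 while zeta(1 - s)
       stays above z / 2 in modulus; so c(s) tends to 0. *)
    assert (Hc : Cmod c <= eps / 2 * (/ (2 * B))).
    { apply Rnot_lt_le. intros L.
      assert (eps / 2 * / (2 * B) * (z / 2) <= Cmod c * Cmod (hurwitz 1 (1 - s))).
      { apply Rmult_le_compat; try lra.
        apply Rmult_le_pos; [lra|left; apply Rinv_0_lt_compat; lra]. }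
      replace (eps / 2 * / (2 * B) * (z / 2)) with (eps / 2 * (z / (4 * B))) in H by (field; lra).
      lra. }
    assert (F := hurwitz_formula s a Hs ltac:(lra)). fold c in F.
    assert (U := periodic_zeta_uniform s a Hs Sa).
    assert (U2 : Cmod (periodic_zeta s a) <= B).
    { eapply Rle_trans; [exact U|]. unfold B. apply Rmult_le_compat_l.
      - left. apply Rinv_0_lt_compat, Rabs_pos_lt; auto.
      - assert (Cmod (s - 1) <= Cmod (s0 - 1) + 1); [|lra].
        eapply Rle_trans; [apply (Cmod_le_minus _ (s0 - 1))|].
        replace (s - 1 - (s0 - 1))%C with (s - s0)%C by ring. rewrite Ds. unfold h. lra. }
    assert (G : Cmod (hz_even s a) <= eps / 2).
    { rewrite F, !Cmod_mult, Cmod_R, (Rabs_pos_eq 2) by lra.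
      apply Rle_trans with (2 * (eps / 2 * / (2 * B)) * B).
      - apply Rmult_le_compat; try apply Cmod_ge_0; auto; [|lra].
        apply Rmult_le_pos; [lra|apply Cmod_ge_0].
      - right. field. lra. }
    generalize (Cmod_le_minus (hz_even s0 a) (hz_even s a)).
    rewrite Cmod_minus_sym in K2. lra. }
  (* Everything in [hz_even s0 a] except the term a^(-s0). *)
  set (k := fun a => ((Rpow_C (a + 1) (- s0) + hurwitz (a + 2) s0) + hz s0 (1 - a))%C).
  assert (Ck : pcont k 0).
  { apply pcont_plus; [apply hz_regular_pcont; lra|].
    apply (pcont_reflect (hz s0)). rewrite Rminus_0_r.
    assert (G : pcont (fun a => Rpow_C a (- s0) + (Rpow_C (a + 1) (- s0) + hurwitz (a + 2) s0))%C 1).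
    { apply pcont_plus; [|apply hz_regular_pcont; lra].
      apply (pcont_Rpow_C (fun a => a)); [apply continuous_id|lra]. }
    apply pcont_eps. intros eps He. destruct (proj1 (pcont_eps _ _) G eps He) as [d [Hd K]].
    exists (Rmin d 1). split; [apply Rmin_pos; lra|]. intros x Hx.
    assert (Hx' := Rlt_le_trans _ _ _ Hx (Rmin_r _ _)). apply Rabs_lt_between in Hx'.
    unfold hz. rewrite !pow0_pos by lra. apply K.
    eapply Rlt_le_trans; [exact Hx|apply Rmin_l]. }
  destruct (proj1 (pcont_eps _ _) Ck (1 / 2) ltac:(lra)) as [d [Hd K]].
  (* At a = exp(- q n) the power a^(-i t) equals (-1)^n, and these points tend to 0. *)
  set (q := PI / Rabs t).
  assert (Hq : 0 < q) by (apply Rdiv_lt_0_compat; [apply PI_RGT_0|apply Rabs_pos_lt; auto]).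
  destruct (nat_above ((- ln d) / q)) as [j Hj].
  assert (A : forall n, (1 <= n)%nat -> (j <= n)%nat -> 0 < exp (- (q * INR n)) < d /\
     exp (- (q * INR n)) < 1).
  { intros n Hn1 Hn. assert (INR j <= INR n) by (apply le_INR; auto).
    assert (1 <= INR n) by (change 1 with (INR 1); apply le_INR; auto).
    split; [split; [apply exp_pos|]|].
    - rewrite <- (exp_ln d) by auto. apply exp_increasing.
      apply Rlt_div_l in Hj; [|auto]. nra.
    - rewrite <- exp_0. apply exp_increasing. nra. }
  assert (P : forall n, (1 <= n)%nat -> (j <= n)%nat ->
     Cmod (RtoC ((-1) ^ n) + k 0) < 1 / 2).
  { intros n Hn1 Hn. destruct (A n Hn1 Hn) as [[A1 A2] A3].
    set (a := exp (- (q * INR n))) in *.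
    assert (Va := V a ltac:(lra)). unfold hz_even, hz in Va. rewrite pow0_pos in Va by auto.
    assert (W : Rpow_C a (- s0) = RtoC ((-1) ^ n)).
    { unfold Rpow_C, a. rewrite ln_exp. unfold Cexp.
      replace (Re (- s0 * RtoC (- (q * INR n)))) with 0 by (simpl; ring).
      replace (Im (- s0 * RtoC (- (q * INR n)))) with (t * q * INR n) by (simpl; ring).
      rewrite exp_0. unfold q.
      assert (CSn : forall n, cos (PI * INR n) = (-1) ^ n /\ sin (PI * INR n) = 0).
      { induction n0 as [|n0 [I1 I2]].
        - simpl. rewrite Rmult_0_r, cos_0, sin_0. auto.
        - rewrite S_INR, Rmult_plus_distr_l, Rmult_1_r, neg_cos, neg_sin, I1, I2. simpl. lra. }
      destruct (CSn n) as [Q1 Q2].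
      unfold Rabs. destruct (Rcase_abs t).
      - replace (t * (PI / - t) * INR n) with (- (PI * INR n)) by (field; lra).
        rewrite cos_neg, sin_neg, Q1, Q2. apply C_ext; simpl; ring.
      - replace (t * (PI / t) * INR n) with (PI * INR n) by (field; lra).
        rewrite Q1, Q2. apply C_ext; simpl; ring. }
    specialize (K a ltac:(rewrite Rminus_0_r, Rabs_pos_eq; lra)).
    rewrite Cmod_minus_sym in K.
    replace (RtoC ((-1) ^ n) + k 0)%C with (k 0 - k a)%C; [exact K|].
    rewrite <- W. unfold Cminus. rewrite Cplus_comm. f_equal.
    apply Ceq_minus. unfold k, hz.
    replace (- (Rpow_C (a + 1) (- s0) + hurwitz (a + 2) s0 + (pow0 s0 (1 - a)
       + (Rpow_C (1 - a + 1) (- s0) + hurwitz (1 - a + 2) s0))) - Rpow_C a (- s0))%C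
     with (- (Rpow_C a (- s0) + (Rpow_C (a + 1) (- s0) + hurwitz (a + 2) s0) + (pow0 s0 (1 - a)
       + (Rpow_C (1 - a + 1) (- s0) + hurwitz (1 - a + 2) s0))))%C by ring.
    rewrite Va. ring. }
  (* Two consecutive signs would both be within 1/2 of - k 0, although they differ by 2. *)
  assert (P1 := P (S j) ltac:(lia) ltac:(lia)). assert (P2 := P (S (S j)) ltac:(lia) ltac:(lia)).
  assert (T := Cmod_triangle_minus (RtoC ((-1) ^ S (S j)) + k 0) (RtoC ((-1) ^ S j) + k 0)).
  replace (RtoC ((-1) ^ S (S j)) + k 0 - (RtoC ((-1) ^ S j) + k 0))%C
    with (RtoC (-2 * (-1) ^ S j)) in T by (apply C_ext; simpl; ring).
  rewrite Cmod_R, Rabs_mult, pow_1_abs, Rabs_left in T by lra. lra.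
Qed.

(** * The sum of digits *)

Definition digits_upto (b N n : nat) : nat := list_sum (map (fun i => digit b i n) (seq 0 N)).

Lemma digits_upto_S b N n : (2 <= b)%nat ->
  digits_upto b (S N) n = (n mod b + digits_upto b N (n / b))%nat.
Proof.
  intros Hb. unfold digits_upto. simpl. unfold digit at 1. rewrite Nat.pow_0_r, Nat.div_1_r.
  f_equal. rewrite <- seq_shift, map_map. f_equal. apply map_ext. intros i. unfold digit.
  rewrite Nat.pow_succ_r', Nat.Div0.div_div. reflexivity.
Qed.

(** The range of digit indices in [digit_sum] depends on n. Padding with zero digits allows n and n
    / b to be compared over a common range. *)
Lemma digits_upto_stable b n : (2 <= b)%nat -> forall N, (S n <= N)%nat ->
  digits_upto b N n = digit_sum b n.
Proof.
  intros Hb. induction n as [n IH] using (well_founded_induction lt_wf). intros N HN.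
  change (digit_sum b n) with (digits_upto b (S n) n).
  destruct N as [|N]; [lia|]. rewrite !digits_upto_S by auto. f_equal.
  destruct (Nat.eq_dec n 0) as [->|Hn].
  - rewrite Nat.Div0.div_0_l. clear. induction N as [|N IH]; [reflexivity|].
    rewrite <- IH. unfold digits_upto. rewrite seq_S, map_app, list_sum_app.
    simpl (list_sum (map _ (cons (0 + N)%nat nil))). unfold digit at 2. rewrite Nat.Div0.div_0_l, Nat.Div0.mod_0_l.
    lia.
  - assert (n / b < n)%nat by (apply Nat.div_lt; lia).
    rewrite (IH (n / b)%nat), (IH (n / b)%nat); auto; lia.
Qed.

Lemma digit_sum_step b n : (2 <= b)%nat ->
  digit_sum b n = (n mod b + digit_sum b (n / b))%nat.
Proof.
  intros Hb. rewrite <- (digits_upto_stable b n Hb (S (S n))) by lia.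
  rewrite digits_upto_S by auto. f_equal. apply digits_upto_stable; auto.
  assert (n / b <= n)%nat by (apply Nat.Div0.div_le_upper_bound; nia). lia.
Qed.

Lemma digit_sum_0 b : digit_sum b 0 = 0%nat.
Proof. unfold digit_sum, digit. simpl. rewrite Nat.Div0.mod_0_l. reflexivity. Qed.

Lemma digit_sum_mul_add b m r : (2 <= b)%nat -> (r < b)%nat ->
  digit_sum b (b * m + r) = (digit_sum b m + r)%nat.
Proof.
  intros Hb Hr. rewrite digit_sum_step by auto.
  rewrite (Nat.add_comm (b * m)), Nat.mul_comm, Nat.Div0.mod_add, Nat.div_add, Nat.mod_small,
    Nat.div_small by lia. simpl. lia.
Qed.

(** * Jumps and growth of the sum of digits *)

Definition digit_jump (b n : nat) : R := INR (digit_sum b (S n)) - INR (digit_sum b n).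

(** If b does not divide n + 1, passing from n to n + 1 causes no carry; only the last digit
    grows. *)
Lemma digit_jump_indivisible b n : (2 <= b)%nat -> ~ Nat.divide b (S n) -> digit_jump b n = 1.
Proof.
  intros Hb H. unfold digit_jump.
  assert (E := Nat.div_mod (S n) b ltac:(lia)). set (q := (S n / b)%nat) in *.
  assert (L := Nat.mod_upper_bound (S n) b ltac:(lia)). set (r := (S n mod b)%nat) in *.
  destruct r as [|r]; [exfalso; apply H; exists q; lia|].
  rewrite E. replace n with (b * q + r)%nat by lia.
  rewrite !digit_sum_mul_add by lia. rewrite !plus_INR, S_INR. ring.
Qed.

(** At a multiple of b the last digit falls from b - 1 to 0, and the carry acts on the remaining
    digits as the step from m to m + 1. *)
Lemma digit_jump_multiple b m : (2 <= b)%nat ->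
  digit_jump b (b * S m - 1) = digit_jump b m - (INR b - 1).
Proof.
  intros Hb. unfold digit_jump.
  replace (S (b * S m - 1)) with (b * S m + 0)%nat by lia.
  replace (b * S m - 1)%nat with (b * m + (b - 1))%nat by lia.
  rewrite !digit_sum_mul_add by lia. rewrite !plus_INR, minus_INR by lia. simpl. ring.
Qed.

Lemma digit_sum_growth b e : (2 <= b)%nat -> 0 < e ->
  exists K, 0 < K /\ forall n, INR (digit_sum b n) <= K * Rpower (INR n + 1) e /\
    INR (digit_sum b (S n)) <= K * Rpower (INR n + 1) e /\ 1 <= Rpower (INR n + 1) e.
Proof.
  intros Hb He. assert (HB : 2 <= INR b) by (change 2 with (INR 2); apply le_INR; auto).
  set (q := Rpower (INR b) (- e)).
  assert (Hq : 0 < q < 1).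
  { split; [apply Rpower_pos|]. unfold q, Rpower. rewrite <- exp_0. apply exp_increasing.
    assert (0 < ln (INR b)) by (rewrite <- ln_1; apply ln_increasing; lra). nra. }
  set (K := INR b / (1 - q)).
  assert (HK : INR b = K * (1 - q)) by (unfold K; field; lra).
  assert (K0 : 0 < K) by (unfold K; apply Rdiv_lt_0_compat; lra).
  assert (P1 : forall n, 1 <= Rpower (INR n + 1) e).
  { intros n. assert (Hn := pos_INR n). unfold Rpower. rewrite <- exp_0 at 1. apply exp_le_compat.
    assert (A : ln 1 <= ln (INR n + 1)) by (apply ln_le; lra). rewrite ln_1 in A. nra. }
  assert (G : forall n, (1 <= n)%nat -> INR (digit_sum b n) <= K * Rpower (INR n) e).
  { induction n as [n IH] using (well_founded_induction lt_wf). intros Hn.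
    assert (N1 : 1 <= INR n) by (change 1 with (INR 1); apply le_INR; auto).
    assert (Pn : 1 <= Rpower (INR n) e).
    { replace (INR n) with (INR (n - 1) + 1); [apply P1|]. rewrite minus_INR by auto. simpl. ring. }
    rewrite digit_sum_step, plus_INR by auto.
    assert (R1 : INR (n mod b) <= INR b)
      by (apply le_INR; generalize (Nat.mod_upper_bound n b); lia).
    destruct (Nat.eq_dec (n / b) 0) as [E|E].
    - rewrite E, digit_sum_0. change (INR 0) with 0. nra.
    - assert (IH' := IH (n / b)%nat ltac:(apply Nat.div_lt; lia) ltac:(lia)).
      assert (D : INR (n / b) <= / INR b * INR n).
      { apply (Rmult_le_reg_l (INR b)); [lra|]. rewrite <- Rmult_assoc, Rinv_r, Rmult_1_l by lra.
        rewrite <- mult_INR. apply le_INR, Nat.Div0.mul_div_le. }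
      assert (D0 : 0 < INR (n / b)) by (apply lt_0_INR; lia).
      assert (D2 : Rpower (INR (n / b)) e <= q * Rpower (INR n) e).
      { replace q with (Rpower (/ INR b) e)
          by (unfold q, Rpower; rewrite ln_Rinv by lra; f_equal; ring).
        rewrite Rpower_mult_distr by (try apply Rinv_0_lt_compat; lra).
        apply Rle_Rpower_l; lra. }
      apply Rle_trans with (INR b * Rpower (INR n) e + K * (q * Rpower (INR n) e)).
      + apply Rplus_le_compat; [nra|].
        eapply Rle_trans; [exact IH'|]. apply Rmult_le_compat_l; lra.
      + rewrite HK at 1. right. ring. }
  exists K. split; auto. intros n. split; [|split; auto].
  - destruct n as [|n].
    + rewrite digit_sum_0. specialize (P1 0%nat). change (INR 0) with 0 at 1. nra.
    + eapply Rle_trans; [apply G; lia|]. apply Rmult_le_compat_l; [lra|].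
      apply Rle_Rpower_l; [lra|]. generalize (lt_0_INR (S n) ltac:(lia)). lra.
  - rewrite <- (S_INR n). apply G. lia.
Qed.

Lemma ex_series_subpolynomial (c : nat -> R) p : 1 < p ->
  (forall e, 0 < e -> exists K, forall n, Rabs (c n) <= K * Rpower (INR n + 1) e) ->
  ex_series (fun n => Rabs (c n) * Rpower (INR n + 1) (- p)).
Proof.
  intros Hp G. destruct (G ((p - 1) / 2) ltac:(lra)) as [K HK].
  apply (ex_series_le (V := R_CompleteNormedModule) _
    (fun n => K * Rpower (INR n + 1) (- ((p + 1) / 2)))).
  - intros n. change (norm ?x) with (Rabs x).
    rewrite Rabs_mult, Rabs_Rabsolu, (Rabs_pos_eq (Rpower _ _)) by (left; apply Rpower_pos).
    apply Rle_trans with (K * Rpower (INR n + 1) ((p - 1) / 2) * Rpower (INR n + 1) (- p)).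
    + apply Rmult_le_compat_r; [left; apply Rpower_pos|apply HK].
    + right. replace (- ((p + 1) / 2)) with ((p - 1) / 2 + - p) by field.
      rewrite Rpower_plus. ring.
  - apply (ex_series_scal (V := R_NormedModule) K (fun n => Rpower (INR n + 1) (- ((p + 1) / 2)))).
    apply ex_series_Rpower; lra.
Qed.

Lemma digit_sum_summable b p : (2 <= b)%nat -> 1 < p ->
  ex_series (fun n => Rabs (INR (digit_sum b (S n))) * Rpower (INR n + 1) (- p)).
Proof.
  intros Hb Hp. apply (ex_series_subpolynomial (fun n => INR (digit_sum b (S n)))); auto.
  intros e He. destruct (digit_sum_growth b e Hb He) as [K [HK G]]. exists K. intros n.
  rewrite Rabs_pos_eq by apply pos_INR. apply G.
Qed.

Lemma digit_jump_summable b p : (2 <= b)%nat -> 1 < p ->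
  ex_series (fun n => Rabs (digit_jump b n - 1) * Rpower (INR n + 1) (- p)).
Proof.
  intros Hb Hp. apply (ex_series_subpolynomial (fun n => digit_jump b n - 1)); auto.
  intros e He. destruct (digit_sum_growth b e Hb He) as [K [HK G]]. exists (K + 1). intros n.
  destruct (G n) as [G1 [G2 G3]]. unfold digit_jump.
  assert (H1 := pos_INR (digit_sum b n)). assert (H2 := pos_INR (digit_sum b (S n))).
  apply Rabs_le. lra.
Qed.

Lemma csums_dominated (c : nat -> R) w : 1 < Re w ->
  (forall p, 1 < p -> ex_series (fun n => Rabs (c n) * Rpower (INR n + 1) (- p))) ->
  exists l, csums (fun n => RtoC (c n) * Rpow_C (INR n + 1) (- w))%C l.
Proof.
  intros Hw H. eexists. apply Cser_correct with (M := fun n => Rabs (c n) * Rpower (INR n + 1) (- Re w)).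
  - intros n. rewrite Cmod_mult, Cmod_R, Cmod_Rpow_C. right. reflexivity.
  - apply H, Hw.
Qed.

Lemma Rpow_C_eq_1 x w : 1 < x -> Rpow_C x w = RtoC 1 -> Re w = 0.
Proof.
  intros Hx H. apply (f_equal Cmod) in H. rewrite Cmod_Rpow_C, Cmod_1 in H.
  unfold Rpower in H. rewrite <- exp_0 in H. apply exp_inv in H.
  assert (0 < ln x) by (rewrite <- ln_1; apply ln_increasing; lra). nra.
Qed.

(* The excess over 1 of the jumps is supported on multiples of [b] and is
   self-similar there, hence its Dirichlet series [X] satisfies
   [X = b^-w (X - (b-1) zeta)]. *)
Lemma digit_jump_series b w : (2 <= b)%nat -> 1 < Re w ->
  csums (fun n => RtoC (digit_jump b n) * Rpow_C (INR n + 1) (- w))%C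
    (hurwitz 1 w * (Rpow_C (INR b) w - RtoC (INR b)) / (Rpow_C (INR b) w - 1))%C.
Proof.
  intros Hb Hw. assert (HB : 2 <= INR b) by (change 2 with (INR 2); apply le_INR; auto).
  destruct (csums_dominated (fun n => digit_jump b n - 1) w Hw
    (fun p Hp => digit_jump_summable b p Hb Hp)) as [X HX].
  assert (HZ := hurwitz_correct 1 w ltac:(lra) Hw). set (Z := hurwitz 1 w) in *.
  set (q := Rpow_C (INR b) w).
  assert (Nq : q <> RtoC 0) by apply Rpow_C_neq0.
  assert (Nq1 : (q - 1)%C <> RtoC 0).
  { apply Cminus_neq0. intros E. apply Rpow_C_eq_1 in E; lra. }
  assert (E : X = (/ q * (X - RtoC (INR b - 1) * Z))%C).
  { apply (csums_unique _ _ _ HX).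
    apply (csums_multiples b (fun m => / q * (RtoC (digit_jump b m - 1) * Rpow_C (INR m + 1) (- w)
        - RtoC (INR b - 1) * Rpow_C (INR m + 1) (- w)))%C); [lia| | |].
    - intros m. rewrite digit_jump_multiple by auto.
      rewrite <- (S_INR (b * S m - 1)). replace (S (b * S m - 1)) with (b * S m)%nat by lia.
      rewrite mult_INR, Rpow_C_mult, <- S_INR, (Rpow_C_opp (INR b)); [|lra|apply lt_0_INR; lia].
      fold q. rewrite !RtoC_minus. ring.
    - intros n Hn. rewrite digit_jump_indivisible by auto. rewrite RtoC_minus. ring.
    - apply csums_scal, csums_minus; auto. apply csums_scal, HZ. }
  assert (G : (X = - (RtoC (INR b - 1) * Z) / (q - 1))%C).
  { apply (f_equal (fun y => q * y)%C) in E. rewrite Cmult_assoc, Cinv_r, Cmult_1_l in E by auto.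
    replace (- (RtoC (INR b - 1) * Z))%C with ((q - 1) * X)%C.
    - field. auto.
    - transitivity (q * X - X)%C; [ring|]. rewrite E. ring. }
  replace (Z * (q - RtoC (INR b)) / (q - 1))%C with (X + Z)%C.
  - eapply csums_ext; [|apply csums_plus; [exact HX|exact HZ]].
    intros n. cbv beta. rewrite RtoC_minus. ring.
  - rewrite G, RtoC_minus. field. auto.
Qed.

Lemma digit_sum_abel b w : (2 <= b)%nat -> 1 < Re w ->
  csums (fun n => RtoC (INR (digit_sum b (S n))) *
      (Rpow_C (INR n + 1) (- w) - Rpow_C (INR n + 1 + 1) (- w)))%C
    (hurwitz 1 w * (Rpow_C (INR b) w - RtoC (INR b)) / (Rpow_C (INR b) w - 1))%C.
Proof.
  intros Hb Hw. assert (H := digit_jump_series b w Hb Hw).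
  set (l := (hurwitz 1 w * (Rpow_C (INR b) w - RtoC (INR b)) / (Rpow_C (INR b) w - 1))%C) in *.
  set (p := fun n => Rpow_C (INR n + 1) (- w)).
  assert (S0 : forall n, csum (fun n => RtoC (INR (digit_sum b (S n))) *
      (Rpow_C (INR n + 1) (- w) - Rpow_C (INR n + 1 + 1) (- w)))%C n =
    (csum (fun n => RtoC (digit_jump b n) * Rpow_C (INR n + 1) (- w)) n
     - RtoC (INR (digit_sum b n)) * p n)%C).
  { induction n as [|n IH].
    - rewrite digit_sum_0. simpl. ring.
    - rewrite !csum_S, IH. unfold digit_jump, p. rewrite RtoC_minus, S_INR. ring. }
  assert (B : ex_series (fun n => Rabs (INR (digit_sum b n)) * Rpower (INR n + 1) (- Re w))).
  { apply (ex_series_subpolynomial (fun n => INR (digit_sum b n))); auto.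
    intros e He. destruct (digit_sum_growth b e Hb He) as [K [HK G]]. exists K. intros n.
    rewrite Rabs_pos_eq by apply pos_INR. apply G. }
  apply ex_series_lim_0, is_lim_seq_spec in B.
  intros eps He. destruct (H (eps / 2) ltac:(lra)) as [N1 K1].
  destruct (B (mkposreal (eps / 2) ltac:(lra))) as [N2 K2]. simpl in K2.
  exists (Nat.max N1 N2). intros n Hn. rewrite S0.
  specialize (K1 n ltac:(lia)). specialize (K2 n ltac:(lia)).
  replace (csum (fun n => RtoC (digit_jump b n) * Rpow_C (INR n + 1) (- w)) n
     - RtoC (INR (digit_sum b n)) * p n - l)%C with
    ((csum (fun n => RtoC (digit_jump b n) * Rpow_C (INR n + 1) (- w)) n - l)
     - RtoC (INR (digit_sum b n)) * p n)%C by ring.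
  eapply Rle_lt_trans; [apply Cmod_triangle_minus|].
  assert (E : Cmod (RtoC (INR (digit_sum b n)) * p n) < eps / 2); [|lra].
  unfold p. rewrite Cmod_mult, Cmod_R, Cmod_Rpow_C. change (Re (- w)) with (- Re w).
  rewrite Rminus_0_r, Rabs_pos_eq in K2; [exact K2|].
  apply Rmult_le_pos; [apply Rabs_pos|left; apply Rpower_pos].
Qed.

(** * Continuation of the Dirichlet series of the sum of digits *)

Lemma cderiv_unique f z l m : cderiv f z l -> cderiv f z m -> l = m.
Proof.
  intros Hl Hm. apply Ceq_minus, Cmod_0_eq. intros eps He.
  destruct (Hl (eps / 2) ltac:(lra)) as [d1 [D1 K1]].
  destruct (Hm (eps / 2) ltac:(lra)) as [d2 [D2 K2]].
  set (h := Rmin d1 d2 / 2). assert (Hd := Rmin_pos _ _ D1 D2).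
  assert (M1 := Rmin_l d1 d2). assert (M2 := Rmin_r d1 d2).
  set (w := (z + RtoC h)%C).
  assert (E : Cmod (w - z) = h).
  { replace (w - z)%C with (RtoC h) by (unfold w; ring). rewrite Cmod_R, Rabs_pos_eq; unfold h; lra. }
  specialize (K1 w ltac:(rewrite E; unfold h; lra)). specialize (K2 w ltac:(rewrite E; unfold h; lra)).
  apply (Rmult_le_reg_r h); [unfold h; lra|].
  rewrite <- E at 1. rewrite <- Cmod_mult.
  replace ((l - m) * (w - z))%C with
    ((f w - f z - m * (w - z)) - (f w - f z - l * (w - z)))%C by ring.
  eapply Rle_trans; [apply Cmod_triangle_minus|]. rewrite E in *. lra.
Qed.

Lemma csum_hol (f : nat -> C -> C) n z : (forall k, (k < n)%nat -> hol (f k) z) ->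
  hol (fun w => csum (fun k => f k w) n) z.
Proof.
  intros H. induction n as [|n IH].
  - apply (hol_const (RtoC 0)).
  - apply (hol_plus (fun w => csum (fun k => f k w) n) (f n)); [apply IH; intros; apply H|apply H]; lia.
Qed.

Lemma csum_remove f n k0 : (k0 < n)%nat ->
  csum f n = (f k0 + csum (fun k => if Nat.eqb k k0 then RtoC 0 else f k) n)%C.
Proof.
  induction n as [|n IH]; [lia|]. intros H. rewrite !csum_S.
  destruct (Nat.eqb_spec n k0) as [->|Hn].
  - rewrite (csum_ext f (fun k => if Nat.eqb k k0 then RtoC 0 else f k)); [ring|].
    intros k Hk. destruct (Nat.eqb_spec k k0); [lia|reflexivity].
  - rewrite IH by lia. ring.
Qed.

Lemma rising_0 k : (1 <= k)%nat -> rising (RtoC 0) k = RtoC 0.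
Proof. destruct k as [|k]; [lia|]. intros _. rewrite rising_S. ring. Qed.

Lemma em_tail_0 d a K : 0 < a -> em_tail d a K (RtoC 0) = RtoC 0.
Proof.
  intros Ha. unfold em_tail.
  replace (fun n => RtoC (d n) * em_diff K 0 (INR n + a))%C with (fun _ : nat => RtoC 0).
  - unfold Cser. simpl. rewrite (Series_ext _ (fun n => 0 * 0)) by (intros; ring).
    rewrite Series_scal_l, Rmult_0_l. reflexivity.
  - apply functional_extensionality. intros n. assert (Hn := pos_INR n).
    replace (em_diff K 0 (INR n + a)) with (RtoC 0); [ring|].
    symmetry. apply Cmod_0_eq. intros eps He.
    eapply Rle_trans; [apply em_diff_bound; [lra|]|].
    + simpl Re. generalize (pos_INR (S (S K))). lra.
    + rewrite rising_0, Cmod_0, Rmult_0_r, Rmult_0_l by lia. lra.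
Qed.

(** Near u0 only the k0-th term may be singular; all other terms and the tail are collected in [R].
    The last clause serves the double pole: at u = 0 the terms with k >= 1 and the tail contain the
    factor u. The order [K + k0] ensures that the k0-th term is present. *)
Lemma em_ext_isolate d a g u0 k0 : em_data d a g ->
  (forall k, k <> k0 -> hol g (u0 + RtoC (INR k))%C) ->
  exists R, hol R u0 /\
    (forall u, Cmod (u - u0) < 1 ->
       em_ext d a g u = (em_coef k0 u * g (u + RtoC (INR k0)) + R u)%C) /\
    (u0 = RtoC 0 -> k0 = 0%nat -> R (RtoC 0) = RtoC 0).
Proof.
  intros D Hg. destruct (nat_above (1 - Re u0 + INR k0)) as [K HK].
  assert (Hk0 := pos_INR k0).
  assert (N0 := Re_near u0 u0 1).
  assert (Kk : (S K > k0)%nat \/ (K < k0)%nat) by lia.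
  exists (fun u => csum (fun k => if Nat.eqb k k0 then RtoC 0 else
      em_coef k u * g (u + RtoC (INR k)))%C (S (K + k0)) - em_tail d a (K + k0) u)%C.
  split; [|split].
  - apply hol_minus.
    + apply (csum_hol (fun k u => if Nat.eqb k k0 then RtoC 0 else
        em_coef k u * g (u + RtoC (INR k)))%C). intros k _.
      destruct (Nat.eqb_spec k k0) as [_|Hk]; [apply hol_const|].
      apply hol_mult.
      * apply hol_everywhere. intros w. apply (em_coef_cdiff k (fun w => w)), cdiff_id.
      * apply (hol_comp (fun u => u + RtoC (INR k))%C g); [auto|].
        apply hol_plus; [apply hol_id|apply hol_const].
    + apply (em_tail_hol d a g); auto. rewrite S_INR, plus_INR. lra.
  - intros u Hu. apply Re_near in Hu.
    rewrite (em_ext_eq d a g (K + k0)) by (auto; rewrite plus_INR; lra). unfold em_sum.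
    rewrite (csum_remove _ _ k0) by lia. ring.
  - intros -> ->. rewrite em_tail_0 by (generalize (em_ge_1 _ _ _ D); lra).
    rewrite (csum_ext _ (fun _ => 0 * 0)%C).
    + rewrite csum_scal. ring.
    + intros k _. destruct (Nat.eqb_spec k 0) as [_|Hk]; [ring|].
      unfold em_coef. rewrite rising_0 by lia. ring.
Qed.

Lemma em_ext_hol d a g u0 : em_data d a g -> (forall k, hol g (u0 + RtoC (INR k))%C) ->
  hol (em_ext d a g) u0.
Proof.
  intros D Hg. destruct (em_ext_isolate d a g u0 0 D ltac:(auto)) as [R [HR [E _]]].
  eapply hol_ext_loc; [exact Rlt_0_1|intros w Hw; symmetry; apply E, Hw|].
  apply hol_plus; auto. apply hol_mult.
  - apply hol_everywhere. intros w. apply (em_coef_cdiff 0 (fun w => w)), cdiff_id.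
  - apply (hol_comp (fun u => u + RtoC (INR 0))%C g); [auto|].
    apply hol_plus; [apply hol_id|apply hol_const].
Qed.

(** * Poles *)

(** If [f] is holomorphic at z, then g - f (w - z)^n is continuous with the nonzero value g(z) at z;
    but it vanishes at nearby points, which contradicts continuity. *)
Lemma hol_not_pole f z : hol f z -> ~ is_pole f z.
Proof.
  intros Hf [n [Hn [g [Hg [Nz E]]]]]. apply holomorphic_at_hol in Hg.
  apply locally'_C_Cmod in E. destruct E as [d [Hd E]].
  assert (C1 : ccont (fun w => g w - f w * (w - z) ^ n)%C z).
  { apply cdiff_ccont, cdiff_minus; [apply hol_cdiff, Hg|]. apply cdiff_mult; [apply hol_cdiff, Hf|].
    apply cdiff_pow, cdiff_minus; [apply cdiff_id|apply cdiff_const]. }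
  assert (V : (g z - f z * (z - z) ^ n)%C = g z).
  { destruct n as [|n]; [lia|]. simpl. ring. }
  destruct (ccont_neq0 _ _ C1 ltac:(cbv beta; rewrite V; exact Nz)) as [r [Hr K]].
  set (h := Rmin d r / 2). assert (Hm := Rmin_pos _ _ Hd Hr).
  assert (M1 := Rmin_l d r). assert (M2 := Rmin_r d r).
  set (w := (z + RtoC h)%C).
  assert (Ew : (w - z)%C = RtoC h) by (unfold w; ring).
  assert (Aw : Cmod (w - z) = h) by (rewrite Ew, Cmod_R, Rabs_pos_eq; unfold h; lra).
  assert (Hw : (w - z)%C <> RtoC 0) by (rewrite Ew; intros Z; apply RtoC_inj in Z; unfold h in Z; lra).
  specialize (K w ltac:(rewrite Aw; unfold h; lra)). cbv beta in K.
  rewrite (E w) in K; [|rewrite Aw; unfold h; lra|intros Z; apply Hw; rewrite Z; ring].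
  replace (g w - g w / (w - z) ^ n * (w - z) ^ n)%C with (RtoC 0) in K
    by (field; apply Cpow_nz, Hw).
  rewrite Cmod_0 in K. generalize (Cmod_ge_0 (g z - f z * (z - z) ^ n)). lra.
Qed.

Lemma simple_pole_of_quotient f N R z d : 0 < d -> hol N z -> hol R z -> N z <> RtoC 0 ->
  (forall w, Cmod (w - z) < d -> w <> z -> f w = (N w / (w - z) + R w)%C) ->
  simple_pole f z /\ is_residue f z (N z).
Proof.
  intros Hd HN HR Nz E. split.
  - split; [lia|]. exists (fun w => N w + R w * (w - z))%C. split; [|split].
    + apply holomorphic_at_hol, hol_plus; auto. apply hol_mult; auto.
      apply hol_minus; [apply hol_id|apply hol_const].
    + replace (N z + R z * (z - z))%C with (N z) by ring. exact Nz.
    + apply locally'_C_Cmod. exists d. split; auto. intros w Hw Hwz.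
      rewrite (E w Hw Hwz). assert (Q := Cminus_neq0 _ _ Hwz). simpl. field. auto.
  - destruct (hol_divided_difference N z HN) as [g [r [Hr [Hg G]]]].
    (* [sum_n] up to 0 has the single term j = 0, so the principal part has length one; the rest of
       [N] is absorbed by its divided difference. *)
    exists 0%nat, (fun _ => N z), (fun w => g w + R w)%C. split; [|split; auto].
    + apply holomorphic_at_hol, hol_plus; auto.
    + apply locally'_C_Cmod. exists (Rmin d r). split; [apply Rmin_pos; auto|]. intros w Hw Hwz.
      assert (M1 := Rmin_l d r). assert (M2 := Rmin_r d r).
      rewrite (E w), (G w), sum_O by (auto; lra). assert (Q := Cminus_neq0 _ _ Hwz).
      simpl. field. auto.
Qed.

(** * The factor 1 / (b^w - 1) *)

(** The entire function (e^z - 1) / z, which lets every zero of b^w - 1 be factored out exactly. *)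
Definition expm1_quot (z : C) : C :=
  if excluded_middle_informative (z = RtoC 0) then RtoC 1 else ((Cexp z - 1) / z)%C.

Lemma expm1_quot_spec z : (Cexp z - 1 = z * expm1_quot z)%C.
Proof.
  unfold expm1_quot. destruct (excluded_middle_informative (z = RtoC 0)) as [->|H].
  - rewrite Cexp_0. ring.
  - field. auto.
Qed.

Lemma expm1_quot_0 : expm1_quot (RtoC 0) = RtoC 1.
Proof. unfold expm1_quot. destruct (excluded_middle_informative _); [auto|congruence]. Qed.

Lemma expm1_quot_cdiff z : cdiff expm1_quot z.
Proof.
  destruct (excluded_middle_informative (z = RtoC 0)) as [->|H].
  - assert (HC : hol Cexp (RtoC 0))
      by (apply hol_everywhere; intros w; apply (cdiff_Cexp (fun w => w)), cdiff_id).
    destruct (hol_divided_difference _ _ HC) as [g [d [Hd [Hg E]]]].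
    assert (G0 : g (RtoC 0) = RtoC 1).
    { rewrite <- Cexp_0. apply (cderiv_unique Cexp (RtoC 0)); [|apply cderiv_Cexp].
      apply (cderiv_of_increment _ _ _ d); auto. apply cdiff_ccont, hol_cdiff, Hg. }
    apply (cdiff_ext_loc g _ _ d); [auto| |apply hol_cdiff, Hg]. intros w Hw.
    unfold expm1_quot. destruct (excluded_middle_informative (w = RtoC 0)) as [->|Nw]; [exact G0|].
    rewrite (E w Hw), Cexp_0. field. auto.
  - apply (cdiff_ext_loc (fun z => (Cexp z - 1) / z)%C _ _ (Cmod z)); [apply Cmod_gt_0; auto| |].
    + intros w Hw. unfold expm1_quot.
      destruct (excluded_middle_informative (w = RtoC 0)) as [->|Nw]; [|reflexivity].
      exfalso. rewrite Cmod_minus_sym in Hw. replace (z - 0)%C with z in Hw by ring. lra.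
    + apply cdiff_div; [|apply cdiff_id|auto].
      apply cdiff_minus; [apply (cdiff_Cexp (fun w => w)), cdiff_id|apply cdiff_const].
Qed.

(* Differentiate [expm1_quot (-z) = exp(-z) expm1_quot z] at 0. *)
Lemma cderiv_expm1_quot_0 : cderiv expm1_quot (RtoC 0) (RtoC (1 / 2)).
Proof.
  destruct (expm1_quot_cdiff (RtoC 0)) as [l Hl].
  assert (E : forall z, expm1_quot (- z) = (Cexp (- z) * expm1_quot z)%C).
  { intros z. assert (H := expm1_quot_spec z). assert (H' := expm1_quot_spec (- z)).
    destruct (excluded_middle_informative (z = RtoC 0)) as [->|Nz].
    - replace (- RtoC 0)%C with (RtoC 0) by ring. rewrite Cexp_0. ring.
    - assert (Q : (z * (expm1_quot (- z) - Cexp (- z) * expm1_quot z) = 0)%C).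
      { transitivity (- (- z * expm1_quot (- z)) - Cexp (- z) * (z * expm1_quot z))%C; [ring|].
        rewrite <- H, <- H', Cexp_opp. field. apply Cexp_neq0. }
      apply Ceq_minus. apply (f_equal (fun y => / z * y)%C) in Q.
      rewrite Cmult_assoc, Cinv_l, Cmult_1_l in Q by auto. rewrite Q. ring. }
  assert (O : cderiv (fun z => - z)%C (RtoC 0) (- RtoC 1)%C) by apply cderiv_opp, cderiv_id.
  assert (D1 : cderiv (fun z => expm1_quot (- z)) (RtoC 0) (l * - RtoC 1)%C).
  { apply (cderiv_comp (fun z => - z)%C expm1_quot); auto.
    replace (- RtoC 0)%C with (RtoC 0) by ring. auto. }
  assert (D2 : cderiv (fun z => Cexp (- z) * expm1_quot z)%C (RtoC 0) (- RtoC 1 + l)%C).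
  { eapply cderiv_eq; [|apply cderiv_mult; [apply (cderiv_comp (fun z => - z)%C Cexp);
      [apply cderiv_Cexp|exact O]|exact Hl]].
    cbv beta. replace (- RtoC 0)%C with (RtoC 0) by ring. rewrite Cexp_0, expm1_quot_0. ring. }
  assert (U := cderiv_unique _ _ _ _ (cderiv_ext _ _ _ _ E D1) D2).
  eapply cderiv_eq; [|exact Hl].
  destruct l as [x y]. injection U. intros U2 U1. apply C_ext; unfold RtoC; simpl; lra.
Qed.

Lemma ln_base_pos b : (2 <= b)%nat -> 0 < ln (INR b).
Proof.
  intros Hb. apply le_INR in Hb. change (INR 2) with 2 in Hb.
  rewrite <- ln_1. apply ln_increasing; lra.
Qed.

Lemma RtoC_neq0 x : x <> 0 -> RtoC x <> RtoC 0.
Proof. intros H E. apply RtoC_inj in E. auto. Qed.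

Lemma omega_eq b m : (2 <= b)%nat -> omega b m = ((0, 2 * PI * IZR m / ln (INR b)) : C).
Proof.
  intros Hb. assert (HL := ln_base_pos b Hb). unfold omega.
  transitivity (Ci * RtoC (2 * PI * IZR m / ln (INR b)))%C.
  - rewrite RtoC_div, !RtoC_mult by lra. field. apply RtoC_neq0. lra.
  - apply C_ext; simpl; ring.
Qed.

Lemma omega_Re b m : (2 <= b)%nat -> Re (omega b m) = 0.
Proof. intros Hb. rewrite omega_eq by auto. reflexivity. Qed.

Lemma omega_0 b : omega b 0 = RtoC 0.
Proof. unfold omega, Cdiv. ring. Qed.

Lemma omega_Im_neq0 b m : (2 <= b)%nat -> m <> 0%Z -> Im (omega b m) <> 0.
Proof.
  intros Hb Hm. rewrite omega_eq by auto. simpl. assert (HL := ln_base_pos b Hb).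
  apply not_0_IZR in Hm. assert (HP := PI_RGT_0). intros E.
  apply Rmult_integral in E. destruct E as [E|E]; [|apply Rinv_neq_0_compat in E; auto; lra].
  apply Rmult_integral in E. destruct E; [lra|contradiction].
Qed.

Lemma omega_neq0 b m : (2 <= b)%nat -> m <> 0%Z -> omega b m <> RtoC 0.
Proof. intros Hb Hm E. apply (omega_Im_neq0 b m Hb Hm). rewrite E. reflexivity. Qed.

Lemma omega_ln b m : (2 <= b)%nat ->
  (omega b m * RtoC (ln (INR b)) = RtoC 2 * RtoC PI * Ci * RtoC (IZR m))%C.
Proof.
  intros Hb. assert (HL := ln_base_pos b Hb). unfold omega. field. apply RtoC_neq0. lra.
Qed.

Lemma Rpow_C_base_eq_1 b w : (2 <= b)%nat ->
  Rpow_C (INR b) w = RtoC 1 <-> exists m, w = omega b m.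
Proof.
  intros Hb. assert (HL := ln_base_pos b Hb).
  assert (NL : RtoC (ln (INR b)) <> RtoC 0) by (apply RtoC_neq0; lra).
  unfold Rpow_C. rewrite Cexp_eq_1. split; intros [m E]; exists m.
  - unfold omega. rewrite <- E. field. auto.
  - rewrite E. apply omega_ln, Hb.
Qed.

Lemma Rpow_C_base_minus_1 b m w : (2 <= b)%nat ->
  (Rpow_C (INR b) w - 1 = (w - omega b m) *
     (RtoC (ln (INR b)) * expm1_quot (RtoC (ln (INR b)) * (w - omega b m))))%C.
Proof.
  intros Hb. set (L := RtoC (ln (INR b))).
  transitivity (L * (w - omega b m) * expm1_quot (L * (w - omega b m)))%C; [|ring].
  rewrite <- expm1_quot_spec. f_equal. unfold Rpow_C. fold L.
  replace (w * L)%C with (L * (w - omega b m) + omega b m * L)%C by ring.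
  rewrite Cexp_plus. replace (Cexp (omega b m * L)) with (RtoC 1); [ring|].
  symmetry. apply Cexp_eq_1. exists m. apply omega_ln, Hb.
Qed.

(* [zeta w * (b^w - b)], with the pole of zeta at 1 cancelled. *)
Definition jump_num (b : nat) (w : C) : C :=
  (hurwitz1 1 (w - 1) * (RtoC (INR b) *
     (RtoC (ln (INR b)) * expm1_quot (RtoC (ln (INR b)) * (w - 1)))))%C.

Definition jump_ext (b : nat) (w : C) : C := (jump_num b w / (Rpow_C (INR b) w - 1))%C.

Lemma jump_num_eq b w : (2 <= b)%nat -> w <> RtoC 1 ->
  jump_num b w = (hurwitz 1 w * (Rpow_C (INR b) w - RtoC (INR b)))%C.
Proof.
  intros Hb Hw. unfold jump_num, hurwitz. set (L := RtoC (ln (INR b))).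
  assert (Nw := Cminus_neq0 _ _ Hw).
  assert (HB : 0 < INR b) by (apply lt_0_INR; lia).
  replace (Rpow_C (INR b) w - RtoC (INR b))%C with (RtoC (INR b) * (Cexp (L * (w - 1)) - 1))%C.
  - rewrite expm1_quot_spec. field. auto.
  - replace w with (w - 1 + 1)%C at 2 by ring. rewrite Rpow_C_plus, (Rpow_C_1 (INR b)) by auto.
    unfold Rpow_C. fold L. rewrite (Cmult_comm L). ring.
Qed.

Lemma expm1_quot_affine_cdiff c a z : cdiff (fun w => expm1_quot (c * (w - a)))%C z.
Proof.
  apply (cdiff_comp (fun w => c * (w - a))%C expm1_quot); [apply expm1_quot_cdiff|].
  apply cdiff_mult; [apply cdiff_const|]. apply cdiff_minus; [apply cdiff_id|apply cdiff_const].
Qed.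

Lemma jump_num_cdiff b z : cdiff (jump_num b) z.
Proof.
  apply cdiff_mult.
  - apply (cdiff_comp (fun w => w - 1)%C (hurwitz1 1)).
    + apply hol_cdiff, hurwitz1_hol. lra.
    + apply cdiff_minus; [apply cdiff_id|apply cdiff_const].
  - apply cdiff_mult; [apply cdiff_const|]. apply cdiff_mult; [apply cdiff_const|].
    apply expm1_quot_affine_cdiff.
Qed.

Lemma jump_ext_hol b w : (2 <= b)%nat -> (forall m, w <> omega b m) -> hol (jump_ext b) w.
Proof.
  intros Hb Hw. apply hol_div.
  - apply hol_everywhere, jump_num_cdiff.
  - apply hol_everywhere. intros z. apply cdiff_minus; [|apply cdiff_const].
    apply (cdiff_Rpow_C _ (fun w => w)), cdiff_id.
  - apply Cminus_neq0. intros E. apply Rpow_C_base_eq_1 in E; auto. destruct E as [m E].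
    apply (Hw m E).
Qed.

Lemma digit_data b : (2 <= b)%nat ->
  em_data (fun n => INR (digit_sum b (S n))) 1 (jump_ext b).
Proof.
  intros Hb. split.
  - lra.
  - intros p Hp. apply digit_sum_summable; auto.
  - intros w Hw. unfold jump_ext. rewrite jump_num_eq; auto.
    + apply digit_sum_abel; auto.
    + intros ->. simpl in Hw. lra.
  - intros w Hw. apply jump_ext_hol; auto. intros m ->. rewrite omega_Re in Hw by auto. lra.
Qed.

(** The product of [jump_ext] and w - omega_m, written so that it has its correct value at omega_m
    itself. *)
Definition jump_polar (b : nat) (m : Z) (w : C) : C :=
  (jump_num b w /
   (RtoC (ln (INR b)) * expm1_quot (RtoC (ln (INR b)) * (w - omega b m))))%C.

Lemma polar_denominator_omega b m :
  (RtoC (ln (INR b)) * expm1_quot (RtoC (ln (INR b)) * (omega b m - omega b m)) =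
   RtoC (ln (INR b)))%C.
Proof.
  replace (RtoC (ln (INR b)) * (omega b m - omega b m))%C with (RtoC 0) by ring.
  rewrite expm1_quot_0. ring.
Qed.

Lemma polar_denominator_cdiff b m z :
  cdiff (fun w => RtoC (ln (INR b)) * expm1_quot (RtoC (ln (INR b)) * (w - omega b m)))%C z.
Proof. apply cdiff_mult; [apply cdiff_const|apply expm1_quot_affine_cdiff]. Qed.

Lemma jump_polar_hol b m : (2 <= b)%nat -> hol (jump_polar b m) (omega b m).
Proof.
  intros Hb. assert (HL := ln_base_pos b Hb). apply hol_div.
  - apply hol_everywhere, jump_num_cdiff.
  - apply hol_everywhere. intros w. apply polar_denominator_cdiff.
  - rewrite polar_denominator_omega. apply RtoC_neq0. lra.
Qed.

Lemma jump_polar_eq b m : (2 <= b)%nat -> exists d, 0 < d /\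
  forall w, Cmod (w - omega b m) < d -> w <> omega b m ->
    jump_ext b w = (jump_polar b m w / (w - omega b m))%C.
Proof.
  intros Hb. assert (HL := ln_base_pos b Hb).
  destruct (ccont_neq0 (fun w => RtoC (ln (INR b)) *
    expm1_quot (RtoC (ln (INR b)) * (w - omega b m)))%C (omega b m)) as [d [Hd K]].
  - apply cdiff_ccont, polar_denominator_cdiff.
  - cbv beta. rewrite polar_denominator_omega. apply RtoC_neq0. lra.
  - exists d. split; auto. intros w Hw Nw. specialize (K w Hw). cbv beta in K.
    unfold jump_ext, jump_polar. rewrite (Rpow_C_base_minus_1 b m) by auto.
    set (D := (RtoC (ln (INR b)) * expm1_quot (RtoC (ln (INR b)) * (w - omega b m)))%C) in *.
    assert (ND : D <> RtoC 0).
    { intros E. rewrite E, Cmod_0 in K. generalize (Cmod_ge_0 (RtoC (ln (INR b)) *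
        expm1_quot (RtoC (ln (INR b)) * (omega b m - omega b m)))). lra. }
    assert (Q := Cminus_neq0 _ _ Nw). field. auto.
Qed.

Lemma jump_polar_omega b m : (2 <= b)%nat ->
  jump_polar b m (omega b m) =
  (zeta (omega b m) * (1 - RtoC (INR b)) / RtoC (ln (INR b)))%C.
Proof.
  intros Hb. unfold jump_polar. rewrite polar_denominator_omega.
  assert (HR := omega_Re b m Hb).
  rewrite jump_num_eq by (auto; intros E; rewrite E in HR; simpl in HR; lra).
  rewrite zeta_hurwitz by lra.
  rewrite (proj2 (Rpow_C_base_eq_1 b (omega b m) Hb)) by eauto. reflexivity.
Qed.

Lemma zeta_omega_neq0 b m : (2 <= b)%nat -> zeta (omega b m) <> RtoC 0.
Proof.
  intros Hb. destruct (Z.eq_dec m 0) as [->|Hm].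
  - rewrite omega_0, zeta_0. apply RtoC_neq0. lra.
  - assert (HI := omega_Im_neq0 b m Hb Hm). rewrite zeta_hurwitz by (rewrite omega_Re by auto; lra).
    rewrite omega_eq in * by auto. apply zeta_imaginary_axis_neq0, HI.
Qed.

Lemma jump_polar_omega_neq0 b m : (2 <= b)%nat -> jump_polar b m (omega b m) <> RtoC 0.
Proof.
  intros Hb. rewrite jump_polar_omega by auto. assert (HL := ln_base_pos b Hb).
  apply le_INR in Hb as HB. change (INR 2) with 2 in HB.
  apply Cmult_neq_0; [apply Cmult_neq_0|].
  - apply zeta_omega_neq0, Hb.
  - rewrite <- RtoC_minus. apply RtoC_neq0. lra.
  - rewrite <- RtoC_inv by lra. apply RtoC_neq0, Rinv_neq_0_compat. lra.
Qed.

(** Source of the simple polar part at s = 1. The quotient rule combines zeta(0) = -1/2, zeta'(0)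
    and the derivative log b of b^w in the numerator with (log b)^2 / 2 in the denominator, the
    latter from [cderiv_expm1_quot_0]. *)
Lemma cderiv_jump_polar_0 b : (2 <= b)%nat -> cderiv (jump_polar b 0) (RtoC 0)
  (RtoC ((INR b - 1) / (2 * ln (INR b)) * ln (2 * PI) - (INR b + 1) / 4)).
Proof.
  intros Hb. assert (HL := ln_base_pos b Hb). set (L := ln (INR b)) in *.
  assert (NL : RtoC L <> RtoC 0) by (apply RtoC_neq0; lra).
  assert (HN : cderiv (jump_num b) (RtoC 0)
    (RtoC (- (1 / 2) * ln (2 * PI)) * (1 - RtoC (INR b)) + RtoC (- (1 / 2)) * RtoC L)%C).
  { apply (cderiv_ext_loc (fun w => zeta w * (Rpow_C (INR b) w - RtoC (INR b)))%C _ _ _ 1); [lra| |].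
    - intros w Hw. apply Re_near in Hw. simpl in Hw.
      rewrite jump_num_eq, zeta_hurwitz; auto; [lra|]. intros ->. simpl in Hw. lra.
    - eapply cderiv_eq; [|apply cderiv_mult; [exact cderiv_zeta_0|apply cderiv_minus;
        [apply (cderiv_Rpow_C _ (fun w => w)), cderiv_id|apply cderiv_const]]].
      cbv beta. rewrite zeta_0, Rpow_C_0. fold L. f_equal; ring. }
  assert (HD : cderiv (fun w => RtoC L * expm1_quot (RtoC L * (w - omega b 0)))%C (RtoC 0)
    (RtoC (L * L / 2))).
  { eapply cderiv_eq; [|apply cderiv_scal, (cderiv_comp (fun w => RtoC L * (w - omega b 0))%C expm1_quot);
      [|apply cderiv_scal, cderiv_minus; [apply cderiv_id|apply cderiv_const]]].
    2:{ cbv beta. rewrite omega_0. replace (RtoC L * (0 - 0))%C with (RtoC 0) by ring.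
        apply cderiv_expm1_quot_0. }
    apply C_ext; simpl; field. }
  assert (VD : (RtoC L * expm1_quot (RtoC L * (0 - omega b 0)))%C = RtoC L)
    by (assert (H := polar_denominator_omega b 0); rewrite omega_0 in *; exact H).
  assert (VN : jump_num b (RtoC 0) = RtoC (- (1 / 2) * (1 - INR b))).
  { rewrite jump_num_eq by (auto; intros E; apply RtoC_inj in E; lra).
    rewrite <- zeta_hurwitz, zeta_0, Rpow_C_0 by (simpl; lra).
    rewrite RtoC_mult, RtoC_minus. reflexivity. }
  eapply cderiv_eq; [|apply (cderiv_mult (jump_num b)); [exact HN|apply cderiv_inv; [exact HD|]]].
  - cbv beta. fold L. rewrite VD, VN. unfold Cdiv. rewrite <- !RtoC_mult, <- !RtoC_inv by nra.
    apply C_ext; simpl; field; lra.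
  - cbv beta. fold L. rewrite VD. auto.
Qed.

(** * The continued function F and its poles *)

Definition digit_ext (b : nat) : C -> C :=
  em_ext (fun n => INR (digit_sum b (S n))) 1 (jump_ext b).

Definition digit_zeta (b : nat) (s : C) : C := (digit_ext b (s - 1) / (s - 1))%C.

Lemma digit_zeta_dirichlet b s : (2 <= b)%nat -> 1 < Re s ->
  is_dirichlet_series (fun n => RtoC (INR (digit_sum b n))) s (digit_zeta b s).
Proof.
  intros Hb Hs. assert (D := digit_data b Hb). apply is_dirichlet_series_csums.
  assert (E := em_ext_series _ _ _ (s - 1) D ltac:(change (0 < Re s - 1); lra)).
  unfold digit_zeta, digit_ext. rewrite <- E. replace (s - 1 + 1)%C with s by ring.
  assert (N : (s - 1)%C <> RtoC 0).
  { apply Cminus_neq0. intros ->. simpl in Hs. lra. }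
  replace ((s - 1) * em_series (fun n => INR (digit_sum b (S n))) 1 s / (s - 1))%C
    with (em_series (fun n => INR (digit_sum b (S n))) 1 s) by (field; auto).
  exact (em_series_correct _ _ _ s D Hs).
Qed.

Lemma omega_shift_inj b m m' k k' : (2 <= b)%nat ->
  (omega b m - RtoC (INR k) + RtoC (INR k'))%C = omega b m' -> k' = k.
Proof.
  intros Hb E. apply (f_equal Re) in E.
  change (Re (omega b m) + - INR k + INR k' = Re (omega b m')) in E. rewrite !omega_Re in E by auto.
  apply INR_eq. lra.
Qed.

(** Points omega_m - k with different k have different real parts, so no other term is singular at
    this one. *)
Lemma digit_ext_isolate b m k : (2 <= b)%nat ->
  exists R, hol R (omega b m - RtoC (INR k))%C /\
    (forall u, Cmod (u - (omega b m - RtoC (INR k))) < 1 ->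
       digit_ext b u = (em_coef k u * jump_ext b (u + RtoC (INR k)) + R u)%C) /\
    ((omega b m - RtoC (INR k))%C = RtoC 0 -> k = 0%nat -> R (RtoC 0) = RtoC 0).
Proof.
  intros Hb. apply (em_ext_isolate _ _ _ _ k (digit_data b Hb)).
  intros k' Hk'. apply jump_ext_hol; auto. intros m' E.
  apply Hk', (omega_shift_inj b m m' k k' Hb E).
Qed.

Lemma digit_ext_principal b m k : (2 <= b)%nat ->
  exists R d, 0 < d /\ hol R (omega b m - RtoC (INR k))%C /\
    (forall u, Cmod (u - (omega b m - RtoC (INR k))) < d -> u <> (omega b m - RtoC (INR k))%C ->
       digit_ext b u = (em_coef k u * jump_polar b m (u + RtoC (INR k))
          / (u - (omega b m - RtoC (INR k))) + R u)%C) /\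
    ((omega b m - RtoC (INR k))%C = RtoC 0 -> k = 0%nat -> R (RtoC 0) = RtoC 0).
Proof.
  intros Hb. destruct (digit_ext_isolate b m k Hb) as [R [HR [E R0]]].
  destruct (jump_polar_eq b m Hb) as [d [Hd K]].
  exists R, (Rmin d 1). split; [apply Rmin_pos; lra|]. split; [auto|]. split; [|auto].
  assert (M1 := Rmin_l d 1). assert (M2 := Rmin_r d 1).
  intros u Hu Nu. rewrite E by lra.
  assert (Q : (u + RtoC (INR k) - omega b m)%C = (u - (omega b m - RtoC (INR k)))%C) by ring.
  rewrite K, Q.
  - unfold Cdiv. ring.
  - rewrite Q. lra.
  - intros E'. apply Nu. rewrite <- E'. ring.
Qed.

Lemma hol_shift f z : hol f (z - 1)%C -> hol (fun s => f (s - 1)%C) z.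
Proof. intros H. apply (hol_comp (fun s => s - 1)%C f); auto. apply hol_minus; [apply hol_id|apply hol_const]. Qed.

Lemma em_coef_hol k z : hol (em_coef k) z.
Proof. apply hol_everywhere. intros w. apply (em_coef_cdiff k (fun w => w)), cdiff_id. Qed.

(** Away from u = 0 the denominator u is a unit: the pole stays simple, and its residue is that of u
    F(1 + u) divided by u. The two side conditions exclude u = 0 and a vanishing coefficient. *)
Lemma digit_zeta_simple_pole b m k : (2 <= b)%nat ->
  (omega b m - RtoC (INR k))%C <> RtoC 0 -> em_coef k (omega b m - RtoC (INR k)) <> RtoC 0 ->
  let z := (1 + (omega b m - RtoC (INR k)))%C in
  simple_pole (digit_zeta b) z /\
  is_residue (digit_zeta b) z (em_coef k (omega b m - RtoC (INR k)) *
    (zeta (omega b m) * (1 - RtoC (INR b)) / RtoC (ln (INR b))) / (omega b m - RtoC (INR k)))%C.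
Proof.
  intros Hb N0 NC z. set (v := (omega b m - RtoC (INR k))%C) in *.
  destruct (digit_ext_principal b m k Hb) as [R [d [Hd [HR [E _]]]]]. fold v in HR, E.
  assert (Zv : (z - 1)%C = v) by (unfold z; ring).
  assert (H1 : hol (fun s => s - 1)%C z) by (apply hol_minus; [apply hol_id|apply hol_const]).
  set (N := fun s => (em_coef k (s - 1) * jump_polar b m (s - 1 + RtoC (INR k)) / (s - 1))%C).
  assert (NZ : N z = (em_coef k v * (zeta (omega b m) * (1 - RtoC (INR b)) / RtoC (ln (INR b))) / v)%C).
  { unfold N. rewrite Zv. replace (v + RtoC (INR k))%C with (omega b m) by (unfold v; ring).
    rewrite jump_polar_omega by auto. reflexivity. }
  rewrite <- NZ.
  apply (simple_pole_of_quotient (digit_zeta b) N (fun s => R (s - 1) / (s - 1))%C z d); auto.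
  - apply hol_div; [apply hol_mult| |]; auto.
    + apply (hol_shift (em_coef k)), em_coef_hol.
    + apply (hol_comp (fun s => s - 1 + RtoC (INR k))%C (jump_polar b m)).
      * rewrite Zv. replace (v + RtoC (INR k))%C with (omega b m) by (unfold v; ring).
        apply jump_polar_hol, Hb.
      * apply hol_plus; [auto|apply hol_const].
    + rewrite Zv. auto.
  - apply hol_div; auto; [|rewrite Zv; auto]. apply (hol_shift R). rewrite Zv. auto.
  - rewrite NZ, <- jump_polar_omega by auto. unfold Cdiv. apply Cmult_neq_0.
    + apply Cmult_neq_0; auto. apply jump_polar_omega_neq0, Hb.
    + intros Z. assert (I := Cinv_r v N0). rewrite Z in I. apply (f_equal Re) in I. simpl in I. lra.
  - intros s Hs Ns.
    assert (Q : (s - 1 - v)%C = (s - z)%C) by (unfold z; ring).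
    unfold digit_zeta. rewrite E, Q.
    + unfold N, Cdiv. ring.
    + rewrite Q. exact Hs.
    + intros F. apply Ns. unfold z. rewrite <- F. ring.
Qed.

Lemma rising_neq0 n : forall v, Re v + INR n < 1 -> rising v n <> RtoC 0.
Proof.
  induction n as [|n IH]; intros v Hv.
  - simpl. apply RtoC_neq0. lra.
  - rewrite S_INR in Hv. rewrite rising_S. apply Cmult_neq_0.
    + intros ->. simpl in Hv. generalize (pos_INR n). lra.
    + apply IH. simpl Re. change (fst v) with (Re v). lra.
Qed.

(** The first factor of the rising factorial is the point u itself, which cancels the denominator in
    the residue and leaves the product in the statement. *)
Lemma rising_shift_prod w k :
  rising (w - RtoC (INR (S k))) (S k) = ((w - RtoC (INR (S k))) * shift_prod (S k) w)%C.
Proof.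
  rewrite rising_S. f_equal. induction k as [|k IH].
  - reflexivity.
  - replace (w - RtoC (INR (S (S k))) + 1)%C with (w - RtoC (INR (S k)))%C
      by (rewrite (S_INR (S k)), RtoC_plus; ring).
    rewrite rising_S, IH. unfold shift_prod.
    replace (S (S k) - 1)%nat with (S (S k - 1)) by lia.
    rewrite seq_S, map_app, fold_right_app. cbn [map fold_right].
    replace (1 + (S k - 1))%nat with (S k) by lia.
    assert (G : forall (l : list C) x, fold_right Cmult x l = (x * fold_right Cmult 1 l)%C).
    { induction l as [|y l IHl]; intros x; simpl; [ring|]. rewrite IHl. ring. }
    rewrite (G _ (_ * _)%C). ring.
Qed.

(** With the factor u cancelled, the residue has the sign (-1)^k (1 - b) = (-1)^(k+1) (b - 1). It is
    nonzero since zeta and [bern k] are, and since the rising factorial starts at real part -k, so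
    its k factors have negative real parts. *)
Lemma digit_zeta_poles_shifted b m k : (2 <= b)%nat -> shift_index k ->
  simple_pole (digit_zeta b) (RtoC 1 - RtoC (INR k) + omega b m)%C /\
  is_residue (digit_zeta b) (RtoC 1 - RtoC (INR k) + omega b m)%C
         (RtoC (-1) ^ (k + 1) * RtoC ((INR b - 1) / ln (INR b))
          * zeta (omega b m) * RtoC (bernoulli k / INR (fact k))
          * shift_prod k (omega b m))%C.
Proof.
  intros Hb Hk. assert (HL := ln_base_pos b Hb). fold (bern k).
  assert (K1 : (1 <= k)%nat) by (destruct Hk as [->|[Hk _]]; lia).
  assert (NB : bern k <> 0).
  { destruct Hk as [->|[H2 He]]; [rewrite bern_1; lra|apply bern_even_neq0; auto]. }
  set (v := (omega b m - RtoC (INR k))%C).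
  assert (Rv : Re v = - INR k).
  { change (Re (omega b m) + - INR k = - INR k). rewrite omega_Re by auto. ring. }
  assert (P : 1 <= INR k) by (change 1 with (INR 1); apply le_INR; auto).
  assert (N0 : v <> RtoC 0) by (intros E; rewrite E in Rv; simpl in Rv; lra).
  assert (Hm1 : forall n, ((-1) ^ n)%C <> RtoC 0) by (intros n; apply Cpow_nz, RtoC_neq0; lra).
  assert (NC : em_coef k v <> RtoC 0).
  { apply Cmult_neq_0; [apply Cmult_neq_0; [apply Hm1|apply RtoC_neq0, NB]|].
    apply rising_neq0. rewrite Rv. lra. }
  destruct (digit_zeta_simple_pole b m k Hb N0 NC) as [S1 S2]. fold v in S1, S2.
  replace (1 - RtoC (INR k) + omega b m)%C with (1 + v)%C by (unfold v; ring).
  split; auto. eapply eq_ind; [exact S2|].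
  destruct k as [|k]; [lia|]. unfold em_coef. unfold v at 1. rewrite rising_shift_prod. fold v.
  rewrite RtoC_div, RtoC_minus by lra. rewrite Nat.add_1_r. simpl Cpow.
  field. split; auto. apply RtoC_neq0. lra.
Qed.

Lemma digit_zeta_poles_line_1 b m : (2 <= b)%nat -> m <> 0%Z ->
  simple_pole (digit_zeta b) (RtoC 1 + omega b m)%C /\
  is_residue (digit_zeta b) (RtoC 1 + omega b m)%C
         (- (RtoC (INR b - 1) / (RtoC 2 * RtoC PI * Ci * RtoC (IZR m)))
          * zeta (omega b m))%C.
Proof.
  intros Hb Hm. assert (HL := ln_base_pos b Hb).
  assert (N0 := omega_neq0 b m Hb Hm).
  assert (E0 : (omega b m - RtoC (INR 0))%C = omega b m) by (simpl INR; ring).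
  assert (C0 : em_coef 0 (omega b m) = RtoC 1) by (unfold em_coef; rewrite bern_0; simpl; ring).
  assert (S := digit_zeta_simple_pole b m 0 Hb). rewrite E0 in S.
  destruct (S N0 ltac:(rewrite C0; apply RtoC_neq0; lra)) as [S1 S2].
  split; auto. eapply eq_ind; [exact S2|].
  assert (NL : RtoC (ln (INR b)) <> RtoC 0) by (apply RtoC_neq0; lra).
  rewrite C0, <- (omega_ln b m Hb), RtoC_minus. field. auto.
Qed.

(* At [u = 0] all terms of the Euler-Maclaurin expansion but the first carry a
   factor [u], which cancels the denominator of [digit_ext b u / u]. *)
Lemma digit_zeta_pole_1 b : (2 <= b)%nat ->
  double_pole (digit_zeta b) (RtoC 1) /\
  bounded_near
    (fun s =>
       (digit_zeta b s -
        (RtoC ((INR b - 1) / (2 * ln (INR b))) / (s - RtoC 1) ^ 2 +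
         RtoC ((INR b - 1) / (2 * ln (INR b)) * ln (2 * PI)
               - (INR b + 1) / 4) / (s - RtoC 1)))%C)
    (RtoC 1).
Proof.
  intros Hb. assert (HL := ln_base_pos b Hb).
  set (c1 := (INR b - 1) / (2 * ln (INR b)) * ln (2 * PI) - (INR b + 1) / 4).
  set (c2 := (INR b - 1) / (2 * ln (INR b))).
  destruct (digit_ext_principal b 0 0 Hb) as [R [d [Hd [HR [E R0]]]]].
  assert (E0 : (omega b 0 - RtoC (INR 0))%C = RtoC 0) by (rewrite omega_0; simpl INR; ring).
  rewrite E0 in HR, E, R0. specialize (R0 eq_refl eq_refl).
  set (H := jump_polar b 0).
  assert (HH : hol H (RtoC 0)) by (unfold H; rewrite <- (omega_0 b); apply jump_polar_hol, Hb).
  assert (H0 : H (RtoC 0) = RtoC c2).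
  { unfold H. rewrite <- (omega_0 b) at 1. rewrite jump_polar_omega, omega_0, zeta_0 by auto.
    rewrite <- RtoC_minus, <- RtoC_mult, <- RtoC_div by lra. unfold c2. f_equal. field. lra. }
  assert (F : forall s, Cmod (s - 1) < d -> s <> RtoC 1 ->
    digit_zeta b s = ((H (s - 1) + (s - 1) * R (s - 1)) / (s - 1) ^ 2)%C).
  { intros s Hs Ns. assert (Q := Cminus_neq0 _ _ Ns). unfold digit_zeta.
    assert (Q0 : (s - 1 - 0)%C = (s - 1)%C) by ring.
    rewrite E, Q0 by (auto; rewrite Q0; auto). fold H.
    replace (s - 1 + RtoC (INR 0))%C with (s - 1)%C by (simpl INR; ring).
    unfold em_coef. rewrite bern_0. simpl. field. auto. }
  assert (Z1 : (1 - 1)%C = RtoC 0) by ring.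
  split.
  - split; [lia|]. exists (fun s => H (s - 1) + (s - 1) * R (s - 1))%C. split; [|split].
    + apply holomorphic_at_hol, hol_plus; [apply (hol_shift H)|apply hol_mult].
      * rewrite Z1. auto.
      * apply hol_minus; [apply hol_id|apply hol_const].
      * apply (hol_shift R). rewrite Z1. auto.
    + rewrite Z1, H0, R0. replace (RtoC c2 + 0 * 0)%C with (RtoC c2) by ring.
      apply RtoC_neq0. unfold c2. apply le_INR in Hb. change (INR 2) with 2 in Hb.
      apply Rgt_not_eq, Rdiv_lt_0_compat; lra.
    + apply locally'_C_Cmod. exists d. split; auto.
  (* Two divided differences give H = c2 + c1 u + u^2 H2, and one gives R = u R1 because R vanishes
     at 0. After division by u^2 exactly the stated polar part and the bounded function H2 + R1
     remain. *)
  - destruct (hol_divided_difference H _ HH) as [H1 [r1 [Hr1 [HH1 G1]]]].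
    destruct (hol_divided_difference H1 _ HH1) as [H2 [r2 [Hr2 [HH2 G2]]]].
    destruct (hol_divided_difference R _ HR) as [R1 [r3 [Hr3 [HR1 G3]]]].
    assert (HC : H1 (RtoC 0) = RtoC c1).
    { apply (cderiv_unique H (RtoC 0)); [|apply cderiv_jump_polar_0, Hb].
      apply (cderiv_of_increment _ _ _ r1); auto. apply cdiff_ccont, hol_cdiff, HH1. }
    assert (CC : ccont (fun u => H2 u + R1 u)%C (RtoC 0)).
    { apply ccont_plus; apply cdiff_ccont, hol_cdiff; auto. }
    destruct (CC 1 Rlt_0_1) as [r4 [Hr4 K4]].
    exists (Cmod (H2 (RtoC 0) + R1 (RtoC 0)) + 1).
    apply locally'_C_Cmod. set (r := Rmin (Rmin d r4) (Rmin r1 (Rmin r2 r3))).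
    exists r. split; [unfold r; repeat apply Rmin_pos; auto|].
    assert (M1 : r <= d) by (eapply Rle_trans; apply Rmin_l).
    assert (M2 : r <= r4) by (eapply Rle_trans; [apply Rmin_l|apply Rmin_r]).
    assert (M3 : r <= r1) by (eapply Rle_trans; [apply Rmin_r|apply Rmin_l]).
    assert (M4 : r <= r2)
      by (eapply Rle_trans; [apply Rmin_r|eapply Rle_trans; [apply Rmin_r|apply Rmin_l]]).
    assert (M5 : r <= r3)
      by (eapply Rle_trans; [apply Rmin_r|eapply Rle_trans; [apply Rmin_r|apply Rmin_r]]).
    intros s Hs Ns. assert (Q := Cminus_neq0 _ _ Ns).
    assert (Q0 : (s - 1 - 0)%C = (s - 1)%C) by ring.
    rewrite F by (auto; lra).
    rewrite (G1 (s - 1)%C), (G2 (s - 1)%C), (G3 (s - 1)%C) by (rewrite Q0; lra).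
    rewrite H0, HC, R0, Q0. specialize (K4 (s - 1)%C ltac:(rewrite Q0; lra)).
    replace ((RtoC c2 + (s - 1) * (RtoC c1 + (s - 1) * H2 (s - 1)) +
       (s - 1) * (0 + (s - 1) * R1 (s - 1))) / (s - 1) ^ 2 -
       (RtoC c2 / (s - 1) ^ 2 + RtoC c1 / (s - 1)))%C
      with (H2 (s - 1) + R1 (s - 1))%C by (simpl; field; auto).
    eapply Rle_trans; [apply (Cmod_le_minus _ (H2 (RtoC 0) + R1 (RtoC 0))%C)|]. lra.
Qed.

(** Unless z - 1 has the form omega_m - k, every term of the expansion is holomorphic there. The
    remaining candidates have odd k >= 3, and their only singular term is multiplied by
    [bern k = 0]. *)
Lemma digit_zeta_hol b z : (2 <= b)%nat -> z <> RtoC 1 ->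
  (forall m, m <> 0%Z -> z <> (1 + omega b m)%C) ->
  (forall k m, shift_index k -> z <> (1 - RtoC (INR k) + omega b m)%C) ->
  hol (digit_zeta b) z.
Proof.
  intros Hb N1 N2 N3. assert (Q := Cminus_neq0 _ _ N1).
  apply hol_div; [|apply hol_minus; [apply hol_id|apply hol_const]|auto].
  apply (hol_shift (digit_ext b)).
  destruct (classic (exists k m, z = (1 - RtoC (INR k) + omega b m)%C)) as [[k [m Ez]]|Hn].
  - destruct k as [|k].
    { exfalso. simpl INR in Ez. destruct (Z.eq_dec m 0) as [->|Hm].
      - rewrite omega_0 in Ez. apply N1. rewrite Ez. ring.
      - apply (N2 m Hm). rewrite Ez. ring. }
    assert (NS : ~ shift_index (S k)) by (intros H; apply (N3 _ m H Ez)).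
    assert (B : bern (S k) = 0).
    { apply bern_odd.
      - destruct (Nat.Even_or_Odd (S k)) as [H|H]; auto. exfalso. apply NS. right. split; auto.
        destruct H as [j Hj]. lia.
      - intros E. apply NS. left. auto. }
    destruct (digit_ext_isolate b m (S k) Hb) as [R [HR [E _]]].
    replace (z - 1)%C with (omega b m - RtoC (INR (S k)))%C by (rewrite Ez; ring).
    apply (hol_ext_loc R _ _ 1); [lra| |auto]. intros w Hw. rewrite E by auto.
    unfold em_coef. rewrite B. ring.
  - apply em_ext_hol; [apply digit_data, Hb|]. intros k. apply jump_ext_hol; auto.
    intros m E. apply Hn. exists k, m. rewrite <- E. ring.
Qed.

Theorem theorem1p1 (b : nat) (hb : (2 <= b)%nat) :
  exists F : C -> C,
    (forall s : C, 1 < Re s ->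
       is_dirichlet_series (fun n => RtoC (INR (digit_sum b n))) s (F s)) /\
    meromorphic F /\
    (forall z : C,
       is_pole F z <->
       (z = RtoC 1 \/
        (exists m : Z, m <> 0%Z /\ z = (RtoC 1 + omega b m)%C) \/
        (exists (k : nat) (m : Z), shift_index k /\
           z = (RtoC 1 - RtoC (INR k) + omega b m)%C))) /\
    (double_pole F (RtoC 1) /\
     bounded_near
       (fun s =>
          (F s -
           (RtoC ((INR b - 1) / (2 * ln (INR b))) / (s - RtoC 1) ^ 2 +
            RtoC ((INR b - 1) / (2 * ln (INR b)) * ln (2 * PI)
                  - (INR b + 1) / 4) / (s - RtoC 1)))%C)
       (RtoC 1)) /\
    (forall m : Z, m <> 0%Z ->
       simple_pole F (RtoC 1 + omega b m)%C /\
       is_residue F (RtoC 1 + omega b m)%C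
         (- (RtoC (INR b - 1) / (RtoC 2 * RtoC PI * Ci * RtoC (IZR m)))
          * zeta (omega b m))%C) /\
    (forall (k : nat) (m : Z), shift_index k ->
       simple_pole F (RtoC 1 - RtoC (INR k) + omega b m)%C /\
       is_residue F (RtoC 1 - RtoC (INR k) + omega b m)%C
         (RtoC (-1) ^ (k + 1) * RtoC ((INR b - 1) / ln (INR b))
          * zeta (omega b m) * RtoC (bernoulli k / INR (fact k))
          * shift_prod k (omega b m))%C).
Proof.
  exists (digit_zeta b).
  assert (P1 := digit_zeta_pole_1 b hb).
  assert (P2 := fun m => digit_zeta_poles_line_1 b m hb).
  assert (P3 := fun k m => digit_zeta_poles_shifted b m k hb).
  set (listed := fun z : C => z = RtoC 1 \/
        (exists m : Z, m <> 0%Z /\ z = (RtoC 1 + omega b m)%C) \/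
        (exists (k : nat) (m : Z), shift_index k /\
           z = (RtoC 1 - RtoC (INR k) + omega b m)%C)).
  assert (L : forall z, listed z -> is_pole (digit_zeta b) z).
  { intros z [->|[[m [Hm ->]]|[k [m [Hk ->]]]]].
    - exists 2%nat. apply P1.
    - exists 1%nat. apply P2, Hm.
    - exists 1%nat. apply P3, Hk. }
  assert (N : forall z, ~ listed z -> hol (digit_zeta b) z).
  { intros z Nz. apply digit_zeta_hol; auto.
    - intros E. apply Nz. left. auto.
    - intros m Hm E. apply Nz. right. left. exists m. auto.
    - intros k m Hk E. apply Nz. right. right. exists k, m. auto. }
  split; [intros s Hs; apply digit_zeta_dirichlet; auto|].
  split; [|split; [|split; [exact P1|split; [exact P2|exact P3]]]].
  - intros z. destruct (classic (listed z)) as [H|H]; [right; auto|left].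
    apply holomorphic_at_hol, N, H.
  - intros z. split; [|apply L]. intros H.
    destruct (classic (listed z)) as [H'|H']; [exact H'|].
    exfalso. apply (hol_not_pole _ _ (N z H') H).
Qed.
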